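(* Let $\mathcal{Q}=(Q_i)_{i\in I}$ be a decomposition cover of an open set $\mathcal{O}\subset\widehat{\mathbb{R}}^d$ of full measure, and let $w=(w_i)_{i\in I}$ be $\mathcal{Q}$-moderate. Let $J$ be countable, $g_j\in L^1(\mathbb{R}^d)\cap L^2(\mathbb{R}^d)$ with $\widehat{g_j}\in C^\infty(\widehat{\mathbb{R}}^d)$ and $C_j\in\mathrm{GL}(d,\mathbb{R})$ for $j\in J$, and let $A,B>0$ be such that $$A\le\sum_{j\in J}\frac1{|\det C_j|}|\widehat{g_j}(\xi)|^2\le B\quad\text{for a.e. }\xi\in\widehat{\mathbb{R}}^d.$$ Suppose that $(T_\gamma g_j)_{j\in J,\gamma\in C_j\mathbb{Z}^d}$ satisfies the $\alpha$-local integrability condition relative to $\mathcal{O}^c$. Let $v:\widehat{\mathbb{R}}^d\to(0,\infty)$ be a measurable weight with $v(\xi)\asymp w_i$ for all $\xi\in Q_i$ and $i\in I$ (with constants independent of $\xi$ and $i$), and let $v_0:\widehat{\mathbb{R}}^d\to(0,\infty)$ be a symmetric weight and $C_v>0$ a constant with $v(\xi+\eta)\le C_v\,v(\xi)\,v_0(\eta)$ for all $\xi,\eta\in\widehat{\mathbb{R}}^d$. Finally, assume that $$C_v\cdot\operatorname*{ess\,sup}_{\xi\in\mathcal{O}}\sum_{\alpha\in\Lambda\setminus\{0\}}|t_\alpha(\xi)|\,v_0(\alpha)<A.$$ Then the frame operator $S:\mathcal{S}_{\mathcal{O}}(\mathbb{R}^d)\to L^2(\mathbb{R}^d)$, $Sf=\sum_{j\in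 J}\sum_{k\in\mathbb{Z}^d}\langle f\mid T_{C_jk}g_j\rangle_{L^2}\,T_{C_jk}g_j$, uniquely extends to a bounded linear operator $S_0:\mathcal{D}(\mathcal{Q},L^2,\ell^2_w)\to\mathcal{D}(\mathcal{Q},L^2,\ell^2_w)$, and this extended operator is boundedly invertible.
   Context: Fourier transform: $\widehat f(\xi)=\int f(x)e^{-2\pi i x\cdot\xi}\,dx$, inverse $\mathcal{F}^{-1}$; $\widehat{\mathbb{R}}^d$ is $\mathbb{R}^d$ viewed as frequency domain. $T_yf(x)=f(x-y)$, $C^{-t}=(C^{-1})^t$. ''Full measure'': null complement. $v_0$ symmetric: $v_0(-\eta)=v_0(\eta)$. Covers. An admissible cover of an open set $\emptyset\neq\mathcal{O}\subset\widehat{\mathbb{R}}^d$ is a family $\mathcal{Q}=(Q_i)_{i\in I}$ of nonempty subsets of $\mathcal{O}$ with union $\mathcal{O}$ and $\sup_i|i^*|<\infty$, $i^*:=\{\ell: Q_\ell\cap Q_i\ne\emptyset\}$. A family $w$ of positive numbers is $\mathcal{Q}$-moderate if $\sup_i\sup_{\ell\in i^*}w_i/w_\ell<\infty$. A BAPU subordinate to $\mathcal{Q}$ is a family $(\varphi_i)_{i}$ in $C_c^\infty(\mathcal{O})$ with $\sum_i\varphi_i=1$ on $\mathcal{O}$, $\varphi_i=0$ on $\mathcal{O}\setminus Q_i$, and $\sup_i\|\mathcal{F}^{-1}\varphi_i\|_{L^1}<\infty$. A decomposition cover is an admissible cover admitting a BAPU; one is fixed. Spaces. $Z(\mathcal{O}):=\mathcal{F}(C_c^\infty(\mathcal{O}))$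 with the topology making $\mathcal{F}$ a homeomorphism; $Z'(\mathcal{O})$ its dual; for $f\in Z'(\mathcal{O})$, $\widehat f(\psi)=f(\widehat\psi)$. $\mathcal{D}(\mathcal{Q},L^p,\ell^q_w)$ is the Banach space of $f\in Z'(\mathcal{O})$ with $\|f\|:=\|(w_i\|\mathcal{F}^{-1}(\varphi_i\widehat f)\|_{L^p})_i\|_{\ell^q}<\infty$. $\mathcal{S}_{\mathcal{O}}(\mathbb{R}^d):=\mathcal{F}^{-1}(C_c^\infty(\mathcal{O}))$; functions $h$ are viewed in $Z'(\mathcal{O})$ via $\phi\mapsto\int h\phi\,dx$. Integrability condition. $\mathcal{B}_{\mathcal{O}}(\mathbb{R}^d):=\{f\in L^2:\widehat f\in L^\infty,\ \operatorname{supp}\widehat f\subset\mathcal{O}\text{ compact}\}$. The system satisfies the $\alpha$-local integrability condition relative to $\mathcal{O}^c$ if for all $f\in\mathcal{B}_{\mathcal{O}}(\mathbb{R}^d)$: $\sum_{j\in J}\frac1{|\det C_j|}\sum_{\alpha\in C_j^{-t}\mathbb{Z}^d}\int|\widehat f(\xi)\widehat f(\xi+\alpha)\widehat{g_j}(\xi)\widehat{g_j}(\xi+\alpha)|\,d\xi<\infty$. $\Lambda:=\bigcup_{j\in J}C_j^{-t}\mathbb{Z}^d$, $\kappa(\alpha):=\{j\in J:\alpha\in C_j^{-t}\mathbb{Z}^d\}$, and $t_\alpha(\xi):=\sum_{j\in\kappa(\alpha)}\frac1{|\det C_j|}\overline{\widehat{g_j}(\xi)}\,\widehat{g_j}(\xi+\alpha)$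 for $\alpha\in\Lambda$. *)

(* Defs.v *)
From HB Require Import structures.
From mathcomp Require Import all_boot all_order all_algebra finmap.
From mathcomp Require Import all_classical all_reals all_analysis ess_sup_inf.
From mathcomp.real_closed Require Import complex.
From mathcomp Require summability.

Set Implicit Arguments.
Unset Strict Implicit.
Unset Printing Implicit Defensive.

Import Order.TTheory GRing.Theory Num.Theory.
Import numFieldNormedType.Exports.

Local Open Scope classical_set_scope.
Local Open Scope ring_scope.

(* R^n is 'cV[R]_n. Its sigma-algebra is generated by the coordinates, as the
   library does for tuples; this is the Borel sigma-algebra. *)
Definition measure_cV_display : measure_display.
Proof. exact. Qed.

Section measurable_cV.
Context {R : realType} (n : nat).

Let coors : 'I_n -> 'cV[R]_n -> measurableTypeR R := fun i x => x i ord0.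

Let cV_set0 : g_sigma_preimage coors set0.
Proof. exact: sigma_algebra0. Qed.

Let cV_setC A : g_sigma_preimage coors A -> g_sigma_preimage coors (~` A).
Proof. exact: sigma_algebraC. Qed.

Let cV_bigcup (F : _^nat) : (forall i, g_sigma_preimage coors (F i)) ->
  g_sigma_preimage coors (\bigcup_i (F i)).
Proof. exact: sigma_algebra_bigcup. Qed.

HB.instance Definition _ := @isMeasurable.Build measure_cV_display
  'cV[R]_n (g_sigma_preimage coors) cV_set0 cV_setC cV_bigcup.

End measurable_cV.

Section lebesgue_cV_construction.
Context {R : realType}.
Local Notation RT := (measurableTypeR R).

Lemma measurable_cV_coord n (i : 'I_n) :
  measurable_fun [set: 'cV[R]_n] (fun x : 'cV[R]_n => x i ord0 : RT).
Proof.
move=> _ Y mY; rewrite setTI; apply: sub_sigma_algebra => /=.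
rewrite -bigcup_seq/=; exists i => /=; first by rewrite mem_index_enum.
by exists Y => //; rewrite setTI.
Qed.

Lemma measurable_fun_cV d1 (T1 : measurableType d1) n (f : T1 -> 'cV[R]_n) :
  (forall i, measurable_fun [set: T1] (fun x => f x i ord0 : RT)) ->
  measurable_fun [set: T1] f.
Proof.
move=> mf.
suff : g_sigma_preimage (fun (i : 'I_n) x => f x i ord0 : RT) `<=` measurable.
  move=> h _ A mA; rewrite setTI; apply: h.
  have -> : (fun (i : 'I_n) x => f x i ord0 : RT) =
            (fun i => (fun v : 'cV[R]_n => v i ord0 : RT) \o f) by [].
  by rewrite g_sigma_preimage_comp; exists A => //; rewrite setTI.
apply: smallest_sub; first exact: sigma_algebra_measurable.
case: n => [|n] in f mf *; first by rewrite big_ord0.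
rewrite -bigcup_mkord_ord; apply: bigcup_sub => i Ii.
by move=> A [B mB <-]; exact: mf.
Qed.

Definition cV_cons n (p : RT * 'cV[R]_n) : 'cV[R]_n.+1 :=
  col_mx (const_mx p.1 : 'cV[R]_1) p.2.

Definition cV_uncons n (x : 'cV[R]_n.+1) : RT * 'cV[R]_n :=
  (x ord0 ord0, \col_i x (lift ord0 i) ord0).

Lemma cV_consK n : cancel (@cV_cons n) (@cV_uncons n).
Proof.
move=> [a x]; congr pair; first by rewrite mxE; case: splitP => // j _; rewrite mxE.
apply/colP => i; rewrite !mxE; case: splitP => [j|j] /=.
  by rewrite ord1.
by move=> [] /val_inj ->.
Qed.

Lemma cV_cons0 n p : @cV_cons n p ord0 ord0 = p.1.
Proof. by have /(congr1 fst) := cV_consK p. Qed.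

Lemma cV_consS n p i : @cV_cons n p (lift ord0 i) ord0 = p.2 i ord0.
Proof. by have /(congr1 snd)/colP/(_ i) := cV_consK p; rewrite mxE. Qed.

Lemma measurable_cV_cons n : measurable_fun setT (@cV_cons n).
Proof.
apply: measurable_fun_cV => i.
have -> : (fun p => @cV_cons n p i ord0 : RT) =
  (if @fintype.split 1 n i is inr j then fun p : RT * 'cV[R]_n => p.2 j ord0 else fst).
  apply/funext => p; rewrite /cV_cons mxE; case: splitP => j _ //.
  by rewrite mxE.
case: (@fintype.split 1 n i) => [j|j]; first exact: measurable_fst.
apply: (@measurableT_comp _ _ _ _ _ _ (fun v : 'cV[R]_n => v j ord0 : RT)) => //.
exact: measurable_cV_coord.
Qed.

Lemma measurable_cV_uncons n : measurable_fun setT (@cV_uncons n).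
Proof.
apply: measurable_fun_pair => /=; first exact: measurable_cV_coord.
apply: measurable_fun_cV => i.
have -> : (fun x : 'cV[R]_n.+1 => (\col_j x (lift ord0 j) ord0) i ord0 : RT) =
  fun x => x (lift ord0 i) ord0 by apply/funext => x; rewrite mxE.
exact: measurable_cV_coord.
Qed.

Section step.
Variables (n : nat) (m : {sigma_finite_measure set 'cV[R]_n -> \bar R}).

Let mc := @measurable_cV_cons n.

Definition lebesgue_step : set 'cV[R]_n.+1 -> \bar R :=
  pushforward (lebesgue_measure \x m)%E (@cV_cons n).

Let step0 : lebesgue_step set0 = 0%E.
Proof. by rewrite /lebesgue_step /pushforward preimage_set0 measure0. Qed.

Let step_ge0 A : (0 <= lebesgue_step A)%E.
Proof. exact: measure_ge0. Qed.

Let mpre A : measurable A -> measurable (@cV_cons n @^-1` A).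
Proof. by move=> mA; rewrite -[X in measurable X]setTI; exact: mc. Qed.

Let step_sigma_additive : semi_sigma_additive lebesgue_step.
Proof.
move=> F mF tF mUF; rewrite /lebesgue_step /pushforward preimage_bigcup.
apply: measure_semi_sigma_additive; first by move=> k; exact: mpre.
- apply/trivIsetP => i j _ _ ij; rewrite -preimage_setI.
  by move/trivIsetP : tF => /(_ _ _ I I ij) ->; rewrite preimage_set0.
- by rewrite -preimage_bigcup; exact: mpre.
Qed.

HB.instance Definition _ := isMeasure.Build _ _ _ lebesgue_step
  step0 step_ge0 step_sigma_additive.

Let step_sigma_finite : sigma_finite setT lebesgue_step.
Proof.
have /sigma_finiteP[F [TF ndF Foo]] := sigma_finiteT (@lebesgue_measure R).
have /sigma_finiteP[G [TG ndG Goo]] := sigma_finiteT m.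
exists (fun k => @cV_uncons n @^-1` (F k `*` G k)).
  rewrite -preimage_bigcup -[LHS](preimage_setT (@cV_uncons n)).
  congr (_ @^-1` _); rewrite -setXTT TF TG predeqE => -[x y]; split.
    move=> [/= [k _ Fkx] [l _ Gly]]; exists (maxn k l) => //; split.
    - by move: x Fkx; exact/subsetPset/ndF/leq_maxl.
    - by move: y Gly; exact/subsetPset/ndG/leq_maxr.
  by move=> [k _ []/= ? ?]; split; exists k.
move=> k; have [mF Fk] := Foo k; have [mG Gk] := Goo k; split.
  by rewrite -[X in measurable X]setTI; apply: measurable_cV_uncons => //;
    exact: measurableX.
rewrite /lebesgue_step /pushforward -comp_preimage.
rewrite (_ : _ \o _ = id) ?preimage_id; last first.
  by apply/funext => p /=; rewrite cV_consK.
by rewrite product_measure1E// lte_mul_pinfty// ge0_fin_numE.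
Qed.

HB.instance Definition _ := Measure_isSigmaFinite.Build _ _ _ lebesgue_step
  step_sigma_finite.

End step.

(* Lebesgue measure on R^n as an iterated product; see lebesgue_cV_box. *)
Fixpoint lebesgue_cV n : {sigma_finite_measure set 'cV[R]_n -> \bar R} :=
  match n with
  | 0%N => dirac (0 : 'cV[R]_0)
  | n'.+1 =>
    lebesgue_step (lebesgue_cV n')
  end.

Lemma lebesgue_cV_box n (a b : 'cV[R]_n) : (forall i, a i ord0 <= b i ord0) ->
  lebesgue_cV n [set x | forall i, a i ord0 <= x i ord0 <= b i ord0] =
  (\prod_(i < n) (b i ord0 - a i ord0))%:E.
Proof.
elim: n => [|n ih] in a b * => ab.
  rewrite big_ord0 /= diracE mem_set//= => i; by case: i.
pose ta (x : 'cV[R]_n.+1) : 'cV[R]_n := \col_i x (lift ord0 i) ord0.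
rewrite /= /lebesgue_step /pushforward.
set B := [set x | forall i : 'I_n,
  (ta a) i ord0 <= x i ord0 <= (ta b) i ord0] : set 'cV[R]_n.
have mB : measurable B.
  rewrite (_ : B = \bigcap_(i in [set: 'I_n])
      (fun x : 'cV[R]_n => x i ord0 : RT) @^-1` `[ta a i ord0, ta b i ord0]).
    apply: fin_bigcap_measurable => // i _.
    by rewrite -[X in measurable X]setTI; apply: measurable_cV_coord => //;
      exact: measurable_itv.
  apply/seteqP; split=> x /= h i; last by have := h i I; rewrite /= in_itv.
  by move=> _; rewrite /= in_itv /= h.
rewrite (_ : _ @^-1` _ = `[a ord0 ord0, b ord0 ord0] `*` B).
  have mI : measurable (`[a ord0 ord0, b ord0 ord0] : set RT).
    exact: measurable_itv.
  have e : lebesgue_measure (`[a ord0 ord0, b ord0 ord0] : set RT) =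
      (b ord0 ord0 - a ord0 ord0)%:E.
    rewrite lebesgue_measure_itv /= lte_fin EFinB.
    have := ab ord0; rewrite le_eqVlt => /predU1P[->|->//].
    by rewrite ltxx subee.
  transitivity (lebesgue_measure (`[a ord0 ord0, b ord0 ord0] : set RT) *
                lebesgue_cV n B)%E; first exact: product_measure1E.
  rewrite e ih; last first.
    by move=> i; rewrite !mxE.
  by rewrite big_ord_recl; under eq_bigr do rewrite !mxE.
apply/seteqP; split=> -[x y] /=.
  move=> h; split=> [|i]; first by have := h ord0; rewrite cV_cons0 in_itv.
  by have := h (lift ord0 i); rewrite cV_consS !mxE.
move=> [hx hy] i; case: (unliftP ord0 i) => [j ->|->].
  by have := hy j; rewrite cV_consS !mxE.
by move: hx; rewrite cV_cons0 in_itv.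
Qed.

End lebesgue_cV_construction.


Section defs.
Context {R : realType} {d : nat}.

Local Notation C := R[i].
Local Notation V := 'cV[R]_d.
Local Notation mu := (@lebesgue_cV R d).

Implicit Types (f g h phi psi : V -> C) (x y xi alpha : V) (O K : set V).
Implicit Types (p q : \bar R).

Definition cabs (z : C) : R := Normc.normc z.

(* R-valued, so that it can be fed to the integral. *)
Definition rpart f : V -> R := fun x => complex.Re (f x).
Definition ipart f : V -> R := fun x => complex.Im (f x).

(* Lebesgue measurable, i.e. a.e. equal to a Borel function. *)
Definition lmeasurable (u : V -> R) : Prop :=
  exists2 u', measurable_fun [set: V] u' & {ae mu, forall x, u x = u' x}.

Definition clmeasurable f : Prop := lmeasurable (rpart f) /\ lmeasurable (ipart f).

Definition cintegral f : C :=
  Complex (\int[mu]_x rpart f x) (\int[mu]_x ipart f x).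

Definition cLnorm p f : \bar R := 'N[mu]_p[(fun x => (cabs (f x))%:E)]%E.

Definition cLp p : set (V -> C) := [set f | clmeasurable f /\ (cLnorm p f < +oo)%E].

Definition rsum (I : choiceType) (D : set I) (a : I -> R) : R :=
  fine (\esum_(i in D) (Num.max (a i) 0)%:E) -
  fine (\esum_(i in D) (Num.max (- a i) 0)%:E).

(* Sum of an absolutely summable family of complex numbers. *)
Definition csum (I : choiceType) (D : set I) (a : I -> C) : C :=
  Complex (rsum D (fun i => complex.Re (a i)))
          (rsum D (fun i => complex.Im (a i))).

Definition dot x y : R := \sum_(i < d) x i ord0 * y i ord0.

Definition cis (t : R) : C := Complex (cos t) (sin t).

Definition fourier f : V -> C :=
  fun xi => cintegral (fun x => f x * cis (- (2 * pi * dot x xi))).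

Definition ifourier f : V -> C :=
  fun x => cintegral (fun xi => f xi * cis (2 * pi * dot x xi)).

Definition truncate (r : R) f : V -> C := fun x => if `|x| <= r then f x else 0.

(* F is the L^2 Fourier transform (Plancherel) of f: the limit in the mean of the
   Fourier integrals over the cubes [-n, n]^d. *)
Definition L2_fourier f (F : V -> C) : Prop :=
  cLp 2%:E F /\
  (fun n : nat => cLnorm 2%:E (fourier (truncate n%:R f) \- F)) @ \oo --> 0%E.

Definition inner2 f g : C := cintegral (fun x => f x * (g x)^*%C).

Definition translate y f : V -> C := fun x => f (x - y).

Fixpoint partial (s : seq 'I_d) (u : V -> R) : V -> R :=
  if s is i :: s' then 'D_(delta_mx i ord0 : V) (partial s' u) else u.

Definition smooth (u : V -> R) : Prop :=
  forall s, continuous (partial s u) /\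
    forall i x, derivable (partial s u) x (delta_mx i ord0 : V).

Definition csmooth f : Prop := smooth (rpart f) /\ smooth (ipart f).

Definition cpartial (s : seq 'I_d) f : V -> C :=
  fun x => Complex (partial s (rpart f) x) (partial s (ipart f) x).

Definition csupport f : set V := closure [set x | f x != 0].

(* C_c^oo(A), its elements being extended by zero to R^d. *)
Definition Ccinfty (A : set V) : set (V -> C) :=
  [set phi | csmooth phi /\ compact (csupport phi) /\ csupport phi `<=` A].

Definition schwartz : set (V -> C) :=
  [set psi | csmooth psi /\
    forall s (n : nat), exists M : R,
      forall x, `|x| ^+ n * cabs (cpartial s psi x) <= M].

Definition CNnorm (N : nat) phi : \bar R :=
  ereal_sup [set (cabs (cpartial s phi x))%:E |
             s in [set s | (size s <= N)%N] & x in [set: V]].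

(* Members of D'(O): linear on C_c^oo(O) and continuous on the Frechet space
   C_c^oo(K) for each compact K in O, which is continuity for the usual
   inductive limit topology. *)
Definition distribution O (u : (V -> C) -> C) : Prop :=
  (forall (a : C) phi psi, Ccinfty O phi -> Ccinfty O psi ->
     u (fun x => a * phi x + psi x) = a * u phi + u psi) /\
  (forall K, compact K -> K `<=` O -> exists (c : R) (N : nat),
     forall phi, Ccinfty K phi -> ((cabs (u phi))%:E <= c%:E * CNnorm N phi)%E).

Definition Zspace O : set (V -> C) := fourier @` Ccinfty O.

Definition fourierZ (u : (V -> C) -> C) : (V -> C) -> C := fun psi => u (fourier psi).

(* Z'(O). Z(O) carries the topology transported from C_c^oo(O) by the Fourier
   transform, so u is in Z'(O) iff its Fourier transform is a distribution.
   Functionals on Z(O) are represented by their extension by zero to all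
   functions, so that equality in Z'(O) is Leibniz equality. *)
Definition Zdual O : set ((V -> C) -> C) :=
  [set u | distribution O (fourierZ u) /\ forall phi, ~ Zspace O phi -> u phi = 0].

Definition embedZ O h : (V -> C) -> C :=
  fun phi => if `[< Zspace O phi >] then cintegral (fun x => h x * phi x) else 0.

(* F^{-1}(phi u^), a tempered distribution: its value at a Schwartz function psi
   is u^(phi F^{-1} psi). *)
Definition ifourier_cut phi (u : (V -> C) -> C) : (V -> C) -> C :=
  fun psi => fourierZ u (fun xi => phi xi * ifourier psi xi).

Definition represents h (u : (V -> C) -> C) : Prop :=
  clmeasurable h /\
  forall psi, schwartz psi ->
    cLp 1%E (fun x => h x * psi x) /\ u psi = cintegral (fun x => h x * psi x).

(* L^p norm of a tempered distribution, +oo if it is not given by a function. *)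
Definition LnormS p (u : (V -> C) -> C) : \bar R :=
  ereal_inf [set cLnorm p h | h in represents ^~ u].

Definition lqnorm (I : choiceType) q (a : I -> \bar R) : \bar R :=
  match q with
  | r%:E => (\esum_(i in [set: I]) (a i `^ r)) `^ r^-1
  | +oo => ereal_sup (0 |` range a)
  | -oo => 0
  end%E.

Section covers.
Variable I : choiceType.
Implicit Types (Q : I -> set V) (w : I -> R) (Phi : I -> V -> C).

Definition neighbors Q (i : I) : set I := [set l | Q l `&` Q i !=set0].

Definition admissible_cover O Q : Prop :=
  [/\ forall i, Q i !=set0, forall i, Q i `<=` O, \bigcup_i Q i = O &
      exists N : nat, forall i, (neighbors Q i #<= `I_N)%card].

Definition moderate Q w : Prop :=
  (forall i, 0 < w i) /\
  exists c : R, forall i l, neighbors Q i l -> w i / w l <= c.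

Definition BAPU O Q Phi : Prop :=
  [/\ forall i, Ccinfty O (Phi i),
      forall xi, O xi -> \sum_(i \in [set: I]) Phi i xi = 1,
      forall i xi, O xi -> ~ Q i xi -> Phi i xi = 0 &
      exists c : R, forall i, (cLnorm 1%E (ifourier (Phi i)) <= c%:E)%E].

Definition decomp_norm Phi p q w (u : (V -> C) -> C) : \bar R :=
  lqnorm q (fun i => (w i)%:E * LnormS p (ifourier_cut (Phi i) u))%E.

(* D(Q, L^p, l^q_w), computed with the BAPU Phi. *)
Definition decomp_space O Phi p q w : set ((V -> C) -> C) :=
  [set u | Zdual O u /\ (decomp_norm Phi p q w u < +oo)%E].

End covers.

Definition S_space O : set (V -> C) := ifourier @` Ccinfty O.

Definition ess_support f : set V :=
  [set x | forall U, nbhs x U -> ~ {ae mu, forall y, U y -> f y = 0}].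

(* Pairs (f, f^) with f in B_O(R^d). *)
Definition B_space O f (F : V -> C) : Prop :=
  [/\ cLp 2%:E f, L2_fourier f F, cLp +oo%E F,
      compact (ess_support F) & ess_support F `<=` O].

Definition intv (k : 'cV[int]_d) : V := map_mx intr k.

(* A^{-t} Z^d *)
Definition dual_lattice (A : 'M[R]_d) : set V :=
  [set alpha | exists k, alpha = (invmx A)^T *m intv k].

Section systems.
Context {J : countType}.
Variables (g : J -> V -> C) (A : J -> 'M[R]_d).

Definition alpha_LIC O : Prop :=
  forall f F, B_space O f F ->
  (\esum_(j in [set: J]) (`|\det (A j)|^-1%:E *
     \esum_(alpha in dual_lattice (A j)) \int[mu]_xi
       (cabs (F xi * F (xi + alpha) *
              fourier (g j) xi * fourier (g j) (xi + alpha)))%:E) < +oo)%E.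

Definition Lambda : set V := \bigcup_j dual_lattice (A j).

Definition kappa alpha : set J := [set j | dual_lattice (A j) alpha].

Definition t_fun alpha : V -> C := fun xi =>
  csum (kappa alpha) (fun j => (`|\det (A j)|^-1)%:C%C *
    (fourier (g j) xi)^*%C * fourier (g j) (xi + alpha)).

Definition atom (jk : J * 'cV[int]_d) : V -> C :=
  translate (A jk.1 *m intv jk.2) (g jk.1).

(* h = S f, the frame series converging unconditionally in L^2. *)
Definition frame_sum f h : Prop :=
  cLp 2%:E h /\
  (fun X : {fset (J * 'cV[int]_d)} =>
     cLnorm 2%:E (fun x => h x - \sum_(jk <- X) inner2 f (atom jk) * atom jk x))
  @ summability.totally --> 0%E.

End systems.

Definition ess_sup_on O (u : V -> \bar R) : \bar R :=
  ess_sup mu (fun xi => if xi \in O then u xi else -oo%E).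

Definition bounded_linear_on (D : set ((V -> C) -> C)) (N : ((V -> C) -> C) -> \bar R)
    (S : ((V -> C) -> C) -> ((V -> C) -> C)) : Prop :=
  [/\ forall u, D u -> D (S u),
      forall (a : C) u1 u2, D u1 -> D u2 ->
        S (fun phi => a * u1 phi + u2 phi) = (fun phi => a * S u1 phi + S u2 phi) &
      exists M : R, forall u, D u -> (N (S u) <= M%:E * N u)%E].

End defs.

(* Main.v *)
(* On the Fourier side D(Q, L^2, l^2_w) is the weighted space L^2(v): u belongs to it iff
   u^ is a function F with v F in L^2, and the norms are equivalent because the cover is
   locally finite and v is comparable to w_i on Q_i.  For f = F^{-1} psi with psi in
   C_c^oo(O), Poisson summation over each lattice C_j Z^d, summed over j by means of the
   local integrability condition, gives <S f, f> = int conj(psi) K psi with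
   (K F)(xi) = sum_alpha conj(t_alpha(xi)) F(xi + alpha), whence S f ~ K psi by
   polarization.  Splitting off alpha = 0, t_0 takes values in [A, B], while Schur's test
   bounds the remaining terms by delta = Cv ess sup sum |t_alpha| v0(alpha) < A, both on
   L^2(v) and on L^2.  Hence I - K/B' is a contraction of L^2(v), B' = max(A, B), and K is
   inverted by a Neumann iteration.  The bound on L^2 makes the atoms a Bessel family, so
   that the frame series converges unconditionally; C_c^oo(O) is dense in L^2(v), which
   gives uniqueness. *)
Require Import Defs.
From HB Require Import structures.
From mathcomp Require Import all_boot all_order fingroup perm all_algebra finmap.
From mathcomp Require Import all_classical all_reals all_analysis ess_sup_inf measurable_realfun.
From mathcomp.real_closed Require Import complex.
From mathcomp Require Import ring lra zify.
From mathcomp Require summability.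

Set Implicit Arguments.
Unset Strict Implicit.
Unset Printing Implicit Defensive.

Import Order.TTheory GRing.Theory Num.Theory.
Import numFieldNormedType.Exports.

Local Open Scope classical_set_scope.
Local Open Scope ring_scope.

Arguments cabs : simpl never.

(** * Complex numbers and complex-valued integrals *)

Section complex_numbers.
Context {R : realType}.
Local Notation C := R[i].
Implicit Types (z w : C) (a b : R).

(** Poisson summation has to work without a convergence theorem for Fourier series. It is therefore
    applied only to autocorrelations, whose Fourier coefficients are squared moduli: testing a
    periodization against normalized powers of a nonnegative trigonometric polynomial yields its
    value at 0 by positivity alone. This is why the diagonal form <S f, f> is computed and
    polarization must supply the rest. One Schur estimate serves both L^2(v) and L^2: moderateness
    of v, applied to the shifts x and -x, gives Cv v0(x) >= 1, so the constant weight 1 obeys the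
    same inequality as v. Elements of the decomposition space are functionals, each given by a
    function determined up to null sets only; an operator on functions descends to them once it
    respects a.e. equality, which its bound on L^2(v) provides. Complex sums are integrals for
    counting measure, and Lebesgue measurable functions are replaced by Borel representatives, so
    that exchanging complex sums and integrals is an instance of Fubini. Young's inequality with a
    free parameter stands in for Minkowski's. *)

Lemma cabs_ge0 z : 0 <= cabs z. Proof. by case: z => a b; exact: sqrtr_ge0. Qed.

Lemma cabsM z w : cabs (z * w) = cabs z * cabs w.
Proof. exact: Normc.normcM. Qed.

Lemma cabsD z w : cabs (z + w) <= cabs z + cabs w.
Proof. exact: (@le_normcD R z w). Qed.

Lemma cabs_sqr z : cabs z ^+ 2 = complex.Re z ^+ 2 + complex.Im z ^+ 2.
Proof. by case: z => a b /=; rewrite sqr_sqrtr// addr_ge0// sqr_ge0. Qed.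

Lemma cabsN z : cabs (- z) = cabs z.
Proof. by case: z => a b; rewrite /cabs /= !sqrrN. Qed.

Lemma cabsB z w : cabs (z - w) = cabs (w - z).
Proof. by rewrite -cabsN opprB. Qed.

Lemma cabs0 : cabs (0 : C) = 0.
Proof. by rewrite /cabs /= expr0n addr0 sqrtr0. Qed.

Lemma cabs_eq0 z : cabs z = 0 -> z = 0.
Proof. exact: Normc.eq0_normc. Qed.

Lemma cabs1 : cabs (1 : C) = 1.
Proof. by rewrite /cabs /= expr0n addr0 expr1n sqrtr1. Qed.

Lemma cabsR a : cabs (a%:C)%C = `|a|.
Proof. by rewrite /cabs /= expr0n addr0 sqrtr_sqr. Qed.

Lemma cabs_conj z : cabs (z^*)%C = cabs z.
Proof. by case: z => a b; rewrite /cabs /= sqrrN. Qed.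

Lemma normRe_le z : `|complex.Re z| <= cabs z.
Proof.
case: z => a b; rewrite /cabs /= -sqrtr_sqr ler_sqrt ?addr_ge0 ?sqr_ge0//.
by rewrite lerDl sqr_ge0.
Qed.

Lemma normIm_le z : `|complex.Im z| <= cabs z.
Proof.
case: z => a b; rewrite /cabs /= -sqrtr_sqr ler_sqrt ?addr_ge0 ?sqr_ge0//.
by rewrite lerDr sqr_ge0.
Qed.

Lemma cabs_le_ReIm z : cabs z <= `|complex.Re z| + `|complex.Im z|.
Proof.
rewrite -(@ler_pXn2r _ 2)// ?nnegrE ?cabs_ge0 ?addr_ge0// cabs_sqr.
rewrite sqrrD !real_normK ?num_real// lerD2r lerDl.
by rewrite mulrn_wge0// mulr_ge0.
Qed.

Lemma cReD z w : complex.Re (z + w) = complex.Re z + complex.Re w.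
Proof. by case: z w => ? ? []. Qed.
Lemma cImD z w : complex.Im (z + w) = complex.Im z + complex.Im w.
Proof. by case: z w => ? ? []. Qed.
Lemma cReN z : complex.Re (- z) = - complex.Re z.
Proof. by case: z. Qed.
Lemma cImN z : complex.Im (- z) = - complex.Im z.
Proof. by case: z. Qed.
Lemma cReM z w : complex.Re (z * w) =
  complex.Re z * complex.Re w - complex.Im z * complex.Im w.
Proof. by case: z w => ? ? []. Qed.
Lemma cImM z w : complex.Im (z * w) =
  complex.Re z * complex.Im w + complex.Im z * complex.Re w.
Proof. by case: z w => ? ? []. Qed.
Lemma cReconj z : complex.Re (z^*)%C = complex.Re z. Proof. by case: z. Qed.
Lemma cImconj z : complex.Im (z^*)%C = - complex.Im z. Proof. by case: z. Qed.

Lemma cplx_eq z w : complex.Re z = complex.Re w -> complex.Im z = complex.Im w -> z = w.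
Proof. by case: z w => ? ? [? ?] /= -> ->. Qed.

Lemma mulC_conj z : z * (z^*)%C = (cabs z ^+ 2)%:C%C.
Proof.
by apply: cplx_eq; rewrite ?(cReM, cImM, cReconj, cImconj) /= ?cabs_sqr; ring.
Qed.

Lemma conjCM z w : ((z * w)^*)%C = (z^*)%C * (w^*)%C.
Proof. by apply: cplx_eq; rewrite !(cReconj, cImconj, cReM, cImM); ring. Qed.
Lemma conjCD z w : ((z + w)^*)%C = (z^*)%C + (w^*)%C.
Proof. by apply: cplx_eq; rewrite !(cReconj, cImconj, cReD, cImD)//; ring. Qed.
Lemma cconjK z : ((z^*)^*)%C = z.
Proof. by apply: cplx_eq; rewrite !(cReconj, cImconj) ?opprK. Qed.

Lemma cisD a b : cis (a + b) = cis a * cis b.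
Proof. by apply: cplx_eq; rewrite ?(cReM, cImM) /= ?cosD ?sinD //; ring. Qed.

Lemma cis0 : cis 0 = 1 :> C.
Proof. by rewrite /cis cos0 sin0. Qed.

Lemma conj_cis a : ((cis a)^*)%C = cis (- a).
Proof. by rewrite /cis cosN sinN. Qed.

Lemma cabs_cis a : cabs (cis a) = 1.
Proof. by rewrite /cabs /= cos2Dsin2 sqrtr1. Qed.

Lemma cabs_sub_sqr z w : cabs (z + w) ^+ 2 <= 2 * cabs z ^+ 2 + 2 * cabs w ^+ 2.
Proof.
rewrite (le_trans (y := (cabs z + cabs w) ^+ 2))//.
  by rewrite ler_pXn2r// ?nnegrE ?addr_ge0 ?cabs_ge0 ?cabsD.
rewrite -subr_ge0 (_ : _ - _ = (cabs z - cabs w) ^+ 2) ?sqr_ge0//; ring.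
Qed.

End complex_numbers.
Arguments cplx_eq {R z w}.

Section complex_integral.
Context {R : realType} d (T : measurableType d).
Local Notation C := R[i].
Implicit Types (f g : T -> C) (u v : T -> R).
Import HBNNSimple.

(** Borel measurability of both parts. The statement uses [clmeasurable], that is, a.e. equality
    with such a function; proofs pass to a Borel representative once and then stay with [cmeas]. *)
Definition cmeas f : Prop := measurable_fun setT (fun x => complex.Re (f x)) /\
  measurable_fun setT (fun x => complex.Im (f x)).

Lemma cmeas_cst (z : C) : cmeas (fun=> z).
Proof. by split; exact: measurable_cst. Qed.

Lemma cmeasD f g : cmeas f -> cmeas g -> cmeas (fun x => f x + g x).
Proof.
move=> [fr fi] [gr gi]; split.
  by under eq_fun do rewrite cReD; exact: measurable_funD.
by under eq_fun do rewrite cImD; exact: measurable_funD.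
Qed.

Lemma cmeasN f : cmeas f -> cmeas (fun x => - f x).
Proof.
move=> [fr fi]; split.
  by under eq_fun do rewrite cReN; exact: measurable_funN.
by under eq_fun do rewrite cImN; exact: measurable_funN.
Qed.

Lemma cmeasB f g : cmeas f -> cmeas g -> cmeas (fun x => f x - g x).
Proof. by move=> mf mg; apply: cmeasD => //; exact: cmeasN. Qed.

Lemma cmeasM f g : cmeas f -> cmeas g -> cmeas (fun x => f x * g x).
Proof.
move=> [fr fi] [gr gi]; split.
  by under eq_fun do rewrite cReM; apply: measurable_funB; exact: measurable_funM.
by under eq_fun do rewrite cImM; apply: measurable_funD; exact: measurable_funM.
Qed.

Lemma cmeas_conj f : cmeas f -> cmeas (fun x => ((f x)^*)%C).
Proof.
move=> [fr fi]; split; first by under eq_fun do rewrite cReconj.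
by under eq_fun do rewrite cImconj; exact: measurable_funN.
Qed.

Lemma cmeasR (u : T -> R) : measurable_fun setT u -> cmeas (fun x => (u x)%:C%C).
Proof. by move=> mu; split => //=; exact: measurable_cst. Qed.

Lemma cmeas_sum (I : Type) (s : seq I) (F : I -> T -> C) :
  (forall i, cmeas (F i)) -> cmeas (fun x => \sum_(i <- s) F i x).
Proof.
move=> mF; elim: s => [|i s ih].
  by under eq_fun do rewrite big_nil; exact: cmeas_cst.
by under eq_fun do rewrite big_cons; exact: cmeasD.
Qed.

Lemma measurable_cabs f : cmeas f -> measurable_fun setT (fun x => cabs (f x)).
Proof.
move=> [fr fi].
have -> : (fun x => cabs (f x)) =
    (fun x => Num.sqrt (complex.Re (f x) ^+ 2 + complex.Im (f x) ^+ 2)).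
  by apply/funext => x; case: (f x).
apply: measurableT_comp => //; first by apply: continuous_measurable_fun => x; exact: sqrt_continuous.
by apply: measurable_funD; apply: measurable_funX.
Qed.

Lemma cmeas_cis (u : T -> R) : measurable_fun setT u -> cmeas (fun x => cis (u x)).
Proof.
move=> mu; split => /=; apply: measurableT_comp => //.
  by apply: continuous_measurable_fun => x; exact: continuous_cos.
by apply: continuous_measurable_fun => x; exact: continuous_sin.
Qed.

Variable m : {measure set T -> \bar R}.

Definition cint f : C :=
  Complex (\int[m]_x complex.Re (f x)) (\int[m]_x complex.Im (f x)).

(** Meant for nonnegative [u]: the value stays in the extended reals, so that [nint u < +oo]
    expresses integrability. *)
Definition nint (u : T -> R) : \bar R := (\int[m]_x (u x)%:E)%E.

Definition cL1 f := cmeas f /\ (nint (fun x => cabs (f x)) < +oo)%E.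

Lemma nint_ge0 u : (forall x, 0 <= u x) -> (0 <= nint u)%E.
Proof. by move=> u0; apply: integral_ge0 => x _; rewrite lee_fin. Qed.

(** The integral of a nonnegative function is a supremum over simple functions below it, whether or
    not the function is measurable. A simple function below [f], cut off on the null set, lies below
    [g] and keeps its integral. *)
Lemma integral_le_ae (f g : T -> \bar R) : (forall x, (0 <= f x)%E) ->
  (forall x, (0 <= g x)%E) -> {ae m, forall x, (f x <= g x)%E} ->
  (\int[m]_x f x <= \int[m]_x g x)%E.
Proof.
move=> f0 g0 [N [mN N0 subN]].
rewrite !ge0_integralTE//; apply: ge_ereal_sup => _ [h hf <-].
have mNC : measurable (~` N) by exact: measurableC.
pose k := mul_nnsfun h (indic_nnsfun R mNC).
rewrite (_ : sintegral m h = sintegral m k); last first.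
  rewrite -!integralT_nnsfun; apply: ge0_ae_eq_integral => //.
  - by apply/measurable_EFinP; exact: measurable_funP.
  - by apply/measurable_EFinP; exact: measurable_funP.
  - by move=> x _; rewrite lee_fin.
  - by move=> x _; rewrite lee_fin.
  - exists N; split => // x /= /not_implyP[_]; apply: contra_notP => nNx.
    by rewrite /= mindicE mem_set// mulr1.
apply: ereal_sup_ubound; exists k => // x /=.
rewrite mindicE; have [Nx|nNx] := pselect (N x).
  by rewrite memNset ?mulr0//; exact.
rewrite mem_set// mulr1 (le_trans (hf x))//.
by apply: contrapT => h1; apply: nNx; exact: subN.
Qed.

Lemma integral_eq_ae (f g : T -> \bar R) : {ae m, forall x, f x = g x} ->
  (\int[m]_x f x = \int[m]_x g x)%E.
Proof.
move=> fg; rewrite integralE [RHS]integralE.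
have aux (h k : T -> \bar R) : (forall x, (0 <= h x)%E) -> (forall x, (0 <= k x)%E) ->
    {ae m, forall x, h x = k x} -> (\int[m]_x h x = \int[m]_x k x)%E.
  move=> h0 k0 hk; apply/eqP; rewrite eq_le !integral_le_ae//.
    by move: hk; apply: filterS => x ->.
  by move: hk; apply: filterS => x ->.
congr (_ - _)%E; apply: aux => //;
  by move: fg; apply: filterS => x h; rewrite ?(funeposE, funenegE) h.
Qed.

Lemma nint_le u v :
  (forall x, 0 <= u x) -> (forall x, u x <= v x) -> (nint u <= nint v)%E.
Proof.
move=> u0 uv; apply: integral_le_ae => [x|x|].
- by rewrite lee_fin.
- by rewrite lee_fin (le_trans (u0 x)).
- by apply: nearW => x; rewrite lee_fin.
Qed.

Lemma nint_le_ae u v : (forall x, 0 <= u x) -> (forall x, 0 <= v x) ->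
  {ae m, forall x, u x <= v x} -> (nint u <= nint v)%E.
Proof.
move=> u0 v0 uv; apply: integral_le_ae => [x|x|]; rewrite ?lee_fin//.
Qed.

Lemma nint_eq_ae u v : {ae m, forall x, u x = v x} -> nint u = nint v.
Proof.
by move=> uv; apply: integral_eq_ae; move: uv; apply: filterS => x ->.
Qed.

Lemma cint_eq_ae f g : {ae m, forall x, f x = g x} -> cint f = cint g.
Proof.
by move=> fg; apply: cplx_eq; congr fine; apply: integral_eq_ae;
  move: fg; apply: filterS => x ->.
Qed.

Lemma nintD u v : measurable_fun setT u -> measurable_fun setT v ->
  (forall x, 0 <= u x) -> (forall x, 0 <= v x) ->
  nint (fun x => u x + v x) = (nint u + nint v)%E.
Proof.
move=> mu mv u0 v0; rewrite /nint -ge0_integralD//.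
- by move=> x _; rewrite lee_fin.
- exact/measurable_EFinP.
- by move=> x _; rewrite lee_fin.
- exact/measurable_EFinP.
Qed.

Lemma nintZ u a : measurable_fun setT u -> 0 <= a -> (forall x, 0 <= u x) ->
  nint (fun x => a * u x) = (a%:E * nint u)%E.
Proof.
move=> mu a0 u0; rewrite /nint -ge0_integralZl_EFin//.
- by move=> x _; rewrite lee_fin.
- exact/measurable_EFinP.
Qed.

Lemma nint_eq u v : (forall x, u x = v x) -> nint u = nint v.
Proof. by move=> uv; congr nint; apply/funext. Qed.

Lemma cL1_le f (u : T -> R) : cmeas f -> (nint u < +oo)%E ->
  (forall x, cabs (f x) <= u x) -> cL1 f.
Proof.
move=> mf u1 fu; split => //; apply: le_lt_trans u1.
by apply: nint_le => // x; exact: cabs_ge0.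
Qed.

Lemma cL1_ae f g : cmeas g -> {ae m, forall x, f x = g x} -> cL1 f -> cL1 g.
Proof.
move=> mg fg [mf f1]; split => //.
by rewrite -(@nint_eq_ae (cabs \o f))//; move: fg; apply: filterS => x /= ->.
Qed.

Lemma cL1_Re f : cL1 f -> m.-integrable setT (fun x => (complex.Re (f x))%:E).
Proof.
move=> [[fr fi] f1]; apply/integrableP; split; first exact/measurable_EFinP.
by apply: le_lt_trans f1; apply: nint_le => x //; exact: normRe_le.
Qed.

Lemma cL1_Im f : cL1 f -> m.-integrable setT (fun x => (complex.Im (f x))%:E).
Proof.
move=> [[fr fi] f1]; apply/integrableP; split; first exact/measurable_EFinP.
by apply: le_lt_trans f1; apply: nint_le => x //; exact: normIm_le.
Qed.

Lemma cL1P f : m.-integrable setT (fun x => (complex.Re (f x))%:E) ->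
  m.-integrable setT (fun x => (complex.Im (f x))%:E) -> cL1 f.
Proof.
move=> /integrableP[/measurable_EFinP fr fr1] /integrableP[/measurable_EFinP fi fi1].
split => //; apply: le_lt_trans (lte_add_pinfty fr1 fi1).
rewrite -[leRHS](@nintD (fun x => `|complex.Re (f x)|) (fun x => `|complex.Im (f x)|))//; last 2 first.
  exact: measurableT_comp.
  exact: measurableT_comp.
by apply: nint_le => x; [exact: cabs_ge0|exact: cabs_le_ReIm].
Qed.

Lemma cL1D f g : cL1 f -> cL1 g -> cL1 (fun x => f x + g x).
Proof.
move=> f1 g1; have [mf f1'] := f1; have [mg g1'] := g1.
apply: (@cL1_le _ (fun x => cabs (f x) + cabs (g x))).
- exact: cmeasD.
- rewrite nintD; [|exact: measurable_cabs|exact: measurable_cabs|by move=> x; exact: cabs_ge0|by move=> x; exact: cabs_ge0].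
  exact: lte_add_pinfty.
- by move=> x; exact: cabsD.
Qed.

Lemma cL1Z (a : C) f : cL1 f -> cL1 (fun x => a * f x).
Proof.
move=> f1; have [mf f1'] := f1.
apply: (@cL1_le _ (fun x => cabs a * cabs (f x))).
- by apply: cmeasM => //; exact: cmeas_cst.
- rewrite nintZ ?cabs_ge0//; first by rewrite lte_mul_pinfty// lee_fin cabs_ge0.
    exact: measurable_cabs.
  by move=> x; exact: cabs_ge0.
- by move=> x; rewrite cabsM.
Qed.

Lemma cL1N f : cL1 f -> cL1 (fun x => - f x).
Proof.
move=> /(cL1Z (-1)); congr cL1; apply/funext => x; exact: mulN1r.
Qed.

Lemma cL1B f g : cL1 f -> cL1 g -> cL1 (fun x => f x - g x).
Proof. by move=> f1 g1; apply: cL1D => //; exact: cL1N. Qed.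

Lemma cL1_conj f : cL1 f -> cL1 (fun x => ((f x)^*)%C).
Proof.
move=> [mf f1]; split; first exact: cmeas_conj.
by apply: le_lt_trans f1; apply: nint_le => x; rewrite ?cabs_conj// cabs_ge0.
Qed.

Lemma cL1_0 : cL1 (fun=> 0).
Proof.
split; first exact: cmeas_cst.
by rewrite /nint cabs0 integral0.
Qed.

Lemma cint0 : cint (fun=> 0) = 0.
Proof. by apply: cplx_eq; rewrite /= /Rintegral /= integral0. Qed.

Lemma cintD f g : cL1 f -> cL1 g -> cint (fun x => f x + g x) = cint f + cint g.
Proof.
move=> f1 g1; apply: cplx_eq => /=.
  rewrite -RintegralD//; [|exact: cL1_Re..].
  by congr Rintegral; apply/funext => x; exact: cReD.
rewrite -RintegralD//; [|exact: cL1_Im..].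
by congr Rintegral; apply/funext => x; exact: cImD.
Qed.

Lemma cintZ (a : C) f : cL1 f -> cint (fun x => a * f x) = a * cint f.
Proof.
move=> f1; have h1 := cL1_Re f1; have h2 := cL1_Im f1.
have i1 (c : R) : m.-integrable setT (EFin \o (fun x => c * complex.Re (f x))).
  by have := integrableZl measurableT c h1; congr integrable; apply/funext => x.
have i2 (c : R) : m.-integrable setT (EFin \o (fun x => c * complex.Im (f x))).
  by have := integrableZl measurableT c h2; congr integrable; apply/funext => x.
apply: cplx_eq; rewrite ?(cReM, cImM) /=.
  rewrite -!RintegralZl// -RintegralB//.
  by congr Rintegral; apply/funext => x; exact: cReM.
rewrite -!RintegralZl// -RintegralD//.
by congr Rintegral; apply/funext => x; exact: cImM.
Qed.

Lemma cintN f : cL1 f -> cint (fun x => - f x) = - cint f.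
Proof.
move=> f1; rewrite -mulN1r -cintZ//; congr cint; apply/funext => x.
by rewrite mulN1r.
Qed.

Lemma cintB f g : cL1 f -> cL1 g -> cint (fun x => f x - g x) = cint f - cint g.
Proof. by move=> f1 g1; rewrite cintD// ?cintN//; exact: cL1N. Qed.

Lemma cint_conj f : cL1 f -> cint (fun x => ((f x)^*)%C) = ((cint f)^*)%C.
Proof.
move=> f1; apply: cplx_eq => /=.
  by congr Rintegral; apply/funext => x; exact: cReconj.
transitivity (\int[m]_x (-1 * complex.Im (f x)))%R.
  by congr Rintegral; apply/funext => x; rewrite cImconj mulN1r.
by rewrite RintegralZl ?mulN1r//; exact: cL1_Im.
Qed.

Lemma cL1_sum (I : Type) (s : seq I) (F : I -> T -> C) :
  (forall i, cL1 (F i)) -> cL1 (fun x => \sum_(i <- s) F i x).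
Proof.
move=> mF; elim: s => [|i s ih].
  by under eq_fun do rewrite big_nil; exact: cL1_0.
by under eq_fun do rewrite big_cons; exact: cL1D.
Qed.

Lemma cint_sum (I : Type) (s : seq I) (F : I -> T -> C) :
  (forall i, cL1 (F i)) -> cint (fun x => \sum_(i <- s) F i x) = \sum_(i <- s) cint (F i).
Proof.
move=> mF; elim: s => [|i s ih].
  by under eq_fun do rewrite big_nil; rewrite big_nil cint0.
rewrite big_cons -ih -cintD//; last exact: cL1_sum.
by congr cint; apply/funext => x; rewrite big_cons.
Qed.

Lemma cint_Re_le f : cL1 f -> (`|complex.Re (cint f)|%:E <= nint (fun x => cabs (f x)))%E.
Proof.
move=> f1; apply: (@le_trans _ _ (nint (fun x => `|complex.Re (f x)|))).
  rewrite /= /Rintegral EFin_normr_Rintegral//; last exact: cL1_Re.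
  apply: le_trans (le_abse_integral _ _ _) _ => //.
  by have /integrableP[] := cL1_Re f1.
by apply: nint_le => // x; exact: normRe_le.
Qed.

(* Rotating the integral onto the positive real axis. *)
Lemma cabs_cint_le f : cL1 f -> ((cabs (cint f))%:E <= nint (fun x => cabs (f x)))%E.
Proof.
move=> f1; have [z0|z0] := eqVneq (cint f) 0.
  by rewrite z0 cabs0 nint_ge0// => x; exact: cabs_ge0.
have cz0 : cabs (cint f) != 0 by apply/eqP => /cabs_eq0/eqP; exact/negP.
pose a : C := ((cint f)^*)%C * ((cabs (cint f))^-1)%:C%C.
have a1 : cabs a = 1.
  by rewrite /a cabsM cabs_conj cabsR ger0_norm ?invr_ge0 ?cabs_ge0// divff.
have := cint_Re_le (cL1Z a f1).
rewrite cintZ// [a * _](_ : _ = (cabs (cint f))%:C%C); last first.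
  rewrite /a mulrAC [X in X * _]mulrC mulC_conj -rmorphM /=.
  by rewrite expr2 mulfK.
rewrite /= ger0_norm ?cabs_ge0// => /le_trans; apply; apply: nint_le => x.
  exact: cabs_ge0.
by rewrite cabsM a1 mul1r.
Qed.

Lemma nint_dct (u : nat -> T -> R) (G : T -> R) :
  (forall n, measurable_fun setT (u n)) ->
  measurable_fun setT G -> (nint G < +oo)%E ->
  (forall n x, 0 <= u n x <= G x) ->
  {ae m, forall x, (u n x @[n --> \oo]) --> (0 : R)} ->
  nint (u n) @[n --> \oo] --> 0%E.
Proof.
move=> mu mG G1 uG u0.
have G0 x : 0 <= G x by have /andP[/le_trans] := uG 0%N x; exact.
have iG : m.-integrable setT (EFin \o G).
  apply/integrableP; split; first exact/measurable_EFinP.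
  by apply: le_lt_trans G1; apply: nint_le => x //=; rewrite ger0_norm.
have [] := @dominated_convergence _ T R m setT measurableT
  (fun n x => (u n x)%:E) (fun=> 0%E) (EFin \o G).
- by move=> n; exact/measurable_EFinP.
- exact: measurable_cst.
- move: u0; apply: filterS => x h _; apply: cvg_EFin => //; exact: nearW.
- exact: iG.
- apply: nearW => x n _ /=; have /andP[a b] := uG n x.
  by rewrite lee_fin ger0_norm.
by move=> _ _; rewrite integral0.
Qed.

(** Here and later, complex limits are expressed by [cabs] of a difference tending to 0, so that
    only the topology of [R] is involved. The bound by [G] passes to [f] almost everywhere, which
    makes [f] integrable. *)
Lemma cint_dct (F : nat -> T -> C) f (G : T -> R) :
  (forall n, cmeas (F n)) -> cmeas f ->
  measurable_fun setT G -> (nint G < +oo)%E ->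
  (forall n x, cabs (F n x) <= G x) ->
  {ae m, forall x, cabs (F n x - f x) @[n --> \oo] --> (0 : R)} ->
  cL1 f /\ cabs (cint (F n) - cint f) @[n --> \oo] --> (0 : R).
Proof.
move=> mF mf mG G1 FG Ff.
have G0 x : 0 <= G x by apply: le_trans (FG 0%N x); exact: cabs_ge0.
have fG : {ae m, forall x, cabs (f x) <= G x}.
  move: Ff; apply: filterS => x /cvgrPdist_lt Ff.
  apply/ler_addgt0Pl => e e0; have [N _ /(_ N (leqnn _))] := Ff e e0.
  rewrite /= sub0r normrN ger0_norm ?cabs_ge0// => h.
  rewrite -(subrK (F N x) (f x)) (le_trans (cabsD _ _))// lerD ?FG//.
  by rewrite cabsB ltW.
have f1 : cL1 f.
  split => //; apply: le_lt_trans G1; apply: nint_le_ae => // x; exact: cabs_ge0.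
have F1 n : cL1 (F n) by exact: (cL1_le (mF n) G1 (FG n)).
split => //.
have mFf n : cmeas (fun x => F n x - f x) by exact: cmeasB.
have : nint (fun x => cabs (F n x - f x)) @[n --> \oo] --> 0%E.
  apply: (@nint_dct _ (fun x => G x + cabs (f x))).
  - by move=> n; exact: measurable_cabs.
  - by apply: measurable_funD => //; exact: measurable_cabs.
  - rewrite nintD//; [|exact: measurable_cabs|by move=> x; exact: cabs_ge0].
    by have [_ f1'] := f1; exact: lte_add_pinfty.
  - move=> n x; rewrite cabs_ge0 (le_trans (cabsD _ _))// cabsN lerD//.
  - exact: Ff.
move=> h.
have : (cabs (cint (F n) - cint f))%:E @[n --> \oo] --> 0%E.
  apply: (@squeeze_cvge _ _ _ _ (cst 0%E) _
      (fun n => nint (fun x => cabs (F n x - f x)))) => //.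
  - apply: nearW => n; rewrite lee_fin cabs_ge0 /= -cintB//.
    by apply: cabs_cint_le; exact: cL1B.
  - exact: cvg_cst.
by move/fine_cvgP => [].
Qed.

End complex_integral.
Arguments cint_eq_ae {R d T m f g}.
Arguments nint_eq_ae {R d T m u v}.

(** * Tonelli and Fubini for complex-valued functions *)

Section fubini.
Context {R : realType} d1 d2 (T1 : measurableType d1) (T2 : measurableType d2).
Local Notation C := R[i].
Variable m1 : {sigma_finite_measure set T1 -> \bar R}.
Variable m2 : {sigma_finite_measure set T2 -> \bar R}.

Lemma ntonelli (u : T1 * T2 -> R) : measurable_fun setT u -> (forall z, 0 <= u z) ->
  (\int[m1]_x nint m2 (fun y => u (x, y)) = \int[m2]_y nint m1 (fun x => u (x, y)))%E.
Proof.
move=> mu u0; apply: (fubini_tonelli (EFin \o u)).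
  exact/measurable_EFinP.
by move=> z; rewrite lee_fin.
Qed.

Lemma measurable_nint (u : T1 * T2 -> R) : measurable_fun setT u -> (forall z, 0 <= u z) ->
  measurable_fun setT (fun x => nint m2 (fun y => u (x, y))).
Proof.
move=> mu u0; apply: (measurable_fun_fubini_tonelli_F (EFin \o u)).
  exact/measurable_EFinP.
by move=> z; rewrite lee_fin.
Qed.

(** The inner integrals are finite only almost everywhere; [FF] and [GG] record that [fine] alters
    them on null sets only. *)
Let rfubini (u : T1 * T2 -> R) : (m1 \x m2)%E.-integrable setT (EFin \o u) ->
  [/\ m1.-integrable setT (EFin \o (fun x => \int[m2]_y u (x, y))),
      m2.-integrable setT (EFin \o (fun y => \int[m1]_x u (x, y))) &
     \int[m1]_x \int[m2]_y u (x, y) = \int[m2]_y \int[m1]_x u (x, y)].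
Proof.
move=> iu.
have iF := integrable_fubini_F iu.
have mu' : measurable_fun setT (EFin \o u) by exact: measurable_int iu.
have iG : m2.-integrable setT (fubini_G m1 (EFin \o u)).
  apply/integrableP; split; first exact: (measurable_fubini_G iu).
  have /(integrable21ltyP m1 m2 mu') := iu; apply: le_lt_trans.
  apply: integral_le_ae => //.
  - by move=> y; exact: integral_ge0.
  - apply: nearW => y; apply: le_abse_integral => //.
    exact: measurableT_comp mu' (measurable_pair2 y).
have FF : {ae m1, forall x, EFin (fine (fubini_F m2 (EFin \o u) x)) = fubini_F m2 (EFin \o u) x}.
  have := integrable_ae measurableT iF.
  by apply: filterS => x /(_ I); exact: fineK.
have GG : {ae m2, forall x, EFin (fine (fubini_G m1 (EFin \o u) x)) = fubini_G m1 (EFin \o u) x}.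
  have := integrable_ae measurableT iG.
  by apply: filterS => x /(_ I); exact: fineK.
split.
- apply/integrableP; split.
    by apply/measurable_EFinP; apply: measurableT_comp => //; exact: measurable_int iF.
  have /integrableP[_] := iF; apply: le_lt_trans.
  apply: integral_le_ae => //; move: FF; apply: filterS => x <-; exact: lexx.
- apply/integrableP; split.
    by apply/measurable_EFinP; apply: measurableT_comp => //; exact: measurable_int iG.
  have /integrableP[_] := iG; apply: le_lt_trans.
  apply: integral_le_ae => //; move: GG; apply: filterS => x <-; exact: lexx.
- congr fine; rewrite (integral_eq_ae FF) (integral_eq_ae GG); exact: Fubini.
Qed.

Lemma cfubini (f : T1 * T2 -> C) : cmeas f ->
  (\int[m1]_x nint m2 (fun y => cabs (f (x, y))) < +oo)%E ->
  [/\ cL1 m1 (fun x => cint m2 (fun y => f (x, y))),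
      cL1 m2 (fun y => cint m1 (fun x => f (x, y))) &
      cint m1 (fun x => cint m2 (fun y => f (x, y))) =
      cint m2 (fun y => cint m1 (fun x => f (x, y)))].
Proof.
move=> mf f1; have [fr fi] := mf.
have [i1 j1 k1] : [/\ m1.-integrable setT (EFin \o (fun x => \int[m2]_y complex.Re (f (x, y)))),
      m2.-integrable setT (EFin \o (fun y => \int[m1]_x complex.Re (f (x, y)))) &
     \int[m1]_x \int[m2]_y complex.Re (f (x, y)) = \int[m2]_y \int[m1]_x complex.Re (f (x, y))].
  apply: (rfubini (u := fun z => complex.Re (f z))).
  apply/integrable12ltyP; first exact/measurable_EFinP.
  apply: le_lt_trans f1; apply: integral_le_ae.
  - by move=> x; exact: integral_ge0.
  - by move=> x; apply: nint_ge0 => y; exact: cabs_ge0.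
  - by apply: nearW => x; apply: nint_le => y //; exact: normRe_le.
have [i2 j2 k2] : [/\ m1.-integrable setT (EFin \o (fun x => \int[m2]_y complex.Im (f (x, y)))),
      m2.-integrable setT (EFin \o (fun y => \int[m1]_x complex.Im (f (x, y)))) &
     \int[m1]_x \int[m2]_y complex.Im (f (x, y)) = \int[m2]_y \int[m1]_x complex.Im (f (x, y))].
  apply: (rfubini (u := fun z => complex.Im (f z))).
  apply/integrable12ltyP; first exact/measurable_EFinP.
  apply: le_lt_trans f1; apply: integral_le_ae.
  - by move=> x; exact: integral_ge0.
  - by move=> x; apply: nint_ge0 => y; exact: cabs_ge0.
  - by apply: nearW => x; apply: nint_le => y //; exact: normIm_le.
by split; [exact: cL1P|exact: cL1P|exact: cplx_eq].
Qed.

Lemma cmeas_cint (f : T1 * T2 -> C) : cmeas f ->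
  cmeas (fun x => cint m2 (fun y => f (x, y))).
Proof.
have aux (u : T1 * T2 -> R) : measurable_fun setT u ->
    measurable_fun setT (fun x => \int[m2]_y u (x, y)).
  move=> mu; apply: measurableT_comp => //.
  under eq_fun do rewrite integralE.
  have mu' : measurable_fun setT (EFin \o u) by exact/measurable_EFinP.
  have mp := measurable_fun_fubini_tonelli_F ((EFin \o u)^\+)%E (measurable_funepos mu')
    (fun=> funepos_ge0 _ _).
  have mn := measurable_fun_fubini_tonelli_F ((EFin \o u)^\-)%E (measurable_funeneg mu')
    (fun=> funeneg_ge0 _ _).
  apply: emeasurable_funB.
    rewrite (_ : (fun=> _) = fubini_F m2 ((EFin \o u)^\+)%E); first exact: mp.
    by apply/funext => x; apply: eq_integral => y _; rewrite !funeposE.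
  rewrite (_ : (fun=> _) = fubini_F m2 ((EFin \o u)^\-)%E); first exact: mn.
  by apply/funext => x; apply: eq_integral => y _; rewrite !funenegE.
by move=> [fr fi]; split; [exact: (aux (fun z => complex.Re (f z)))|exact: (aux (fun z => complex.Im (f z)))].
Qed.

End fubini.

Section discrete.
Context {R : realType} d (T : measurableType d).
Local Notation C := R[i].

Lemma measurable_nat_prod d' (U : measurableType d') (f : nat * T -> U) :
  (forall n, measurable_fun setT (fun t => f (n, t))) -> measurable_fun setT f.
Proof.
move=> mf _ B mB; rewrite setTI.
rewrite (_ : _ @^-1` _ = \bigcup_n ([set n] `*` ((fun t => f (n, t)) @^-1` B))).
  apply: bigcupT_measurable => n; apply: measurableX => //.
  by have := mf n measurableT _ mB; rewrite setTI.
apply/seteqP; split=> [[n t] /= h|[n t] [k _ [/= -> //]]].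
by exists n.
Qed.

Lemma cmeas_nat_prod (f : nat * T -> C) :
  (forall n, cmeas (fun t => f (n, t))) -> cmeas f.
Proof. by move=> mf; split; apply: measurable_nat_prod => n; have [] := mf n. Qed.

Lemma cmeas_nat (f : nat -> C) : cmeas f.
Proof. by split. Qed.

End discrete.

HB.instance Definition _ (R : realType) := @Measure_isSigmaFinite.Build _ nat R
  (@counting nat R) (sigma_finite_counting R).

(** Packing counting measure as sigma-finite makes the Fubini lemmas above apply to sums. *)
Definition countN {R : realType} : {sigma_finite_measure set nat -> \bar R} :=
  @counting nat R.

(** * Summable families *)

Section countable_sums.
Context {R : realType}.
Local Notation C := R[i].
Local Notation N := (@countN R).

(** Indices mapped to [None] are idle, so that empty, finite and infinite sets are handled alike. *)
Lemma countable_enum (X : choiceType) (D : set X) : countable D ->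
  exists e : nat -> option X, [/\ forall n x, e n = Some x -> D x,
    forall x, D x -> exists n, e n = Some x &
    forall n m x, e n = Some x -> e m = Some x -> n = m].
Proof.
move=> /countable_injP[f injf].
pose P n := exists2 x, D x & f x = n.
exists (fun n => if pselect (P n) is left h then Some (projT1 (cid2 h)) else None).
split=> [n x|x Dx|n m x].
- by case: pselect => //= h [<-]; case: cid2.
- exists (f x); case: pselect => [h|[]]; last by exists x.
  case: cid2 => y Dy fyx /=; congr Some; apply: injf => //; exact: mem_set.
- case: pselect => //= h [<-]; case: pselect => //= h' [].
  by case: cid2 => y Dy fy /=; case: cid2 => z Dz fz /= yz; rewrite -fy -fz yz.
Qed.

Lemma esum_enum (X : choiceType) (D : set X) (e : nat -> option X) (a : X -> \bar R) :
  [/\ forall n x, e n = Some x -> D x,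
    forall x, D x -> exists n, e n = Some x &
    forall n m x, e n = Some x -> e m = Some x -> n = m] ->
  (forall x, 0 <= a x)%E ->
  (\esum_(x in D) a x = \int[N]_n oapp a 0%E (e n))%E.
Proof.
move=> [eD De einj] a0.
have b0 n : (0 <= oapp a 0%E (e n))%E by case: (e n).
rewrite ge0_integral_count// nneseries_esumT//.
pose P := [set n | e n].
rewrite (esumID P)// [X in (_ = _ + X)%E]esum1 ?adde0; last first.
  by move=> n [_]; rewrite /P /=; case: (e n).
rewrite setTI.
have [x0|nx0] := pselect (exists x : X, True); last first.
  rewrite !esum1 // => [n /= _|x Dx]; last by exfalso; apply: nx0; exists x.
  by case: (e n) => // x; exfalso; apply: nx0; exists x.
pose g n := odflt (projT1 (cid x0)) (e n).
rewrite (@reindex_esum _ _ _ P D g).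
  by apply: eq_esum => n; rewrite /P /g /=; case: (e n).
split.
- by move=> n; rewrite /P /g /=; case E: (e n) => [x|//] _; exact: eD E.
- move=> n m; rewrite /P /g !inE /=; case E: (e n) => [x|//]; case F: (e m) => [y|//] _ _ /= xy.
  by apply: einj E _; rewrite xy.
- by move=> x /De[n en]; exists n; rewrite /P /g /= en.
Qed.

(** Through this identification with an integral over [nat], sums inherit linearity, the triangle
    inequality and Fubini. The two parts in [rsum] match the positive and negative parts of the
    integral. *)
Lemma csum_enum (X : choiceType) (D : set X) (e : nat -> option X) (a : X -> C) :
  [/\ forall n x, e n = Some x -> D x,
    forall x, D x -> exists n, e n = Some x &
    forall n m x, e n = Some x -> e m = Some x -> n = m] ->
  (\esum_(x in D) (cabs (a x))%:E < +oo)%E ->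
  csum D a = cint N (fun n => oapp a 0 (e n)) /\ cL1 N (fun n => oapp a 0 (e n)).
Proof.
move=> eP afin.
have a1 : cL1 N (fun n => oapp a 0 (e n)).
  split; first exact: cmeas_nat.
  move: afin; rewrite (esum_enum eP); last by move=> x; rewrite lee_fin cabs_ge0.
  congr (_ < _)%E; apply: eq_integral => n _; case: (e n) => //=.
  by rewrite cabs0.
split => //.
have aux (h : C -> R) (b := fun x => h (a x)) : h 0 = 0 ->
    N.-integrable setT (fun n => (oapp b 0 (e n))%:E) ->
    rsum D b = \int[N]_n oapp b 0 (e n).
  move=> h0 ib; rewrite /Rintegral integralE fineB; last 2 first.
    exact: integrable_pos_fin_num.
    exact: integrable_neg_fin_num.
  rewrite /rsum; congr (fine _ - fine _); rewrite (esum_enum eP).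
  - by apply: eq_integral => n _; rewrite funeposE; case: (e n) => [x|] /=; rewrite ?EFin_max// maxxx.
  - by move=> x; rewrite lee_fin le_max lexx orbT.
  - by apply: eq_integral => n _; rewrite funenegE; case: (e n) => [x|] /=; rewrite ?EFin_max ?oppr0// maxxx.
  - by move=> x; rewrite lee_fin le_max lexx orbT.
have eRe n : oapp (fun x => complex.Re (a x)) 0 (e n) = complex.Re (oapp a 0 (e n)).
  by case: (e n).
have eIm n : oapp (fun x => complex.Im (a x)) 0 (e n) = complex.Im (oapp a 0 (e n)).
  by case: (e n).
apply: cplx_eq => /=; rewrite aux//.
- by congr Rintegral; apply/funext.
- by under eq_fun do rewrite eRe; exact: cL1_Re.
- by congr Rintegral; apply/funext.
- by under eq_fun do rewrite eIm; exact: cL1_Im.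
Qed.

End countable_sums.

Section csum_theory.
Context {R : realType}.
Local Notation C := R[i].
Local Notation N := (@countN R).
Variable X : choiceType.
Implicit Types (D : set X) (a b : X -> C).

Definition csummable D a := (\esum_(x in D) (cabs (a x))%:E < +oo)%E.

Lemma csummable_le D a (u : X -> R) :
  (forall x, D x -> cabs (a x) <= u x) -> (\esum_(x in D) (u x)%:E < +oo)%E -> csummable D a.
Proof.
move=> au; apply: le_lt_trans; apply: le_esum => x Dx.
by rewrite lee_fin au.
Qed.

Lemma csummable0 D : csummable D (fun=> 0).
Proof. by rewrite /csummable esum1// => x _; rewrite cabs0. Qed.

Lemma csummableD D a b : csummable D a -> csummable D b -> csummable D (fun x => a x + b x).
Proof.
move=> ha hb; rewrite /csummable.
apply: (@le_lt_trans _ _ (\esum_(x in D) ((cabs (a x))%:E + (cabs (b x))%:E))%E).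
  by apply: le_esum => x _; rewrite -EFinD lee_fin cabsD.
by rewrite esumD ?lte_add_pinfty// => x _; rewrite lee_fin cabs_ge0.
Qed.

Lemma csummableZ D (c : C) a : countable D -> csummable D a -> csummable D (fun x => c * a x).
Proof.
move=> cD ha; have [e eP] := countable_enum cD; have [_ a1] := csum_enum eP ha.
have [_] := cL1Z c a1; apply: le_lt_trans.
rewrite (esum_enum eP); last by move=> x; rewrite lee_fin cabs_ge0.
apply: integral_le_ae => [n|n|].
- by case: (e n) => //= x; rewrite lee_fin cabs_ge0.
- by rewrite lee_fin cabs_ge0.
- by apply: nearW => n; case: (e n) => //=; rewrite mulr0 cabs0.
Qed.

Lemma eq_csum D a b : (forall x, D x -> a x = b x) -> csum D a = csum D b.
Proof.
by move=> ab; apply: cplx_eq; congr (fine _ - fine _); apply: eq_esum => x Dx; rewrite ab.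
Qed.

Lemma csum_mkcond D a : csum D a = csum setT (fun x => if x \in D then a x else 0).
Proof.
by apply: cplx_eq; congr (fine _ - fine _); rewrite esum_mkcond; apply: eq_esum => x Dx /=;
  case: ifPn => //= _; rewrite ?oppr0 maxxx.
Qed.

Lemma csumD D a b : countable D -> csummable D a -> csummable D b ->
  csum D (fun x => a x + b x) = csum D a + csum D b.
Proof.
move=> cD ha hb; have [e eP] := countable_enum cD.
have [-> a1] := csum_enum eP ha; have [-> b1] := csum_enum eP hb.
have [-> ab1] := csum_enum eP (csummableD ha hb).
by rewrite -cintD//; congr cint; apply/funext => n; case: (e n) => //=; rewrite addr0.
Qed.

Lemma csumZ D (c : C) a : countable D -> csummable D a ->
  csum D (fun x => c * a x) = c * csum D a.
Proof.
move=> cD ha; have [e eP] := countable_enum cD.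
have [-> a1] := csum_enum eP ha.
have [-> ab1] := csum_enum eP (csummableZ c cD ha).
by rewrite -cintZ//; congr cint; apply/funext => n; case: (e n) => //=; rewrite mulr0.
Qed.

Lemma cabs_csum_le D a : countable D -> csummable D a ->
  ((cabs (csum D a))%:E <= \esum_(x in D) (cabs (a x))%:E)%E.
Proof.
move=> cD ha; have [e eP] := countable_enum cD.
have [-> a1] := csum_enum eP ha.
apply: le_trans (cabs_cint_le a1) _.
rewrite (esum_enum eP); last by move=> x; rewrite lee_fin cabs_ge0.
rewrite /nint le_eqVlt; apply/orP; left; apply/eqP; apply: eq_integral => n _.
by case: (e n) => //=; rewrite cabs0.
Qed.

Lemma csum_set1 (y : X) (c : C) : csum setT (fun x => if x == y then c else 0) = c.
Proof.
have -> : (fun x => if x == y then c else 0) = (fun x => if x \in [set y] then c else 0).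
  apply/funext => x; congr (if _ then _ else _).
  by apply/eqP/idP => [->|/set_mem //]; exact: mem_set.
rewrite -csum_mkcond; apply: cplx_eq => /=; rewrite /rsum !esum_set1 /= ?lee_fin ?le_max ?lexx ?orbT//.
  by case: (leP (complex.Re c) 0); case: (leP (- complex.Re c) 0); lra.
by case: (leP (complex.Im c) 0); case: (leP (- complex.Im c) 0); lra.
Qed.

Lemma csummable_fset (s : {fset X}) a : csummable setT (fun x => if x \in s then a x else 0).
Proof.
rewrite /csummable.
rewrite (_ : \esum_(x in _) _ = \esum_(x in [set` s]) (cabs (a x))%:E)%E; last first.
  rewrite [RHS]esum_mkcond; apply: eq_esum => x _.
  by rewrite mem_setE; case: ifP; rewrite ?cabs0.
rewrite esum_fset//; last by move=> x _; rewrite lee_fin cabs_ge0.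
by rewrite fsbig_finite//= sumEFin ltry.
Qed.

Lemma csum_fset (s : {fset X}) a : countable [set: X] ->
  csum setT (fun x => if x \in s then a x else 0) = \sum_(x <- s) a x.
Proof.
move=> cX.
have [r ru sr] : exists2 r : seq X, uniq r & (forall x, (x \in s) = (x \in r)).
  by exists (enum_fset s); [exact: fset_uniq|].
have -> : \sum_(x <- s) a x = \sum_(x <- r) a x.
  apply: perm_big; exact: uniq_perm.
under eq_csum do rewrite sr.
have sm (r' : seq X) : csummable setT (fun x => if x \in r' then a x else 0).
  have := csummable_fset [fset x in r']%fset a; congr csummable.
  by apply/funext => x; rewrite inE.
elim: r ru {s sr} => [_|y r ih /= /andP[yr ru]].
  rewrite big_nil (_ : (fun _ => _) = (fun=> 0 * 0)); last by apply/funext => x; rewrite mulr0.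
  by rewrite csumZ ?mul0r//; exact: csummable0.
rewrite big_cons -ih// -(csum_set1 y (a y)) -csumD//; last first.
  have := sm [:: y]; congr csummable; apply/funext => x; rewrite inE.
  by case: eqP => // ->.
apply: eq_csum => x _; rewrite inE; case: eqP => [->|_] /=; last by rewrite add0r.
by rewrite (negbTE yr) addr0.
Qed.

(** A finite set that almost attains the supremum of the absolute partial sums controls the absolute
    tail of every larger finite set, hence the error of its partial sum. *)
Lemma csum_lim a (eps : R) : countable [set: X] -> csummable setT a -> 0 < eps ->
  exists s0 : {fset X}, forall s : {fset X}, (s0 `<=` s)%fset ->
    (\esum_(x in ~` [set` s]) (cabs (a x))%:E <= eps%:E)%E /\
    cabs (csum setT a - \sum_(x <- s) a x) <= eps.
Proof.
move=> cX ha e0.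
have tot : (\esum_(x in setT) (cabs (a x))%:E)%E \is a fin_num.
  by rewrite ge0_fin_numE// esum_ge0// => x _; rewrite lee_fin cabs_ge0.
have [_ [F [finF _] <-] hF] := @ub_ereal_sup_adherent _ _ eps e0 tot.
exists (fset_set F) => s sF.
have tail : (\esum_(x in ~` [set` s]) (cabs (a x))%:E <= eps%:E)%E.
  move: hF; rewrite -/(esum _ _) (esumID [set` s]) ?setTI; last first.
    by move=> x _; rewrite lee_fin cabs_ge0.
  have lF : (\sum_(x \in F) (cabs (a x))%:E <= \esum_(x in [set` s]) (cabs (a x))%:E)%E.
    rewrite -esum_fset//; last by move=> x _; rewrite lee_fin cabs_ge0.
    rewrite esum_mkcond [leRHS]esum_mkcond; apply: le_esum => x _.
    rewrite mem_setE; have [Fx|_] := boolP (x \in F); last first.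
      by case: ifP => //; rewrite lee_fin cabs_ge0.
    by rewrite (fsubsetP sF)// in_fset_set.
  have := csummable_fset s a; rewrite /csummable.
  rewrite (_ : \esum_(x in setT) _ = \esum_(x in [set` s]) (cabs (a x))%:E)%E; last first.
    rewrite [RHS]esum_mkcond; apply: eq_esum => x _.
    by rewrite mem_setE; case: ifP; rewrite ?cabs0.
  have : (0 <= \esum_(x in [set` s]) (cabs (a x))%:E)%E.
    by rewrite esum_ge0// => x _; rewrite lee_fin cabs_ge0.
  move: lF; set S := (\esum_(x in [set` s]) _)%E; set T := (\esum_(x in ~` _) _)%E.
  move=> lF S0 Sfin /(fun h => lt_le_trans h lF).
  have Sf : S \is a fin_num by rewrite ge0_fin_numE.
  by rewrite -(fineK Sf); move: (fine S) => S'; case: T => [r| |] /=; [rewrite lte_fin lee_fin; lra | rewrite ltNge leey | rewrite leNye].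
split => //.
have sb : csummable setT (fun x => if x \in s then 0 else a x).
  by apply: csummable_le ha => x _; case: ifP => //; rewrite cabs0 cabs_ge0.
rewrite -csum_fset// {1}(_ : a = fun x => (if x \in s then a x else 0) + (if x \in s then 0 else a x)); last first.
  by apply/funext => x; case: ifP; rewrite ?addr0 ?add0r.
rewrite csumD//; last exact: csummable_fset.
rewrite addrC addrA addNr add0r -lee_fin; apply: le_trans tail.
apply: le_trans (cabs_csum_le _ _) _ => //.
rewrite [leRHS]esum_mkcond; apply: le_esum => x _.
rewrite in_setC mem_setE; case: ifP => //=; by rewrite ?cabs0.
Qed.

Lemma csum_reindex (Y : choiceType) (P : set Y) D (f : Y -> X) a :
  set_bij P D f -> csum D a = csum P (a \o f).
Proof. by move=> bf; apply: cplx_eq; congr (fine _ - fine _); rewrite (reindex_esum P _ f). Qed.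

End csum_theory.

Section sums_and_integrals.
Context {R : realType} d (T : measurableType d).
Local Notation C := R[i].
Local Notation N := (@countN R).
Variable m : {sigma_finite_measure set T -> \bar R}.
Variable X : choiceType.
Implicit Types (D : set X).

Lemma nint_esum D (u : X -> T -> R) : countable D ->
  (forall x, measurable_fun setT (u x)) -> (forall x t, 0 <= u x t) ->
  ((\int[m]_t \esum_(x in D) (u x t)%:E) = (\esum_(x in D) nint m (u x)))%E.
Proof.
move=> cD mu u0; have [e eP] := countable_enum cD.
rewrite (esum_enum eP); last by move=> x; exact: nint_ge0.
pose v (z : nat * T) := oapp (fun x => u x z.2) 0 (e z.1).
have v0 z : 0 <= v z by rewrite /v; case: (e _) => /=.
have mv : measurable_fun setT v.
  apply: measurable_nat_prod => n; rewrite /v /=; case: (e n) => [x|] /=; first exact: mu.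
  exact: measurable_cst.
transitivity (\int[m]_t nint N (fun n => v (n, t)))%E.
  apply: eq_integral => t _; rewrite (esum_enum eP); last by move=> x; rewrite lee_fin.
  by apply: eq_integral => n _; rewrite /v /=; case: (e n).
rewrite -(ntonelli N m mv v0); apply: eq_integral => n _.
rewrite /v /=; case: (e n) => [x|] //=.
by rewrite /nint integral0.
Qed.

Lemma measurable_esum D (u : X -> T -> R) : countable D ->
  (forall x, measurable_fun setT (u x)) -> (forall x t, 0 <= u x t) ->
  measurable_fun setT (fun t => \esum_(x in D) (u x t)%:E)%E.
Proof.
move=> cD mu u0; have [e eP] := countable_enum cD.
pose v (z : T * nat) := oapp (fun x => u x z.1) 0 (e z.2).
have v0 z : 0 <= v z by rewrite /v; case: (e _) => /=.
have mv' : measurable_fun setT (fun z : nat * T => v (z.2, z.1)).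
  apply: measurable_nat_prod => n; rewrite /v /=; case: (e n) => [x|] /=; first exact: mu.
  exact: measurable_cst.
have mv : measurable_fun setT v.
  have := measurableT_comp mv' (measurable_swap (T1 := T) (T2 := nat)).
  by congr measurable_fun; apply/funext => -[].
have := @measurable_nint R _ _ T nat N v mv v0.
congr measurable_fun; apply/funext => t.
rewrite (esum_enum eP); last by move=> x; rewrite lee_fin.
by apply: eq_integral => n _; rewrite /v /=; case: (e n).
Qed.

Lemma cmeas_csum D (f : X -> T -> C) : countable D -> (forall x, cmeas (f x)) ->
  cmeas (fun t => csum D (f ^~ t)).
Proof.
move=> cD mf.
have aux (u : X -> T -> R) : (forall x, measurable_fun setT (u x)) ->
    measurable_fun setT (fun t => rsum D (u ^~ t)).
  move=> mu; apply: measurable_funB; apply: measurableT_comp => //.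
    apply: (measurable_esum (u := fun x t => Num.max (u x t) 0)) => // [x|x t].
      exact: measurable_maxr.
    by rewrite le_max lexx orbT.
  apply: (measurable_esum (u := fun x t => Num.max (- u x t) 0)) => // [x|x t].
    by apply: measurable_maxr => //; exact: measurable_funN.
  by rewrite le_max lexx orbT.
split; [apply: (aux (fun x t => complex.Re (f x t)))|apply: (aux (fun x t => complex.Im (f x t)))];
  by move=> x; have [] := mf x.
Qed.

(** Fubini for counting measure times [m]. Tonelli gives the a.e. summability; where it fails,
    [csum] takes a meaningless value, but only on a null set. *)
Lemma csum_cint D (f : X -> T -> C) : countable D -> (forall x, cmeas (f x)) ->
  (\esum_(x in D) nint m (fun t => cabs (f x t)) < +oo)%E ->
  [/\ {ae m, forall t, csummable D (f ^~ t)},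
      cL1 m (fun t => csum D (f ^~ t)), csummable D (fun x => cint m (f x)) &
      csum D (fun x => cint m (f x)) = cint m (fun t => csum D (f ^~ t))].
Proof.
move=> cD mf f1; have [e eP] := countable_enum cD.
have mfa x : measurable_fun setT (fun t => cabs (f x t)) by exact: measurable_cabs.
have f1' : ((\int[m]_t \esum_(x in D) (cabs (f x t))%:E) < +oo)%E.
  by rewrite nint_esum// => x t; exact: cabs_ge0.
have aef : {ae m, forall t, csummable D (f ^~ t)}.
  have i : m.-integrable setT (fun t => \esum_(x in D) (cabs (f x t))%:E)%E.
    apply/integrableP; split; first by apply: measurable_esum => // x t; exact: cabs_ge0.
    apply: le_lt_trans f1'; apply: integral_le_ae => // [t|].
      by rewrite esum_ge0// => x _; rewrite lee_fin cabs_ge0.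
    apply: nearW => t; rewrite gee0_abs// esum_ge0// => x _; by rewrite lee_fin cabs_ge0.
  have := integrable_ae measurableT i; apply: filterS => t /(_ I).
  by rewrite ge0_fin_numE// esum_ge0// => x _; rewrite lee_fin cabs_ge0.
have sc : csummable D (fun x => cint m (f x)).
  apply: le_lt_trans f1; apply: le_esum => x Dx.
  have [fx|] := ltP (nint m (fun t => cabs (f x t))) +oo%E.
    by apply: cabs_cint_le; split.
  by rewrite leye_eq => /eqP ->; rewrite leey.
have [-> _] := csum_enum eP sc.
pose g (z : nat * T) := oapp (fun x => f x z.2) 0 (e z.1).
have mg : cmeas g.
  apply: cmeas_nat_prod => n; rewrite /g /=; case: (e n) => [x|] /=; first exact: mf.
  exact: cmeas_cst.
have g1 : (\int[N]_n nint m (fun t => cabs (g (n, t))) < +oo)%E.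
  apply: le_lt_trans f1; rewrite (esum_enum eP); last by move=> x; apply: nint_ge0 => t; exact: cabs_ge0.
  rewrite le_eqVlt; apply/orP; left; apply/eqP; apply: eq_integral => n _.
  rewrite /g /=; case: (e n) => [x|] //=.
  by rewrite /nint cabs0 integral0.
have [_ h1 h2] := @cfubini R _ _ nat T N m g mg g1.
have eqg : {ae m, forall t, cint N (fun n => g (n, t)) = csum D (f ^~ t)}.
  move: aef; apply: filterS => t ht; have [-> _] := csum_enum eP ht.
  by congr cint; apply/funext => n; rewrite /g /=; case: (e n).
have cc := cmeas_csum cD mf.
split => //; first exact: cL1_ae eqg h1.
rewrite -(cint_eq_ae eqg) -h2; congr cint; apply/funext => n.
by rewrite /g /=; case: (e n) => [x|] //=; rewrite cint0.
Qed.

End sums_and_integrals.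

Section csum_fubini.
Context {R : realType}.
Local Notation C := R[i].
Local Notation N := (@countN R).
Variables (X Y : choiceType).

(** An instance of [csum_cint] whose measure space is [nat], enumerating the second index set. *)
Lemma csum_exchange (D : set X) (E : set Y) (f : X -> Y -> C) :
  countable D -> countable E ->
  (\esum_(x in D) \esum_(y in E) (cabs (f x y))%:E < +oo)%E ->
  [/\ forall y, E y -> csummable D (f ^~ y), csummable E (fun y => csum D (f ^~ y)) &
  csum D (fun x => csum E (f x)) = csum E (fun y => csum D (f ^~ y))].
Proof.
move=> cD cE f1; have [e eP] := countable_enum cE.
have a0 x y : (0 <= (cabs (f x y))%:E)%E by rewrite lee_fin cabs_ge0.
have f2 : (\esum_(y in E) \esum_(x in D) (cabs (f x y))%:E < +oo)%E.
  move: f1; rewrite !esum_esum// => h; apply: le_lt_trans h.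
  rewrite (@reindex_esum _ _ _ (D `*`` (fun=> E)) _ (fun z => (z.2, z.1)))//.
  split=> [[x y] []//|[x y] [x' y'] _ _ [] -> ->//|[y x] [/= Ey Dx]].
  by exists (x, y).
have fx x : D x -> csummable E (f x).
  move=> Dx; apply: le_lt_trans f1.
  by apply: esum_ge; exists [set x]; rewrite ?fsbig_set1//; split => // _ ->.
have fy y : E y -> csummable D (f ^~ y).
  move=> Ey; apply: le_lt_trans f2.
  by apply: esum_ge; exists [set y]; rewrite ?fsbig_set1//; split => // _ ->.
split => //.
  apply: le_lt_trans f2; apply: le_esum => y Ey.
  by apply: cabs_csum_le => //; exact: fy.
pose g x n := oapp (f x) 0 (e n).
have gE x : (nint N (fun n => cabs (g x n)) = \esum_(y in E) (cabs (f x y))%:E)%E.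
  rewrite (esum_enum eP)//; apply: eq_integral => n _; rewrite /g; case: (e n) => //=.
  by rewrite cabs0.
have [||_ h1 h2 h3] := @csum_cint R _ nat N X D g cD; first by move=> x; exact: cmeas_nat.
  by under eq_esum do rewrite gE.
transitivity (csum D (fun x => cint N (g x))).
  by apply: eq_csum => x Dx; have [->] := csum_enum eP (fx _ Dx).
have sE : csummable E (fun y => csum D (f ^~ y)).
  apply: le_lt_trans f2; apply: le_esum => y Ey.
  by apply: cabs_csum_le => //; exact: fy.
rewrite h3; have [-> _] := csum_enum eP sE; congr cint; apply/funext => n.
rewrite /g; case: (e n) => //=.
rewrite (_ : (fun _ => _) = (fun=> 0 * 0)); last by apply/funext => x; rewrite mulr0.
by rewrite csumZ ?mul0r//; exact: csummable0.
Qed.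

End csum_fubini.

(** * Integrals under maps that scale the measure *)

Section transfer.
Context {R : realType} d1 d2 (T1 : measurableType d1) (T2 : measurableType d2).
Variables (m1 : {measure set T1 -> \bar R}) (m2 : {measure set T2 -> \bar R}).
Variables (phi : T1 -> T2) (c : R).
Hypothesis mphi : measurable_fun setT phi.
Hypothesis c0 : 0 <= c.
Hypothesis phiE : forall E, measurable E -> m1 (phi @^-1` E) = (c%:E * m2 E)%E.

Lemma integral_transfer (u : T2 -> \bar R) : measurable_fun setT u ->
  (forall x, (0 <= u x)%E) ->
  (\int[m1]_x u (phi x) = c%:E * \int[m2]_x u x)%E.
Proof.
move=> mu u0.
have := @ge0_integral_pushforward _ _ _ _ R phi mphi m1 setT u measurableT mu.
rewrite preimage_setT => H; transitivity (\int[pushforward m1 phi]_y u y)%E.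
  by rewrite H.
pose nc := NngNum c0.
transitivity (\int[mscale nc m2]_x u x)%E.
  by apply: eq_measure_integral => A mA _; exact: phiE.
by rewrite ge0_integral_mscale.
Qed.

Lemma nint_transfer (u : T2 -> R) : measurable_fun setT u -> (forall x, 0 <= u x) ->
  nint m1 (u \o phi) = (c%:E * nint m2 u)%E.
Proof.
move=> mu u0; apply: (integral_transfer (u := EFin \o u)) => [|x].
  exact/measurable_EFinP.
by rewrite lee_fin.
Qed.

Lemma cL1_transfer f : cL1 m2 f -> cL1 m1 (f \o phi).
Proof.
move=> [[fr fi] f1]; split.
  by split; [exact: (measurableT_comp fr mphi)|exact: (measurableT_comp fi mphi)].
rewrite (nint_transfer (u := fun x => cabs (f x))).
- by rewrite lte_mul_pinfty// lee_fin.
- exact: measurable_cabs.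
- by move=> x; exact: cabs_ge0.
Qed.

Lemma cint_transfer f : cL1 m2 f -> cint m1 (f \o phi) = c%:C%C * cint m2 f.
Proof.
move=> f1.
have aux (u : T2 -> R) : m2.-integrable setT (EFin \o u) ->
    \int[m1]_x u (phi x) = c * \int[m2]_x u x.
  move=> iu; have /measurable_EFinP mu := measurable_int _ iu.
  have up := integrable_pos_fin_num measurableT iu.
  have un := integrable_neg_fin_num measurableT iu.
  rewrite /Rintegral integralE [in RHS]integralE.
  have -> : (\int[m1]_x ((fun x => (u (phi x))%:E)^\+ x) =
      c%:E * \int[m2]_x ((EFin \o u)^\+ x))%E.
    have := nint_transfer (u := fun x => Num.max (u x) 0).
    rewrite /nint => H; transitivity (\int[m1]_x (Num.max (u (phi x)) 0)%:E)%E; last first.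
      rewrite H; first by congr (_ * _)%E; apply: eq_integral => x _; rewrite funeposE EFin_max.
      - exact: measurable_maxr.
      - by move=> x; rewrite le_max lexx orbT.
    - by apply: eq_integral => x _; rewrite funeposE EFin_max.
  have -> : (\int[m1]_x ((fun x => (u (phi x))%:E)^\- x) =
      c%:E * \int[m2]_x ((EFin \o u)^\- x))%E.
    have := nint_transfer (u := fun x => Num.max (- u x) 0).
    rewrite /nint => H; transitivity (\int[m1]_x (Num.max (- u (phi x)) 0)%:E)%E; last first.
      rewrite H; first by congr (_ * _)%E; apply: eq_integral => x _; rewrite funenegE EFin_max.
      - by apply: measurable_maxr => //; exact: measurable_funN.
      - by move=> x; rewrite le_max lexx orbT.
    - by apply: eq_integral => x _; rewrite funenegE EFin_max.
  rewrite -(fineK up) -(fineK un) -!EFinM -!EFinB /=; ring.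
apply: cplx_eq; rewrite ?(cReM, cImM) /= ?mul0r ?subr0 ?addr0.
  exact: (aux (fun x => complex.Re (f x)) (cL1_Re f1)).
exact: (aux (fun x => complex.Im (f x)) (cL1_Im f1)).
Qed.

End transfer.

Lemma count_bigcup_measurable d (T : measurableType d) (P : countType) (D : set P)
  (F : P -> set T) : (forall p, D p -> measurable (F p)) ->
  measurable (\bigcup_(p in D) F p).
Proof.
move=> mF.
pose G n := if @choice.unpickle P n is Some p then (if p \in D then F p else set0) else set0.
rewrite (_ : \bigcup_(p in D) F p = \bigcup_n G n).
  apply: bigcupT_measurable => n; rewrite /G; case: choice.unpickle => [p|] //.
  by case: ifPn => // /set_mem /mF.
apply/seteqP; split=> x.
  by move=> [p Dp Fx]; exists (choice.pickle p) => //; rewrite /G choice.pickleK mem_set.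
move=> [n _]; rewrite /G; case: choice.unpickle => [p|] //.
by case: ifPn => // /set_mem Dp Fx; exists p.
Qed.

(** * Lebesgue measure on R^d *)

Section topology_cV.
Context {R : realType} {n : nat}.
Local Notation V := 'cV[R]_n.

Lemma cV_norm_lt (x : V) e : 0 < e -> `|x| < e <-> forall i, `|x i ord0| < e.
Proof.
move=> e0; rewrite {1}/Num.norm /= mx_normrE; split.
  move=> h i; apply: le_lt_trans h.
  by apply: (le_bigmax _ (fun ij : 'I_n * 'I_1 => `|x ij.1 ij.2|) (i, ord0)).
by move=> h; apply/bigmax_ltP; split => // -[i j] _ /=; rewrite (ord1 j).
Qed.

Lemma cV_norm_coord (x : V) i : `|x i ord0| <= `|x|.
Proof.
rewrite [leRHS]/Num.norm /= mx_normrE.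
by apply: (le_bigmax _ (fun ij : 'I_n * 'I_1 => `|x ij.1 ij.2|) (i, ord0)).
Qed.

Lemma cV_norm_le (x : V) e : 0 <= e -> `|x| <= e <-> forall i, `|x i ord0| <= e.
Proof.
move=> e0; split=> [h i|h]; first exact: le_trans (cV_norm_coord x i) h.
rewrite {1}/Num.norm /= mx_normrE.
by apply/bigmax_leP; split => // -[i j] _ /=; rewrite (ord1 j).
Qed.

Lemma coord_cont i : continuous (fun x : V => x i ord0).
Proof. exact: coord_continuous. Qed.

Lemma measurable_coord i : measurable_fun setT (fun x : V => x i ord0).
Proof. exact: measurable_cV_coord. Qed.

Lemma measurable_cV_ball (q : V) e : measurable (ball q e).
Proof.
have [e0|e0] := ltP 0 e; last first.
  rewrite (_ : ball q e = set0) ?measurable0//; apply/seteqP; split => // x.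
  by rewrite -ball_normE /ball_ /= => h; have := le_lt_trans (normr_ge0 _) h; rewrite ltNge e0.
rewrite (_ : ball q e = \bigcap_(i in [set: 'I_n]) [set x | `|q i ord0 - x i ord0| < e]).
  apply: fin_bigcap_measurable => // i _.
  rewrite (_ : (fun _ => _) = (fun x : V => x i ord0) @^-1` ball (q i ord0) e)//.
  by rewrite -[X in measurable X]setTI; apply: measurable_coord => //; exact: measurable_ball.
apply/seteqP; split=> x; rewrite -ball_normE /ball_ /=.
  by move=> /cV_norm_lt -/(_ e0) h i _; have := h i; rewrite !mxE.
by move=> h; apply/cV_norm_lt => // i; rewrite !mxE; exact: h.
Qed.

(** An open set is the countable union of the balls it contains with rational centre and radius
    1/(k+1). *)
Lemma open_measurable_cV (A : set V) : open A -> measurable A.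
Proof.
move=> oA.
pose emb (q : 'cV[rat]_n) : V := map_mx (@ratr R) q.
pose P (p : 'cV[rat]_n * nat) := ball (emb p.1) p.2.+1%:R^-1 `<=` A.
rewrite (_ : A = \bigcup_(p in [set p | P p]) ball (emb p.1) p.2.+1%:R^-1).
  by apply: count_bigcup_measurable => // p _; exact: measurable_cV_ball.
apply/seteqP; split=> [x Ax|x [p Pp]]; last exact: Pp.
have /nbhs_ballP[e /= e0 xe] : nbhs x A by exact: open_nbhs_nbhs.
have [k ke] : exists k : nat, k.+1%:R^-1 < e / 2 by by have [k] := @ltr_add_invr R 0 (e / 2) ltac:(lra); rewrite add0r; exists k.
have k0 : 0 < k.+1%:R^-1 :> R by rewrite invr_gt0.
have hq i : exists q : rat, `|x i ord0 - ratr q| < k.+1%:R^-1.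
  move: k0; set t := _^-1 => t0.
  have tt : x i ord0 - t < x i ord0 + t by lra.
  have [q] := rat_in_itvoo tt.
  by rewrite in_itv /= => /andP[a b]; exists q; rewrite ltr_norml; apply/andP; lra.
have [q qE] := choice hq.
pose v : 'cV[rat]_n := \col_i q i.
have xv : `|emb v - x| < k.+1%:R^-1.
  by apply/cV_norm_lt => // i; rewrite !mxE distrC.
exists (v, k); last by rewrite -ball_normE /ball_ /=.
move=> y; rewrite /= -ball_normE /ball_ /= => vy; apply: xe.
rewrite -ball_normE /ball_ /=; apply: (@lt_trans _ _ (k.+1%:R^-1 + k.+1%:R^-1)); last by rewrite [ltRHS]splitr ltrD.
by apply: le_lt_trans (ler_distD (emb v) _ _) _; rewrite distrC; exact: ltrD.
Qed.

Lemma continuous_measurable_cV (f : V -> R) : continuous f -> measurable_fun setT f.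
Proof.
move=> cf; apply: (measurability _ (RGenOpens.measurableE R)) => //.
move=> _ [_ [a [b ->] <-]]; rewrite setTI; apply: open_measurable_cV.
by move/continuousP : cf; apply; exact: interval_open.
Qed.

(** Heine-Borel, carried over from row vectors by transposition, which is continuous. *)
Lemma compact_cV (A : set V) : closed A -> (exists M, forall x, A x -> `|x| <= M) -> compact A.
Proof.
move=> cA [M AM].
have tc m k : continuous (@trmx R m k).
  move=> x B /nbhs_ballP[e /= e0 eB]; apply/nbhs_ballP; exists e => //= y [_ xy].
  by apply: eB; split => // i j; rewrite !mxE; exact: xy.
have -> : A = trmx @` ((@trmx R 1 n) @^-1` A).
  apply/seteqP; split=> [x Ax|_ [x Ax <-]//]; exists (x^T); rewrite ?trmxK//=.
  by rewrite trmxK.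
apply: continuous_compact; first by apply: continuous_subspaceT; exact: tc.
apply: bounded_closed_compact.
  exists M; split; first exact: num_real.
  move=> N MN x /AM AMx; have M0 : 0 <= M := le_trans (normr_ge0 _) AMx.
  have h := (cV_norm_le _ M0).1 AMx.
  rewrite /Num.norm /= mx_normrE.
  apply/bigmax_leP; split; first by rewrite (le_trans M0)// ltW.
  move=> [i j] _ /=.
  by have := h j; rewrite mxE (ord1 i) => /le_trans; apply; rewrite ltW.
by apply: closed_comp => // x _; exact: tc.
Qed.

End topology_cV.

Section lebesgue_cV_uniqueness.
Context {R : realType} {n : nat}.
Local Notation V := 'cV[R]_n.
Local Notation mu := (@lebesgue_cV R n).

Definition cbox (a b : V) : set V := [set x | forall i, a i ord0 <= x i ord0 <= b i ord0].

Lemma measurable_cbox a b : measurable (cbox a b).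
Proof.
rewrite (_ : cbox a b = \bigcap_(i in [set: 'I_n])
    ((fun x : V => x i ord0) @^-1` `[a i ord0, b i ord0])).
  apply: fin_bigcap_measurable => // i _; rewrite -[X in measurable X]setTI.
  by apply: measurable_coord => //; exact: measurable_itv.
by apply/seteqP; split=> x /= h i; [move=> _; rewrite /= in_itv /=|have := h i I; rewrite /= in_itv].
Qed.

Let G : set (set V) := [set A | exists a b, A = cbox a b].

Let measurableG : @measurable _ V = <<s G>>.
Proof.
apply/seteqP; split; last first.
  apply: smallest_sub; first exact: sigma_algebra_measurable.
  by move=> _ [a [b ->]]; exact: measurable_cbox.
have mi (i : 'I_n) : measurable_fun [set: g_sigma_algebraType G]
    (fun x : g_sigma_algebraType G => (x : V) i ord0).
  apply: (measurability _ (RGenCInfty.measurableE R)) => //.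
  move=> _ [_ [x ->] <-]; rewrite setTI.
  pose lo k : V := \col_j (if j == i then x else - k%:R).
  pose hi k : V := \col_j (k%:R).
  (* A coordinate half-space is the union of boxes with side [x, k] in direction [i] and sides
     [-k, k] in the others. *)
  rewrite (_ : _ @^-1` _ = \bigcup_k cbox (lo k) (hi k)).
    apply: bigcupT_measurable => k; apply: sub_sigma_algebra.
    by exists (lo k), (hi k).
  apply/seteqP; split=> [y /=|y [k _ /(_ i)]]; rewrite ?in_itv /= ?mxE ?eqxx ?andbT.
    move=> xy; exists (Num.truncn (`|y| + 1)).+1 => // j; rewrite !mxE.
    have := cV_norm_coord y j; have := truncnS_gt (`|y| + 1).
    set t := _%:R => ty; rewrite ler_norml => /andP[ya yb].
    apply/andP; split; last lra.
    by case: eqP => [->//|_]; lra.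
  by move=> /andP[xy _]; rewrite in_itv /= xy.
apply: smallest_sub; first exact: smallest_sigma_algebra.
case: n G mi => [|k] G' mi; first by rewrite big_ord0.
rewrite -bigcup_mkord_ord; apply: bigcup_sub => i Ii A [B mB <-].
exact: mi.
Qed.

Lemma lebesgue_cbox (a b : V) : (forall i, a i ord0 <= b i ord0) ->
  mu (cbox a b) = (\prod_(i < n) (b i ord0 - a i ord0))%:E.
Proof. exact: lebesgue_cV_box. Qed.

(** Closed boxes form a pi-system generating the Borel sets, and the cubes [-k, k]^n exhaust the
    space. A box with some a_i > b_i is empty, so only proper boxes have to be compared. *)
Lemma measure_cV_unique (m1 m2 : {measure set V -> \bar R}) :
  (forall a b : V, (forall i, a i ord0 <= b i ord0) -> m1 (cbox a b) = m2 (cbox a b)) ->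
  (forall a b : V, (forall i, a i ord0 <= b i ord0) -> (m1 (cbox a b) < +oo)%E) ->
  forall E, measurable E -> m1 E = m2 E.
Proof.
move=> mE m1fin E ME; pose g k := cbox (const_mx (- k%:R)) (const_mx k%:R).
apply: (measure_unique G g) => //.
- move=> _ _ [a [b ->]] [a' [b' ->]].
  exists (\col_i Num.max (a i ord0) (a' i ord0)), (\col_i Num.min (b i ord0) (b' i ord0)).
  apply/seteqP; split=> x.
    move=> [h h'] i; rewrite !mxE ge_max le_min.
    by have /andP[-> ->] := h i; have /andP[-> ->] := h' i.
  move=> h; split=> i; have := h i; rewrite !mxE ge_max le_min;
    by move=> /andP[/andP[h1 h2] /andP[h3 h4]]; rewrite ?h1 ?h2 ?h3 ?h4.
- by move=> k; exists (const_mx (- k%:R)), (const_mx k%:R).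
- apply/seteqP; split => // x _; exists (Num.truncn (`|x|)).+1 => // i; rewrite !mxE.
  have := cV_norm_coord x i; have := truncnS_gt `|x|.
  set t := _%:R => ty; rewrite ler_norml => /andP[ya yb].
  by apply/andP; split; lra.
- move=> _ [a [b ->]].
  have [ab|nab] := pselect (forall i, a i ord0 <= b i ord0); first exact: mE.
  rewrite (_ : cbox a b = set0) ?measure0//; apply/seteqP; split => // x h.
  by apply: nab => i; have /andP[/le_trans] := h i; exact.
- by move=> k; apply: m1fin => i; rewrite !mxE (le_trans (y := 0))// oppr_le0.
Qed.

Lemma lebesgue_cV_unique (m : {measure set V -> \bar R}) :
  (forall a b : V, (forall i, a i ord0 <= b i ord0) ->
     m (cbox a b) = (\prod_(i < n) (b i ord0 - a i ord0))%:E) ->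
  forall E, measurable E -> m E = mu E.
Proof.
move=> mE; apply: measure_cV_unique => a b ab; first by rewrite mE// -lebesgue_cV_box.
by rewrite mE// ltry.
Qed.

(** The constant belongs to preimages, hence is the inverse of the Jacobian factor: 1/|det A| for a
    linear map. *)
Definition scales (f : V -> V) (c : R) : Prop :=
  [/\ measurable_fun setT f, 0 <= c &
      forall E, measurable E -> mu (f @^-1` E) = (c%:E * mu E)%E].

Lemma scales_comp f g a b : scales f a -> scales g b -> scales (f \o g) (a * b).
Proof.
move=> [mf a0 fE] [mg b0 gE]; split; first exact: measurableT_comp.
  exact: mulr_ge0.
move=> E ME; rewrite comp_preimage gE ?fE//; last first.
  by rewrite -[X in measurable X]setTI; exact: mf.
by rewrite muleA -EFinM mulrC.
Qed.

Lemma scales_boxes (f : V -> V) : measurable_fun setT f ->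
  (forall a b : V, (forall i, a i ord0 <= b i ord0) -> exists a' b' : V,
    [/\ forall i, a' i ord0 <= b' i ord0, f @^-1` cbox a b = cbox a' b' &
     \prod_(i < n) (b' i ord0 - a' i ord0) = \prod_(i < n) (b i ord0 - a i ord0)]) ->
  scales f 1.
Proof.
move=> mf H; split => // E ME; rewrite mul1e.
rewrite -[LHS]/(pushforward mu f E).
apply: (@lebesgue_cV_unique (pushforward mu f)) => // a b /H[a' [b' [ab' fE pE]]].
by rewrite /= /pushforward fE lebesgue_cV_box// pE.
Qed.

Lemma measurable_cV d (T : measurableType d) (f : T -> V) :
  (forall i, measurable_fun setT (fun x => f x i ord0)) -> measurable_fun setT f.
Proof. exact: measurable_fun_cV. Qed.

Lemma scales_shift (t : V) : scales (fun x => x + t) 1.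
Proof.
apply: scales_boxes.
  apply: measurable_cV => i; under eq_fun do rewrite mxE.
  by apply: measurable_funD => //; exact: measurable_coord.
move=> a b ab; exists (a - t), (b - t); split.
- by move=> i; rewrite !mxE lerD2r.
- by apply/seteqP; split=> x h i; have := h i; rewrite /= !mxE lerBlDr lerBrDr.
- by apply: eq_bigr => i _; rewrite !mxE; ring.
Qed.

Lemma measurable_mulmx (A : 'M[R]_n) : measurable_fun setT (fun x : V => A *m x).
Proof.
apply: measurable_cV => i; under eq_fun do rewrite mxE.
apply: measurable_sum => j; apply: measurable_funM => //; exact: measurable_coord.
Qed.

Lemma scales_perm (s : {perm 'I_n}) : scales (fun x : V => perm_mx s *m x) 1.
Proof.
apply: scales_boxes; first exact: measurable_mulmx.
have E (x : V) i : (perm_mx s *m x) i ord0 = x (s i) ord0.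
  by rewrite -row_permE mxE.
move=> a b ab; exists (\col_i a ((s^-1)%g i) ord0), (\col_i b ((s^-1)%g i) ord0); split.
- by move=> i; rewrite !mxE.
- apply/seteqP; split=> x h i.
    by have := h ((s^-1)%g i); rewrite E permKV !mxE.
  by have := h (s i); rewrite E !mxE permK.
- rewrite [RHS](reindex_inj (@perm_inj _ (s^-1)%g)).
  by apply: eq_bigr => i _; rewrite !mxE.
Qed.

End lebesgue_cV_uniqueness.

(** * The determinant as scaling factor of Lebesgue measure *)

Section triangular.
Context {R : realType}.
Local Notation RT := (measurableTypeR R).

(** Positive factors are settled by uniqueness of Lebesgue measure on half-open intervals; a
    negative factor is a positive one composed with the reflection. *)
Lemma lebesgue_scale (k : R) : k != 0 -> forall X : set RT, measurable X ->
  lebesgue_measure (( *%R k) @^-1` X) = ((`|k|^-1)%:E * lebesgue_measure X)%E.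
Proof.
move=> k0.
have mk (c : R) : measurable_fun [set: RT] (( *%R c) : RT -> RT) by exact: mulrl_measurable.
have pos (c : R) : 0 < c -> forall X : set RT, measurable X ->
    lebesgue_measure (( *%R c) @^-1` X) = ((c^-1)%:E * lebesgue_measure X)%E.
  move=> c0 X mX.
  pose m := mscale (NngNum (ltW c0)) (pushforward (@lebesgue_measure R) (( *%R c) : RT -> RT)).
  have := @lebesgue_measure_unique R (m (mk c)).
  move=> /(_ _ X mX) ->; last first.
    move=> _ [[a b] /= ab <-]; rewrite /m /mscale /pushforward /=.
    rewrite (_ : pushforward _ _ _ = lebesgue_measure (`]c^-1 * a, c^-1 * b]%classic : set RT)).
      rewrite !lebesgue_measure_itv /= !lte_fin ltr_pM2l ?invr_gt0//.
      case: ifP => _; last by rewrite mule0.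
      by rewrite -!EFinB -EFinM -mulrBr mulVKf ?gt_eqF.
    congr lebesgue_measure; apply/seteqP; split=> x /=; rewrite !in_itv /=.
      by move=> /andP[h1 h2]; rewrite ltr_pdivrMl// ler_pdivlMl// h1 h2.
    by rewrite ltr_pdivrMl// ler_pdivlMl.
  by rewrite /m /mscale /pushforward /= muleA -EFinM mulVf ?gt_eqF// mul1e.
move=> X mX; have [kp|kn|kk] := ltgtP k 0; last by rewrite kk eqxx in k0.
  have mX' : measurable ((-%R : RT -> RT) @^-1` X).
    by rewrite -[X in measurable X]setTI; apply: oppr_measurable.
  have k0' : 0 < - k by rewrite oppr_gt0.
  rewrite ltr0_norm// -[lebesgue_measure X]lebesgue_measureN// /pushforward -pos//.
  by congr lebesgue_measure; apply/seteqP; split=> x /=; rewrite mulNr opprK.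
by rewrite pos// gtr0_norm.
Qed.

Lemma nint_cV_cons n (u : 'cV[R]_n.+1 -> R) : measurable_fun setT u -> (forall x, 0 <= u x) ->
  nint (lebesgue_cV n.+1) u =
  (\int[lebesgue_measure]_a nint (lebesgue_cV n) (fun x => u (cV_cons (a, x))))%E.
Proof.
move=> mu u0.
have mu' : measurable_fun setT (EFin \o u) by exact/measurable_EFinP.
have mc := @measurable_cV_cons R n.
have := ge0_integral_pushforward mc (lebesgue_measure \x lebesgue_cV n)%E measurableT mu'.
rewrite preimage_setT => H.
transitivity (\int[pushforward (lebesgue_measure \x lebesgue_cV n) (@cV_cons R n)]_y (EFin \o u) y)%E.
  by apply: eq_measure_integral.
rewrite H; last by move=> y _; rewrite lee_fin.
rewrite fubini_tonelli1//; first exact: measurableT_comp.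
by move=> z; rewrite lee_fin.
Qed.

Lemma scales_lower n (L : 'M[R]_n) : (forall i j : 'I_n, (i < j)%N -> L i j = 0) ->
  (forall i, L i i != 0) -> scales (fun x : 'cV[R]_n => L *m x) (\prod_i `|L i i|^-1).
Proof.
elim: n L => [|n ih] L L0 Ld.
  split; first exact: measurable_mulmx.
    by rewrite big_ord0.
  move=> E ME; rewrite big_ord0 mul1e; congr (lebesgue_cV 0 _).
  by apply/seteqP; split=> x; rewrite /= (_ : L *m x = x)//; apply/colP => -[].
pose l : R := L ord0 ord0.
pose c : 'cV[R]_n := \col_i L (lift ord0 i) ord0.
pose L' : 'M[R]_n := \matrix_(i, j) L (lift ord0 i) (lift ord0 j).
have [|//|mL' d0 L'E] := ih L'.
  by move=> i j ij; rewrite mxE L0.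
  by move=> i; rewrite mxE.
have LE a x : L *m cV_cons (a, x) = cV_cons (l * a, L' *m x + a *: c).
  apply/colP => i; rewrite mxE big_ord_recl cV_cons0 /=.
  under eq_bigr do rewrite cV_consS /=.
  case: (unliftP ord0 i) => [j ->|->].
    rewrite cV_consS /= !mxE addrC mulrC; congr (_ + _).
    by apply: eq_bigr => k _; rewrite mxE.
  by rewrite cV_cons0 /= big1 ?addr0// => k _; rewrite L0 ?mul0r.
split; first exact: measurable_mulmx.
  by rewrite prodr_ge0.
move=> E ME; rewrite big_ord_recl -/l.
have mc (F : set 'cV[R]_n.+1) : measurable F -> measurable (@cV_cons R n @^-1` F).
  by move=> mF; rewrite -[X in measurable X]setTI; apply: measurable_cV_cons.
have ME' : measurable ((fun x => L *m x) @^-1` E).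
  by rewrite -[X in measurable X]setTI; apply: measurable_mulmx.
pose W := @cV_cons R n @^-1` E.
have mW : measurable W by exact: mc.
rewrite [LHS]/(product_measure1 _ _ _) [X in _ = (_ * X)%E]/(product_measure1 _ _ _).
pose h a := lebesgue_cV n (xsection W a).
have mh : measurable_fun setT h by exact: measurable_fun_xsection.
transitivity (\int[lebesgue_measure]_a ((\prod_(i < n) `|L' i i|^-1)%:E * h (l * a)%R))%E.
  apply: eq_integral => a _ /=.
  have [_ _ sE] := scales_comp (@scales_shift R n (a *: c)) (And3 mL' d0 L'E).
  have := sE _ (measurable_xsection (l * a) mW); rewrite mul1r => <-.
  congr (lebesgue_cV n _); apply/seteqP; split=> x /=.
    by rewrite /xsection /= !inE /W /= LE.
  by rewrite /xsection /= !inE /W /= LE.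
rewrite ge0_integralZl//; last first.
  have ml : measurable_fun [set: RT] ( *%R l : RT -> RT) by exact: mulrl_measurable.
  have mhl : measurable_fun [set: RT] (h \o ( *%R l : RT -> RT)) by apply: measurableT_comp.
  exact: mhl.
have l0 : l != 0 by exact: Ld.
have ml : measurable_fun [set: RT] ( *%R l : RT -> RT) by exact: mulrl_measurable.
have i0 : 0 <= `|l|^-1 by rewrite invr_ge0.
have E1 := @integral_transfer R _ _ RT RT lebesgue_measure lebesgue_measure ( *%R l) _
  ml i0 (lebesgue_scale l0) h mh (fun=> measure_ge0 _ _).
rewrite E1 muleA -EFinM; congr (_%:E * _)%E; rewrite mulrC; congr (_ * _).
by apply: eq_bigr => i _; rewrite mxE.
Qed.

(** Conjugation by the permutation that reverses the coordinates makes an upper triangular matrix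
    lower triangular. *)
Lemma scales_upper n (U : 'M[R]_n) : (forall i j : 'I_n, (j < i)%N -> U i j = 0) ->
  (forall i, U i i != 0) -> scales (fun x : 'cV[R]_n => U *m x) (\prod_i `|U i i|^-1).
Proof.
move=> U0 Ud.
pose w : {perm 'I_n} := perm (@rev_ord_inj n).
have wE i : w i = rev_ord i by rewrite permE.
pose L : 'M[R]_n := \matrix_(i, j) U (rev_ord i) (rev_ord j).
have UE : U = perm_mx w *m L *m perm_mx w.
  have ww : (w^-1)%g = w.
    by apply/permP => k; apply: (@perm_inj _ w); rewrite permKV !wE rev_ordK.
  rewrite -row_permE -[X in _ *m perm_mx X]ww -col_permE.
  by apply/matrixP => i j; rewrite !mxE !wE !rev_ordK.
have L0 : forall i j : 'I_n, (i < j)%N -> L i j = 0.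
  by move=> i j ij; rewrite mxE U0//=; apply: ltn_sub2l; rewrite ?ltnS// (leq_ltn_trans _ (ltn_ord j)).
have Ld : forall i, L i i != 0 by move=> i; rewrite mxE.
have h := scales_comp (scales_perm w) (scales_comp (scales_lower L0 Ld) (scales_perm w)).
have -> : \prod_i `|U i i|^-1 = 1 * (\prod_i `|L i i|^-1 * 1).
  rewrite mul1r mulr1 (reindex_inj rev_ord_inj) /=.
  by apply: eq_bigr => i _; rewrite mxE.
move: h; congr scales; apply/funext => x /=.
by rewrite [in RHS]UE !mulmxA.
Qed.

(** Through the factorization P A = L U with unit diagonal in L: every factor scales the measure,
    and only the diagonal of U contributes. The factorization concerns positive sizes, so dimension
    0 is treated apart. *)
Lemma scales_mulmx n (A : 'M[R]_n) : A \in unitmx ->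
  scales (fun x : 'cV[R]_n => A *m x) (`|\det A|^-1).
Proof.
case: n A => [|n] A uA.
  split; first exact: measurable_mulmx.
    by rewrite invr_ge0.
  move=> E ME; rewrite det_mx00 normr1 invr1 mul1e; congr (lebesgue_cV 0 _).
  by apply/seteqP; split=> x; rewrite /= (_ : A *m x = x)//; apply/colP => -[].
have := cormen_lup_correct A; have := cormen_lup_perm A; have := cormen_lup_detL A.
have := @cormen_lup_lower _ _ A; have := @cormen_lup_upper _ _ A.
case: cormen_lup => [[P L] U] /= U0 Ll detL /is_perm_mxP[s ->] E.
have detP : `|\det (perm_mx s : 'M[R]_n.+1)| = 1.
  by rewrite det_perm normrX normrN1 expr1n.
have AE : A = perm_mx (s^-1)%g *m L *m U.
  by rewrite -mulmxA [X in _ *m X](_ : _ = perm_mx s *m A) ?E// mulmxA -perm_mxM mulVg perm_mx1 mul1mx.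
have L0 : forall i j : 'I_n.+1, (i < j)%N -> L i j = 0.
  by move=> i j ij; rewrite Ll ?(ltnW ij)//; case: eqP ij => // ->; rewrite ltnn.
have L1 i : L i i = 1 by rewrite Ll// eqxx.
have Ld i : L i i != 0 by rewrite L1 oner_neq0.
have detU : \det U = \prod_i U i i.
  rewrite -det_tr det_trig; first by apply: eq_bigr => i _; rewrite mxE.
  by apply/is_trig_mxP => i j ij; rewrite mxE U0.
have detA : `|\det A| = `|\prod_i U i i|.
  have := congr1 (fun M => `|\det M|) E.
  by rewrite !det_mulmx !normrM detP mul1r detL normr1 mul1r detU.
have Ud i : U i i != 0.
  apply/eqP => Ui; move: uA; rewrite unitmxE unitfE -normr_eq0 detA (bigD1 i)//= Ui mul0r.
  by rewrite normr0 eqxx.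
have h := scales_comp (scales_perm (s^-1)%g) (scales_comp (scales_lower L0 Ld) (scales_upper U0 Ud)).
have -> : `|\det A|^-1 = 1 * (\prod_i `|L i i|^-1 * \prod_i `|U i i|^-1).
  rewrite mul1r [X in X * _]big1 ?mul1r; last by move=> i _; rewrite L1 normr1 invr1.
  by rewrite detA normr_prod prodfV.
move: h; congr scales; apply/funext => x /=.
by rewrite [in RHS]AE !mulmxA.
Qed.

End triangular.

Section change_of_variables.
Context {R : realType} {n : nat}.
Local Notation V := 'cV[R]_n.
Local Notation mu := (@lebesgue_cV R n).
Implicit Types (u : V -> R) (f : V -> R[i]).

Lemma nint_shift u t : measurable_fun setT u -> (forall x, 0 <= u x) ->
  nint mu (fun x => u (x + t)) = nint mu u.
Proof.
move=> mu' u0; have [m1 m2 m3] := @scales_shift R n t.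
by rewrite (nint_transfer m1 m2 m3 mu' u0) mul1e.
Qed.

Lemma cL1_shift f t : cL1 mu f -> cL1 mu (fun x => f (x + t)).
Proof. by have [m1 m2 m3] := @scales_shift R n t; exact: (cL1_transfer m1 m2 m3). Qed.

Lemma cint_shift f t : cL1 mu f -> cint mu (fun x => f (x + t)) = cint mu f.
Proof.
move=> f1; have [m1 m2 m3] := @scales_shift R n t.
by rewrite (cint_transfer m1 m2 m3 f1) mul1r.
Qed.

Lemma nint_mulmx u (A : 'M[R]_n) : A \in unitmx -> measurable_fun setT u -> (forall x, 0 <= u x) ->
  nint mu (fun x => u (A *m x)) = ((`|\det A|^-1)%:E * nint mu u)%E.
Proof.
move=> uA mu' u0; have [m1 m2 m3] := scales_mulmx uA.
by rewrite (nint_transfer m1 m2 m3 mu' u0).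
Qed.

Lemma cL1_mulmx f (A : 'M[R]_n) : A \in unitmx -> cL1 mu f -> cL1 mu (fun x => f (A *m x)).
Proof. by move=> uA; have [m1 m2 m3] := scales_mulmx uA; exact: (cL1_transfer m1 m2 m3). Qed.

Lemma cint_mulmx f (A : 'M[R]_n) : A \in unitmx -> cL1 mu f ->
  cint mu (fun x => f (A *m x)) = (`|\det A|^-1)%:C%C * cint mu f.
Proof.
move=> uA f1; have [m1 m2 m3] := scales_mulmx uA.
by rewrite (cint_transfer m1 m2 m3 f1).
Qed.

Lemma ae_shift (P : V -> Prop) t : {ae mu, forall x, P x} -> {ae mu, forall x, P (x + t)}.
Proof.
move=> [N [mN N0 PN]]; have [m1 m2 m3] := @scales_shift R n t.
exists ((fun x => x + t) @^-1` N); split.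
- by rewrite -[X in measurable X]setTI; exact: m1.
- by rewrite m3// N0 mule0.
- by move=> x /= h; exact: PN.
Qed.

Lemma measurable_shift d' (T : measurableType d') (f : V -> T) t :
  measurable_fun setT f -> measurable_fun setT (fun x : V => f (x + t)).
Proof. by move=> mf; have [m1 _ _] := @scales_shift R n t; exact: measurableT_comp. Qed.

Lemma cmeas_shift f t : cmeas f -> cmeas (fun x : V => f (x + t)).
Proof. by move=> [fr fi]; split; [exact: (measurable_shift t fr)|exact: (measurable_shift t fi)]. Qed.

End change_of_variables.

(** * The exponential on the line and its Poisson kernel *)

Section one_dimensional_kernel.
Context {R : realType}.
Local Notation leb := (@lebesgue_measure R).

(** By symmetry the integral is twice that over the half-line, where [f] agrees with a function [g]
    having an explicit antiderivative; the absolute value inside [f] disappears this way. *)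
Lemma even_integral_FTC (f g F : R -> R) (l : R) : (forall x, 0 <= f x) -> continuous f ->
  (forall x, f (- x) = f x) -> (forall x, 0 <= x -> f x = g x) -> continuous g ->
  (forall x : R, is_derive x 1 F (g x)) -> F x @[x --> +oo] --> l ->
  (\int[leb]_x (f x)%:E = (2 * (l - F 0))%:E)%E.
Proof.
move=> f0 cf ef fg cg dF Fl.
rewrite ge0_symfun_integralT//; last by move=> x /=; rewrite ef.
have -> : [set x : R | 0 <= x] = `[0, +oo[%classic by rewrite set_itvcy.
have -> : (\int[leb]_(x in `[0%R, +oo[) (f x)%:E = \int[leb]_(x in `[0%R, +oo[) (g x)%:E)%E.
  apply: eq_integral => x; rewrite inE /= in_itv /= andbT => x0; by rewrite fg.
rewrite (@ge0_continuous_FTC2y _ g F 0 l)//.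
- by move=> x x0; rewrite -fg.
- exact: continuous_subspaceT.
- apply: cvg_at_right_filter; apply: differentiable_continuous.
  by apply/derivable1_diffP; exact: ex_derive.
- by move=> x _; rewrite derive1E; apply: derive_val.
Qed.

Definition expk (x : R) : R := expR (- `|x|).

Lemma expk_cont : continuous expk.
Proof.
move=> x; apply: (@continuous_comp _ _ _ (fun x : R => - `|x|) expR).
  by apply: continuousN; exact: norm_continuous.
exact: continuous_expR.
Qed.

Lemma expkN x : expk (- x) = expk x. Proof. by rewrite /expk normrN. Qed.

Lemma expk_ge0 x : 0 <= expk x. Proof. exact: expR_ge0. Qed.

Lemma is_derive_expRN (x : R) : is_derive x 1 (fun x => - expR (- x)) (expR (- x)).
Proof.
have := @is_deriveN _ _ _ _ _ _ _ (is_derive1_comp (is_derive_expR (- x)) (is_deriveN (is_derive_id x 1))).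
by move=> h; apply: is_derive_eq h _; rewrite mulrN1 opprK.
Qed.

Lemma integral_expk : (\int[leb]_x (expk x)%:E = 2%:E)%E.
Proof.
have dF (x : R) : is_derive x 1 (fun x : R => - expR (- x)) (expR (- x)) := is_derive_expRN x.
rewrite (@even_integral_FTC expk (fun x => expR (- x)) (fun x => - expR (- x)) 0).
- by rewrite oppr0 expR0 sub0r opprK mulr1.
- exact: expk_ge0.
- exact: expk_cont.
- exact: expkN.
- by move=> x x0; rewrite /expk ger0_norm.
- move=> x; apply: (@continuous_comp _ _ _ (fun x : R => - x) expR); last exact: continuous_expR.
  exact: oppr_continuous.
- by rewrite -oppr0; apply: cvgN; exact: cvgr_expR.
Qed.

(** Adding 1 to the cosine makes the integrand nonnegative, as [even_integral_FTC] requires; the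
    integral of [expk] alone is subtracted later. *)
Lemma integral_expk_cos (a : R) :
  (\int[leb]_x (expk x * (1 + cos (a * x)))%:E = (2 * (1 + (1 + a ^+ 2)^-1))%:E)%E.
Proof.
pose c := (1 + a ^+ 2)^-1.
have ca : 1 + a ^+ 2 != 0 by rewrite gt_eqF// ltr_pwDl// sqr_ge0.
pose F (x : R) := - expR (- x) + expR (- x) * (c * (a * sin (a * x) - cos (a * x))).
have dsin (x : R) : is_derive x 1 (fun x => sin (a * x)) (a * cos (a * x)).
  have h : is_derive x 1 (fun x : R => a * x) a.
    by apply: is_derive_eq (is_deriveZ a (is_derive_id x 1)) _; rewrite /GRing.scale /= mulr1.
  by apply: is_derive_eq (is_derive1_comp (is_derive_sin (a * x)) h) _; rewrite mulrC.
have dcos (x : R) : is_derive x 1 (fun x => cos (a * x)) (- (a * sin (a * x))).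
  have h : is_derive x 1 (fun x : R => a * x) a.
    by apply: is_derive_eq (is_deriveZ a (is_derive_id x 1)) _; rewrite /GRing.scale /= mulr1.
  by apply: is_derive_eq (is_derive1_comp (is_derive_cos (a * x)) h) _; rewrite mulrC mulrN.
have dexp (x : R) : is_derive x 1 (fun x => expR (- x)) (- expR (- x)).
  have := is_deriveN (is_derive_expRN x).
  by rewrite (_ : - (fun x : R => _) = fun x => expR (- x))//; apply/funext => y; rewrite fctE opprK.
have ccos : continuous (fun x => cos (a * x)).
  move=> x; apply: differentiable_continuous; apply/derivable1_diffP; by case: (dcos x).
have cexp : continuous (fun x : R => expR (- x)).
  move=> x; apply: differentiable_continuous; apply/derivable1_diffP; by case: (dexp x).
have dF (x : R) : is_derive x 1 F (expR (- x) * (1 + cos (a * x))).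
  have h1 := is_deriveB (is_deriveZ a (dsin x)) (dcos x).
  have h2 := is_deriveM (dexp x) (is_deriveZ c h1).
  apply: is_derive_eq (is_deriveD (is_derive_expRN x) h2) _.
  transitivity (expR (- x) + (expR (- x) * (c * (a * (a * cos (a * x)) + a * sin (a * x))) +
    c * (a * sin (a * x) - cos (a * x)) * (- expR (- x)))).
    by rewrite opprK.
  by rewrite /c; field; exact: ca.
rewrite (@even_integral_FTC _ (fun x => expR (- x) * (1 + cos (a * x))) F 0).
- rewrite /F oppr0 expR0 mulr0 sin0 cos0 mulr0 sub0r mul1r sub0r opprD opprK.
  by rewrite mulrN1 opprK.
- by move=> x; rewrite mulr_ge0 ?expk_ge0// -lerBlDl sub0r cos_geN1.
- move=> x; apply: cvgM; first exact: expk_cont.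
  by apply: cvgD; [exact: cvg_cst|exact: ccos].
- by move=> x; rewrite expkN mulrN cosN.
- by move=> x x0; rewrite /expk ger0_norm.
- move=> x; apply: cvgM; first exact: cexp.
  by apply: cvgD; [exact: cvg_cst|exact: ccos].
- rewrite -[X in _ --> X](addr0 (0 : R)); apply: cvgD.
    by rewrite -oppr0; apply: cvgN; exact: cvgr_expR.
  pose M := `|c| * (`|a| + 1).
  apply/cvgr0Pnorm_le => e e0.
  have M0 : 0 <= M by rewrite mulr_ge0// addr_ge0.
  have : \forall x \near +oo, `|expR (- x)| <= e / (M + 1).
    move/cvgr0Pnorm_le : (@cvgr_expR R); apply.
    by rewrite divr_gt0// ltr_pwDr.
  apply: filterS => x; rewrite normrM => h.
  apply: (@le_trans _ _ (e / (M + 1) * M)).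
    rewrite ler_pM// normrM /M ler_wpM2l// (le_trans (ler_normB _ _))// lerD//.
      by rewrite normrM ler_piMr// ler_norml sin_geN1 sin_le1.
    by rewrite ler_norml cos_geN1 cos_le1.
  by rewrite mulrAC ler_pdivrMr ?ltr_pwDr// ler_wpM2l ?(ltW e0)// lerDl.
Qed.

(** The Fourier transform of [expk]: a Poisson kernel of total mass 1. *)
Definition pker (x : R) : R := 2 / (1 + (2 * pi * x) ^+ 2).

Lemma pker_den (x : R) : 0 < 1 + (2 * pi * x) ^+ 2.
Proof. by rewrite ltr_pwDl// sqr_ge0. Qed.

Lemma pker_ge0 x : 0 <= pker x.
Proof. by rewrite /pker divr_ge0// ltW// pker_den. Qed.

Lemma pker_cont : continuous pker.
Proof.
move=> x; apply: cvgM; first exact: cvg_cst.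
apply: cvgV; first by rewrite gt_eqF// pker_den.
apply: cvgD; first exact: cvg_cst.
apply: (@cvg_comp _ _ _ (fun x => 2 * pi * x) (fun x => x ^+ 2)); last exact: exprn_continuous.
by apply: cvgM; [exact: cvg_cst|exact: cvg_id].
Qed.

Lemma integral_pker : (\int[leb]_x (pker x)%:E = 1)%E.
Proof.
have p0 : pi != 0 :> R by rewrite gt_eqF// pi_gt0.
have h x : is_derive x (1 : R) (fun x => 2 * pi * x) (2 * pi : R).
  by apply: is_derive_eq (is_deriveZ (2 * pi) (is_derive_id x 1)) _; rewrite /GRing.scale /= mulr1.
have dF (x : R) : is_derive x 1 (fun x => pi^-1 * atan (2 * pi * x)) (pker x).
  apply: is_derive_eq (is_deriveZ pi^-1 (is_derive1_comp (is_derive1_atan _) (h x))) _.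
  transitivity (pi^-1 * ((1 + (2 * pi * x) ^+ 2)^-1 * (2 * pi))) => //.
  rewrite /pker mulrCA (_ : pi^-1 * (2 * pi) = 2) 1?mulrC//.
  exact: (mulfK p0 2).
rewrite (@even_integral_FTC pker pker (fun x => pi^-1 * atan (2 * pi * x)) (pi^-1 * (pi / 2)))//.
- by rewrite mulr0 atan0 mulr0 subr0 (mulKf p0) divff.
- exact: pker_ge0.
- exact: pker_cont.
- by move=> x; rewrite /pker mulrN sqrrN.
- exact: pker_cont.
- apply: cvgM; first exact: cvg_cst.
  apply: (@cvg_comp _ _ _ (fun x => 2 * pi * x) atan); last exact: cvgy_atan.
  by apply: gt0_cvgMry; [rewrite mulr_gt0// pi_gt0|exact: cvg_id].
Qed.

End one_dimensional_kernel.

(** * Integrals of products of functions of one coordinate *)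

Section product_integrals.
Context {R : realType}.
Local Notation C := R[i].
Local Notation leb := (@lebesgue_measure R).
Local Notation RT := (measurableTypeR R).

Lemma cint_prod d1 d2 (T1 : measurableType d1) (T2 : measurableType d2)
  (m1 : {sigma_finite_measure set T1 -> \bar R}) (m2 : {sigma_finite_measure set T2 -> \bar R})
  (f : T1 * T2 -> C) : cL1 (m1 \x m2)%E f ->
  cint (m1 \x m2)%E f = cint m1 (fun x => cint m2 (fun y => f (x, y))).
Proof.
move=> f1.
have aux (u : T1 * T2 -> R) : (m1 \x m2)%E.-integrable setT (EFin \o u) ->
    \int[(m1 \x m2)%E]_z u z = \int[m1]_x \int[m2]_y u (x, y).
  move=> iu; congr fine; rewrite -integral12_prod_meas1//.
  apply: integral_eq_ae; have := integrable_ae measurableT (integrable_fubini_F iu).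
  by apply: filterS => x /(_ I) h; rewrite /Rintegral fineK.
apply: cplx_eq => /=.
  exact: (aux (fun z => complex.Re (f z)) (cL1_Re f1)).
exact: (aux (fun z => complex.Im (f z)) (cL1_Im f1)).
Qed.

Lemma cint_cV_cons n (f : 'cV[R]_n.+1 -> C) : cL1 (lebesgue_cV n.+1) f ->
  cint (lebesgue_cV n.+1) f = cint leb (fun a => cint (lebesgue_cV n) (fun x => f (cV_cons (a, x)))).
Proof.
move=> f1.
have tr : forall E, measurable E -> (leb \x lebesgue_cV n)%E (@cV_cons R n @^-1` E) =
    (1%:E * lebesgue_cV n.+1 E)%E by move=> E ME; rewrite mul1e.
have := cint_transfer (@measurable_cV_cons R n) ler01 tr f1.
rewrite mul1r => <-; apply: cint_prod.
exact: (cL1_transfer (@measurable_cV_cons R n) ler01 tr f1).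
Qed.

Lemma cmeas_prod_coord n (h : 'I_n -> RT -> C) : (forall i, cmeas (h i)) ->
  cmeas (fun x : 'cV[R]_n => \prod_i h i (x i ord0)).
Proof.
move=> mh; elim: (index_enum _) => [|i s ih].
  by under eq_fun do rewrite big_nil; exact: cmeas_cst.
under eq_fun do rewrite big_cons; apply: cmeasM => //.
have [hr hi] := mh i.
by split; [exact: (measurableT_comp hr (measurable_coord i))|
           exact: (measurableT_comp hi (measurable_coord i))].
Qed.

Lemma nint_prod_coord n (h : 'I_n -> RT -> R) : (forall i, measurable_fun setT (h i)) ->
  (forall i x, 0 <= h i x) -> (forall i, (nint leb (h i) < +oo)%E) ->
  nint (lebesgue_cV n) (fun x => \prod_i h i (x i ord0)) = (\prod_i fine (nint leb (h i)))%:E.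
Proof.
elim: n h => [|n ih] h mh h0 h1.
  rewrite big_ord0 /nint; under eq_integral do rewrite big_ord0.
  by rewrite integral_cst //= diracE mem_set ?mul1e.
have mp : measurable_fun setT (fun x : 'cV[R]_n.+1 => \prod_i h i (x i ord0)).
  apply: measurable_prod => i _; exact: measurableT_comp (mh i) (measurable_coord i).
rewrite nint_cV_cons//; last by move=> x; exact: prodr_ge0.
have fin0 : nint leb (h ord0) \is a fin_num by rewrite ge0_fin_numE ?nint_ge0.
transitivity (\int[leb]_a ((\prod_(i < n) fine (nint leb (h (lift ord0 i)))) * h ord0 a)%:E)%E.
  apply: eq_integral => a _.
  rewrite (@nint_eq _ _ _ _ _ (fun x : 'cV[R]_n => h ord0 a * \prod_(i < n) h (lift ord0 i) (x i ord0))); last first.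
    move=> x; rewrite big_ord_recl cV_cons0; congr (_ * _).
    by apply: eq_bigr => i _; rewrite cV_consS.
  rewrite nintZ//.
  - by rewrite (ih (fun i => h (lift ord0 i)))// -EFinM mulrC.
  - by apply: measurable_prod => i _; exact: measurableT_comp (mh _) (measurable_coord i).
  - by move=> x; exact: prodr_ge0.
rewrite -[LHS]/(nint leb (fun a => _ * h ord0 a)) nintZ//; last first.
  by rewrite prodr_ge0// => i _; rewrite fine_ge0// nint_ge0.
by rewrite big_ord_recl -[X in (_ * X)%E](fineK fin0) -EFinM mulrC.
Qed.

Lemma cabs_prod (I : Type) (s : seq I) (F : I -> C) :
  cabs (\prod_(i <- s) F i) = \prod_(i <- s) cabs (F i).
Proof. by elim/big_rec2 : _ => [|i x y _ <-]; rewrite ?cabs1 ?cabsM. Qed.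

Lemma cL1_prod_coord n (h : 'I_n -> RT -> C) : (forall i, cL1 leb (h i)) ->
  cL1 (lebesgue_cV n) (fun x => \prod_i h i (x i ord0)).
Proof.
move=> h1; have mh i : cmeas (h i) by have [] := h1 i.
split; first exact: cmeas_prod_coord.
rewrite (@nint_eq _ _ _ _ _ (fun x : 'cV[R]_n => \prod_i cabs (h i (x i ord0)))); last first.
  by move=> x; rewrite cabs_prod.
rewrite (nint_prod_coord (h := fun i a => cabs (h i a))).
- exact: ltry.
- by move=> i; exact: measurable_cabs.
- by move=> i x; exact: cabs_ge0.
- by move=> i; have [] := h1 i.
Qed.

Lemma cint_prod_coord n (h : 'I_n -> RT -> C) : (forall i, cL1 leb (h i)) ->
  cint (lebesgue_cV n) (fun x => \prod_i h i (x i ord0)) = \prod_i cint leb (h i).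
Proof.
elim: n h => [|n ih] h h1.
  rewrite big_ord0; under eq_fun do rewrite big_ord0.
  by apply: cplx_eq; rewrite /= Rintegral_cst//= ?mul0r// mul1r indicE mem_set.
rewrite cint_cV_cons; last exact: cL1_prod_coord.
rewrite big_ord_recl mulrC -cintZ//; congr cint; apply/funext => a.
rewrite -(ih (fun i => h (lift ord0 i)))// mulrC -cintZ; last exact: (cL1_prod_coord (h := fun i => h (lift ord0 i))).
congr cint; apply/funext => x; rewrite big_ord_recl cV_cons0; congr (_ * _).
by apply: eq_bigr => i _; rewrite cV_consS.
Qed.

End product_integrals.

Section cis_bounds.
Context {R : realType}.

Lemma cmeas_comp d1 d2 (T1 : measurableType d1) (T2 : measurableType d2) (f : T2 -> R[i]) (g : T1 -> T2) :
  cmeas f -> measurable_fun setT g -> cmeas (f \o g).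
Proof. by move=> [fr fi] mg; split; [exact: (measurableT_comp fr mg)|exact: (measurableT_comp fi mg)]. Qed.

End cis_bounds.

(** * The Fourier transform *)

Section fourier_transform.
Context {R : realType} {d : nat}.
Local Notation C := R[i].
Local Notation V := 'cV[R]_d.
Local Notation mu := (@lebesgue_cV R d).
Implicit Types (f g h : V -> C) (x y xi : V).

Lemma dotC x y : dot x y = dot y x.
Proof. by apply: eq_bigr => i _; rewrite mulrC. Qed.

Lemma dotDl x y z : dot (x + y) z = dot x z + dot y z.
Proof. by rewrite /dot -big_split; apply: eq_bigr => i _; rewrite mxE mulrDl. Qed.

Lemma dotNl x z : dot (- x) z = - dot x z.
Proof. by rewrite /dot -sumrN; apply: eq_bigr => i _; rewrite mxE mulNr. Qed.

Lemma dotDr x y z : dot z (x + y) = dot z x + dot z y.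
Proof. by rewrite dotC dotDl !(dotC z). Qed.

Lemma dotNr x z : dot x (- z) = - dot x z.
Proof. by rewrite dotC dotNl dotC. Qed.

Lemma dotZl a x z : dot (a *: x) z = a * dot x z.
Proof. by rewrite /dot mulr_sumr; apply: eq_bigr => i _; rewrite mxE mulrA. Qed.

Lemma dotZr a x z : dot x (a *: z) = a * dot x z.
Proof. by rewrite dotC dotZl dotC. Qed.

Lemma dot0l x : dot 0 x = 0.
Proof. by rewrite /dot big1// => i _; rewrite mxE mul0r. Qed.

Lemma dot0r x : dot x 0 = 0.
Proof. by rewrite dotC dot0l. Qed.

Lemma dot_mulmx (A : 'M[R]_d) x y : dot (A *m x) y = dot x (A^T *m y).
Proof.
rewrite /dot; under eq_bigr do rewrite mxE mulr_suml.
rewrite exchange_big; apply: eq_bigr => i _; rewrite mxE mulr_sumr.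
by apply: eq_bigr => j _; rewrite mxE; ring.
Qed.

Lemma measurable_dot2 dT (T : measurableType dT) (a b : T -> V) :
  measurable_fun setT a -> measurable_fun setT b -> measurable_fun setT (fun t => dot (a t) (b t)).
Proof.
move=> ma mb; apply: measurable_sum => i.
by apply: measurable_funM; [exact: (measurableT_comp (measurable_coord i) ma)|exact: (measurableT_comp (measurable_coord i) mb)].
Qed.

Lemma fourierE f xi : fourier f xi = cint mu (fun x => f x * cis (- (2 * pi * dot x xi))).
Proof. by []. Qed.

Lemma ifourierE f x : ifourier f x = cint mu (fun xi => f xi * cis (2 * pi * dot x xi)).
Proof. by []. Qed.

Lemma ifourier_fourier f x : ifourier f x = fourier f (- x).
Proof.
by rewrite fourierE ifourierE; congr cint; apply/funext => y; rewrite dotNr mulrN opprK dotC.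
Qed.

Lemma cL1_cis f (u : V -> R) : measurable_fun setT u -> cL1 mu f -> cL1 mu (fun x => f x * cis (u x)).
Proof.
move=> mu' [mf f1]; split; first by apply: cmeasM => //; exact: cmeas_cis.
by apply: le_lt_trans f1; apply: nint_le => x; rewrite ?cabs_ge0// cabsM cabs_cis mulr1.
Qed.

Lemma measurable_dotl c xi : measurable_fun setT (fun x : V => c * dot x xi).
Proof.
apply: measurable_funM; first exact: measurable_cst.
by apply: (measurable_dot2 (a := id)) => //; exact: measurable_cst.
Qed.

Lemma cL1_fourier f xi : cL1 mu f -> cL1 mu (fun x => f x * cis (- (2 * pi * dot x xi))).
Proof.
by move=> f1; apply: cL1_cis => //; apply: measurable_funN; exact: measurable_dotl.
Qed.

Lemma cL1_ifourier f x : cL1 mu f -> cL1 mu (fun xi => f xi * cis (2 * pi * dot x xi)).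
Proof.
by move=> f1; apply: cL1_cis => //; under eq_fun do rewrite dotC; exact: measurable_dotl.
Qed.

Lemma fourier_eq_ae f g : {ae mu, forall x, f x = g x} -> fourier f = fourier g.
Proof.
move=> fg; apply/funext => xi; rewrite !fourierE; apply: cint_eq_ae.
by move: fg; apply: filterS => x ->.
Qed.

Lemma fourierB f g : cL1 mu f -> cL1 mu g -> fourier (fun x => f x - g x) = fun xi => fourier f xi - fourier g xi.
Proof.
move=> f1 g1; apply/funext => xi; rewrite !fourierE -cintB; [|exact: cL1_fourier..].
by congr cint; apply/funext => x; rewrite mulrBl.
Qed.

Lemma cabs_fourier_le f xi : cL1 mu f -> ((cabs (fourier f xi))%:E <= nint mu (fun x => cabs (f x)))%E.
Proof.
move=> f1; rewrite fourierE; apply: le_trans (cabs_cint_le (cL1_fourier xi f1)) _.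
by apply: nint_le => x; rewrite ?cabs_ge0// cabsM cabs_cis mulr1.
Qed.

Lemma cL1_bound f : cL1 mu f -> exists M : R, 0 <= M /\ (nint mu (fun x => cabs (f x)) <= M%:E)%E.
Proof.
move=> [_ f1]; exists (fine (nint mu (fun x => cabs (f x)))).
have n0 := nint_ge0 mu (fun x => cabs_ge0 (f x)).
by rewrite fine_ge0// fineK// ge0_fin_numE.
Qed.

Lemma cmeas_fourier f : cmeas f -> cmeas (fourier f).
Proof.
move=> mf; apply: (@cmeas_cint R _ _ V V mu (fun z => f z.2 * cis (- (2 * pi * dot z.2 z.1)))).
apply: cmeasM; first exact: (cmeas_comp mf measurable_snd).
apply: cmeas_cis; apply: measurable_funN; apply: measurable_funM; first exact: measurable_cst.
by apply: measurable_dot2; [exact: measurable_snd|exact: measurable_fst].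
Qed.

Lemma measurable_oppV : measurable_fun setT (fun x : V => - x).
Proof.
apply: measurable_cV => i; under eq_fun do rewrite mxE.
by apply: measurable_funN; exact: measurable_coord.
Qed.

Lemma cmeas_ifourier f : cmeas f -> cmeas (ifourier f).
Proof.
move=> mf; rewrite (_ : ifourier f = fourier f \o (fun x => - x)).
  exact: (cmeas_comp (cmeas_fourier mf) measurable_oppV).
by apply/funext => x; rewrite ifourier_fourier.
Qed.

Lemma cL1_prod_bounded f g (M : R) : cL1 mu f -> cmeas g -> (forall x, cabs (g x) <= M) ->
  cL1 mu (fun x => f x * g x).
Proof.
move=> [mf f1] mg gM; have M0 : 0 <= M := le_trans (cabs_ge0 _) (gM 0).
apply: (@cL1_le _ _ _ _ _ (fun x => M * cabs (f x))).
- exact: cmeasM.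
- rewrite nintZ ?lte_mul_pinfty ?lee_fin//; first exact: measurable_cabs.
  by move=> x; exact: cabs_ge0.
- by move=> x; rewrite cabsM mulrC ler_wpM2r ?cabs_ge0.
Qed.

Lemma fourier_bounded f : cL1 mu f -> exists M : R, forall xi, cabs (fourier f xi) <= M.
Proof.
move=> f1; have [M [_ hM]] := cL1_bound f1; exists M => xi.
by rewrite -lee_fin (le_trans (cabs_fourier_le xi f1)).
Qed.

Lemma ifourier_bounded f : cL1 mu f -> exists M : R, forall xi, cabs (ifourier f xi) <= M.
Proof.
by move=> /fourier_bounded[M h]; exists M => x; rewrite ifourier_fourier.
Qed.

(** Fubini for f(y) g(x) k(y, x) with a unimodular kernel; both signs of the exponent are
    instances. *)
Let mul_formula f g (k : V * V -> C) : cmeas k -> (forall z, cabs (k z) = 1) ->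
  cL1 mu f -> cL1 mu g ->
  cint mu (fun x => cint mu (fun y => f y * k (y, x)) * g x) =
  cint mu (fun y => f y * cint mu (fun x => g x * k (y, x))).
Proof.
move=> mk k1 f1 g1; have [mf f1'] := f1; have [mg g1'] := g1.
pose F (z : V * V) := f z.1 * g z.2 * k z.
have mF : cmeas F.
  apply: cmeasM => //; apply: cmeasM; first exact: (cmeas_comp mf measurable_fst).
  exact: (cmeas_comp mg measurable_snd).
have Ffin : (\int[mu]_y nint mu (fun x => cabs (F (y, x))) < +oo)%E.
  have [M [M0 hM]] := cL1_bound g1.
  apply: (@le_lt_trans _ _ (nint mu (fun y => M * cabs (f y)))).
    apply: integral_le_ae => [y|y|].
    - by apply: nint_ge0 => x; exact: cabs_ge0.
    - by rewrite lee_fin mulr_ge0// cabs_ge0.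
    apply: nearW => y.
    rewrite (@nint_eq _ _ _ _ _ (fun x => cabs (f y) * cabs (g x))); last first.
      by move=> x; rewrite /F /= !cabsM k1 mulr1.
    rewrite nintZ ?cabs_ge0//; [|exact: measurable_cabs|by move=> x; exact: cabs_ge0].
    by rewrite mulrC EFinM lee_wpmul2l// lee_fin cabs_ge0.
  rewrite nintZ// ?lte_mul_pinfty ?lee_fin//; first exact: measurable_cabs.
  by move=> x; exact: cabs_ge0.
have [_ _ E] := @cfubini R _ _ V V mu mu F mF Ffin.
have kx x : cmeas (fun y => k (y, x)) by exact: (cmeas_comp mk (measurable_pair2 x)).
have ky y : cmeas (fun x => k (y, x)) by exact: (cmeas_comp mk (measurable_pair1 y)).
transitivity (cint mu (fun x => cint mu (fun y => F (y, x)))).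
  congr cint; apply/funext => x; rewrite mulrC -cintZ; last first.
    by apply: (cL1_prod_bounded (M := 1) f1 (kx x)) => y; rewrite k1.
  by congr cint; apply/funext => y; rewrite /F /= mulrCA mulrA.
rewrite -E; congr cint; apply/funext => y; rewrite -cintZ; last first.
  by apply: (cL1_prod_bounded (M := 1) g1 (ky y)) => x; rewrite k1.
by congr cint; apply/funext => x; rewrite /F /= mulrA.
Qed.

Lemma fourier_mul f g : cL1 mu f -> cL1 mu g ->
  cint mu (fun x => fourier f x * g x) = cint mu (fun x => f x * fourier g x).
Proof.
move=> f1 g1.
transitivity (cint mu (fun y => f y * cint mu (fun x => g x * cis (- (2 * pi * dot y x))))).
  apply: (@mul_formula f g (fun z => cis (- (2 * pi * dot z.1 z.2)))) => //; last first.
    by move=> z; exact: cabs_cis.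
  apply: cmeas_cis; apply: measurable_funN; apply: measurable_funM; first exact: measurable_cst.
  by apply: measurable_dot2; [exact: measurable_fst|exact: measurable_snd].
by congr cint; apply/funext => y; congr (_ * _); rewrite fourierE; congr cint; apply/funext => x; rewrite dotC.
Qed.

Lemma ifourier_mul f g : cL1 mu f -> cL1 mu g ->
  cint mu (fun x => ifourier f x * g x) = cint mu (fun x => f x * ifourier g x).
Proof.
move=> f1 g1.
transitivity (cint mu (fun y => f y * cint mu (fun x => g x * cis (2 * pi * dot x y)))).
  apply: (@mul_formula f g (fun z => cis (2 * pi * dot z.2 z.1))) => //; last first.
    by move=> z; exact: cabs_cis.
  apply: cmeas_cis; apply: measurable_funM; first exact: measurable_cst.
  by apply: measurable_dot2; [exact: measurable_snd|exact: measurable_fst].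
by congr cint; apply/funext => y; congr (_ * _); rewrite ifourierE; congr cint; apply/funext => x; rewrite dotC.
Qed.

Lemma fourier_conj f xi : cL1 mu f -> fourier (fun x => ((f x)^*)%C) xi = ((ifourier f xi)^*)%C.
Proof.
move=> f1; rewrite fourierE ifourierE -cint_conj; last exact: cL1_ifourier.
by congr cint; apply/funext => x; rewrite conjCM conj_cis dotC.
Qed.

Lemma ifourier_conj f x : cL1 mu f -> ifourier (fun x => ((f x)^*)%C) x = ((fourier f x)^*)%C.
Proof.
by move=> f1; rewrite ifourier_fourier fourier_conj// ifourier_fourier opprK.
Qed.

Lemma fourier_shift f t xi : cL1 mu f ->
  fourier (fun x => f (x + t)) xi = cis (2 * pi * dot t xi) * fourier f xi.
Proof.
move=> f1; have := cint_shift t (cL1_fourier xi f1).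
rewrite /= -fourierE => <-; rewrite -cintZ; last first.
  have := cL1_shift t (cL1_fourier xi f1); congr cL1.
rewrite fourierE; congr cint; apply/funext => x.
rewrite mulrCA; congr (_ * _); rewrite -cisD; congr cis.
rewrite dotDl; ring.
Qed.

End fourier_transform.

Section limits_of_integrals.
Context {R : realType} d (T : measurableType d).
Local Notation C := R[i].
Variable m : {measure set T -> \bar R}.

Lemma ccvg_unique (a : nat -> C) (l1 l2 : C) :
  cabs (a n - l1) @[n --> \oo] --> (0 : R) -> cabs (a n - l2) @[n --> \oo] --> (0 : R) -> l1 = l2.
Proof.
move=> h1 h2; apply/eqP; rewrite -subr_eq0; apply/eqP/cabs_eq0/eqP.
rewrite eq_le cabs_ge0 andbT; apply/ler_addgt0Pl => e e0; rewrite addr0.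
have e20 : 0 < e / 2 by rewrite divr_gt0.
near \oo => n.
rewrite [leRHS]splitr -(subrKA (a n)) (le_trans (cabsD _ _))// lerD//.
  rewrite cabsB; have : `|cabs (a n - l1)| < e / 2.
    by near: n; move/cvgr0Pnorm_lt : h1; exact.
  by rewrite ger0_norm ?cabs_ge0// => /ltW.
have : `|cabs (a n - l2)| < e / 2.
  by near: n; move/cvgr0Pnorm_lt : h2; exact.
by rewrite ger0_norm ?cabs_ge0// => /ltW.
Unshelve. all: by end_near. Qed.

Lemma nint_fatou (u : nat -> T -> R) (v : T -> R) (M : \bar R) :
  (forall n, measurable_fun setT (u n)) -> (forall n x, 0 <= u n x) ->
  {ae m, forall x, u n x @[n --> \oo] --> v x} -> (forall x, 0 <= v x) ->
  (forall n, nint m (u n) <= M)%E -> (nint m v <= M)%E.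
Proof.
move=> mu u0 uv v0 uM.
have mu' n : measurable_fun setT (EFin \o u n) by exact/measurable_EFinP.
have := @fatou _ T R m setT measurableT (fun n x => (u n x)%:E) mu'.
move=> F.
have {}F : (\int[m]_x limn_einf ((fun n x => (u n x)%:E) ^~ x) <= limn_einf (fun n => nint m (u n)))%E.
  by apply: F => n x; rewrite lee_fin.
have E : nint m v = (\int[m]_x limn_einf ((fun n x => (u n x)%:E) ^~ x))%E.
  apply: integral_eq_ae; move: uv; apply: filterS => x h.
  apply/esym; have : (u n x)%:E @[n --> \oo] --> (v x)%:E by apply: cvg_EFin => //; exact: nearW.
  by move/cvg_limn_einf_sup => [].
rewrite E; apply: le_trans F _.
rewrite limn_einf_lim; apply: lime_le; first exact: is_cvg_einfs.
apply: nearW => n; apply: le_trans (uM n).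
by apply: ereal_inf_lbound; exists n => /=.
Qed.

End limits_of_integrals.

(** * Exponential damping and the Poisson approximate identity *)

Section fourier_kernel.
Context {R : realType} {d : nat}.
Local Notation C := R[i].
Local Notation V := 'cV[R]_d.
Local Notation mu := (@lebesgue_cV R d).
Local Notation leb := (@lebesgue_measure R).
Local Notation RT := (measurableTypeR R).
Implicit Types (f g h : V -> C) (x y xi : V).

Definition Ed x : R := expR (- \sum_i `|x i ord0|).
Definition Kd x : R := \prod_i pker (x i ord0).

Lemma Ed_prod x : Ed x = \prod_i expk (x i ord0).
Proof. by rewrite /Ed -sumrN expR_sum. Qed.

Lemma Ed_ge0 x : 0 <= Ed x. Proof. exact: expR_ge0. Qed.
Lemma Ed_le1 x : Ed x <= 1.
Proof. by rewrite /Ed -expR0 ler_expR oppr_le0 sumr_ge0. Qed.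
Lemma Kd_ge0 x : 0 <= Kd x. Proof. by apply: prodr_ge0 => i _; exact: pker_ge0. Qed.
Lemma measurable_expk : measurable_fun [set: RT] (expk : RT -> R).
Proof. by apply: continuous_measurable_fun; exact: expk_cont. Qed.
Lemma measurable_pker : measurable_fun [set: RT] (pker : RT -> R).
Proof. by apply: continuous_measurable_fun; exact: pker_cont. Qed.

Lemma measurable_Ed : measurable_fun setT (Ed : V -> R).
Proof.
have -> : Ed = fun x : V => \prod_i expk (x i ord0) by apply/funext => x; exact: Ed_prod.
apply: measurable_prod => i _.
exact: (measurableT_comp measurable_expk (measurable_coord i)).
Qed.

Lemma measurable_Kd : measurable_fun setT (Kd : V -> R).
Proof.
apply: measurable_prod => i _.
exact: (measurableT_comp measurable_pker (measurable_coord i)).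
Qed.

Lemma nint_Kd : nint mu Kd = 1%E.
Proof.
rewrite (nint_prod_coord (h := fun=> pker)).
- by rewrite big1// => i _; rewrite /nint integral_pker.
- by move=> _; exact: measurable_pker.
- by move=> _ x; exact: pker_ge0.
- by move=> _; rewrite /nint integral_pker ltry.
Qed.

Lemma nint_Ed : (nint mu Ed < +oo)%E.
Proof.
have -> : Ed = fun x : V => \prod_i expk (x i ord0) by apply/funext => x; exact: Ed_prod.
rewrite (nint_prod_coord (h := fun=> expk)) ?ltry//.
- by move=> _; exact: measurable_expk.
- by move=> _ x; exact: expk_ge0.
- by move=> _; rewrite /nint integral_expk ltry.
Qed.

Let expk_cis (a t : R) : C := (expk t)%:C%C * cis (- (a * t)).

Let cL1_expk_cis a : cL1 leb (expk_cis a : RT -> C).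
Proof.
apply: (@cL1_le _ _ _ _ _ (expk : RT -> R)).
- apply: cmeasM; first exact: cmeasR measurable_expk.
  apply: cmeas_cis; apply: measurable_funN; exact: mulrl_measurable.
- by rewrite /nint integral_expk ltry.
- by move=> t; rewrite cabsM cabs_cis mulr1 cabsR ger0_norm ?expk_ge0.
Qed.

(** The real part is the integral with 1 + cos minus that of [expk]; the imaginary part equals its
    own negative by the reflection t -> -t. *)
Let cint_expk_cis a : cint leb (expk_cis a : RT -> C) = (2 / (1 + a ^+ 2))%:C%C.
Proof.
have h1 := cL1_expk_cis a.
have iexp : leb.-integrable setT (EFin \o expk).
  apply/integrableP; split; first by apply/measurable_EFinP; exact: measurable_expk.
  apply: (@le_lt_trans _ _ (nint leb (expk : RT -> R))); last by rewrite /nint integral_expk ltry.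
  by apply: nint_le => // t; rewrite ger0_norm ?expk_ge0.
have ecos t : complex.Re (expk_cis a t) = expk t * cos (a * t).
  by rewrite /expk_cis cReM /= cosN; ring.
have icos := cL1_Re h1.
apply: cplx_eq => /=.
  transitivity (\int[leb]_t (expk t * (1 + cos (a * t)) - expk t)).
    by apply: eq_Rintegral => t _; rewrite cosN; ring.
  rewrite RintegralB//; last first.
    have := integrableD measurableT iexp icos; congr integrable.
    apply/funext => t; transitivity ((expk t + complex.Re (expk_cis a t))%:E) => //.
    by rewrite ecos /=; congr EFin; ring.
  rewrite /Rintegral integral_expk_cos integral_expk /=; ring.
have mN : measurable_fun [set: RT] (-%R : RT -> RT) by exact: oppr_measurable.
have trN E : measurable E -> leb ((-%R : RT -> RT) @^-1` E) = (1%:E * leb E)%E.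
  by move=> mE; rewrite mul1e -[RHS]lebesgue_measureN.
have := cint_transfer mN ler01 trN h1.
have -> : (expk_cis a : RT -> C) \o -%R = fun t => ((expk_cis a t)^*)%C.
  apply/funext => t; rewrite /expk_cis [LHS]/comp conjCM conj_cis expkN mulrN !opprK.
  by congr (_ * _); apply: cplx_eq; rewrite ?cReconj ?cImconj /= ?oppr0.
rewrite cint_conj// mul1r => /(congr1 (@complex.Im _)); rewrite cImconj => /= E.
lra.
Qed.

Lemma cis_sum (I : Type) (s : seq I) (F : I -> R) : \prod_(i <- s) cis (F i) = cis (\sum_(i <- s) F i) :> C.
Proof. by elim/big_rec2 : _ => [|i x y _ ->]; rewrite ?cis0// cisD. Qed.

Lemma cL1_Ed : cL1 mu (fun x => (Ed x)%:C%C).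
Proof.
apply: (@cL1_le _ _ _ _ _ Ed); [exact: cmeasR measurable_Ed|exact: nint_Ed|].
by move=> x; rewrite cabsR ger0_norm ?Ed_ge0.
Qed.

Lemma fourier_Ed xi : fourier (fun x => (Ed x)%:C%C) xi = (Kd xi)%:C%C.
Proof.
rewrite fourierE.
transitivity (cint mu (fun x => \prod_i expk_cis (2 * pi * xi i ord0) (x i ord0))).
  congr cint; apply/funext => x; rewrite big_split /= Ed_prod rmorph_prod; congr (_ * _).
  rewrite cis_sum; congr cis; rewrite sumrN mulr_sumr; congr (- _).
  by apply: eq_bigr => i _; ring.
rewrite (cint_prod_coord (h := fun i => expk_cis (2 * pi * xi i ord0)))//.
rewrite rmorph_prod; apply: eq_bigr => i _; exact: cint_expk_cis.
Qed.

Variable e : R.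
Hypothesis e0 : 0 < e.

Let eM : (e%:M : 'M[R]_d) \in unitmx.
Proof. by rewrite unitmxE det_scalar unitrX// unitfE gt_eqF. Qed.

Let detE : `|\det (e%:M : 'M[R]_d)|^-1 = (e ^+ d)^-1.
Proof. by rewrite det_scalar ger0_norm// exprn_ge0// ltW. Qed.

Let ed0 : e ^+ d != 0. Proof. by rewrite expf_neq0// gt_eqF. Qed.

Definition Eeps x : R := Ed (e *: x).
(** The dilation of [Kd] normalized in L^1, which is the Fourier transform of [Eeps] by
    [fourier_Eeps]. *)
Definition Keps x : R := (e ^+ d)^-1 * Kd (e^-1 *: x).

Lemma cL1_Eeps : cL1 mu (fun x => (Eeps x)%:C%C).
Proof.
have := cL1_mulmx eM cL1_Ed; congr cL1; apply/funext => x.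
by rewrite mul_scalar_mx.
Qed.

Lemma Eeps_ge0 x : 0 <= Eeps x. Proof. exact: Ed_ge0. Qed.
Lemma Eeps_le1 x : Eeps x <= 1. Proof. exact: Ed_le1. Qed.

Lemma fourier_Eeps xi : fourier (fun x => (Eeps x)%:C%C) xi = (Keps xi)%:C%C.
Proof.
have := cint_mulmx eM (cL1_fourier (e^-1 *: xi) cL1_Ed).
rewrite -fourierE fourier_Ed detE -rmorphM /= => <-.
rewrite fourierE; congr cint; apply/funext => x.
rewrite mul_scalar_mx /Eeps; congr (_ * cis (- (_ * _))).
by rewrite dotZl dotZr mulrA mulfV ?mul1r// gt_eqF.
Qed.

Lemma Keps_ge0 x : 0 <= Keps x.
Proof. by rewrite mulr_ge0 ?Kd_ge0// invr_ge0 exprn_ge0// ltW. Qed.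

Lemma measurable_Keps : measurable_fun setT (Keps : V -> R).
Proof.
apply: measurable_funM; first exact: measurable_cst.
have := measurableT_comp measurable_Kd (measurable_mulmx (e^-1)%:M).
by congr measurable_fun; apply/funext => x; rewrite /= mul_scalar_mx.
Qed.

Lemma measurable_Eeps : measurable_fun setT (Eeps : V -> R).
Proof.
have := measurableT_comp measurable_Ed (measurable_mulmx e%:M).
by congr measurable_fun; apply/funext => x; rewrite /= mul_scalar_mx.
Qed.

Lemma nint_Keps : nint mu Keps = 1%E.
Proof.
have := nint_mulmx eM measurable_Keps Keps_ge0.
rewrite detE (_ : (fun x => Keps _) = fun x => (e ^+ d)^-1 * Kd x); last first.
  by apply/funext => x; rewrite /Keps mul_scalar_mx scalerA mulVf ?gt_eqF// scale1r.
have i0 : 0 <= (e ^+ d)^-1 by rewrite invr_ge0 exprn_ge0// ltW.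
rewrite nintZ//; [|exact: measurable_Kd|exact: Kd_ge0].
rewrite nint_Kd => /(congr1 (fun z => ((e ^+ d)%:E * z)%E)).
by rewrite mule1 muleA -!EFinM mulfV// mul1e => <-.
Qed.

Lemma cL1_Keps : cL1 mu (fun x => (Keps x)%:C%C).
Proof.
apply: (@cL1_le _ _ _ _ _ Keps); [exact: cmeasR measurable_Keps|by rewrite nint_Keps ltry|].
by move=> x; rewrite cabsR ger0_norm ?Keps_ge0.
Qed.

(* Damping the Fourier transform by E(e xi) amounts to convolving with the dilated Poisson kernel. *)
Lemma ifourier_damped h x : cL1 mu h ->
  ifourier (fun xi => fourier h xi * (Eeps xi)%:C%C) x = cint mu (fun y => h (y + x) * (Keps y)%:C%C).
Proof.
move=> h1; rewrite ifourierE.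
transitivity (cint mu (fun xi => fourier h xi * ((Eeps xi)%:C%C * cis (2 * pi * dot x xi)))).
  by congr cint; apply/funext => xi; rewrite mulrA.
rewrite fourier_mul//; last exact: cL1_ifourier cL1_Eeps.
have E y : fourier (fun xi => (Eeps xi)%:C%C * cis (2 * pi * dot x xi)) y = (Keps (y - x))%:C%C.
  rewrite -fourier_Eeps !fourierE; congr cint; apply/funext => xi.
  rewrite -mulrA -cisD; congr (_ * cis _); rewrite dotDr dotNr (dotC x); ring.
have hK : cL1 mu (fun y => h y * fourier (fun xi => (Eeps xi)%:C%C * cis (2 * pi * dot x xi)) y).
  have [M hM] := fourier_bounded (cL1_ifourier x cL1_Eeps).
  apply: (cL1_prod_bounded (M := M) h1) => //.
  by apply: cmeas_fourier; have [] := cL1_ifourier x cL1_Eeps.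
rewrite -(cint_shift x hK); congr cint; apply/funext => y.
by rewrite E addrK.
Qed.

Lemma cint_Keps (u : V -> C) : cL1 mu (fun y => u y * (Keps y)%:C%C) ->
  cint mu (fun y => u y * (Keps y)%:C%C) = cint mu (fun z => u (e *: z) * (Kd z)%:C%C).
Proof.
move=> u1; have := cint_mulmx eM u1; rewrite detE => /(congr1 (fun z => (e ^+ d)%:C%C * z)).
rewrite mulrA -rmorphM mulfV// mul1r => <-.
rewrite -cintZ; last exact: (cL1_mulmx eM u1).
congr cint; apply/funext => z; rewrite mul_scalar_mx mulrCA; congr (_ * _).
by rewrite -rmorphM /Keps scalerA mulVf ?gt_eqF// scale1r mulrA mulfV// mul1r.
Qed.

(** Damping makes every integral absolutely convergent. By the multiplication formula the left side
    is the integral of h times the conjugate of h smoothed by [Keps]; then 2|h(x) h(x+y)| <=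
    |h(x)|^2 + |h(x+y)|^2 and the total mass 1 of the kernel give the bound. *)
Lemma contraction_damped h : cL1 mu h ->
  (nint mu (fun xi => cabs (fourier h xi) ^+ 2 * Eeps xi)%R <= nint mu (fun x => cabs (h x) ^+ 2)%R)%E.
Proof.
move=> h1; have [mh _] := h1.
pose G xi := fourier h xi * (Eeps xi)%:C%C.
have [M hM] := fourier_bounded h1.
have mF := cmeas_fourier mh.
have G1 : cL1 mu G.
  rewrite /G; under eq_fun do rewrite mulrC.
  exact: (cL1_prod_bounded (M := M) cL1_Eeps).
have mG : cmeas (ifourier G) by apply: cmeas_ifourier; have [] := G1.
have Gc1 : cL1 mu (fun xi => ((G xi)^*)%C) by exact: cL1_conj.
have i0 : cL1 mu (fun xi => fourier h xi * ((G xi)^*)%C).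
  by under eq_fun do rewrite mulrC; exact: (cL1_prod_bounded (M := M) Gc1).
have EE xi : fourier h xi * ((G xi)^*)%C = (cabs (fourier h xi) ^+ 2 * Eeps xi)%:C%C.
  rewrite /G conjCM mulrA mulC_conj.
  by apply: cplx_eq; rewrite ?(cReM, cImM, cReconj, cImconj) /=; ring.
have -> : nint mu (fun xi => cabs (fourier h xi) ^+ 2 * Eeps xi) =
    (cabs (cint mu (fun xi => fourier h xi * ((G xi)^*)%C)))%:E.
  have pos xi : 0 <= cabs (fourier h xi) ^+ 2 * Eeps xi.
    by rewrite mulr_ge0 ?Eeps_ge0// sqr_ge0.
  have EF : (fun xi => fourier h xi * ((G xi)^*)%C) = fun xi => (cabs (fourier h xi) ^+ 2 * Eeps xi)%:C%C.
    by apply/funext => xi; exact: EE.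
  rewrite EF.
  have fin : nint mu (fun xi => cabs (fourier h xi) ^+ 2 * Eeps xi) \is a fin_num.
    rewrite ge0_fin_numE ?nint_ge0//; have [_ hfin] := i0; move: hfin; congr (_ < _)%E.
    by apply: nint_eq => xi; rewrite EE cabsR ger0_norm.
  rewrite (_ : cint mu _ = (fine (nint mu (fun xi => cabs (fourier h xi) ^+ 2 * Eeps xi)))%:C%C).
    by rewrite cabsR ger0_norm ?fine_ge0 ?nint_ge0// fineK.
  by apply: cplx_eq => //=; rewrite /Rintegral integral0.
rewrite fourier_mul//.
have E2 x : h x * fourier (fun xi => ((G xi)^*)%C) x =
    h x * ((cint mu (fun y => h (y + x) * (Keps y)%:C%C))^*)%C.
  by rewrite fourier_conj// ifourier_damped.
have h2 : cL1 mu (fun x => h x * fourier (fun xi => ((G xi)^*)%C) x).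
  have [M' hM'] := fourier_bounded Gc1.
  by apply: (cL1_prod_bounded (M := M') h1) => //; apply: cmeas_fourier; have [] := Gc1.
apply: le_trans (cabs_cint_le h2) _.
have mabs2 : measurable_fun setT (fun x => cabs (h x) ^+ 2).
  by apply: measurable_funX; exact: measurable_cabs.
pose u (z : V * V) := (cabs (h z.1) ^+ 2 / 2 + cabs (h (z.2 + z.1)) ^+ 2 / 2) * Keps z.2.
have mK2 : measurable_fun setT (fun z : V * V => Keps z.2).
  exact: (measurableT_comp measurable_Keps measurable_snd).
have madd : measurable_fun setT (fun z : V * V => z.2 + z.1).
  apply: measurable_cV => i; under eq_fun do rewrite mxE.
  by apply: measurable_funD;
    [exact: (measurableT_comp (measurable_coord i) measurable_snd)|
     exact: (measurableT_comp (measurable_coord i) measurable_fst)].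
have mu_ : measurable_fun setT u.
  apply: measurable_funM => //; apply: measurable_funD; apply: measurable_funM => //;
    try exact: measurable_cst.
    exact: (measurableT_comp mabs2 measurable_fst).
  exact: (measurableT_comp mabs2 madd).
have u0 z : 0 <= u z.
  by rewrite mulr_ge0 ?Keps_ge0// addr_ge0// divr_ge0// sqr_ge0.
have hK x : cL1 mu (fun y => h (y + x) * (Keps y)%:C%C).
  have [M' hM'] := fourier_bounded cL1_Eeps.
  apply: (cL1_prod_bounded (M := M')); first exact: cL1_shift.
    exact: cmeasR measurable_Keps.
  by move=> y; have := hM' y; rewrite fourier_Eeps.
apply: (@le_trans _ _ (\int[mu]_x nint mu (fun y => u (x, y)))%E).
  apply: integral_le_ae => [x|x|].
  - by rewrite lee_fin cabs_ge0.
  - exact: nint_ge0.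
  apply: nearW => x; rewrite E2 cabsM cabs_conj EFinM.
  apply: (@le_trans _ _ ((cabs (h x))%:E * nint mu (fun y => cabs (h (y + x) * (Keps y)%:C%C)%R))%E).
    by rewrite lee_wpmul2l// ?lee_fin ?cabs_ge0// cabs_cint_le.
  rewrite -nintZ ?cabs_ge0//; last 2 first.
    by apply: measurable_cabs; have [] := hK x.
    by move=> y; exact: cabs_ge0.
  apply: nint_le => y; first by rewrite mulr_ge0 ?cabs_ge0.
  rewrite cabsM cabsR (ger0_norm (Keps_ge0 y)) mulrA /u /= ler_wpM2r ?Keps_ge0//.
  rewrite -mulrDl ler_pdivlMr// -subr_ge0.
  rewrite (_ : _ - _ = (cabs (h x) - cabs (h (y + x))) ^+ 2) ?sqr_ge0//; ring.
rewrite (ntonelli mu mu mu_ u0).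
set N := nint mu (fun x => cabs (h x) ^+ 2).
rewrite le_eqVlt; apply/orP; left; apply/eqP.
have N0 : (0 <= N)%E by apply: nint_ge0 => x; exact: sqr_ge0.
transitivity (\int[mu]_y (N * (Keps y)%:E))%E.
  apply: eq_integral => y _.
  rewrite (@nint_eq _ _ _ _ _ (fun x => Keps y * (2^-1 * cabs (h x) ^+ 2 + 2^-1 * cabs (h (x + y)) ^+ 2))); last first.
    by move=> x; rewrite /u /= (addrC y); ring.
  have m1 : measurable_fun setT (fun x => 2^-1 * cabs (h x) ^+ 2).
    by apply: measurable_funM => //; exact: measurable_cst.
  have m2 : measurable_fun setT (fun x => 2^-1 * cabs (h (x + y)) ^+ 2).
    exact: (measurable_shift y m1).
  have p1 x : 0 <= 2^-1 * cabs (h x) ^+ 2 by rewrite mulr_ge0// sqr_ge0.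
  rewrite nintZ ?Keps_ge0//; [|exact: measurable_funD|by move=> x; exact: addr_ge0].
  rewrite nintD// (nint_shift (u := fun x => 2^-1 * cabs (h x) ^+ 2))//.
  rewrite nintZ//; last by move=> x; exact: sqr_ge0.
  rewrite -/N muleC; congr (_ * _)%E.
  rewrite -ge0_muleDl ?lee_fin// -EFinD (_ : 2^-1 + 2^-1 = 1 :> R) ?mul1e//; lra.
rewrite ge0_integralZl//.
- by rewrite -/(nint mu Keps) nint_Keps mule1.
- by apply/measurable_EFinP; exact: measurable_Keps.
- by move=> y _; rewrite lee_fin Keps_ge0.
Qed.

End fourier_kernel.

(** * Pointwise inversion and the L^2 contraction *)

Section inversion.
Context {R : realType} {d : nat}.
Local Notation C := R[i].
Local Notation V := 'cV[R]_d.
Local Notation mu := (@lebesgue_cV R d).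
Implicit Types (f g h : V -> C) (x y xi : V).

Definition epsn (n : nat) : R := n.+1%:R^-1.

Lemma epsn_gt0 n : 0 < epsn n. Proof. by rewrite invr_gt0. Qed.

Lemma epsn_cvg0 : epsn n @[n --> \oo] --> (0 : R).
Proof. exact: cvg_harmonic. Qed.

Lemma Eeps_cvg xi : Eeps (epsn n) xi @[n --> \oo] --> (1 : R).
Proof.
have -> : (fun n => Eeps (epsn n) xi) = fun n => expR (- (epsn n * \sum_i `|xi i ord0|)).
  apply/funext => n; rewrite /Eeps /Ed mulr_sumr; congr (expR (- _)).
  by apply: eq_bigr => i _; rewrite mxE normrM ger0_norm// ltW// epsn_gt0.
move: (\sum_i _) => S; rewrite -expR0 -oppr0 -(mul0r S).
apply: (@cvg_comp _ _ _ _ (@expR R)); last exact: continuous_expR.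
by apply: cvgN; apply: cvgMl; exact: epsn_cvg0.
Qed.

Lemma cvg_squeeze0 (a b : nat -> R) : (forall n, 0 <= a n <= b n) ->
  b n @[n --> \oo] --> 0 -> a n @[n --> \oo] --> 0.
Proof.
move=> ab b0; apply: (@squeeze_cvgr _ _ _ _ (cst 0) b) => //; last exact: cvg_cst.
by apply: nearW => n; exact: ab.
Qed.

Definition ccont_at f x := forall e : R, 0 < e -> \forall y \near x, cabs (f y - f x) < e.

Lemma ccont_seq f x (a : nat -> V) : ccont_at f x -> a n @[n --> \oo] --> x ->
  cabs (f (a n) - f x) @[n --> \oo] --> (0 : R).
Proof.
move=> fx ax; apply/cvgr0Pnorm_lt => e e0.
near=> n; rewrite ger0_norm ?cabs_ge0//; near: n; exact: (ax _ (fx e e0)).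
Unshelve. all: by end_near.
Qed.

(** The damped inverse transform has two limits. Dominated convergence on the frequency side gives
    the undamped inverse transform; on the space side, after the kernel is rescaled to the fixed
    [Kd], continuity at [x] gives [h x]. *)
Lemma fourier_inversion h x (M : R) : cL1 mu h -> cL1 mu (fourier h) ->
  (forall y, cabs (h y) <= M) -> ccont_at h x -> ifourier (fourier h) x = h x.
Proof.
move=> h1 F1 hM hx; have [mh _] := h1; have [mF F1'] := F1.
pose a n := ifourier (fun xi => fourier h xi * (Eeps (epsn n) xi)%:C%C) x.
apply: (@ccvg_unique _ a).
  have [||||||_ H] := @cint_dct _ _ _ mu
    (fun n xi => fourier h xi * (Eeps (epsn n) xi)%:C%C * cis (2 * pi * dot x xi))
    (fun xi => fourier h xi * cis (2 * pi * dot x xi)) (fun xi => cabs (fourier h xi)).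
  - move=> n; apply: cmeasM; first apply: cmeasM => //.
      by apply: cmeasR; exact: measurable_Eeps.
    by apply: cmeas_cis; under eq_fun do rewrite dotC; exact: measurable_dotl.
  - by have [] := cL1_ifourier x F1.
  - exact: measurable_cabs.
  - exact: F1'.
  - move=> n xi; rewrite !cabsM cabs_cis mulr1 cabsR ger0_norm ?Eeps_ge0//.
    by rewrite ler_piMr ?cabs_ge0 ?Eeps_le1.
  - apply: nearW => xi.
    apply: (@cvg_squeeze0 _ (fun n => cabs (fourier h xi) * `|Eeps (epsn n) xi - 1|)).
      move=> n; rewrite cabs_ge0 /= -mulrBl cabsM cabs_cis mulr1.
      rewrite -{2}[fourier h xi]mulr1 -mulrBr cabsM ler_wpM2l ?cabs_ge0//.
      by rewrite -cabsR rmorphB.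
    rewrite -(mulr0 (cabs (fourier h xi))); apply: cvgMr.
    apply/norm_cvg0P; rewrite -(subrr 1); apply: cvgB; [exact: Eeps_cvg|exact: cvg_cst].
  exact: H.
have aE n : a n = cint mu (fun z => h (epsn n *: z + x) * (Kd z)%:C%C).
  rewrite /a ifourier_damped ?epsn_gt0//.
  apply: (@cint_Keps _ _ (epsn n) (epsn_gt0 n) (fun y => h (y + x))).
  under eq_fun do rewrite mulrC.
  apply: (cL1_prod_bounded (M := M)); first by apply: cL1_Keps; exact: epsn_gt0.
    exact: cmeas_shift.
  by move=> y; exact: hM.
have mhs n : cmeas (fun z : V => h (epsn n *: z + x)).
  have [m1 m2] := cmeas_shift x mh.
  have := cmeas_comp (conj m1 m2 : cmeas (fun y => h (y + x))) (measurable_mulmx (epsn n)%:M).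
  by congr cmeas; apply/funext => z; rewrite /= mul_scalar_mx.
have M0 : 0 <= M := le_trans (cabs_ge0 _) (hM x).
have [||||||_ H] := @cint_dct _ _ _ mu (fun n (z : V) => h (epsn n *: z + x) * (Kd z)%:C%C)
    (fun z : V => h x * (Kd z)%:C%C) (fun z : V => M * Kd z).
- by move=> n; apply: cmeasM => //; apply: cmeasR; exact: measurable_Kd.
- by apply: cmeasM; [exact: cmeas_cst|apply: cmeasR; exact: measurable_Kd].
- by apply: measurable_funM; [exact: measurable_cst|exact: measurable_Kd].
- rewrite nintZ//; [|exact: measurable_Kd|exact: Kd_ge0].
  by rewrite nint_Kd mule1 ltry.
- by move=> n z; rewrite cabsM cabsR ger0_norm ?Kd_ge0// ler_wpM2r ?Kd_ge0.
- apply: nearW => z.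
  apply: (@cvg_squeeze0 _ (fun n => cabs (h (epsn n *: z + x) - h x) * Kd z)).
    by move=> n; rewrite cabs_ge0 /= -mulrBl cabsM cabsR ger0_norm ?Kd_ge0.
  rewrite -(mul0r (Kd z)); apply: cvgMl; apply: (ccont_seq hx).
  rewrite -[X in _ --> X]add0r -(scale0r z); apply: cvgD; last exact: cvg_cst.
  by apply: cvgZl; exact: epsn_cvg0.
move: H; rewrite cintZ; last first.
  have := @cL1_Keps R d 1 ltr01; congr cL1; apply/funext => z.
  by rewrite /Keps expr1n invr1 mul1r scale1r.
rewrite [X in h x * X](_ : _ = 1) ?mulr1.
  by under eq_fun do rewrite -aE.
apply: cplx_eq => /=; rewrite /Rintegral ?integral0//.
by rewrite -/(nint mu Kd) nint_Kd.
Qed.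

(** Fatou's lemma, as the damping is removed. The right-hand side may be infinite. *)
Lemma fourier_contraction h : cL1 mu h ->
  (nint mu (fun xi => cabs (fourier h xi) ^+ 2)%R <= nint mu (fun x => cabs (h x) ^+ 2)%R)%E.
Proof.
move=> h1; have [mh _] := h1.
have m2 : measurable_fun setT (fun xi => cabs (fourier h xi) ^+ 2).
  by apply: measurable_funX; apply: measurable_cabs; exact: cmeas_fourier.
apply: (@nint_fatou _ _ _ mu (fun n xi => cabs (fourier h xi) ^+ 2 * Eeps (epsn n) xi)).
- by move=> n; apply: measurable_funM => //; exact: measurable_Eeps.
- by move=> n xi; rewrite mulr_ge0 ?Eeps_ge0// sqr_ge0.
- apply: nearW => xi; rewrite -[X in _ --> X]mulr1; apply: cvgMr; exact: Eeps_cvg.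
- by move=> xi; exact: sqr_ge0.
- by move=> n; apply: contraction_damped => //; exact: epsn_gt0.
Qed.

End inversion.

Lemma ecvg0P {R : realType} (u : nat -> \bar R) : (forall n, (0 <= u n)%E) ->
  (u n @[n --> \oo] --> 0%E) <->
  (forall a : R, 0 < a -> exists N, forall n, (N <= n)%N -> (u n <= a%:E)%E).
Proof.
move=> u0; split=> [u_ a a0|h].
  have /fine_cvgP[[N1 _ H1] /cvgr0Pnorm_le/(_ a a0)[N2 _ H2]] := u_.
  exists (maxn N1 N2) => n; rewrite geq_max => /andP[/H1 n1 /H2 n2].
  by rewrite -(fineK n1) lee_fin; move: n2 => /=; rewrite ger0_norm ?fine_ge0.
apply/fine_cvgP; split.
  have [N HN] := h 1 ltr01; exists N => // n /= Nn.
  by rewrite ge0_fin_numE// (le_lt_trans (HN n Nn))// ltry.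
apply/cvgr0Pnorm_le => a a0; have [N HN] := h a a0; exists N => // n /= Nn.
rewrite ger0_norm ?fine_ge0// -lee_fin fineK ?HN// ge0_fin_numE//.
by rewrite (le_lt_trans (HN n Nn))// ltry.
Qed.

(** * Completeness of L^2 *)

Section riesz_fischer.
Context {R : realType} d (T : measurableType d).
Local Notation C := R[i].
Variable m : {sigma_finite_measure set T -> \bar R}.
Implicit Types f g : T -> C.

Definition n2 f := nint m (fun x => cabs (f x) ^+ 2).

Lemma n2_ge0 f : (0 <= n2 f)%E.
Proof. by apply: nint_ge0 => x; exact: sqr_ge0. Qed.

Lemma measurable_cabs2 f : cmeas f -> measurable_fun setT (fun x => cabs (f x) ^+ 2).
Proof. by move=> mf; apply: measurable_funX; exact: measurable_cabs. Qed.

Lemma n2D_le f g : cmeas f -> cmeas g -> (n2 (fun x => f x + g x)%R <= 2%:E * n2 f + 2%:E * n2 g)%E.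
Proof.
move=> mf mg; rewrite -!nintZ//; try exact: measurable_cabs2; try (by move=> x; exact: sqr_ge0).
rewrite -nintD; first last.
- by move=> x; rewrite mulr_ge0// sqr_ge0.
- by move=> x; rewrite mulr_ge0// sqr_ge0.
- by apply: measurable_funM; [exact: measurable_cst|exact: measurable_cabs2].
- by apply: measurable_funM; [exact: measurable_cst|exact: measurable_cabs2].
by apply: nint_le => x; [exact: sqr_ge0|exact: cabs_sub_sqr].
Qed.

Lemma n2_eq_ae f g : {ae m, forall x, f x = g x} -> n2 f = n2 g.
Proof. by move=> fg; apply: nint_eq_ae; move: fg; apply: filterS => x ->. Qed.

Lemma n2Z (a : C) f : cmeas f -> n2 (fun x => a * f x) = ((cabs a ^+ 2)%:E * n2 f)%E.
Proof.
move=> mf; rewrite -nintZ ?sqr_ge0//; [|exact: measurable_cabs2|by move=> x; exact: sqr_ge0].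
by apply: nint_eq => x; rewrite cabsM exprMn.
Qed.

Lemma n2B_sym f g : n2 (fun x => f x - g x) = n2 (fun x => g x - f x).
Proof. by apply: nint_eq => x; rewrite cabsB. Qed.

(** Geometric decay of the squared increments forces convergence outside a null set, and the
    pointwise bound on the tail integrates to convergence in L^2. *)
Lemma riesz_fischer (f : nat -> T -> C) (c r : R) : (forall n, cmeas (f n)) ->
  0 < r < 1 -> 0 <= c ->
  (forall n, (n2 (fun x => f n.+1 x - f n x)%R <= (c * r ^+ n)%:E)%E) ->
  exists2 g, cmeas g & n2 (fun x => f n x - g x) @[n --> \oo] --> 0%E.
Proof.
move=> mf /andP[r0 r1] c0 fc.
pose D n x := cabs (f n.+1 x - f n x) ^+ 2.
have mD n : measurable_fun setT (D n) by apply: measurable_cabs2; exact: cmeasB.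
have D0 n x : 0 <= D n x by exact: sqr_ge0.
pose s := Num.sqrt r.
have s0 : 0 < s by rewrite sqrtr_gt0.
have s1 : s < 1 by rewrite -[ltRHS]sqrtr1 ltr_sqrt.
have ss : s ^+ 2 = r by rewrite sqr_sqrtr// ltW.
(* Weighting the squared increments by s^-n keeps them summable almost everywhere. *)
pose u n x := (s ^- n) * D n x.
have u0 n x : 0 <= u n x by rewrite mulr_ge0// invr_ge0 exprn_ge0// ltW.
have mu' n : measurable_fun setT (u n) by apply: measurable_funM => //; exact: measurable_cst.
have cN : countable [set: nat] by exact: countableP.
have sumu : (\esum_(n in [set: nat]) nint m (u n) < +oo)%E.
  apply: (@le_lt_trans _ _ (\esum_(n in [set: nat]) (c * s ^+ n)%:E)%E).
    apply: le_esum => n _; rewrite nintZ//; last by rewrite invr_ge0 exprn_ge0// ltW.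
    apply: (@le_trans _ _ ((s ^- n)%:E * (c * r ^+ n)%:E)%E).
      by apply: lee_wpmul2l; [rewrite lee_fin invr_ge0 exprn_ge0// ltW|exact: fc].
    rewrite -EFinM lee_fin -ss -exprM mulnC exprM mulrCA expr2 mulKf//.
    by rewrite expf_neq0// gt_eqF.
  rewrite -nneseries_esumT; last by move=> n; rewrite lee_fin mulr_ge0// exprn_ge0// ltW.
  apply: le_lt_trans (ltry (c / (1 - s))); apply: lime_le.
    by apply: is_cvg_nneseries => k _; rewrite lee_fin mulr_ge0// exprn_ge0// ltW.
  apply: nearW => n; rewrite sumEFin lee_fin.
  by have := geometric_le_lim n c0 s0; rewrite ger0_norm ?(ltW s0)//; exact.
pose H x := (\esum_(n in [set: nat]) (u n x)%:E)%E.
have iH : (\int[m]_x H x < +oo)%E by rewrite nint_esum.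
have mH : measurable_fun setT H by exact: measurable_esum.
have H0 x : (0 <= H x)%E by apply: esum_ge0 => n _; rewrite lee_fin.
pose E := [set x | (H x < +oo)%E].
have mE : measurable E.
  have := emeasurable_fun_infty_o measurableT mH +oo%E.
  by congr measurable; apply/seteqP; split => x /=; [move=> []|].
have aeE : {ae m, forall x, E x}.
  have i : m.-integrable setT H.
    apply/integrableP; split => //; apply: le_lt_trans iH; apply: integral_le_ae => //.
    by apply: nearW => x; rewrite gee0_abs.
  have := integrable_ae measurableT i; apply: filterS => x /(_ I) /=.
  by rewrite ge0_fin_numE.
pose q := Num.sqrt s.
have q0 : 0 < q by rewrite sqrtr_gt0.
have q1 : q < 1 by rewrite -[ltRHS]sqrtr1 ltr_sqrt.
have qq : q ^+ 2 = s by rewrite sqr_sqrtr// ltW.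
(* With s = r^(1/2) and q = s^(1/2), the bound D n <= s^n H makes the increments at most h q^n: the
   decay left after the weighting is still geometric. *)
pose h x := Num.sqrt (fine (H x)).
have step x n : E x -> cabs (f n.+1 x - f n x) <= h x * q ^+ n.
  move=> Ex; have finH : H x \is a fin_num by rewrite ge0_fin_numE.
  have : u n x <= fine (H x).
    rewrite -lee_fin fineK//; apply: esum_ge; exists [set n]; first by split => //; exact: finite_set1.
    by rewrite fsbig_set1.
  rewrite /u mulrC ler_pdivrMr ?exprn_gt0// => le.
  rewrite -(@ler_pXn2r _ 2)// ?nnegrE ?cabs_ge0 ?mulr_ge0 ?sqrtr_ge0 ?exprn_ge0 ?(ltW q0)//.
  by rewrite exprMn sqr_sqrtr ?fine_ge0// -exprM mulnC exprM qq.
have step2 x n k : E x -> cabs (f (n + k)%N x - f n x) <= h x * q ^+ n / (1 - q).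
  move=> Ex.
  have {1}-> : f (n + k)%N x - f n x = \sum_(0 <= j < k) (f (n + j).+1 x - f (n + j)%N x).
    by under eq_bigr do rewrite -addnS; rewrite (telescope_sumr (fun j => f (n + j)%N x))// addn0.
  apply: (@le_trans _ _ (\sum_(0 <= j < k) h x * q ^+ n * q ^+ j)).
    elim/big_rec2 : _ => [|j y z _ le]; first by rewrite cabs0.
    by rewrite (le_trans (cabsD _ _))// lerD// -mulrA -exprD step.
  have := @geometric_le_lim R k (h x * q ^+ n) q.
  rewrite ger0_norm ?(ltW q0)//; apply => //.
  by rewrite mulr_ge0 ?sqrtr_ge0 ?exprn_ge0 ?ltW.
have qn0 c' : c' * q ^+ n @[n --> \oo] --> (0 : R).
  by apply: (@cvg_geometric R c' q); rewrite ger0_norm ?ltW.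
have cau (p : C -> R) x : (forall z w, p (z - w) = p z - p w) -> (forall z, `|p z| <= cabs z) -> E x ->
    cvg (p (f n x) @[n --> \oo]).
  move=> pB pc Ex; apply/cauchy_cvgP/cauchy_exP => e e0.
  have := qn0 (h x / (1 - q)); move/cvgr0Pnorm_lt => /(_ _ e0) [N _ /(_ N (leqnn N)) /= HN].
  exists (p (f N x)); exists N => // n /= Nn; rewrite /ball /= -pB (le_lt_trans (pc _))//.
  rewrite cabsB -(subnKC Nn) (le_lt_trans (step2 _ _ _ Ex))//.
  by rewrite mulrAC (le_lt_trans _ HN)// ler_norm.
(* The factor [\1_E] makes the sequence converge everywhere, so that its limit is measurable. *)
pose rl (p : C -> R) x := lim ((p (f n x) * \1_E x) @[n --> \oo]).
have rlP (p : C -> R) x : (forall z w, p (z - w) = p z - p w) -> (forall z, `|p z| <= cabs z) ->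
    (p (f n x) * \1_E x) @[n --> \oo] --> rl p x.
  move=> pB pc; rewrite /rl indicE; have [|nEx] := boolP (x \in E).
    rewrite inE => Ex; under eq_fun do rewrite mulr1; exact: (cau _ _ pB pc Ex).
  by under eq_fun do rewrite mulr0; exact: is_cvg_cst.
have mrl (p : C -> R) : (forall z w, p (z - w) = p z - p w) -> (forall z, `|p z| <= cabs z) ->
    (forall n, measurable_fun setT (fun x => p (f n x))) -> measurable_fun setT (rl p).
  move=> pB pc mp; apply: (@measurable_fun_cvg _ _ _ setT (fun n x => p (f n x) * \1_E x)).
    by move=> n; apply: measurable_funM.
  by move=> x _; exact: rlP.
have ReB (z w : C) : complex.Re (z - w) = complex.Re z - complex.Re w by rewrite cReD cReN.
have ImB (z w : C) : complex.Im (z - w) = complex.Im z - complex.Im w by rewrite cImD cImN.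
pose g x := Complex (rl (@complex.Re R) x) (rl (@complex.Im R) x).
have mg : cmeas g.
  split; [apply: (mrl _ ReB (@normRe_le R))|apply: (mrl _ ImB (@normIm_le R))] => n;
    by have [] := mf n.
exists g => //.
have bnd (p : C -> R) x n : (forall z w, p (z - w) = p z - p w) -> (forall z, `|p z| <= cabs z) -> E x ->
    `|p (f n x) - rl p x| <= h x * q ^+ n / (1 - q).
  move=> pB pc Ex; have c' := rlP p x pB pc.
  have {}c' : `|p (f n x) - p (f k x)| @[k --> \oo] --> `|p (f n x) - rl p x|.
    apply: cvg_norm; apply: cvgB; first exact: cvg_cst.
    by move: c'; rewrite indicE mem_set//; under eq_fun do rewrite mulr1.
  rewrite -(cvg_lim _ c')//; apply: limr_le; first by apply/cvg_ex; eexists; exact: c'.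
  exists n => // k /= nk; rewrite -pB (le_trans (pc _))// cabsB -(subnKC nk); exact: step2.
(* k n times H is the square of twice the tail bound, one copy each for the real and the imaginary
   part. *)
pose k n := 4 * s ^+ n / (1 - q) ^+ 2.
have k0 n : 0 <= k n by rewrite divr_ge0 ?sqr_ge0// mulr_ge0// exprn_ge0// ltW.
have le n : (n2 (fun x => f n x - g x)%R <= (k n)%:E * \int[m]_x H x)%E.
  rewrite -ge0_integralZl ?lee_fin//; rewrite /n2 /nint; apply: integral_le_ae.
  - by move=> x; rewrite lee_fin sqr_ge0.
  - by move=> x; apply: mule_ge0; rewrite ?lee_fin.
  move: aeE; apply: filterS => x Ex; have finH : H x \is a fin_num by rewrite ge0_fin_numE.
  rewrite -(fineK finH) -EFinM lee_fin.
  rewrite -[leRHS](_ : (2 * (h x * q ^+ n / (1 - q))) ^+ 2 = _); last first.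
    rewrite !exprMn exprVn sqr_sqrtr ?fine_ge0// -exprM mulnC exprM qq /k; ring.
  rewrite ler_pXn2r ?nnegrE ?cabs_ge0//; last first.
    by rewrite mulr_ge0// divr_ge0 ?subr_ge0 ?(ltW q1)// mulr_ge0 ?sqrtr_ge0 ?exprn_ge0 ?(ltW q0).
  rewrite (le_trans (cabs_le_ReIm _))// ReB ImB mulr_natl mulr2n.
  by rewrite lerD// bnd//; [exact: normRe_le|exact: normIm_le].
have finI : (\int[m]_x H x)%E \is a fin_num.
  by rewrite ge0_fin_numE//; apply: integral_ge0 => x _; exact: H0.
apply: (@squeeze_cvge _ _ _ _ (cst 0%E) _ (fun n => (k n * fine (\int[m]_x H x))%:E)).
- by apply: nearW => n; rewrite n2_ge0 /= EFinM fineK.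
- exact: cvg_cst.
- apply: cvg_EFin; first exact: nearW.
  rewrite -(mul0r (fine (\int[m]_x H x)%E)); apply: cvgMl.
  rewrite /k; under eq_fun do rewrite mulrAC.
  by apply: cvg_geometric; rewrite ger0_norm ?ltW.
Qed.

(** A subsequence with squared increments at most 2^-k converges by [riesz_fischer], and the Cauchy
    property carries the whole sequence along. *)
Lemma L2_complete (f : nat -> T -> C) : (forall n, cmeas (f n)) ->
  (forall a : R, 0 < a -> exists N, forall n k, (N <= n <= k)%N ->
    (n2 (fun x => f k x - f n x)%R <= a%:E)%E) ->
  exists2 g, cmeas g & n2 (fun x => f n x - g x) @[n --> \oo] --> 0%E.
Proof.
move=> mf fe.
have H k : exists N, (k <= N)%N /\ forall n m, (N <= n <= m)%N ->
    (n2 (fun x => f m x - f n x)%R <= (1 * 2^-1 ^+ k)%:E)%E.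
  have [N HN] := fe (1 * 2^-1 ^+ k) (ltac:(by rewrite mul1r exprn_gt0// invr_gt0)).
  exists (maxn k N); split; first exact: leq_maxl.
  by move=> n m'; rewrite geq_max -andbA => /andP[_ /HN].
pose sg k := proj1_sig (cid (H k)).
have sg1 k : (k <= sg k)%N by have [] := proj2_sig (cid (H k)).
have sg2 k n m' : (sg k <= n <= m')%N -> (n2 (fun x => f m' x - f n x)%R <= (1 * 2^-1 ^+ k)%:E)%E.
  by have [_] := proj2_sig (cid (H k)); exact.
have [|||k|g mg /ecvg0P fg] := @riesz_fischer (f \o sg) 1 2^-1.
- by move=> n; exact: mf.
- by rewrite invr_gt0 ltr0n/= invf_lt1// ltr1n.
- by [].
(* [sg] is not arranged to be increasing, so both orders occur. *)
- have [le|/ltnW le] := leqP (sg k) (sg k.+1); first by apply: sg2; rewrite leqnn.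
  rewrite n2B_sym; apply: (@le_trans _ _ (1 * 2^-1 ^+ k.+1)%:E).
    by apply: sg2; rewrite leqnn.
  by rewrite lee_fin !mul1r exprS ler_piMl ?exprn_ge0 ?invr_ge0// invf_le1// ler1n.
exists g => //; apply/ecvg0P => [n|a a0]; first exact: n2_ge0.
have a4 : 0 < a / 4 by rewrite divr_gt0.
have [N HN] := fe _ a4; have [K HK] := fg (fun n => n2_ge0 _) _ a4.
exists N => n Nn; pose k := maxn (maxn N n) K.
have le k' : (k <= k')%N -> [/\ (N <= k')%N, (n <= k')%N & (K <= k')%N].
  by rewrite !geq_max => /andP[/andP[]].
have [k1 k2 _] := le _ (sg1 k); have [_ _ k3] := le _ (leqnn k).
rewrite [X in n2 X](_ : _ = fun x => (f n x - f (sg k) x) + (f (sg k) x - g x)); last first.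
  by apply/funext => x; rewrite addrA subrK.
apply: le_trans (n2D_le _ _) _; [exact: cmeasB|exact: cmeasB|].
have -> : (a%:E = 2%:E * (a / 4)%:E + 2%:E * (a / 4)%:E)%E.
  by rewrite -EFinM -EFinD; congr EFin; field.
apply: leeD; apply: lee_wpmul2l => //; last exact: HK.
by rewrite n2B_sym; apply: HN; rewrite Nn.
Qed.

End riesz_fischer.

(** * Smooth functions and test functions *)

Section flat.
Context {R : realType}.
Implicit Types (t : R) (k : nat).

(* The functions t^-k e^{-1/t}, extended by 0 to t <= 0, span a space closed under d/dt. *)
Definition flat k t : R := if 0 < t then t^-1 ^+ k * expR (- t^-1) else 0.

Lemma flat_ge0 k t : 0 <= flat k t.
Proof.
rewrite /flat; case: ifPn => // t0.
by rewrite mulr_ge0 ?expR_ge0// exprn_ge0// invr_ge0 ltW.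
Qed.

Lemma flat0_gt0 t : 0 < t -> 0 < flat 0 t.
Proof. by move=> t0; rewrite /flat t0 mul1r expR_gt0. Qed.

Lemma flat0_le1 t : flat 0 t <= 1.
Proof.
rewrite /flat; case: ifPn => // t0.
by rewrite mul1r -expR0 ler_expR oppr_le0 invr_ge0 ltW.
Qed.

(** One term of the exponential series gives e^(1/t) >= t^-(k+1)/(k+1)!. A bound linear in |t| is
    what continuity at 0 uses for every k. *)
Lemma flat_bound k t : `|flat k t| <= k.+1`!%:R * `|t|.
Proof.
rewrite (ger0_norm (flat_ge0 _ _)) /flat; case: ifPn => [t0|_]; last exact: mulr_ge0.
have f0 : 0 < k.+1`!%:R :> R by rewrite ltr0n fact_gt0.
have i0 : 0 <= t^-1 by rewrite invr_ge0 ltW.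
rewrite (gtr0_norm t0) expRN ler_pdivrMr ?expR_gt0//.
have := expR_ge1Dxn k i0; rewrite -lerBrDl => le.
have {}le : t^-1 ^+ k.+1 <= k.+1`!%:R * expR t^-1.
  by rewrite mulrC -ler_pdivrMr// (le_trans le)// gerBl.
rewrite (_ : t^-1 ^+ k = t * t^-1 ^+ k.+1).
  by rewrite [leRHS]mulrAC [leRHS]mulrC ler_wpM2l// ltW.
by rewrite exprS mulrA mulfV ?mul1r// gt_eqF.
Qed.

(** At 0 the difference quotient of [flat k] is [flat k.+1] itself, which tends to 0 by
    [flat_bound]. *)
Lemma is_derive_flat k t : is_derive t 1 (flat k) (flat k.+2 t - k%:R * flat k.+1 t).
Proof.
have [t0|t0|->] := ltgtP t 0.
- apply: (@near_eq_is_derive _ _ _ (cst 0)).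
    near=> s; rewrite /flat ltNge ltW//; near: s; exact: lt_nbhsl.
  apply: is_derive_eq (is_derive_cst _ _ _) _.
  by rewrite /flat ltNge (ltW t0) /= mulr0 subr0.
- apply: (@near_eq_is_derive _ R R (fun s : R => s^-1 ^+ k * expR (- s^-1))).
    near=> s; rewrite /flat ifT//; near: s; exact: lt_nbhsr.
  have tn0 : t != 0 by rewrite gt_eqF.
  have dV : is_derive t 1 (fun s : R => s^-1) (- t ^- 2).
    by apply: is_derive_eq (is_deriveV tn0 (is_derive_id _ _)) _; rewrite [LHS]mulr1.
  have dE : is_derive t 1 (fun s : R => expR (- s^-1)) (t ^- 2 * expR (- t^-1)).
    have dN := is_deriveN dV.
    by apply: is_derive_eq (is_derive1_comp (is_derive_expR _) dN) _; rewrite opprK mulrC.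
  have dX : is_derive t 1 (fun s : R => s^-1 ^+ k) (k%:R * t^-1 ^+ k.-1 * (- t ^- 2)).
    by have := is_deriveX k dV; congr is_derive; apply/funext => s; rewrite exprfctE.
  apply: is_derive_eq (is_deriveM dX dE) _.
  rewrite /flat t0 -exprVn -[_ *: (_ *: _)]/(_ * (_ * _)) -[_ *: _]/(_ * _).
  case: k {dX} => [|k] /=; rewrite ?exprS; ring.
- have f0 : 0 < k.+2`!%:R :> R by rewrite ltr0n fact_gt0.
  have lim : h^-1 *: (flat k (h *: 1 + 0) - flat k 0) @[h --> (0 : R)^'] --> (0 : R).
    rewrite (_ : (fun h => _) = flat k.+1).
      have c0 : flat k.+1 h @[h --> (0 : R)] --> (0 : R).
        apply/cvgrPdist_lt => e e0; near=> h.
        rewrite sub0r normrN; apply: le_lt_trans (flat_bound _ _) _.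
        rewrite mulrC -ltr_pdivlMr//; near: h.
        by exists (e / k.+2`!%:R) => [|y] /=; [exact: divr_gt0|rewrite sub0r normrN].
      exact: cvg_within_filter c0.
    apply/funext => h; rewrite /flat ltxx subr0 addr0 scaler1; case: ifPn => // _.
      by rewrite exprS -mulrA.
    by rewrite [LHS]mulr0.
  have fl j : flat j (0 : R) = 0 by rewrite /flat ltxx.
  rewrite !fl mulr0 subr0; apply: DeriveDef; first by apply/cvg_ex; exists 0; exact: lim.
  exact: (cvg_lim _ lim).
Unshelve. all: by end_near. Qed.

End flat.

Section smooth_algebra.
Context {R : realType} {d : nat}.
Local Notation C := R[i].
Local Notation V := 'cV[R]_d.
Local Notation mu := (@lebesgue_cV R d).
Implicit Types (u v : V -> R) (f g : V -> C) (x y xi : V).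

Local Notation e_ i := (delta_mx i ord0 : V).

(** Coinduction, in place of formulas for iterated derivatives: smoothness is proved by exhibiting a
    class stable under partial differentiation. *)
Lemma smooth_coind (P : (V -> R) -> Prop) :
  (forall u, P u -> [/\ continuous u, forall i x, derivable u x (e_ i) & forall i, P ('D_(e_ i) u)]) ->
  forall u, P u -> smooth u.
Proof.
move=> H u Pu s; suff /H[c dd _] : P (partial s u) by [].
by elim: s => //= i s /H[].
Qed.

Lemma partial_rcons s i u : partial (rcons s i) u = partial s ('D_(e_ i) u).
Proof. by elim: s => //= j s ->. Qed.

Lemma smoothP u : smooth u ->
  [/\ continuous u, forall i x, derivable u x (e_ i) & forall i, smooth ('D_(e_ i) u)].
Proof.
move=> su; split; [exact: (su [::]).1|exact: (su [::]).2|].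
by move=> i s; rewrite -partial_rcons; exact: su.
Qed.

Lemma smooth_is_derive u x i : smooth u -> is_derive x (e_ i) u ('D_(e_ i) u x).
Proof. by case/smoothP=> _ du _; exact: derivableP. Qed.

(** A chain rule that looks at [u] only on the line through [x] in direction [w], where [u] is a
    function [h] of an affine parameter. *)
Lemma derive_line u (h : R -> R) x (w : V) (t c a : R) : (forall s, u (s *: w + x) = h (s * c + t)) ->
  is_derive t 1 h a -> is_derive x w u (c * a).
Proof.
move=> uh dh; have dt : differentiable h t by apply/derivable1_diffP; case: dh.
have E : (fun s : R => s^-1 *: (u (s *: w + x) - u x)) =
    fun s : R => s^-1 *: (h (s *: c + t) - h t).
  apply/funext => s; rewrite uh; have := uh 0; rewrite scale0r add0r mul0r add0r => ->.
  by [].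
have := @diff_derivable _ _ _ h t c dt; rewrite /derivable -[X in X @ _]/(fun s : R => s^-1 *: (h (s *: c + t) - h t)) -E => du.
apply: DeriveDef; first exact: du.
transitivity ('D_c h t).
  by transitivity (lim (s^-1 *: (u (s *: w + x) - u x) @[s --> 0^'])); [|rewrite E].
rewrite deriveE// -{1}(mulr1 c) -[c * 1]/(c *: 1) linearZ -deriveE//.
by case: dh => _ <-.
Qed.

Lemma continuous_affine_coord i (a b : R) : continuous (fun x : V => a * x i ord0 + b).
Proof.
move=> x; apply: (@continuousD _ _ _ (fun x : V => a * x i ord0) (cst b)); last exact: cst_continuous.
by apply: (@continuousM _ _ (cst a)); [exact: cst_continuous|exact: coord_cont].
Qed.

Lemma continuous_dot y : continuous (dot y : V -> R).
Proof.
have H (s : seq 'I_d) : continuous (fun x : V => \sum_(i <- s) y i ord0 * x i ord0).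
  elim: s => [|i s ih].
    by under eq_fun do rewrite big_nil; exact: cst_continuous.
  under eq_fun do rewrite big_cons.
  move=> x; have h : {for x, continuous (fun x : V => y i ord0 * x i ord0)}.
    by apply: (@continuousM _ _ (cst _)); [exact: cst_continuous|exact: coord_cont].
  exact: (continuousD h (ih x)).
exact: H.
Qed.

Lemma smooth_cst (c : R) : smooth (fun _ : V => c).
Proof.
apply: (@smooth_coind (fun u => exists c, u = cst c)); last by exists c.
move=> _ [{}c ->]; split; [exact: cst_continuous|by move=> i x; exact: derivable_cst|].
by move=> i; exists 0; apply/funext => x; exact: derive_cst.
Qed.

(* The algebra generated by smooth functions and the profiles t^-k e^{-1/t} of affine coordinates. *)
Inductive salg : (V -> R) -> Prop :=
| salg_smooth u : smooth u -> salg u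
| salg_flat k i (c b : R) : salg (fun x => flat k (c * x i ord0 + b))
| salg_add u v : salg u -> salg v -> salg (u + v)
| salg_mul u v : salg u -> salg v -> salg (u * v).

Lemma salg_derive u : salg u -> [/\ continuous u, forall i x, derivable u x (e_ i) &
   forall i, salg ('D_(e_ i) u)].
Proof.
elim=> {u} [u /smoothP[cu du Du]|k i c b|u v _ [cu du Du] _ [cv dv Dv]|u v su [cu du Du] sv [cv dv Dv]].
- by split => // i; exact: salg_smooth.
- have D j x : is_derive x (e_ j) (fun x : V => flat k (c * x i ord0 + b))
      ((c * (i == j)%:R) * (flat k.+2 (c * x i ord0 + b) - k%:R * flat k.+1 (c * x i ord0 + b))).
    apply: (derive_line (h := flat k) _ (is_derive_flat _ _)) => s.
    by rewrite !mxE eqxx andbT; congr flat; ring.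
  split.
  + move=> x; apply: (@continuous_comp _ _ _ (fun x : V => c * x i ord0 + b) (flat k)).
      exact: continuous_affine_coord.
    by apply/differentiable_continuous/derivable1_diffP; case: (is_derive_flat k (c * x i ord0 + b)).
  + by move=> j x; case: (D j x).
  + move=> j; rewrite (_ : 'D_(e_ j) _ = cst (c * (i == j)%:R) *
        ((fun x => flat k.+2 (c * x i ord0 + b)) + cst (- k%:R) * (fun x => flat k.+1 (c * x i ord0 + b)))).
      by repeat (apply: salg_add || apply: salg_mul || exact: salg_flat || (apply: salg_smooth; exact: smooth_cst)).
    by apply/funext => x; rewrite derive_val -mulNr.
- split; first by move=> x; exact: (continuousD (cu x) (cv x)).
    by move=> i x; exact: derivableD.
  move=> i; rewrite (_ : 'D_(e_ i) _ = 'D_(e_ i) u + 'D_(e_ i) v); first exact: salg_add.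
  by apply/funext => x; rewrite deriveD.
- split; first by move=> x; exact: (continuousM (cu x) (cv x)).
    by move=> i x; exact: derivableM.
  move=> i; rewrite (_ : 'D_(e_ i) _ = u * 'D_(e_ i) v + v * 'D_(e_ i) u).
    by apply: salg_add; apply: salg_mul.
  by apply/funext => x; rewrite deriveM.
Qed.

Lemma salgE u : salg u -> smooth u.
Proof. exact: smooth_coind salg_derive u. Qed.

Lemma smoothD u v : smooth u -> smooth v -> smooth (fun x => u x + v x).
Proof. by move=> su sv; apply: salgE; apply: salg_add; exact: salg_smooth. Qed.

Lemma smoothM u v : smooth u -> smooth v -> smooth (fun x => u x * v x).
Proof. by move=> su sv; apply: salgE; apply: salg_mul; exact: salg_smooth. Qed.

Lemma smoothN u : smooth u -> smooth (fun x => - u x).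
Proof.
move=> su; have := smoothM (smooth_cst (-1)) su.
by congr smooth; apply/funext => x; rewrite mulN1r.
Qed.

Lemma smooth_flat k i (c b : R) : smooth (fun x : V => flat k (c * x i ord0 + b)).
Proof. by apply: salgE; exact: salg_flat. Qed.

Lemma smooth_prod (I : Type) (s : seq I) (F : I -> V -> R) : (forall i, smooth (F i)) ->
  smooth (fun x => \prod_(i <- s) F i x).
Proof.
move=> sF; elim: s => [|i s ih].
  by have := smooth_cst 1; congr smooth; apply/funext => x; rewrite big_nil.
by have := smoothM (sF i) ih; congr smooth; apply/funext => x; rewrite big_cons.
Qed.

(** Differentiation shifts the phase by pi/2, so the functions a cos(y.x + b) form a stable class
    that already contains the sines. *)
Lemma smooth_cos y (a b : R) : smooth (fun x => a * cos (dot y x + b)).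
Proof.
apply: (@smooth_coind (fun u => exists a b, u = fun x => a * cos (dot y x + b))); last by exists a, b.
move=> _ [{}a [{}b ->]].
have D i x : is_derive x (e_ i) (fun x => a * cos (dot y x + b)) (y i ord0 * (a * cos (dot y x + (b + pi / 2)))).
  have dc : is_derive (dot y x + b) 1 (fun t => a * cos t) (a * (- sin (dot y x + b))).
    by apply: is_derive_eq (is_deriveZ a (is_derive_cos _)) _.
  rewrite addrA cosDpihalf; apply: (derive_line (h := fun t => a * cos t) _ dc) => s.
  rewrite dotDr dotZr (_ : dot y (e_ i) = y i ord0) ?addrA//.
  rewrite /dot (bigD1 i)//= big1 ?addr0 => [|j ji]; first by rewrite mxE !eqxx mulr1.
  by rewrite mxE (negPf ji) mulr0.
split.
- move=> x; apply: continuousM; first exact: cst_continuous.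
  apply: (@continuous_comp _ _ _ (fun x : V => dot y x + b) cos); last exact: continuous_cos.
  apply: continuousD; last exact: cst_continuous.
  exact: continuous_dot.
- by move=> i x; case: (D i x).
- move=> i; exists (y i ord0 * a), (b + pi / 2); apply/funext => x.
  by rewrite derive_val mulrA.
Qed.

Lemma smooth_coord i : smooth (fun x : V => x i ord0).
Proof.
apply: (@smooth_coind (fun u => exists a b, u = fun x : V => a * x i ord0 + b)); last first.
  by exists 1, 0; apply/funext => x; rewrite mul1r addr0.
move=> _ [a [b ->]].
have D j x : is_derive x (e_ j) (fun x : V => a * x i ord0 + b) ((i == j)%:R * a).
  have di : is_derive (x i ord0) 1 (fun t : R => a * t + b) a.
    apply: is_derive_eq (is_deriveD (is_deriveZ a (is_derive_id _ _)) (is_derive_cst b _ _)) _.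
    by rewrite addr0 [LHS]mulr1.
  apply: (derive_line (h := fun t => a * t + b) _ di) => s.
  by rewrite !mxE eqxx andbT.
split.
- exact: continuous_affine_coord.
- by move=> j x; case: (D j x).
- move=> j; exists 0, ((i == j)%:R * a); apply/funext => x.
  by rewrite derive_val mul0r add0r.
Qed.

End smooth_algebra.

Section test_functions.
Context {R : realType} {d : nat}.
Local Notation C := R[i].
Local Notation V := 'cV[R]_d.
Local Notation mu := (@lebesgue_cV R d).
Implicit Types (u v : V -> R) (f g : V -> C) (x y xi : V) (A B : set V).

Local Notation e_ i := (delta_mx i ord0 : V).

Lemma csmoothD f g : csmooth f -> csmooth g -> csmooth (fun x => f x + g x).
Proof.
move=> [f1 f2] [g1 g2]; split.
  by have := smoothD f1 g1; congr smooth; apply/funext => x; rewrite /rpart cReD.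
by have := smoothD f2 g2; congr smooth; apply/funext => x; rewrite /ipart cImD.
Qed.

Lemma csmoothM f g : csmooth f -> csmooth g -> csmooth (fun x => f x * g x).
Proof.
move=> [f1 f2] [g1 g2]; split.
  have := smoothD (smoothM f1 g1) (smoothN (smoothM f2 g2)).
  by congr smooth; apply/funext => x; rewrite /rpart cReM.
have := smoothD (smoothM f1 g2) (smoothM f2 g1).
by congr smooth; apply/funext => x; rewrite /ipart cImM.
Qed.

Lemma csmoothR u : smooth u -> csmooth (fun x => (u x)%:C%C).
Proof. by move=> su; split => //; exact: smooth_cst. Qed.

Lemma csmooth_cst (c : C) : csmooth (fun _ : V => c).
Proof. by split; exact: smooth_cst. Qed.

Lemma csmooth_conj f : csmooth f -> csmooth (fun x => ((f x)^*)%C).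
Proof.
move=> [f1 f2]; split.
  by move: f1; congr smooth; apply/funext => x; rewrite /rpart cReconj.
by have := smoothN f2; congr smooth; apply/funext => x; rewrite /ipart cImconj.
Qed.

Lemma csmooth_cis y (b : R) : csmooth (fun x => cis (dot y x + b)).
Proof.
split.
  by have := smooth_cos y 1 b; congr smooth; apply/funext => x; rewrite mul1r.
have := smooth_cos y 1 (b - pi / 2); congr smooth; apply/funext => x.
by rewrite mul1r /ipart /= addrA cosBpihalf.
Qed.

Lemma csmooth_sum (I : Type) (s : seq I) (F : I -> V -> C) : (forall i, csmooth (F i)) ->
  csmooth (fun x => \sum_(i <- s) F i x).
Proof.
move=> sF; elim: s => [|i s ih].
  by have := csmooth_cst 0; congr csmooth; apply/funext => x; rewrite big_nil.
by have := csmoothD (sF i) ih; congr csmooth; apply/funext => x; rewrite big_cons.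
Qed.

Definition cderiv i f : V -> C := fun x => Complex ('D_(e_ i) (rpart f) x) ('D_(e_ i) (ipart f) x).

Lemma cpartial_rcons s i f : cpartial (rcons s i) f = cpartial s (cderiv i f).
Proof. by apply/funext => x; rewrite /cpartial !partial_rcons. Qed.

Lemma csmooth_deriv i f : csmooth f -> csmooth (cderiv i f).
Proof. by move=> [/smoothP[_ _ h1] /smoothP[_ _ h2]]; split; [exact: h1|exact: h2]. Qed.

Lemma csmooth_cmeas f : csmooth f -> cmeas f.
Proof. by move=> [/smoothP[c1 _ _] /smoothP[c2 _ _]]; split; exact: continuous_measurable_cV. Qed.

Lemma ccontP f x : continuous (rpart f) -> continuous (ipart f) -> ccont_at f x.
Proof.
move=> c1 c2 e e0; have e2 : 0 < e / 2 by rewrite divr_gt0.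
have /cvgrPdist_lt/(_ _ e2) h1 := c1 x; have /cvgrPdist_lt/(_ _ e2) h2 := c2 x.
near=> y; apply: le_lt_trans (cabs_le_ReIm _) _; rewrite cReD cImD cReN cImN (splitr e).
by apply: ltrD; rewrite distrC; near: y.
Unshelve. all: by end_near. Qed.

Lemma csmooth_ccont f x : csmooth f -> ccont_at f x.
Proof. by move=> [/smoothP[c1 _ _] /smoothP[c2 _ _]]; exact: ccontP. Qed.

Lemma csupport_cmpl f x : ~ csupport f x -> f x = 0.
Proof. by move=> h; apply/eqP; apply: contrapT => /negP f0; apply: h; exact: subset_closure. Qed.

Lemma Ccinfty_sub A B f : A `<=` B -> Ccinfty A f -> Ccinfty B f.
Proof. by move=> AB [sf [cf fA]]; split => //; split => //; exact: subset_trans fA AB. Qed.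

Lemma Ccinfty_intro A f K : csmooth f -> compact K -> K `<=` A -> (forall x, ~ K x -> f x = 0) -> Ccinfty A f.
Proof.
move=> sf cK KA f0.
have sub : csupport f `<=` K.
  have clK : closed K by apply: compact_closed => //; exact: norm_hausdorff.
  rewrite (closure_id K).1//; apply: closureS => x /= /eqP fx.
  by apply: contrapT => /f0.
split => //; split; last exact: subset_trans sub KA.
by apply: subclosed_compact sub => //; exact: closed_closure.
Qed.

Lemma Ccinfty0 A : Ccinfty A (fun _ => 0).
Proof. by apply: (@Ccinfty_intro _ _ set0) => //; [exact: csmooth_cst|exact: compact0]. Qed.

Lemma CcinftyM A f g : Ccinfty A f -> csmooth g -> Ccinfty A (fun x => f x * g x).
Proof.
move=> [sf [cf fA]] sg; apply: (Ccinfty_intro _ cf fA); first exact: csmoothM.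
by move=> x /csupport_cmpl ->; rewrite mul0r.
Qed.

Lemma CcinftyD A f g : Ccinfty A f -> Ccinfty A g -> Ccinfty A (fun x => f x + g x).
Proof.
move=> [sf [cf fA]] [sg [cg gA]].
apply: (@Ccinfty_intro _ _ (csupport f `|` csupport g)); first exact: csmoothD.
- exact: compactU.
- by rewrite subUset.
- by move=> x /not_orP[/csupport_cmpl -> /csupport_cmpl ->]; rewrite addr0.
Qed.

Lemma CcinftyZ A (c : C) f : Ccinfty A f -> Ccinfty A (fun x => c * f x).
Proof.
move=> Af; have := CcinftyM Af (csmooth_cst c).
by congr Ccinfty; apply/funext => x; rewrite mulrC.
Qed.

Lemma Ccinfty_sum A (I : Type) (s : seq I) (F : I -> V -> C) : (forall i, Ccinfty A (F i)) ->
  Ccinfty A (fun x => \sum_(i <- s) F i x).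
Proof.
move=> sF; elim: s => [|i s ih].
  by have := Ccinfty0 A; congr Ccinfty; apply/funext => x; rewrite big_nil.
by have := CcinftyD (sF i) ih; congr Ccinfty; apply/funext => x; rewrite big_cons.
Qed.

Lemma Ccinfty_conj A f : Ccinfty A f -> Ccinfty A (fun x => ((f x)^*)%C).
Proof.
move=> [sf [cf fA]]; apply: (Ccinfty_intro _ cf fA); first exact: csmooth_conj.
by move=> x /csupport_cmpl ->; rewrite rmorph0.
Qed.

Lemma Ccinfty_deriv A i f : Ccinfty A f -> Ccinfty A (cderiv i f).
Proof.
move=> [sf [cf fA]]; apply: (Ccinfty_intro _ cf fA); first exact: csmooth_deriv.
move=> x nx; have op : open (~` csupport f) by apply: closed_openC; exact: closed_closure.
have E : {near x, f =1 (fun=> 0)}.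
  by move/open_nbhs_nbhs : (conj op nx : open_nbhs x _) ; apply: filterS => y /csupport_cmpl.
have D0 u : {near x, u =1 (fun=> 0)} -> 'D_(e_ i) u x = 0.
  by move=> h; rewrite (near_eq_derive _ h) derive_cst.
by apply: cplx_eq => /=; apply: D0; move: E; apply: filterS => y; rewrite /rpart /ipart => ->.
Qed.

Lemma Ccinfty_box A f : Ccinfty A f -> exists2 M : R, 0 <= M &
  forall x, cabs (f x) <= M /\ (M < `|x| -> f x = 0).
Proof.
move=> [sf [cf fA]].
have [M0 [_ HM]] := compact_bounded cf.
have bnd u : continuous u -> exists N : R, forall x, csupport f x -> `|u x| <= N.
  move=> cu; have cI : compact (u @` csupport f).
    by apply: continuous_compact => //; apply: continuous_subspaceT.
  have [N0 [_ HN]] := compact_bounded cI; exists (N0 + 1) => x fx.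
  by apply: (HN (N0 + 1)); [rewrite ltrDl|exists x].
have [/smoothP[c1 _ _] /smoothP[c2 _ _]] := sf.
have [N1 H1] := bnd _ c1; have [N2 H2] := bnd _ c2.
exists (Num.max (M0 + 1) (Num.max (N1 + N2) 0)); first by rewrite !le_max lexx !orbT.
move=> x; split.
  have [fx|/csupport_cmpl ->] := pselect (csupport f x); last by rewrite cabs0 !le_max lexx !orbT.
  by rewrite !le_max (le_trans (cabs_le_ReIm _) (lerD (H1 x fx) (H2 x fx))) !orbT.
rewrite !gt_max => /andP[Mx _]; apply: csupport_cmpl => fx.
have := HM (M0 + 1); rewrite ltrDl ltr01 => /(_ isT _ fx) /=.
by rewrite leNgt Mx.
Qed.

Lemma nint_boxcst (M c : R) : 0 <= M -> 0 <= c ->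
  (nint mu (fun x => if (`|x| <= M)%R then c else 0)%R < +oo)%E.
Proof.
move=> M0 c0.
have E : [set x : V | `|x| <= M] = cbox (const_mx (- M)) (const_mx M).
  apply/seteqP; split => x /=; rewrite cV_norm_le//.
    by move=> h i; have := h i; rewrite !mxE ler_norml.
  by move=> h i; have := h i; rewrite !mxE ler_norml.
have -> : (fun x : V => if (`|x| <= M)%R then c else 0) =
    fun x => c * \1_[set x : V | `|x| <= M] x.
  apply/funext => x; rewrite indicE; case: ifPn => h.
    by rewrite mem_set// mulr1.
  by rewrite memNset ?mulr0//= => /idP; apply/negP.
have mE : measurable [set x : V | `|x| <= M] by rewrite E; exact: measurable_cbox.
have fE : (mu [set x : V | `|x| <= M]%R < +oo)%E.
  rewrite E; have := @lebesgue_cbox R d (const_mx (- M)) (const_mx M).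
  move=> ->; first exact: ltry.
  by move=> i; rewrite !mxE (le_trans (y := 0))// oppr_le0.
rewrite nintZ//; rewrite /nint integral_indic// setIT.
by rewrite lte_mul_pinfty.
Qed.

Lemma Ccinfty_cmeas A f : Ccinfty A f -> cmeas f.
Proof. by move=> [/csmooth_cmeas]. Qed.

Lemma Ccinfty_cL1 A f : Ccinfty A f -> cL1 mu f.
Proof.
move=> Af; have [M M0 HM] := Ccinfty_box Af; split; first exact: Ccinfty_cmeas Af.
apply: le_lt_trans (nint_boxcst M0 M0); apply: nint_le => x; first exact: cabs_ge0.
have [h1 h2] := HM x; case: ifPn => //; rewrite -ltNge => /h2 ->.
by rewrite cabs0.
Qed.

Lemma Ccinfty_n2 A f : Ccinfty A f -> (n2 mu f < +oo)%E.
Proof.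
move=> Af; have [M M0 HM] := Ccinfty_box Af.
apply: le_lt_trans (nint_boxcst M0 (sqr_ge0 M)); apply: nint_le => x; first exact: sqr_ge0.
have [h1 h2] := HM x; case: ifPn => [_|]; first by rewrite ler_sqr ?nnegrE ?cabs_ge0.
by rewrite -ltNge => /h2 ->; rewrite cabs0 expr0n.
Qed.

(** Positive exactly on the open box between [a] and [b]. *)
Definition bump (a b : V) x : R := \prod_i (flat 0 (x i ord0 - a i ord0) * flat 0 (b i ord0 - x i ord0)).

Lemma bump_ge0 a b x : 0 <= bump a b x.
Proof. by apply: prodr_ge0 => i _; rewrite mulr_ge0 ?flat_ge0. Qed.

Lemma bump_le1 a b x : bump a b x <= 1.
Proof.
apply: prodr_ile1 => i _; rewrite mulr_ge0 ?flat_ge0//=.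
by rewrite -[leRHS]mulr1 ler_pM ?flat_ge0 ?flat0_le1.
Qed.

Lemma bump_gt0 (a b x : V) : (forall i, a i ord0 < x i ord0 < b i ord0) -> 0 < bump a b x.
Proof.
by move=> h; apply: prodr_gt0 => i _; have /andP[h1 h2] := h i; rewrite mulr_gt0 ?flat0_gt0 ?subr_gt0.
Qed.

Lemma bump_out (a b x : V) i : ~~ (a i ord0 < x i ord0 < b i ord0) -> bump a b x = 0.
Proof.
move=> h; rewrite /bump (bigD1 i)//= /flat !subr_gt0.
by move: h; rewrite negb_and => /orP[/negPf ->|/negPf ->]; rewrite ?mulr0 !mul0r.
Qed.

Lemma smooth_bump a b : smooth (bump a b).
Proof.
apply: smooth_prod => i; apply: smoothM.
  by have := smooth_flat 0 i 1 (- a i ord0); congr smooth; apply/funext => x; rewrite mul1r.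
by have := smooth_flat 0 i (-1) (b i ord0); congr smooth; apply/funext => x; rewrite mulN1r addrC.
Qed.

Lemma smoothX u n : smooth u -> smooth (fun x => u x ^+ n).
Proof.
move=> su; elim: n => [|n ih]; first exact: smooth_cst.
by have := smoothM su ih; congr smooth; apply/funext => x; rewrite exprS.
Qed.

(* Increases with n to the indicator of the open box. *)
Definition bumpn n (a b : V) x : R := 1 - (1 - bump a b x) ^+ n.

Lemma bumpn_ge0 n a b x : 0 <= bumpn n a b x.
Proof. by rewrite subr_ge0 exprn_ile1 ?subr_ge0 ?bump_le1// gerBl bump_ge0. Qed.

Lemma bumpn_le1 n a b x : bumpn n a b x <= 1.
Proof. by rewrite gerBl exprn_ge0// subr_ge0 bump_le1. Qed.

Lemma bumpn_out n (a b x : V) i : ~~ (a i ord0 < x i ord0 < b i ord0) -> bumpn n a b x = 0.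
Proof. by move=> h; rewrite /bumpn (bump_out h) subr0 expr1n subrr. Qed.

Lemma bumpn_cvg (a b x : V) : (forall i, a i ord0 < x i ord0 < b i ord0) ->
  bumpn n a b x @[n --> \oo] --> (1 : R).
Proof.
move=> /bump_gt0 h; rewrite -[X in _ --> X]subr0; apply: cvgB; first exact: cvg_cst.
have : geometric 1 (1 - bump a b x) n @[n --> \oo] --> (0 : R).
  by apply: cvg_geometric; rewrite ger0_norm ?subr_ge0 ?bump_le1// gtrBl.
by under eq_fun do rewrite /= mul1r.
Qed.

Lemma compact_cbox (a b : V) : compact (cbox a b).
Proof.
apply: compact_cV.
  rewrite (_ : cbox a b = \bigcap_(i in [set: 'I_d]) (fun x : V => x i ord0) @^-1` `[a i ord0, b i ord0]).
    apply: closed_bigI => i _; apply: closed_comp; last exact: itv_closed.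
    by move=> x _; exact: coord_cont.
  apply/seteqP; split => x /= h i; first by move=> _; have := h i; rewrite /= in_itv.
  by have := h i I; rewrite /= in_itv.
exists (`|a| + `|b|) => x h; apply/cV_norm_le; first by rewrite addr_ge0.
move=> i; have := cV_norm_coord a i; have := cV_norm_coord b i.
rewrite !ler_norml => /andP[b1 b2] /andP[a1 a2]; have /andP[h1 h2] := h i.
by have := normr_ge0 a; have := normr_ge0 b => nb na; apply/andP; split; lra.
Qed.

Lemma Ccinfty_bumpn A n a b : cbox a b `<=` A -> Ccinfty A (fun x => (bumpn n a b x)%:C%C).
Proof.
move=> sub; apply: (Ccinfty_intro _ (@compact_cbox a b) sub).
  apply: csmoothR; apply: smoothD; first exact: smooth_cst.
  apply: smoothN; apply: smoothX; apply: smoothD; first exact: smooth_cst.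
  by apply: smoothN; exact: smooth_bump.
move=> x /existsNP[i /negP h]; rewrite (@bumpn_out _ _ _ _ i)//.
by apply: contra h => /andP[/ltW -> /ltW ->].
Qed.

End test_functions.

(** * Derivatives of complex-valued functions of a real variable *)

Section cder.
Context {R : realType}.
Local Notation C := R[i].

Definition cder (f : R -> C) (t : R) (f' : C) : Prop :=
  is_derive t 1 (fun s => complex.Re (f s)) (complex.Re f') /\
  is_derive t 1 (fun s => complex.Im (f s)) (complex.Im f').

Lemma cder_eq f t a b : cder f t a -> a = b -> cder f t b.
Proof. by move=> h <-. Qed.

Lemma cder_unique f t a b : cder f t a -> cder f t b -> a = b.
Proof. by move=> [[_ a1] [_ a2]] [[_ b1] [_ b2]]; apply: cplx_eq; rewrite -?a1 -?a2. Qed.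

Lemma cderZ (c : C) f t f' : cder f t f' -> cder (fun s => c * f s) t (c * f').
Proof.
move=> [h1 h2]; split.
  have := is_deriveD (is_deriveZ (complex.Re c) h1) (is_deriveZ (- complex.Im c) h2).
  rewrite scaleNr cReM; congr is_derive.
  by apply/funext => s; rewrite cReM -mulNr.
have := is_deriveD (is_deriveZ (complex.Re c) h2) (is_deriveZ (complex.Im c) h1).
move=> h; rewrite cImM; move: h; congr is_derive.
by apply/funext => s; rewrite cImM.
Qed.

Lemma cder_cis (a b : R) t : cder (fun s => cis (s * a + b)) t (a%:C%C * Complex 0 1 * cis (t * a + b)).
Proof.
have da : is_derive t 1 (fun s : R => s * a + b) a.
  apply: is_derive_eq (is_deriveD (is_deriveM (is_derive_id t 1) (is_derive_cst a _ _)) (is_derive_cst b _ _)) _.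
  by rewrite addr0 scaler0 add0r [LHS]mulr1.
split.
  apply: is_derive_eq (is_derive1_comp (is_derive_cos _) da) _.
  by rewrite !(cReM, cImM) /=; ring.
apply: is_derive_eq (is_derive1_comp (is_derive_sin _) da) _.
by rewrite !(cReM, cImM) /=; ring.
Qed.

(** The mean value theorem is applied to cosine and sine separately, whence the factor 2. *)
Lemma cabs_cis_sub (s t : R) : cabs (cis s - cis t) <= 2 * `|s - t|.
Proof.
have lip (f df : R -> R) : (forall x : R, is_derive x 1 f (df x)) -> (forall x, `|df x| <= 1) ->
    `|f s - f t| <= `|s - t|.
  move=> fd d1; wlog st : s t / s <= t => [H|].
    by have [/H//|/ltW/H] := leP s t; rewrite distrC (distrC t).
  have [c _ e] := MVT_segment st (fun x _ => fd x) (ltac:(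
    by apply: continuous_subspaceT => x; apply/differentiable_continuous/derivable1_diffP; case: (fd x))).
  by rewrite distrC (distrC s) e normrM ler_piMl.
apply: le_trans (cabs_le_ReIm _) _; rewrite mulr_natl mulr2n cReD cImD cReN cImN.
apply: lerD.
  apply: (lip _ (fun x => - sin x) (@is_derive_cos R)) => x.
  by rewrite normrN ler_norml sin_geN1 sin_le1.
apply: (lip _ cos (@is_derive_sin R)) => x.
by rewrite ler_norml cos_geN1 cos_le1.
Qed.

Context d (T : measurableType d) (m : {measure set T -> \bar R}).

Lemma cint_cder (f f' : R -> T -> C) (G : T -> R) :
  (forall h, -1 < h < 1 -> cL1 m (f h)) ->
  (forall h x, -1 < h < 1 -> cder (f^~ x) h (f' h x)) ->
  measurable_fun setT G -> (nint m G < +oo)%E ->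
  (forall h x, -1 < h < 1 -> cabs (f' h x) <= G x) ->
  cder (fun h => cint m (f h)) 0 (cint m (f' 0)).
Proof.
move=> fi fd mG iG fG.
have Ioo h : (`]-1, 1[%classic : set R) h -> -1 < h < 1 by rewrite /= in_itv.
have I0 : (`]-1, 1[%classic : set R) 0 by rewrite /= in_itv /= ltrN10 ltr01.
have G0 x : 0 <= G x by apply: le_trans (fG 0 x _); rewrite ?cabs_ge0 ?ltrN10 ?ltr01.
have intG : m.-integrable setT (EFin \o G).
  apply/integrableP; split; first exact/measurable_EFinP.
  by apply: le_lt_trans iG; apply: nint_le => x //; rewrite ger0_norm.
suff H (p : C -> R) : (forall h : R, -1 < h < 1 -> m.-integrable setT (fun x => (p (f h x))%:E)) ->
    (forall (h : R) x, -1 < h < 1 -> is_derive h 1 (fun s => p (f s x)) (p (f' h x))) ->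
    (forall z, `|p z| <= cabs z) ->
    is_derive (0 : R) 1 (fun h : R => \int[m]_x (p (f h x))) (\int[m]_x (p (f' 0 x))).
  split; [apply: (H (@complex.Re R))|apply: (H (@complex.Im R))].
  - by move=> h /fi/cL1_Re.
  - by move=> h x /(fd h x)[].
  - exact: normRe_le.
  - by move=> h /fi/cL1_Im.
  - by move=> h x /(fd h x)[].
  - exact: normIm_le.
move=> fi' fd' pc.
have hi h : (`]-1, 1[%classic : set R) h -> m.-integrable setT (EFin \o (fun x => p (f h x))).
  by move=> /Ioo /fi'.
have hd h x : (`]-1, 1[%classic : set R) h -> [set: T] x -> derivable (fun s => p (f s x)) h 1.
  by move=> /Ioo hh _; case: (fd' h x hh).
have dE h x : -1 < h < 1 -> partial1of2 (fun s x => p (f s x)) h x = p (f' h x).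
  by move=> hh; rewrite partial1of2E; case: (fd' h x hh).
have hb h x : (`]-1, 1[%classic : set R) h -> [set: T] x -> `|partial1of2 (fun s x => p (f s x)) h x| <= G x.
  by move=> /Ioo hh _; rewrite dE// (le_trans (pc _))// fG.
apply: DeriveDef.
  exact: (@derivable_under_integral _ _ _ m _ _ measurableT _ _ _ I0 hi hd _ G0 intG hb).
rewrite -derive1E (@differentiation_under_integral _ _ _ m _ _ measurableT _ _ _ I0 hi hd _ G0 intG hb).
by apply: eq_Rintegral => x _; rewrite -(dE 0 x) ?ltrN10 ?ltr01.
Qed.

End cder.

(** * Fourier transforms of rapidly decreasing functions *)

Section fourier_smooth.
Context {R : realType} {d : nat}.
Local Notation C := R[i].
Local Notation V := 'cV[R]_d.
Local Notation mu := (@lebesgue_cV R d).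
Implicit Types (f g eta psi : V -> C) (x y xi : V).
Local Notation e_ i := (delta_mx i ord0 : V).

(** Stable under multiplication by coordinates, which is what repeated differentiation of the
    Fourier transform under the integral consumes. *)
Definition rapid f := forall s : seq 'I_d, cL1 mu (fun x => (\prod_(i <- s) x i ord0)%:C%C * f x).

Lemma rapid_cL1 f : rapid f -> cL1 mu f.
Proof. by move=> /(_ [::]); congr cL1; apply/funext => x; rewrite big_nil mul1r. Qed.

Lemma rapid_coord i f : rapid f -> rapid (fun x => (x i ord0)%:C%C * f x).
Proof.
move=> rf s; have := rf (i :: s); congr cL1; apply/funext => x.
by rewrite big_cons mulrA -rmorphM [x i ord0 * _]mulrC.
Qed.

Lemma rapidZ (c : C) f : rapid f -> rapid (fun x => c * f x).
Proof.
move=> rf s; have := cL1Z c (rf s); congr cL1; apply/funext => x.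
by rewrite mulrCA.
Qed.

Lemma rapid_conj f : rapid f -> rapid (fun x => ((f x)^*)%C).
Proof.
move=> rf s; have := cL1_conj (rf s); congr cL1; apply/funext => x.
by rewrite conjCM; congr (_ * _); apply: cplx_eq => /=; rewrite ?oppr0.
Qed.

Lemma dot_delta x i : dot x (e_ i) = x i ord0.
Proof.
rewrite /dot (bigD1 i)//= big1 ?addr0 => [|j ji]; first by rewrite mxE !eqxx mulr1.
by rewrite mxE (negPf ji) mulr0.
Qed.

(** The multiplier -2 pi sqrt(-1) x_i; on the Fourier side it is the partial derivative in direction
    [i]. *)
Definition fmul i f x : C := ((- (2 * pi * x i ord0))%:C%C * Complex 0 1) * f x.

Lemma fmulE i f : fmul i f = fun x => (- (2 * pi)%:C%C * Complex 0 1) * ((x i ord0)%:C%C * f x).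
Proof. by apply/funext => x; rewrite /fmul rmorphN rmorphM; ring. Qed.

Lemma rapid_fmul i f : rapid f -> rapid (fmul i f).
Proof. by move=> rf; rewrite fmulE; apply: rapidZ; exact: rapid_coord. Qed.

Lemma cder_partial f i xi (c : C) :
  cder (fun h : R => f (h *: e_ i + xi)) 0 c ->
  is_derive xi (e_ i) (rpart f) (complex.Re c) /\ is_derive xi (e_ i) (ipart f) (complex.Im c).
Proof.
move=> [h1 h2]; split.
  by rewrite -[X in is_derive _ _ _ X]mul1r; apply: derive_line h1 => s; rewrite mulr1 addr0.
by rewrite -[X in is_derive _ _ _ X]mul1r; apply: derive_line h2 => s; rewrite mulr1 addr0.
Qed.

Lemma cder_fourier f i xi : rapid f ->
  cder (fun h : R => fourier f (h *: e_ i + xi)) 0 (fourier (fmul i f) xi).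
Proof.
move=> rf; have f1 := rapid_cL1 rf; have [mf _] := f1.
pose F (h : R) x := f x * cis (h * (- (2 * pi * x i ord0)) + - (2 * pi * dot x xi)).
pose F' (h : R) x := f x * ((- (2 * pi * x i ord0))%:C%C * Complex 0 1 *
  cis (h * (- (2 * pi * x i ord0)) + - (2 * pi * dot x xi))).
have FE h : fourier f (h *: e_ i + xi) = cint mu (F h).
  rewrite fourierE; congr cint; apply/funext => x; congr (_ * cis _).
  by rewrite dotDr dotZr dot_delta; ring.
have [mg g1] := rapid_cL1 (rapid_fmul i rf).
under eq_fun do rewrite FE.
rewrite (_ : fourier _ _ = cint mu (F' 0)); last first.
  rewrite fourierE; congr cint; apply/funext => x.
  by rewrite /F' mul0r add0r /fmul mulrA (mulrC (f x)).
apply: (@cint_cder _ _ _ mu F F' (fun x => cabs (fmul i f x))).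
- move=> h _; have := cL1_fourier (h *: e_ i + xi) f1; congr cL1; apply/funext => x.
  by congr (_ * cis _); rewrite dotDr dotZr dot_delta; ring.
- by move=> h x _; apply: cderZ; exact: cder_cis.
- exact: measurable_cabs.
- exact: g1.
- by move=> h x _; rewrite /F' mulrA cabsM cabs_cis mulr1 mulrC.
Qed.

Lemma cderiv_fourier i f : rapid f -> cderiv i (fourier f) = fourier (fmul i f).
Proof.
move=> rf; apply/funext => xi; have [h1 h2] := cder_partial (cder_fourier i xi rf).
by apply: cplx_eq => /=; [case: h1|case: h2].
Qed.

Lemma dot_le x y : `|dot x y| <= (\sum_i `|x i ord0|) * `|y|.
Proof.
rewrite mulr_suml (le_trans (ler_norm_sum _ _ _))// ler_sum// => i _.
by rewrite normrM ler_wpM2l// cV_norm_coord.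
Qed.

(** The estimates |cis a - cis b| <= 2|a - b| and [dot_le] turn the first moments of [f] into a
    Lipschitz constant. Besides continuity, this later provides the Lipschitz hypothesis for
    autocorrelations. *)
Lemma fourier_lipschitz f : rapid f -> exists2 L : R, 0 < L &
  forall x y, cabs (fourier f x - fourier f y) <= L * `|x - y|.
Proof.
move=> rf; have f1 := rapid_cL1 rf; have [mf _] := f1.
pose g x : C := (4 * pi)%:C%C * \sum_i (cabs ((x i ord0)%:C%C * f x))%:C%C.
have g1 : cL1 mu g.
  apply: cL1Z; apply: cL1_sum => i; have [m1 h1] := rapid_cL1 (rapid_coord i rf).
  apply: cL1_le (h1) _; first by apply: cmeasR; exact: measurable_cabs.
  by move=> x; rewrite cabsR ger0_norm ?cabs_ge0.
have gE x : cabs (g x) = 4 * pi * (cabs (f x) * \sum_i `|x i ord0|).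
  rewrite /g -rmorph_sum -rmorphM cabsR ger0_norm; last first.
    by rewrite mulr_ge0 ?mulr_ge0 ?pi_ge0// sumr_ge0// => i _; exact: cabs_ge0.
  congr (_ * _); rewrite mulr_sumr; apply: eq_bigr => i _.
  by rewrite cabsM cabsR mulrC.
have [M [M0 hM]] := cL1_bound g1.
exists (M + 1); first by rewrite ltr_wpDl.
move=> x y; rewrite !fourierE -cintB; [|exact: cL1_fourier|exact: cL1_fourier].
rewrite -lee_fin; apply: le_trans (cabs_cint_le (cL1B (cL1_fourier x f1) (cL1_fourier y f1))) _.
apply: (@le_trans _ _ (nint mu (fun z => `|x - y| * cabs (g z))%R)).
  apply: nint_le => z; first exact: cabs_ge0.
  rewrite -mulrBr cabsM gE; apply: le_trans (ler_wpM2l (cabs_ge0 _) (cabs_cis_sub _ _)) _.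
  rewrite -opprB normrN opprK addrC -mulrBr -dotNr -dotDr normrM ger0_norm ?mulr_ge0 ?pi_ge0//.
  rewrite [leRHS](_ : _ = cabs (f z) * (2 * (2 * pi * ((\sum_i `|z i ord0|) * `|x - y|)))); last by ring.
  rewrite ler_wpM2l ?cabs_ge0// ler_wpM2l// ler_wpM2l ?mulr_ge0 ?pi_ge0//.
  exact: dot_le.
rewrite nintZ//; [|by apply: measurable_cabs; have [] := g1|by move=> z; exact: cabs_ge0].
rewrite mulrC EFinM; apply: lee_wpmul2l; first by rewrite lee_fin.
by apply: le_trans hM _; rewrite lee_fin lerDl.
Qed.

(** Real and imaginary parts of transforms of rapid functions form a stable class for
    [smooth_coind], since differentiation acts as [fmul] before the transform. *)
Lemma csmooth_fourier f : rapid f -> csmooth (fourier f).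
Proof.
move=> rf; pose P (u : V -> R) := exists2 f, rapid f & u = rpart (fourier f) \/ u = ipart (fourier f).
suff H u : P u -> smooth u by split; apply: H; exists f => //; [left|right].
apply: smooth_coind => {}u [{rf}f rf ufE].
have cont (p : C -> R) : (forall z w, p (z - w) = p z - p w) -> (forall z, `|p z| <= cabs z) ->
    continuous (fun x : V => p (fourier f x) : R).
  move=> pB pc x; have [L L0 HL] := fourier_lipschitz rf.
  apply/(@cvgrPdist_lt _ _ _ _ (@nbhs_filter V x)) => e e0; near=> y.
  rewrite -pB (le_lt_trans (pc _))// (le_lt_trans (HL _ _))// mulrC -ltr_pdivlMr//.
  near: y; apply: cvgr_dist_lt => //; exact: divr_gt0.
case: ufE => ->.
  split; first by apply: (cont (@complex.Re R)) => [z w|z]; rewrite ?normRe_le// cReD cReN.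
    by move=> i x; have [[]] := cder_partial (cder_fourier i x rf).
  move=> i; exists (fmul i f); first exact: rapid_fmul.
  by left; apply/funext => x; have [[_ ->]] := cder_partial (cder_fourier i x rf).
split; first by apply: (cont (@complex.Im R)) => [z w|z]; rewrite ?normIm_le// cImD cImN.
  by move=> i x; have [_ []] := cder_partial (cder_fourier i x rf).
move=> i; exists (fmul i f); first exact: rapid_fmul.
by right; apply/funext => x; have [_ [_ ->]] := cder_partial (cder_fourier i x rf).
Unshelve. all: by end_near. Qed.

Lemma derive_shift (u : V -> R) x w (h a : R) : is_derive (h *: w + x) w u a ->
  is_derive h 1 (fun s : R => u (s *: w + x)) a.
Proof.
move=> [du <-].
have E : (fun s : R => s^-1 *: (u ((s *: 1 + h) *: w + x) - u (h *: w + x))) =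
    fun s : R => s^-1 *: (u (s *: w + (h *: w + x)) - u (h *: w + x)).
  by apply/funext => s; rewrite [s *: 1]mulr1 scalerDl addrA.
have du' : cvg (s^-1 *: (u ((s *: 1 + h) *: w + x) - u (h *: w + x)) @[s --> (0 : R)^']) by rewrite E.
apply: DeriveDef; first exact: du'.
by transitivity (lim (s^-1 *: (u ((s *: 1 + h) *: w + x) - u (h *: w + x)) @[s --> 0^'])); [|rewrite E].
Qed.

Lemma measurable_boxcst (M c : R) : measurable_fun setT (fun x : V => if `|x| <= M then c else 0).
Proof.
apply: measurable_fun_ifT; [|exact: measurable_cst|exact: measurable_cst].
apply: measurable_fun_ler; last exact: measurable_cst.
by apply: continuous_measurable_cV; exact: norm_continuous.
Qed.

Lemma csmooth_coord i : csmooth (fun x : V => (x i ord0)%:C%C).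
Proof. by apply: csmoothR; exact: smooth_coord. Qed.

Lemma Ccinfty_fmul A i eta : Ccinfty A eta -> Ccinfty A (fmul i eta).
Proof.
move=> Ae; rewrite fmulE; apply: CcinftyZ.
have := CcinftyM Ae (csmooth_coord i); congr Ccinfty.
by apply/funext => x; rewrite mulrC.
Qed.

Lemma Ccinfty_rapid A eta : Ccinfty A eta -> rapid eta.
Proof.
move=> Ae s; apply: (@Ccinfty_cL1 _ _ A).
have sm : csmooth (fun x : V => (\prod_(i <- s) x i ord0)%:C%C).
  by apply: csmoothR; apply: smooth_prod => i; exact: smooth_coord.
have := CcinftyM Ae sm; congr Ccinfty.
by apply/funext => x; rewrite mulrC.
Qed.

(* Differentiate the identity [fourier_shift] at 0. *)
Lemma fourier_cderiv A i eta xi : Ccinfty A eta ->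
  fourier (cderiv i eta) xi = ((2 * pi * xi i ord0)%:C%C * Complex 0 1) * fourier eta xi.
Proof.
move=> Ae; have e1 := Ccinfty_cL1 Ae; have De := Ccinfty_deriv i Ae.
have [M M0 HM] := Ccinfty_box De; have [se _] := Ae.
pose F (h : R) x := eta (h *: e_ i + x) * cis (- (2 * pi * dot x xi)).
pose F' (h : R) x := cderiv i eta (h *: e_ i + x) * cis (- (2 * pi * dot x xi)).
have FE h : cint mu (F h) = fourier eta xi * cis (h * (2 * pi * xi i ord0) + 0).
  have := fourier_shift (h *: e_ i) xi e1.
  rewrite dotZl dotC dot_delta addr0 fourierE => E.
  transitivity (cint mu (fun x => eta (x + h *: e_ i) * cis (- (2 * pi * dot x xi)))).
    by congr cint; apply/funext => x; rewrite /F addrC.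
  by rewrite E mulrC; congr (_ * cis _); ring.
have s1 h : cL1 mu (fun x => eta (h *: e_ i + x)).
  by have := cL1_shift (h *: e_ i) e1; congr cL1; apply/funext => x; rewrite addrC.
have H : cder (fun h => cint mu (F h)) 0 (cint mu (F' 0)).
  apply: (@cint_cder _ _ _ mu F F' (fun x => if `|x| <= M + 1 then M else 0)).
  - by move=> h _; apply: cL1_fourier.
  - move=> h x _; rewrite /F' mulrC (_ : F^~ x = fun s => cis (- (2 * pi * dot x xi)) * eta (s *: e_ i + x)); last first.
      by apply/funext => s; rewrite mulrC.
    apply: cderZ.
    have D (u : V -> R) : smooth u -> is_derive h 1 (fun s : R => u (s *: e_ i + x)) ('D_(e_ i) u (h *: e_ i + x)).
      by move=> su; apply: derive_shift; exact: smooth_is_derive.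
    by case: se => ? ?; split; apply: D.
  - exact: measurable_boxcst.
  - by apply: nint_boxcst => //; rewrite addr_ge0.
  - move=> h x /andP[h1 h2]; rewrite /F' cabsM cabs_cis mulr1.
    have [b1 b2] := HM (h *: e_ i + x); case: ifPn => // xM; rewrite b2 ?cabs0//.
    move: xM; rewrite -ltNge => xM.
    have e1' : `|h *: e_ i| <= 1.
      apply/cV_norm_le => // j; rewrite !mxE normrM.
      have hh : `|h| <= 1 by rewrite ler_norml !ltW.
      by case: (_ && _); rewrite ?normr1 ?mulr1// normr0 mulr0.
    have := ler_normB (h *: e_ i + x) (h *: e_ i); rewrite addrAC subrr add0r => tri.
    by rewrite -(ltrD2r 1) (lt_le_trans xM)// (le_trans tri)// lerD2l.
have E0 : cint mu (F' 0) = fourier (cderiv i eta) xi.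
  by rewrite fourierE; congr cint; apply/funext => x; rewrite /F' scale0r add0r.
rewrite -E0; apply: (cder_unique H); under eq_fun do rewrite FE.
apply: cder_eq (cderZ _ (cder_cis _ _ _)) _.
by rewrite mul0r add0r cis0 mulr1 mulrC.
Qed.

Lemma norm_coord_max x : `|x| = 0 \/ exists i, `|x| = `|x i ord0|.
Proof.
have [->|x0] := eqVneq `|x| 0; [by left|right; apply: contrapT => H].
have p : 0 < `|x| by rewrite lt_def x0 normr_ge0.
suff : `|x| < `|x| by rewrite ltxx.
apply/(cV_norm_lt _ p) => i; rewrite lt_neqAle cV_norm_coord andbT.
by apply/eqP => e; apply: H; exists i.
Qed.

Definition decays f := forall n : nat, exists M : R, forall x, `|x| ^+ n * cabs (f x) <= M.

(** Each derivative of [eta] is again a test function and multiplies the transform by a factor of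
    modulus 2 pi |xi_i| >= |xi_i|. The sup norm reduces a power of |xi| to a power of a single
    coordinate. *)
Lemma decays_fourier A eta : Ccinfty A eta -> decays (fourier eta).
Proof.
move=> Ae n.
have H (s : seq 'I_d) : exists M : R, forall xi, \prod_(i <- s) `|xi i ord0| * cabs (fourier eta xi) <= M.
  elim: s => [|i s ih] in eta Ae *.
    have [M HM] := fourier_bounded (Ccinfty_cL1 Ae).
    by exists M => xi; rewrite big_nil mul1r.
  have [M HM] := ih _ (Ccinfty_deriv i Ae); exists M => xi; apply: le_trans (HM xi).
  rewrite big_cons (fourier_cderiv _ _ Ae) !cabsM cabsR.
  have -> : cabs (Complex 0 1) = 1 :> R by rewrite /cabs /= expr0n expr1n add0r sqrtr1.
  rewrite mulr1 !normrM (ger0_norm (pi_ge0 R)) ger0_norm// mulrCA.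
  rewrite -mulrA; apply: ler_wpM2r; first by rewrite mulr_ge0 ?cabs_ge0// prodr_ge0.
  by rewrite ler_peMl// -[leLHS]mulr1 ler_pM// ?ler1n// (le_trans _ (pi_ge2 R))// ler1n.
have [M0 H0] := H [::].
have Mi i : exists M : R, forall xi, `|xi i ord0| ^+ n * cabs (fourier eta xi) <= M.
  have [M HM] := H (nseq n i); exists M => xi; have := HM xi.
  by rewrite big_nseq -Monoid.iteropE.
pose M i := sval (cid (Mi i)); have HM i := svalP (cid (Mi i)).
exists (`|M0| + \sum_i `|M i|) => xi; have [->|[i ->]] := norm_coord_max xi.
  rewrite ler_wpDr ?sumr_ge0// expr0n; case: n {H Mi M HM} => [|n] /=; last by rewrite mul0r.
  by have := H0 xi; rewrite big_nil => /le_trans; apply; exact: ler_norm.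
rewrite ler_wpDl// (bigD1 i)//= ler_wpDr ?sumr_ge0//.
by apply: le_trans (HM i xi) _; exact: ler_norm.
Qed.

Lemma cpartial_nil f : cpartial [::] f = f.
Proof. by apply/funext => x; rewrite /cpartial /= /rpart /ipart; case: (f x). Qed.

Lemma schwartz_decays psi : schwartz psi -> decays psi.
Proof. by move=> [_ H] n; have [M HM] := H [::] n; exists M; move: HM; rewrite cpartial_nil. Qed.

Lemma schwartz_fourier A eta : Ccinfty A eta -> schwartz (fourier eta).
Proof.
move=> Ae; split; first exact: csmooth_fourier (Ccinfty_rapid Ae).
move=> s; elim/last_ind: s eta Ae => [|s i ih] eta Ae n.
  by rewrite cpartial_nil; exact: decays_fourier Ae n.
rewrite cpartial_rcons (cderiv_fourier _ (Ccinfty_rapid Ae)).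
exact: ih (Ccinfty_fmul i Ae) n.
Qed.

(** 1/[Kd] is a product of d factors, each at most P (1 + |x|^2), so decay of order 2d produces an
    integrable majorant. *)
Lemma decays_Kd f : decays f -> exists2 M : R, 0 <= M & forall x, cabs (f x) <= M * Kd x.
Proof.
move=> df; have [M0 H0] := df 0%N; have [M1 H1] := df (2 * d)%N.
pose P : R := 1 + 4 * pi ^+ 2.
have P0 : 0 < P by rewrite ltr_pwDl// mulr_ge0 ?sqr_ge0.
have M00 : 0 <= M0 := le_trans (mulr_ge0 (exprn_ge0 _ (normr_ge0 _)) (cabs_ge0 _)) (H0 0).
have M10 : 0 <= M1 := le_trans (mulr_ge0 (exprn_ge0 _ (normr_ge0 _)) (cabs_ge0 _)) (H1 0).
exists (P ^+ d * 2 ^+ d * (M0 + M1)).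
  by rewrite mulr_ge0 ?addr_ge0// mulr_ge0 ?exprn_ge0// ltW.
move=> x; have K0 : 0 < Kd x.
  by apply: prodr_gt0 => i _; rewrite /pker divr_gt0// ltr_pwDl// sqr_ge0.
rewrite -ler_pdivrMr//; set c := cabs (f x).
have Ki : (Kd x)^-1 <= (P * (1 + `|x| ^+ 2)) ^+ d.
  rewrite -[X in _ ^+ X]card_ord -prodr_const /Kd -prodfV; apply: ler_prod => i _.
  rewrite invr_ge0 /pker divr_ge0 ?ler0n ?addr_ge0 ?sqr_ge0//= invf_div ler_pdivrMr//.
  have : x i ord0 ^+ 2 <= `|x| ^+ 2.
    by rewrite -[leLHS]real_normK ?num_real// ler_pXn2r ?nnegrE// cV_norm_coord.
  move=> h; rewrite /P !exprMn (_ : 2 ^+ 2 = 4 :> R); [|by ring].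
  have p2 : 0 <= pi ^+ 2 :> R by exact: sqr_ge0.
  have x2 : 0 <= `|x| ^+ 2 by exact: sqr_ge0.
  have := ler_wpM2l p2 h; have := mulr_ge0 p2 x2; move: p2 x2; move: (pi ^+ 2) (`|x| ^+ 2) (x i ord0 ^+ 2) => a b e a0 b0 ab0 abe.
  rewrite -subr_ge0 (_ : _ - _ = 1 + 2 * b + 8 * a + 4 * (a * b) + 4 * (a * b - a * e)); last by ring.
  by rewrite !addr_ge0 ?mulr_ge0 ?subr_ge0.
have B : (1 + `|x| ^+ 2) ^+ d <= 2 ^+ d * (1 + `|x| ^+ (2 * d)).
  have x2 : 0 <= `|x| ^+ 2 by exact: sqr_ge0.
  rewrite exprM; move: (`|x| ^+ 2) x2 => a a0.
  have [a1|/ltW a1] := leP a 1.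
    rewrite -[leLHS]mulr1; apply: ler_pM; rewrite ?exprn_ge0 ?addr_ge0//; last by rewrite lerDl exprn_ge0.
    by rewrite lerXn2r ?nnegrE ?addr_ge0//; lra.
  rewrite mulrDr -exprMn ler_wpDl ?mulr_ge0 ?exprn_ge0//.
  by rewrite lerXn2r ?nnegrE ?addr_ge0 ?mulr_ge0//; lra.
apply: (@le_trans _ _ (c * (P * (1 + `|x| ^+ 2)) ^+ d)); first by rewrite ler_wpM2l ?cabs_ge0.
rewrite exprMn -!mulrA mulrC -!mulrA ler_wpM2l ?exprn_ge0 ?(ltW P0)//.
apply: le_trans (ler_wpM2r (cabs_ge0 _) B) _; rewrite -mulrA ler_wpM2l ?exprn_ge0//.
rewrite mulrDl mul1r lerD//.
by have := H0 x; rewrite expr0 mul1r.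
Qed.

Lemma decays_rapid f : cmeas f -> decays f -> rapid f.
Proof.
move=> mf df s.
have ds : decays (fun x => (\prod_(i <- s) x i ord0)%:C%C * f x).
  move=> n; have [M HM] := df (n + size s)%N; exists M => x; apply: le_trans (HM x).
  rewrite exprD cabsM cabsR -mulrA ler_wpM2l ?exprn_ge0// ler_wpM2r ?cabs_ge0//.
  rewrite normr_prod; move: HM => _; elim: s => [|i s ih]; first by rewrite big_nil.
  by rewrite big_cons exprS ler_pM ?prodr_ge0// cV_norm_coord.
have [M M0 HM] := decays_Kd ds.
apply: (@cL1_le _ _ _ _ _ (fun x => M * Kd x)) => //.
  apply: cmeasM => //; apply: cmeasR; move: HM ds => _ _; elim: s => [|i s ih].
    by under eq_fun do rewrite big_nil; exact: measurable_cst.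
  under eq_fun do rewrite big_cons.
  by apply: measurable_funM; [exact: measurable_coord|exact: ih].
rewrite nintZ//; [|exact: measurable_Kd|exact: Kd_ge0].
by rewrite nint_Kd mule1 ltry.
Qed.

Lemma decays_n2 f : decays f -> (n2 mu f < +oo)%E.
Proof.
move=> df; have [M M0 HM] := decays_Kd df; have [M1 HM1] := df 0%N.
have M10 : 0 <= M1 := le_trans (mulr_ge0 (exprn_ge0 _ (normr_ge0 _)) (cabs_ge0 _)) (HM1 0).
apply: (@le_lt_trans _ _ (nint mu (fun x => (M1 * M) * Kd x)%R)).
  apply: nint_le => x; first exact: sqr_ge0.
  rewrite expr2 -mulrA ler_pM ?cabs_ge0//.
  by have := HM1 x; rewrite expr0 mul1r.
rewrite nintZ ?mulr_ge0//; [|exact: measurable_Kd|exact: Kd_ge0].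
by rewrite nint_Kd mule1 ltry.
Qed.

Lemma schwartz_rapid psi : schwartz psi -> rapid psi.
Proof.
move=> sp; apply: decays_rapid (schwartz_decays sp).
by case: sp => /csmooth_cmeas.
Qed.

Lemma csmooth_ifourier f : rapid f -> csmooth (ifourier f).
Proof.
move=> rf; have := csmooth_conj (csmooth_fourier (rapid_conj rf)).
by congr csmooth; apply/funext => x; rewrite (fourier_conj _ (rapid_cL1 rf)) cconjK.
Qed.

Lemma fourierK A eta : Ccinfty A eta -> ifourier (fourier eta) = eta.
Proof.
move=> Ae; apply/funext => x; have [M _ HM] := Ccinfty_box Ae.
apply: (@fourier_inversion _ _ _ _ M).
- exact: Ccinfty_cL1 Ae.
- by apply: rapid_cL1; apply: schwartz_rapid; exact: schwartz_fourier Ae.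
- by move=> y; have [] := HM y.
- by apply: csmooth_ccont; case: Ae.
Qed.

Lemma ifourierK A eta : Ccinfty A eta -> fourier (ifourier eta) = eta.
Proof.
move=> Ae; have Ce := Ccinfty_conj Ae.
have C1 : cL1 mu (ifourier eta).
  have := cL1_conj (rapid_cL1 (schwartz_rapid (schwartz_fourier Ce))).
  by congr cL1; apply/funext => x; rewrite (fourier_conj _ (Ccinfty_cL1 Ae)); exact: cconjK.
apply/funext => x; have := congr1 (fun f => ((f x)^*)%C) (fourierK Ce).
have -> : fourier (fun y => ((eta y)^*)%C) = fun y => ((ifourier eta y)^*)%C.
  by apply/funext => y; rewrite (fourier_conj _ (Ccinfty_cL1 Ae)).
rewrite ifourier_conj// => E; rewrite -[LHS]cconjK E; exact: cconjK.
Qed.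

End fourier_smooth.

Section density_measure.
Context {R : realType} d (T : measurableType d).
Variables (m : {measure set T -> \bar R}) (u : T -> R).
Hypotheses (mu : measurable_fun setT u) (u0 : forall x, 0 <= u x).

(** The measure with density [u]; uniqueness of measures then decides when two densities agree. *)
Definition dens (A : set T) : \bar R := (\int[m]_(x in A) (u x)%:E)%E.

Let dens0 : dens set0 = 0%E. Proof. exact: integral_set0. Qed.

Let dens_ge0 A : (0 <= dens A)%E.
Proof. by apply: integral_ge0 => x _; rewrite lee_fin. Qed.

Let dens_sigma : semi_sigma_additive dens.
Proof.
move=> F mF tF mUF; rewrite /dens ge0_integral_bigcup//.
- by apply: is_cvg_ereal_nneg_natsum_cond => n _ _; exact: dens_ge0.
- by apply/measurable_EFinP; apply: measurable_funTS.
- by move=> x _; rewrite lee_fin.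
Qed.

HB.instance Definition _ := isMeasure.Build _ _ _ dens dens0 dens_ge0 dens_sigma.

Lemma dens_nint A : measurable A -> dens A = nint m (fun x => u x * \1_A x).
Proof.
move=> mA; rewrite /dens integral_mkcond /nint; apply: eq_integral => x _.
by rewrite /patch indicE; case: (x \in A); rewrite ?mulr1 ?mulr0.
Qed.

End density_measure.

(** * Exhaustion of open sets by rational boxes *)

Section rational_boxes.
Context {R : realType} {d : nat}.
Local Notation V := 'cV[R]_d.
Local Notation mu := (@lebesgue_cV R d).
Implicit Types (a b x : V) (U : set V).

Definition obox a b : set V := [set x | forall i, a i ord0 < x i ord0 < b i ord0].

Lemma obox_cbox a b : obox a b `<=` cbox a b.
Proof. by move=> x h i; have /andP[/ltW -> /ltW ->] := h i. Qed.

Lemma open_obox a b : open (obox a b).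
Proof.
rewrite openE => x h; have H i : nbhs x [set y : V | a i ord0 < y i ord0 < b i ord0].
  have oI : open ((fun y : V => y i ord0) @^-1` `]a i ord0, b i ord0[).
    by apply: open_comp; [move=> y _; exact: coord_cont|exact: interval_open].
  have : (fun y : V => y i ord0) @^-1` `]a i ord0, b i ord0[ = [set y : V | a i ord0 < y i ord0 < b i ord0].
    by apply/seteqP; split => y /=; rewrite in_itv.
  by move=> <-; apply: open_nbhs_nbhs; split => //=; rewrite in_itv /= h.
have := @filter_forall _ _ _ _ (@nbhs_filter V x) H; apply: filterS => y hy i; exact: hy.
Qed.

Definition ratv (q : 'cV[rat]_d) : V := map_mx ratr q.

Lemma rat_box U x : open U -> U x -> exists p q : 'cV[rat]_d,
  obox (ratv p) (ratv q) x /\ cbox (ratv p) (ratv q) `<=` U.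
Proof.
move=> oU Ux; have /nbhs_ballP[e /= e0 eU] : nbhs x U by exact: open_nbhs_nbhs.
have [e2 e20 e2e] : exists2 e2 : R, 0 < e2 & e2 < e.
  by exists (e / 2); [exact: divr_gt0|rewrite ltr_pdivrMr// mulr_natr mulr2n ltrDl].
have H1 i : exists q : rat, x i ord0 - e2 < ratr q < x i ord0.
  have [q] := @rat_in_itvoo R (x i ord0 - e2) (x i ord0) (ltac:(by rewrite gtrBl)).
  by rewrite in_itv /=; exists q.
have H2 i : exists q : rat, x i ord0 < ratr q < x i ord0 + e2.
  have [q] := @rat_in_itvoo R (x i ord0) (x i ord0 + e2) (ltac:(by rewrite ltrDl)).
  by rewrite in_itv /=; exists q.
exists (\col_i sval (cid (H1 i))), (\col_i sval (cid (H2 i))); split.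
  move=> i; rewrite !mxE; have /andP[_ ->] := svalP (cid (H1 i)).
  by have /andP[-> _] := svalP (cid (H2 i)).
move=> y h; apply: eU; rewrite -ball_normE /=; apply/(cV_norm_lt _ e0) => i.
rewrite !mxE; have := h i; rewrite !mxE.
have /andP[a1 a2] := svalP (cid (H1 i)); have /andP[b1 b2] := svalP (cid (H2 i)).
move=> /andP[c1 c2]; rewrite ltr_norml; apply/andP; split; lra.
Qed.

Section exhaustion.
Variable U : set V.

(* the n-th rational box, when it lies in U *)
Definition nbox (n : nat) : option (V * V) :=
  if choice.unpickle n is Some (p, q) then
    if `[< cbox (ratv p) (ratv q) `<=` U >] then Some (ratv p, ratv q) else None
  else None.

Lemma nboxS n ab : nbox n = Some ab -> cbox ab.1 ab.2 `<=` U.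
Proof.
by rewrite /nbox; case: (choice.unpickle n) => [[p q]|//]; case: asboolP => // h [<-].
Qed.

Lemma nbox_cover x : open U -> U x -> exists n ab, nbox n = Some ab /\ obox ab.1 ab.2 x.
Proof.
move=> oU Ux; have [p [q [xpq pqU]]] := rat_box oU Ux.
exists (choice.pickle (p, q)), (ratv p, ratv q); split => //.
by rewrite /nbox choice.pickleK; case: asboolP.
Qed.

(* open sets with compact closure in U increasing to U *)
Definition exh_open (n : nat) : set V :=
  \bigcup_(k in `I_n) (if nbox k is Some ab then obox ab.1 ab.2 else set0).

Definition exh_compact (n : nat) : set V :=
  \bigcup_(k in `I_n) (if nbox k is Some ab then cbox ab.1 ab.2 else set0).

Lemma open_exh n : open (exh_open n).
Proof. by apply: bigcup_open => k _; case: (nbox k) => [ab|]; [exact: open_obox|exact: open0]. Qed.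

Lemma exh_sub n : exh_open n `<=` exh_compact n.
Proof.
by move=> x [k kn h]; exists k => //; move: h; case: (nbox k) => // ab; exact: obox_cbox.
Qed.

Lemma compact_exh n : compact (exh_compact n).
Proof.
elim: n => [|n ih].
  rewrite (_ : exh_compact 0 = set0); first exact: compact0.
  by apply/seteqP; split => // x [k].
rewrite (_ : exh_compact n.+1 = exh_compact n `|` (if nbox n is Some ab then cbox ab.1 ab.2 else set0)).
  by apply: compactU => //; case: (nbox n) => [ab|]; [exact: compact_cbox|exact: compact0].
apply/seteqP; split => [x [k /= kn]|x [[k /= kn]|]].
- by move: kn; rewrite ltnS leq_eqVlt => /predU1P[->|kn]; [right|left; exists k].
- by exists k => //=; rewrite ltnS ltnW.
- by exists n => /=.
Qed.

Lemma exh_compactS n : exh_compact n `<=` U.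
Proof. by move=> x [k _]; case E : (nbox k) => [ab|//]; exact: nboxS E _. Qed.

Lemma exh_openS n : exh_open n `<=` U.
Proof. exact: subset_trans (@exh_sub n) (@exh_compactS n). Qed.

Lemma exh_mono n k : (n <= k)%N -> exh_open n `<=` exh_open k.
Proof. by move=> nk x [j jn]; exists j => //=; exact: leq_trans nk. Qed.

Lemma exh_cover x : open U -> U x -> exists n, exh_open n x.
Proof.
move=> oU Ux; have [n [ab [E h]]] := nbox_cover oU Ux.
by exists n.+1; exists n => /=; rewrite ?ltnSn// E.
Qed.

Lemma exh_absorb (K : set V) : open U -> compact K -> K `<=` U -> exists n, K `<=` exh_open n.
Proof.
move=> oU; rewrite compact_cover => cK KU.
have [] := cK nat setT exh_open.
- by move=> n _; exact: open_exh.
- by move=> x /KU Ux; have [n] := exh_cover oU Ux; exists n.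
move=> D _ KD; exists (\max_(i <- D) i)%N => x /KD[n /= nD].
by apply: exh_mono; apply: leq_bigmax_seq.
Qed.

End exhaustion.

End rational_boxes.

(** * The fundamental lemma *)

Section fundamental_lemma.
Context {R : realType} {d : nat}.
Local Notation C := R[i].
Local Notation V := 'cV[R]_d.
Local Notation mu := (@lebesgue_cV R d).
Implicit Types (F : V -> C) (r : V -> R) (a b x : V) (U : set V).

Lemma ae0_nint r : measurable_fun setT r -> (forall x, 0 <= r x) -> nint mu r = 0%E ->
  {ae mu, forall x, r x = 0}.
Proof.
move=> mr r0 i0.
have H : (\int[mu]_x `|(EFin \o r) x| = 0)%E.
  by rewrite -[RHS]i0; apply: eq_integral => x _; rewrite /= ger0_norm.
have := (ae_eq_integral_abs mu measurableT (f := EFin \o r) (ltac:(exact/measurable_EFinP))).1 H.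
by apply: filterS => x /(_ I) /= [].
Qed.

(** The positive part [u] and the negative part [v] of [r] are densities of measures that agree on
    boxes, hence on all Borel sets. On the set r > 0 the density [v] vanishes, so [u] has integral
    0; the set r < 0 serves in the same way for [v]. *)
Lemma ae0_of_boxes r : mu.-integrable setT (EFin \o r) ->
  (forall a b, \int[mu]_x (r x * \1_(cbox a b) x) = 0) -> {ae mu, forall x, r x = 0}.
Proof.
move=> ir r0; have /integrableP[/measurable_EFinP mr fr] := ir.
pose u x := Num.max (r x) 0; pose v x := Num.max (- r x) 0.
have mu_ : measurable_fun setT u by apply: measurable_maxr => //; exact: measurable_cst.
have mv : measurable_fun setT v by apply: measurable_maxr; [exact: measurable_funN|exact: measurable_cst].
have u0 x : 0 <= u x by rewrite le_max lexx orbT.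
have v0 x : 0 <= v x by rewrite le_max lexx orbT.
have uv x : r x = u x - v x by rewrite /u /v; have [h|h] := leP (r x) 0; have [h'|h'] := leP (- r x) 0; lra.
have ur x : u x <= `|r x| by rewrite ge_max ler_norm normr_ge0.
have vr x : v x <= `|r x| by rewrite ge_max -normrN ler_norm normr_ge0.
have fin (w : V -> R) (E : set V) : measurable E -> (forall x, 0 <= w x) -> (forall x, w x <= `|r x|) ->
    (nint mu (fun x => w x * \1_E x)%R < +oo)%E.
  move=> mE w0 wr; apply: le_lt_trans fr; apply: nint_le => x; first exact: mulr_ge0.
  by rewrite -[leRHS]mulr1 ler_pM// indicE; case: (_ \in _).
have agree (E : set V) : measurable E -> dens mu u E = dens mu v E.
  apply: (@measure_cV_unique _ _ (dens mu u) (dens mu v)) => a b ab; last first.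
    rewrite /= dens_nint//; last exact: measurable_cbox.
    by apply: fin => //; exact: measurable_cbox.
  rewrite /= !dens_nint//; try exact: measurable_cbox.
  have iw (w : V -> R) : measurable_fun setT w -> (forall x, 0 <= w x) -> (forall x, w x <= `|r x|) ->
      mu.-integrable setT (EFin \o (fun x => w x * \1_(cbox a b) x)).
    move=> mw w0 wr; apply/integrableP; split.
      by apply/measurable_EFinP; apply: measurable_funM => //; apply: measurable_indic; exact: measurable_cbox.
    apply: le_lt_trans (fin w _ (measurable_cbox a b) w0 wr); apply: nint_le => x //.
    by rewrite ger0_norm ?mulr_ge0.
  have := r0 a b.
  rewrite (_ : Rintegral _ _ _ = \int[mu]_x (u x * \1_(cbox a b) x - v x * \1_(cbox a b) x)); last first.
    by apply: eq_Rintegral => x _; rewrite -mulrBl -uv.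
  rewrite RintegralB//; [|exact: iw|exact: iw].
  move=> /eqP; rewrite subr_eq0 => /eqP e.
  rewrite -[LHS]fineK; last by rewrite ge0_fin_numE ?nint_ge0 ?fin// => *; (exact: mulr_ge0 || exact: measurable_cbox).
  rewrite -[RHS]fineK; last by rewrite ge0_fin_numE ?nint_ge0 ?fin// => *; (exact: mulr_ge0 || exact: measurable_cbox).
  by congr EFin.
have ae0 (w w' : V -> R) (E : set V) : measurable_fun setT w -> (forall x, 0 <= w x) -> measurable E -> dens mu w E = dens mu w' E ->
   (forall x, w x = w x * \1_E x) -> (forall x, w' x * \1_E x = 0) -> measurable_fun setT w' -> (forall x, 0 <= w' x) ->
   {ae mu, forall x, w x = 0}.
  move=> mw w0 mE e wE w'E mw' w'0; apply: ae0_nint => //.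
  rewrite (nint_eq _ wE) -dens_nint// e dens_nint// (nint_eq _ w'E).
  by rewrite /nint integral0.
have pr : measurable [set x | 0 < r x].
  have := mr measurableT _ (measurable_itv `]0, +oo[); rewrite setTI; congr measurable.
  by apply/seteqP; split => x /=; rewrite in_itv /= andbT.
have nr : measurable [set x | r x < 0].
  by have := mr measurableT _ (measurable_itv `]-oo, 0[); rewrite setTI; congr measurable.
have hu : {ae mu, forall x, u x = 0}.
  apply: (ae0 u v [set x | 0 < r x]) => // [|x|x]; first exact: agree.
    rewrite indicE /u; have [h|h] := ltP 0 (r x); first by rewrite mem_set ?mulr1.
    by rewrite mul0r.
  rewrite indicE /v; have [h|h] := ltP 0 (r x).
    by rewrite ?max_r ?mul0r// oppr_le0 ltW.
  by rewrite memNset ?mulr0//= => /(le_lt_trans h); rewrite ltxx.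
have hv : {ae mu, forall x, v x = 0}.
  apply: (ae0 v u [set x | r x < 0]) => // [|x|x]; first by rewrite agree.
    rewrite indicE /v; have [h|h] := ltP (r x) 0; first by rewrite mem_set ?mulr1.
    by rewrite max_r ?mul0r// oppr_le0.
  rewrite indicE /u; have [h|h] := ltP (r x) 0.
    by rewrite ?max_r ?mul0r// ltW.
  by rewrite memNset ?mulr0//= => /(le_lt_trans h); rewrite ltxx.
by apply: filterS2 hu hv => x ux vx; rewrite uv ux vx subr0.
Qed.

Let outside_box (x a b e e' : R) : (x < a - e) || (b + e < x) -> e' < e ->
  a - e' < x -> x < b + e' -> False.
Proof. by move=> /orP[h1|h1] h2 h3 h4; lra. Qed.

(** Dominated convergence along the test functions [bumpn n a b]. *)
Let bump_box F A B a b : cmeas F -> (nint mu (fun x => cabs (F x) * \1_(cbox A B) x)%R < +oo)%E ->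
  cbox a b `<=` cbox A B -> (forall eta, Ccinfty (cbox A B) eta -> cint mu (fun x => F x * eta x) = 0) ->
  cint mu (fun x => F x * (\1_(obox a b) x)%:C%C) = 0.
Proof.
move=> mF fF sub H.
have mo : measurable_fun setT (\1_(obox a b) : V -> R).
  by apply: measurable_indic; apply: open_measurable_cV; exact: open_obox.
have mb n : measurable_fun setT (bumpn n a b).
  by have [] := Ccinfty_cmeas (@Ccinfty_bumpn _ _ _ n a b (@subset_refl _ _)).
have bo n x : ~ obox a b x -> bumpn n a b x = 0.
  by move=> /existsNP[i /negP h]; exact: bumpn_out h.
have [||||||_] := @cint_dct _ _ _ mu (fun n x => F x * (bumpn n a b x)%:C%C)
   (fun x => F x * (\1_(obox a b) x)%:C%C) (fun x => cabs (F x) * \1_(cbox A B) x).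
- by move=> n; apply: cmeasM => //; exact: cmeasR.
- by apply: cmeasM => //; exact: cmeasR.
- apply: measurable_funM; first exact: measurable_cabs.
  by apply: measurable_indic; exact: measurable_cbox.
- exact: fF.
- move=> n x; rewrite cabsM cabsR ger0_norm ?bumpn_ge0// ler_wpM2l ?cabs_ge0// indicE.
  have [h|/bo ->] := pselect (obox a b x); last by case: (_ \in _).
  by rewrite mem_set ?bumpn_le1//; apply: sub; exact: obox_cbox.
- apply: nearW => x; under eq_fun do rewrite -mulrBr cabsM -rmorphB /= cabsR.
  rewrite -(mulr0 (cabs (F x))); apply: cvgMr; rewrite indicE.
  have [h|h] := pselect (obox a b x).
    rewrite mem_set//; apply/norm_cvg0P; rewrite -(subrr 1).
    by apply: cvgB; [exact: bumpn_cvg|exact: cvg_cst].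
  by rewrite memNset//; under eq_fun do rewrite bo// subrr normr0; exact: cvg_cst.
move=> lim; apply: (ccvg_unique lim).
rewrite (_ : (fun n => _) = fun=> 0); first exact: cvg_cst.
apply/funext => n; rewrite H ?subrr ?cabs0//.
by apply: Ccinfty_bumpn.
Qed.

Let box_ae0 F A B : cmeas F -> (nint mu (fun x => cabs (F x) * \1_(cbox A B) x)%R < +oo)%E ->
  (forall eta, Ccinfty (cbox A B) eta -> cint mu (fun x => F x * eta x) = 0) ->
  {ae mu, forall x, obox A B x -> F x = 0}.
Proof.
move=> mF fF H.
pose F1 x := F x * (\1_(obox A B) x)%:C%C.
have mo a b : measurable_fun setT (\1_(obox a b) : V -> R).
  by apply: measurable_indic; apply: open_measurable_cV; exact: open_obox.
have mc a b : measurable_fun setT (\1_(cbox a b) : V -> R).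
  by apply: measurable_indic; exact: measurable_cbox.
have mF1 : cmeas F1 by apply: cmeasM => //; exact: cmeasR.
have i1 : cL1 mu F1.
  split => //; apply: le_lt_trans fF; apply: nint_le => x; first exact: cabs_ge0.
  rewrite /F1 cabsM cabsR !indicE ler_wpM2l ?cabs_ge0//.
  have [h|h] := boolP (x \in obox A B); last by rewrite normr0; case: (_ \in _).
  by rewrite mem_set ?normr1//; apply: obox_cbox; rewrite -inE.
have F1c a b : cint mu (fun x => F1 x * (\1_(cbox a b) x)%:C%C) = 0.
  (* Slightly enlarged open boxes descend to [cbox a b]; clipping them to the box from [A] to [B]
     keeps the test functions supported there. *)
  pose an n : V := \col_i Num.max (a i ord0 - epsn n) (A i ord0).
  pose bn n : V := \col_i Num.min (b i ord0 + epsn n) (B i ord0).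
  have sub n : cbox (an n) (bn n) `<=` cbox A B.
    move=> x h i; have := h i; rewrite !mxE ge_max le_min.
    by move=> /andP[/andP[_ ->] /andP[_ ->]].
  have sub' n : obox (an n) (bn n) `<=` obox A B.
    move=> x h i; have := h i; rewrite !mxE gt_max lt_min.
    by move=> /andP[/andP[_ ->] /andP[_ ->]].
  have [||||||_] := @cint_dct _ _ _ mu (fun n x => F x * (\1_(obox (an n) (bn n)) x)%:C%C)
     (fun x => F1 x * (\1_(cbox a b) x)%:C%C) (fun x => cabs (F1 x)).
  - by move=> n; apply: cmeasM => //; exact: cmeasR.
  - by apply: cmeasM => //; exact: cmeasR.
  - exact: measurable_cabs.
  - by case: i1.
  - move=> n x; rewrite /F1 !cabsM !cabsR !indicE ler_wpM2l ?cabs_ge0//.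
    have [h|h] := boolP (x \in obox (an n) (bn n)); last by rewrite normr0.
    by rewrite mem_set ?normr1//; apply: (sub' n); rewrite -inE.
  - apply: nearW => x; rewrite /F1.
    have ev : \forall n \near \oo, \1_(obox (an n) (bn n)) x = \1_(obox A B) x * \1_(cbox a b) x :> R.
      have [hAB|hAB] := pselect (obox A B x); last first.
        apply: nearW => n; rewrite !indicE (memNset hAB) mul0r memNset//.
        by move/sub'.
      rewrite indicE (mem_set hAB) mul1r.
      have [hab|hab] := pselect (cbox a b x).
        apply: nearW => n; rewrite !indicE (mem_set hab) mem_set// => i; rewrite !mxE gt_max lt_min.
        have /andP[-> ->] := hAB i; have /andP[h1 h2] := hab i; rewrite !andbT.
        by have := @epsn_gt0 R n; move: h1 h2; move: (epsn n) => e h1 h2 e0; apply/andP; split; lra.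
      have /existsNP[i /negP] := hab; rewrite negb_and -!ltNge => out.
      have [e e0 he] : exists2 e : R, 0 < e & (x i ord0 < a i ord0 - e) || (b i ord0 + e < x i ord0).
        case/orP: out => h; [exists ((a i ord0 - x i ord0) / 2)|exists ((x i ord0 - b i ord0) / 2)]; lra.
      have /cvgr0Pnorm_lt/(_ e e0) := @epsn_cvg0 R; apply: filterS => n.
      rewrite ger0_norm; last exact: ltW (epsn_gt0 _).
      move=> en.
      rewrite !indicE (memNset hab) memNset// => /(_ i); rewrite !mxE gt_max lt_min.
      by move=> /andP[/andP[h1 _] /andP[h2 _]]; exact: (outside_box he en h1 h2).
    apply/cvgr0Pnorm_lt => e e0; move: ev; apply: filterS => n ->.
    by rewrite rmorphM mulrA subrr cabs0 normr0.
  move=> lim; apply: (ccvg_unique lim).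
  rewrite (_ : (fun n => _) = fun=> 0); first exact: cvg_cst.
  by apply/funext => n; rewrite (bump_box mF fF (sub n))// subrr cabs0.
have hRe : {ae mu, forall x, complex.Re (F1 x) = 0}.
  apply: (ae0_of_boxes (cL1_Re i1)) => a b; have /(congr1 (@complex.Re R)) := F1c a b.
  move=> E; transitivity (\int[mu]_x (complex.Re (F1 x * (\1_(cbox a b) x)%:C%C))); last exact: E.
  by apply: eq_Rintegral => x _; rewrite cReM [X in _ - X]mulr0 subr0.
have hIm : {ae mu, forall x, complex.Im (F1 x) = 0}.
  apply: (ae0_of_boxes (cL1_Im i1)) => a b; have /(congr1 (@complex.Im R)) := F1c a b.
  move=> E; transitivity (\int[mu]_x (complex.Im (F1 x * (\1_(cbox a b) x)%:C%C))); last exact: E.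
  by apply: eq_Rintegral => x _; rewrite cImM [X in X + _]mulr0 add0r.
apply: filterS2 hRe hIm => x h1 h2 hx.
have : F1 x = 0 by apply: cplx_eq.
by rewrite /F1 indicE mem_set// mulr1.
Qed.

(** The local statement [box_ae0] on each rational box inside [U]; there are countably many of them
    and they cover [U]. *)
Lemma fundamental_lemma U F : open U -> cmeas F ->
  (forall a b, cbox a b `<=` U -> (nint mu (fun x => cabs (F x) * \1_(cbox a b) x)%R < +oo)%E) ->
  (forall eta, Ccinfty U eta -> cint mu (fun x => F x * eta x) = 0) ->
  {ae mu, forall x, U x -> F x = 0}.
Proof.
move=> oU mF fF H.
have {}H : {ae mu, forall x n, if nbox U n is Some ab then obox ab.1 ab.2 x -> F x = 0 else True}.
  apply/ae_foralln => n; case E : (nbox U n) => [ab|]; last exact: aeW.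
  have sub := nboxS E; apply: box_ae0 => //; first exact: fF.
  by move=> eta ce; apply: H; exact: Ccinfty_sub ce.
move: H; apply: filterS => x Hx Ux.
by have [n [ab [E h]]] := nbox_cover oU Ux; have := Hx n; rewrite E; exact.
Qed.

End fundamental_lemma.

(** * Young, Cauchy-Schwarz and limits in L^2 *)

Section L2.
Context {R : realType} dT (T : measurableType dT).
Local Notation C := R[i].
Variable m : {sigma_finite_measure set T -> \bar R}.
Implicit Types f g : T -> C.

(** The free parameter allows sharp constants, both in limits and in the contraction estimate for
    the Neumann iteration. *)
Lemma cabsD_sqr_le (s : R) (z w : C) : 0 < s ->
  cabs (z + w) ^+ 2 <= (1 + s) * cabs z ^+ 2 + (1 + s^-1) * cabs w ^+ 2.
Proof.
move=> s0; apply: (@le_trans _ _ ((cabs z + cabs w) ^+ 2)).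
  by rewrite lerXn2r ?nnegrE ?addr_ge0 ?cabs_ge0// cabsD.
move: (cabs z) (cabs w) => a b; rewrite -subr_ge0.
rewrite (_ : _ - _ = s^-1 * (s * a - b) ^+ 2); last by field; rewrite gt_eqF.
by rewrite mulr_ge0 ?sqr_ge0// invr_ge0 ltW.
Qed.

Lemma n2D_le_s (s : R) f g : 0 < s -> cmeas f -> cmeas g ->
  (n2 m (fun x => f x + g x)%R <= (1 + s)%:E * n2 m f + (1 + s^-1)%:E * n2 m g)%E.
Proof.
move=> s0 mf mg; have s1 : 0 <= 1 + s by rewrite addr_ge0// ltW.
have s2 : 0 <= 1 + s^-1 by rewrite addr_ge0// invr_ge0 ltW.
rewrite -!nintZ//; try exact: measurable_cabs2; try (by move=> x; exact: sqr_ge0).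
rewrite -nintD; first last.
- by move=> x; rewrite mulr_ge0// sqr_ge0.
- by move=> x; rewrite mulr_ge0// sqr_ge0.
- by apply: measurable_funM; [exact: measurable_cst|exact: measurable_cabs2].
- by apply: measurable_funM; [exact: measurable_cst|exact: measurable_cabs2].
by apply: nint_le => x; [exact: sqr_ge0|exact: cabsD_sqr_le].
Qed.

(** A small [s] keeps the factor in front of M close to 1, while the term it enlarges tends to 0
    along the sequence. *)
Lemma n2_limit_le (f : nat -> T -> C) g (M : \bar R) : (forall n, cmeas (f n)) -> cmeas g ->
  n2 m (fun x => f n x - g x) @[n --> \oo] --> 0%E -> (forall n, n2 m (f n) <= M)%E -> (n2 m g <= M)%E.
Proof.
move=> mf mg /ecvg0P fg fM; case: M fM => [M| |] fM; last 2 first.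
- exact: leey.
- by have := le_trans (n2_ge0 m (f 0%N)) (fM 0%N).
have M0 : 0 <= M by rewrite -lee_fin (le_trans (n2_ge0 m (f 0%N))).
apply/lee_addgt0Pr => e e0.
have [s s0 se] : exists2 s, 0 < s & s * M <= e / 2.
  have e2 : 0 < e / 2 by rewrite divr_gt0.
  exists (e / 2 / (M + 1)); first by rewrite divr_gt0// ltr_wpDl.
  by rewrite mulrAC ler_pdivrMr ?ltr_wpDl// ler_wpM2l ?(ltW e2)// lerDl.
have c0 : 0 < 1 + s^-1 by rewrite addr_gt0// invr_gt0.
have [N /(_ N (leqnn N)) HN] := fg (fun n => n2_ge0 _ _) _ (divr_gt0 (divr_gt0 e0 (ltr0n R 2)) c0).
rewrite [X in n2 _ X](_ : g = fun x => f N x + (g x - f N x)); last by apply/funext => x; rewrite addrC subrK.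
apply: le_trans (n2D_le_s s0 (mf N) (cmeasB mg (mf N))) _.
apply: (@le_trans _ _ ((1 + s)%:E * M%:E + (1 + s^-1)%:E * (e / 2 / (1 + s^-1))%:E)%E).
  apply: leeD; apply: lee_wpmul2l; rewrite ?lee_fin ?(ltW c0)//; first by rewrite addr_ge0// ltW.
  by rewrite n2B_sym.
rewrite -!EFinM -!EFinD lee_fin.
have -> : (1 + s^-1) * (e / 2 / (1 + s^-1)) = e / 2 by rewrite mulrC divfK// gt_eqF.
by rewrite mulrDl mul1r -addrA lerD2l [leRHS]splitr lerD2r.
Qed.

(** Integrating 2|f g| <= t|f|^2 + |g|^2/t gives a bound for every t > 0; the choice t = A/X, with A
    the modulus of the integral, is the optimal one in disguise. *)
Lemma cauchy_schwarz f g : cmeas f -> cmeas g -> (n2 m f < +oo)%E -> (n2 m g < +oo)%E ->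
  cL1 m (fun x => f x * g x) /\
  cabs (cint m (fun x => f x * g x)) ^+ 2 <= fine (n2 m f) * fine (n2 m g).
Proof.
move=> mf mg ff fg; set X := fine (n2 m f); set Y := fine (n2 m g).
have X0 : 0 <= X by rewrite fine_ge0// n2_ge0.
have Y0 : 0 <= Y by rewrite fine_ge0// n2_ge0.
have XE : n2 m f = X%:E by rewrite fineK// ge0_fin_numE// n2_ge0.
have YE : n2 m g = Y%:E by rewrite fineK// ge0_fin_numE// n2_ge0.
have key (t : R) : 0 < t -> (2%:E * nint m (fun x => cabs (f x * g x))%R <= (t * X + t^-1 * Y)%:E)%E.
  move=> t0; have ti : 0 <= t^-1 by rewrite invr_ge0 ltW.
  have -> : ((t * X + t^-1 * Y)%:E = t%:E * X%:E + t^-1%:E * Y%:E)%E by rewrite -!EFinM -EFinD.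
  rewrite -XE -YE -!nintZ//; try exact: measurable_cabs2; try (by move=> x; rewrite ?cabs_ge0 ?sqr_ge0);
    try (by apply: measurable_cabs; exact: cmeasM); try exact: ltW.
  rewrite -nintD; first last.
  - by move=> x; rewrite mulr_ge0// sqr_ge0.
  - by move=> x; rewrite mulr_ge0 ?sqr_ge0// ltW.
  - by apply: measurable_funM; [exact: measurable_cst|exact: measurable_cabs2].
  - by apply: measurable_funM; [exact: measurable_cst|exact: measurable_cabs2].
  apply: nint_le => x; first by rewrite mulr_ge0 ?cabs_ge0.
  rewrite cabsM; move: (cabs (f x)) (cabs (g x)) => a b; rewrite -subr_ge0.
  rewrite (_ : _ - _ = t^-1 * (t * a - b) ^+ 2); last by field; rewrite gt_eqF.
  by rewrite mulr_ge0 ?sqr_ge0.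
have i1 : cL1 m (fun x => f x * g x).
  split; first exact: cmeasM.
  have := key 1 ltr01; case: (nint _ _) => [r|//|//]; first by rewrite ltry.
  by rewrite mulry gtr0_sg// mul1e.
split => //; set A := cabs _.
have kA (t : R) : 0 < t -> 2 * A <= t * X + t^-1 * Y.
  move=> t0; rewrite -lee_fin; apply: le_trans (key t t0).
  by rewrite EFinM lee_wpmul2l// cabs_cint_le.
have A0 : 0 <= A by exact: cabs_ge0.
have [A00|An0] := eqVneq A 0; first by rewrite A00 expr0n mulr_ge0.
have {An0}A0 : 0 < A by rewrite lt_def An0.
have [X00|Xn0] := eqVneq X 0.
  (* For X = 0 this t gives 2A <= Y/(Y + 1) A, which contradicts A > 0. *)
  have := kA ((Y + 1) / A) (divr_gt0 (ltr_wpDl Y0 ltr01) A0).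
  have : Y / (Y + 1) * A <= A.
    by rewrite ler_piMl ?(ltW A0)// ler_pdivrMr ?ltr_wpDl// mul1r lerDl.
  rewrite X00 mulr0 add0r invf_div -mulrA [A * _]mulrC mulrA; lra.
have {Xn0}X0 : 0 < X by rewrite lt_def Xn0.
have := kA (A / X) (divr_gt0 A0 X0); rewrite divfK ?gt_eqF// invf_div => h.
have : A <= X / A * Y by lra.
by rewrite mulrAC ler_pdivlMr// expr2.
Qed.

Lemma cint_limit (f : nat -> T -> C) g h : (forall n, cmeas (f n)) -> cmeas g -> cmeas h ->
  n2 m (fun x => f n x - g x) @[n --> \oo] --> 0%E -> (forall n, n2 m (f n) < +oo)%E ->
  (n2 m g < +oo)%E -> (n2 m h < +oo)%E ->
  cabs (cint m (fun x => f n x * h x) - cint m (fun x => g x * h x)) @[n --> \oo] --> (0 : R).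
Proof.
move=> mf mg mh /ecvg0P fg ff fing finh.
apply/cvgr0Pnorm_le => e e0; set Y := fine (n2 m h); have Y0 : 0 <= Y by rewrite fine_ge0// n2_ge0.
have d0 : 0 < e ^+ 2 / (Y + 1) by rewrite divr_gt0 ?exprn_gt0// ltr_wpDl.
have [N HN] := fg (fun n => n2_ge0 _ _) _ d0; exists N => // n /= Nn.
have [i1 _] := cauchy_schwarz (mf n) mh (ff n) finh.
have [i2 _] := cauchy_schwarz mg mh fing finh.
have dn := HN n Nn.
have [_] := @cauchy_schwarz (fun x => f n x - g x) h (cmeasB (mf n) mg) mh (le_lt_trans dn (ltry _)) finh.
rewrite -cintB// ger0_norm ?cabs_ge0// (_ : (fun x => f n x * h x - g x * h x) = fun x => (f n x - g x) * h x); last first.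
  by apply/funext => x; rewrite mulrBl.
move=> h2; rewrite -(@ler_pXn2r _ 2)// ?nnegrE ?cabs_ge0 ?(ltW e0)//.
apply: le_trans h2 _; apply: (@le_trans _ _ (e ^+ 2 / (Y + 1) * Y)).
  apply: ler_wpM2r => //; rewrite -lee_fin fineK//.
  by rewrite ge0_fin_numE ?n2_ge0// (le_lt_trans dn (ltry _)).
by rewrite mulrAC ler_pdivrMr ?ltr_wpDl// ler_wpM2l ?sqr_ge0// lerDl.
Qed.

End L2.

(** * Plancherel theory *)

Section L2_fourier.
Context {R : realType} {d : nat}.
Local Notation C := R[i].
Local Notation V := 'cV[R]_d.
Local Notation mu := (@lebesgue_cV R d).
Implicit Types (f g h eta : V -> C) (x xi : V).

Lemma cmeas_truncate (r : R) f : cmeas f -> cmeas (truncate r f).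
Proof.
move=> mf; have -> : truncate r f = fun x => (if `|x| <= r then 1 else 0)%:C%C * f x.
  by apply/funext => x; rewrite /truncate; case: ifP; rewrite ?mul1r ?mul0r.
by apply: cmeasM => //; apply: cmeasR; exact: measurable_boxcst.
Qed.

Lemma n2_truncate_le (r : R) f : (n2 mu (truncate r f) <= n2 mu f)%E.
Proof.
apply: nint_le => x; first exact: sqr_ge0.
by rewrite /truncate; case: ifP => // _; rewrite cabs0 expr0n sqr_ge0.
Qed.

Lemma n2_truncate_cvg f : cmeas f -> (n2 mu f < +oo)%E ->
  n2 mu (fun x => truncate n%:R f x - f x) @[n --> \oo] --> 0%E.
Proof.
move=> mf ff; apply: (@nint_dct _ _ _ _ (fun n x => cabs (truncate n%:R f x - f x) ^+ 2) (fun x => cabs (f x) ^+ 2)).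
- by move=> n; apply: measurable_cabs2; apply: cmeasB => //; exact: cmeas_truncate.
- exact: measurable_cabs2.
- exact: ff.
- move=> n x; rewrite sqr_ge0 /= /truncate; case: ifP => _; last by rewrite sub0r cabsN.
  by rewrite subrr cabs0 expr0n sqr_ge0.
- apply: nearW => x; apply/cvgr0Pnorm_lt => e e0; near=> n.
  have xn : `|x| <= n%:R by near: n; exact: nbhs_infty_ger.
  by rewrite /truncate xn subrr cabs0 expr0n normr0.
Unshelve. all: by end_near. Qed.

Lemma cL1_truncate (r : R) f : 0 <= r -> cmeas f -> (n2 mu f < +oo)%E -> cL1 mu (truncate r f).
Proof.
move=> r0 mf ff; apply: (@cL1_le _ _ _ _ _ (fun x => cabs (f x) ^+ 2 + (if `|x| <= r then 1 else 0))).
- exact: cmeas_truncate.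
- rewrite nintD//; first by rewrite lte_add_pinfty// nint_boxcst.
  + exact: measurable_cabs2.
  + exact: measurable_boxcst.
  + by move=> x; exact: sqr_ge0.
  + by move=> x; case: ifP.
- move=> x; rewrite /truncate; case: ifP => _; last by rewrite cabs0 addr0 sqr_ge0.
  have := cabs_ge0 (f x); move: (cabs _) => a a0; nra.
Qed.

(** The contraction property makes the transforms of the truncations a Cauchy sequence. The
    multiplication formula survives the limit because both sides are pairings with a fixed square
    integrable function. *)
Lemma L2_fourier_ex h : cmeas h -> (n2 mu h < +oo)%E ->
  exists F, [/\ cmeas F, (n2 mu F <= n2 mu h)%E,
    n2 mu (fun x => fourier (truncate n%:R h) x - F x) @[n --> \oo] --> 0%E &
    forall eta, cL1 mu eta -> (n2 mu eta < +oo)%E ->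
      cint mu (fun x => F x * eta x) = cint mu (fun x => h x * fourier eta x)].
Proof.
move=> mh fh; pose t n := truncate n%:R h.
have mt n : cmeas (t n) by exact: cmeas_truncate.
have t1 n : cL1 mu (t n) by exact: cL1_truncate.
have ft n : (n2 mu (t n) < +oo)%E := le_lt_trans (n2_truncate_le _ _) fh.
have mF n : cmeas (fourier (t n)) by exact: cmeas_fourier.
have Fle n : (n2 mu (fourier (t n)) <= n2 mu h)%E.
  by apply: le_trans (fourier_contraction (t1 n)) _; exact: n2_truncate_le.
have tcvg := n2_truncate_cvg mh fh; have /ecvg0P tc := tcvg.
have [||F mFl Fcvg] := @L2_complete _ _ _ mu (fun n => fourier (t n)).
- exact: mF.
- move=> a a0; have [N HN] := tc (fun n => n2_ge0 _ _) _ a0; exists N => n k /andP[Nn nk].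
  rewrite [X in n2 _ X](_ : _ = fourier (fun x => t k x - t n x)); last first.
    by rewrite fourierB//.
  apply: le_trans (fourier_contraction (cL1B (t1 k) (t1 n))) _.
  apply: le_trans (HN n Nn); apply: nint_le => x; first exact: sqr_ge0.
  rewrite lerXn2r ?nnegrE ?cabs_ge0// /t /truncate.
  have [h1|h1] := leP `|x| n%:R.
    have -> : `|x| <= k%:R by rewrite (le_trans h1)// ler_nat.
    by rewrite !subrr.
  by rewrite subr0 sub0r cabsN; case: ifP => // _; rewrite cabs0 cabs_ge0.
have Fh : (n2 mu F <= n2 mu h)%E by exact: n2_limit_le Fcvg Fle.
exists F; split => // eta e1 e2; have [me _] := e1.
have l1 := cint_limit mF mFl me Fcvg (fun n => le_lt_trans (Fle n) fh) (le_lt_trans Fh fh) e2.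
have l2 := cint_limit mt mh (cmeas_fourier me) tcvg ft fh (le_lt_trans (fourier_contraction e1) e2).
apply: (ccvg_unique l1).
by under eq_fun do rewrite fourier_mul//; exact: l2.
Qed.

Lemma L2_locint a b f : cmeas f -> (n2 mu f < +oo)%E ->
  (nint mu (fun x => cabs (f x) * \1_(cbox a b) x)%R < +oo)%E.
Proof.
move=> mf ff; have mc : measurable_fun setT (\1_(cbox a b) : V -> R).
  by apply: measurable_indic; exact: measurable_cbox.
apply: (@le_lt_trans _ _ (nint mu (fun x => cabs (f x) ^+ 2 + \1_(cbox a b) x)%R)).
  apply: nint_le => x; first by rewrite mulr_ge0 ?cabs_ge0.
  rewrite indicE; case: (_ \in _); rewrite ?mulr0 ?addr0 ?sqr_ge0// mulr1.
  have := cabs_ge0 (f x); move: (cabs _) => c c0 /=; nra.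
rewrite nintD//; [|exact: measurable_cabs2|by move=> x; exact: sqr_ge0].
apply: lte_add_pinfty; first exact: ff.
rewrite /nint integral_indic ?setIT//; last exact: measurable_cbox.
have [ab|/existsNP[i /negP ab]] := pselect (forall i, a i ord0 <= b i ord0).
  have h : (mu (cbox a b) < +oo)%E by rewrite lebesgue_cbox// ltry.
  exact: h.
rewrite (_ : cbox a b = set0) ?measure0 ?ltry//; apply/seteqP; split => // x /(_ i) /andP[h1 h2].
by case/negP: ab; exact: le_trans h1 h2.
Qed.

Lemma ifourierE_conj A eta : Ccinfty A eta ->
  ifourier eta = fun x => ((fourier (fun y => ((eta y)^*)%C) x)^*)%C.
Proof. by move=> Ae; apply/funext => x; rewrite (fourier_conj _ (Ccinfty_cL1 Ae)) cconjK. Qed.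

Lemma decays_ifourier A eta : Ccinfty A eta -> decays (ifourier eta).
Proof.
move=> Ae; rewrite (ifourierE_conj Ae) => n; have [M HM] := decays_fourier (Ccinfty_conj Ae) n.
by exists M => x; rewrite cabs_conj.
Qed.

Lemma rapid_ifourier A eta : Ccinfty A eta -> rapid (ifourier eta).
Proof.
move=> Ae; apply: decays_rapid (decays_ifourier Ae).
by apply: cmeas_ifourier; exact: Ccinfty_cmeas Ae.
Qed.

Lemma cint_CcM A f eta : cL1 mu f -> Ccinfty A eta -> cL1 mu (fun x => f x * eta x).
Proof.
move=> f1 Ae; have [M _ HM] := Ccinfty_box Ae.
rewrite (_ : (fun x => _) = fun x => eta x * f x); last by apply/funext => x; rewrite mulrC.
have [mf _] := f1; have := @cL1_prod_bounded _ _ f eta M f1 (Ccinfty_cmeas Ae) (fun x => (HM x).1).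
by congr cL1; apply/funext => x; rewrite mulrC.
Qed.

Lemma ae_eq_of_test f g : cmeas f -> cmeas g ->
  (forall a b, (nint mu (fun x => cabs (f x) * \1_(cbox a b) x)%R < +oo)%E) ->
  (forall a b, (nint mu (fun x => cabs (g x) * \1_(cbox a b) x)%R < +oo)%E) ->
  (forall eta, Ccinfty setT eta -> cint mu (fun x => (f x - g x) * eta x) = 0) ->
  {ae mu, forall x, f x = g x}.
Proof.
move=> mf mg lf lg H.
suff : {ae mu, forall x, [set: V] x -> f x - g x = 0}.
  by apply: filterS => x /(_ I) /eqP; rewrite subr_eq0 => /eqP.
apply: fundamental_lemma => //; [exact: openT|exact: cmeasB|move=> a b _].
have mc : measurable_fun setT (\1_(cbox a b) : V -> R).
  by apply: measurable_indic; exact: measurable_cbox.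
apply: (@le_lt_trans _ _ (nint mu (fun x => cabs (f x) * \1_(cbox a b) x + cabs (g x) * \1_(cbox a b) x)%R)).
  apply: nint_le => x; first by rewrite mulr_ge0 ?cabs_ge0.
  by rewrite -mulrDl ler_wpM2r// (le_trans (cabsD _ _))// cabsN.
rewrite nintD; first exact: lte_add_pinfty.
- by apply: measurable_funM => //; exact: measurable_cabs.
- by apply: measurable_funM => //; exact: measurable_cabs.
- by move=> x; rewrite mulr_ge0 ?cabs_ge0.
- by move=> x; rewrite mulr_ge0 ?cabs_ge0.
Qed.

(** For the reverse inequality the contraction is applied once more, to the L^2 transform F of the
    conjugate of [fourier h]; testing against C_c^oo identifies F with the conjugate of [h]. *)
Lemma fourier_isometry h : cL1 mu h -> (n2 mu h < +oo)%E -> n2 mu (fourier h) = n2 mu h.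
Proof.
move=> h1 h2; have [mh _] := h1; apply/eqP; rewrite eq_le fourier_contraction//=.
have mF := cmeas_fourier mh; have F2 := le_lt_trans (fourier_contraction h1) h2.
have mFc : cmeas (fun x => ((fourier h x)^*)%C) by exact: cmeas_conj.
have n2c f : n2 mu (fun x => ((f x)^*)%C) = n2 mu f by apply: nint_eq => x; rewrite cabs_conj.
have [F [mF' Fle _ FE]] := L2_fourier_ex mFc (ltac:(by rewrite n2c)).
rewrite n2c in Fle; apply: le_trans (Fle); rewrite -(n2c h).
rewrite (@n2_eq_ae _ _ _ _ _ F)//.
have F2' : (n2 mu F < +oo)%E := le_lt_trans Fle F2.
apply: ae_eq_of_test => // [|a b|a b|eta ce].
- exact: cmeas_conj.
- by apply: L2_locint; [exact: cmeas_conj|rewrite n2c].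
- exact: L2_locint.
have e1 := Ccinfty_cL1 ce; have e2 := Ccinfty_n2 ce; have [me _] := e1.
have i1 := cint_CcM (cL1_conj h1) ce; have [i2 _] := cauchy_schwarz mF' me F2' e2.
rewrite (_ : (fun x => _) = fun x => ((h x)^*)%C * eta x - F x * eta x); last first.
  by apply/funext => x; rewrite mulrBl.
rewrite cintB// FE//; apply/eqP; rewrite subr_eq0; apply/eqP.
have cc := Ccinfty_conj ce; have k1 := rapid_cL1 (rapid_ifourier cc).
have := fourier_mul h1 k1; rewrite (ifourierK cc) => /(congr1 (fun z => (z^*)%C)).
rewrite -cint_conj; last first.
  have [M HM] := fourier_bounded h1.
  have := cL1_prod_bounded k1 mF HM; congr cL1; apply/funext => x; rewrite mulrC//.
rewrite -cint_conj; last exact: cint_CcM h1 cc.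
move=> E; symmetry; transitivity (cint mu (fun x => ((fourier h x * ifourier (fun y => ((eta y)^*)%C) x)^*)%C)).
  by congr cint; apply/funext => x; rewrite conjCM (ifourier_conj _ e1) cconjK.
by rewrite E; congr cint; apply/funext => x; rewrite conjCM cconjK.
Qed.

(** [L2_fourier_ex] provides a limit; that it is [f] is tested against C_c^oo functions, for which
    inversion holds pointwise. *)
Lemma fourier_truncate_ifourier f : cL1 mu f -> (n2 mu f < +oo)%E ->
  n2 mu (fun x => fourier (truncate n%:R (ifourier f)) x - f x) @[n --> \oo] --> 0%E.
Proof.
move=> f1 f2; have [mf _] := f1; have mi := cmeas_ifourier mf.
have n2c g : n2 mu (fun x => ((g x)^*)%C) = n2 mu g by apply: nint_eq => x; rewrite cabs_conj.
have i2 : (n2 mu (ifourier f) < +oo)%E.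
  rewrite -n2c (_ : (fun x => _) = fourier (fun x => ((f x)^*)%C)); last first.
    by apply/funext => x; rewrite fourier_conj.
  apply: le_lt_trans (fourier_contraction (cL1_conj f1)) _.
  by have := n2c f; rewrite /n2 => ->.
have [F [mF Fle Fcvg FE]] := L2_fourier_ex mi i2.
have F2 := le_lt_trans Fle i2.
suff fF : {ae mu, forall x, f x = F x}.
  have E n : n2 mu (fun x => fourier (truncate n%:R (ifourier f)) x - f x) =
      n2 mu (fun x => fourier (truncate n%:R (ifourier f)) x - F x).
    by apply: n2_eq_ae; move: fF; apply: filterS => x ->.
  by under eq_fun do rewrite E.
apply: ae_eq_of_test => // [a b|a b|eta ce].
- exact: L2_locint.
- exact: L2_locint.
have e1 := Ccinfty_cL1 ce; have e2 := Ccinfty_n2 ce; have [me _] := e1.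
have i1 := cint_CcM f1 ce; have [i2' _] := cauchy_schwarz mF me F2 e2.
rewrite (_ : (fun x => _) = fun x => f x * eta x - F x * eta x); last first.
  by apply/funext => x; rewrite mulrBl.
rewrite cintB// FE// (ifourier_mul f1) ?(fourierK ce) ?subrr//.
by apply: rapid_cL1; apply: schwartz_rapid; exact: schwartz_fourier ce.
Qed.

End L2_fourier.

(** * Poisson summation *)

Section poisson.
Context {R : realType} {d : nat}.
Local Notation C := R[i].
Local Notation V := 'cV[R]_d.
Local Notation Z := 'cV[int]_d.
Local Notation mu := (@lebesgue_cV R d).
Implicit Types (f H P : V -> C) (x xi t : V) (k l : Z).
Local Notation iv := (@intv R d).

Lemma cis_int (z : int) : cis (2 * pi * z%:~R) = 1 :> C.
Proof.
have c1 : cis (2 * pi) = 1 :> C.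
  by rewrite /cis mulrC mulr_natr cos2pi sin2pi.
have nat (n : nat) : cis (2 * pi * n%:R) = 1 :> C.
  by elim: n => [|n ih]; rewrite ?mulr0 ?cis0// -[n.+1%:R]natr1 mulrDr mulr1 cisD ih c1 mulr1.
case: z => n; first exact: nat.
rewrite NegzE mulrNz mulrN -conj_cis pmulrn nat.
by apply: cplx_eq; rewrite ?cReconj ?cImconj /= ?oppr0.
Qed.

Lemma intvD k l : iv (k + l) = iv k + iv l.
Proof. by apply/colP => i; rewrite !mxE intrD. Qed.

Lemma intvN k : iv (- k) = - iv k.
Proof. by apply/colP => i; rewrite !mxE intrN. Qed.

Lemma intv0 : iv 0 = 0.
Proof. by apply/colP => i; rewrite !mxE. Qed.

Lemma dot_intv k l : dot (iv k) (iv l) = (\sum_i k i ord0 * l i ord0)%:~R.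
Proof. by rewrite /dot [RHS]rmorph_sum; apply: eq_bigr => i _; rewrite !mxE -intrM. Qed.

Definition periodic P := forall x k, P (x + iv k) = P x.

Lemma periodic_cis l : periodic (fun x => cis (2 * pi * dot (iv l) x)).
Proof. by move=> x k; rewrite dotDr mulrDr cisD dot_intv cis_int mulr1. Qed.

(** Half-open, so that its integer translates tile the space without overlap. *)
Definition hcube : set V := [set x | forall i, - 2^-1 <= x i ord0 < 2^-1].
Definition chi x : R := \1_hcube x.

Lemma chi_prod x : chi x = \prod_i \1_[set t | - 2^-1 <= t < 2^-1] (x i ord0).
Proof.
rewrite /chi indicE; have [h|h] := boolP (x \in hcube).
  rewrite big1// => i _; rewrite indicE mem_set//.
  by move: h; rewrite inE; exact.
have /existsNP[i hi] : ~ hcube x by move=> hx; move: h; rewrite mem_set.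
by rewrite (bigD1 i)//= indicE memNset ?mul0r.
Qed.

Let itvE : [set t : R | - 2^-1 <= t < 2^-1] = `[- 2^-1, 2^-1[%classic.
Proof. by apply/seteqP; split => t /=; rewrite in_itv. Qed.

Lemma measurable_chi : measurable_fun setT chi.
Proof.
rewrite (_ : chi = fun x => \prod_i \1_[set t : R | - 2^-1 <= t < 2^-1] (x i ord0)); last first.
  by apply/funext => x; exact: chi_prod.
elim: (index_enum _) => [|i s ih]; first by under eq_fun do rewrite big_nil; exact: measurable_cst.
under eq_fun do rewrite big_cons; apply: measurable_funM => //.
apply: measurableT_comp (measurable_coord i); apply: measurable_indic.
by rewrite itvE; exact: measurable_itv.
Qed.

Lemma chi_ge0 x : 0 <= chi x. Proof. by rewrite /chi indicE. Qed.
Lemma chi_le1 x : chi x <= 1. Proof. by rewrite /chi indicE; case: (_ \in _). Qed.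

Lemma nint_chi : nint mu chi = 1%E.
Proof.
rewrite (_ : chi = fun x => \prod_i \1_[set t : R | - 2^-1 <= t < 2^-1] (x i ord0)); last first.
  by apply/funext => x; exact: chi_prod.
have h1 : nint (@lebesgue_measure R) (\1_[set t : R | - 2^-1 <= t < 2^-1]) = 1%E.
  have mI : measurable ([set t : R | - 2^-1 <= t < 2^-1] : set (measurableTypeR R)).
    by rewrite itvE; exact: measurable_itv.
  rewrite /nint integral_indic// setIT itvE.
  have := @lebesgue_measure_itv R `[- 2^-1, 2^-1[; rewrite /= lte_fin gtrN ?invr_gt0//.
  by rewrite -EFinB opprK (_ : 2^-1 + 2^-1 = 1 :> R) => [-> //|]; lra.
rewrite (nint_prod_coord (h := fun=> \1_[set t : R | - 2^-1 <= t < 2^-1])).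
- by rewrite h1 /= big1.
- by move=> _; apply: measurable_indic; rewrite itvE; exact: measurable_itv.
- by move=> _ t; rewrite indicE.
- by move=> _; rewrite h1 ltry.
Qed.

Lemma chi_out x : 2^-1 < `|x| -> chi x = 0.
Proof.
move=> h; rewrite /chi indicE memNset// => hx.
have : `|x| <= 2^-1 by apply/cV_norm_le => // i; rewrite ler_norml; have /andP[-> /ltW ->] := hx i.
by move=> /(lt_le_trans h); rewrite ltxx.
Qed.

(** The integer points of [-N, N]^d as a duplicate-free list, so that periodizations of compactly
    supported functions are finite sums. *)
Definition zbox (N : nat) : seq Z :=
  [seq (\col_i (t i ord0 : nat)%:Z - const_mx N%:Z) | t : 'cV['I_(N.*2).+1]_d].

Lemma mem_zbox N k : (forall i, `|k i ord0| <= N%:Z) -> k \in zbox N.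
Proof.
move=> h; have hi i : (absz (k i ord0 + N%:Z)%R < (N.*2).+1)%N.
  by have := h i; rewrite ler_norml => /andP[h1 h2]; lia.
apply/mapP; exists (\col_i Ordinal (hi i)); rewrite ?mem_enum//.
apply/colP => i; rewrite !mxE /=; have := h i; rewrite ler_norml => /andP[h1 _].
by rewrite gez0_abs ?addrK// -lerBlDr sub0r.
Qed.

Lemma uniq_zbox N : uniq (zbox N).
Proof.
rewrite map_inj_uniq ?enum_uniq// => s t /colP e; apply/colP => i; apply: val_inj.
by have := e i; rewrite !mxE => /addIr [].
Qed.

Definition zfloor x : Z := \col_i Num.floor (x i ord0 + 2^-1).

Lemma hcube_floor x k : hcube (x - iv k) <-> k = zfloor x.
Proof.
split=> [h|->].
  apply/colP => i; rewrite !mxE; apply/esym; apply: floor_def.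
  have := h i; rewrite !mxE intrD => /andP[h1 h2]; apply/andP; split; lra.
move=> i; rewrite !mxE; have := floor_itv (x i ord0 + 2^-1); rewrite intrD => /andP[h1 h2].
by apply/andP; split; lra.
Qed.

Lemma zfloor_bound x (M : R) N i : `|x| <= M -> M + 1 <= N%:R -> `|zfloor x i ord0| <= N%:Z.
Proof.
move=> xM MN; rewrite mxE -(ler_int R) intr_norm.
have := floor_itv (x i ord0 + 2^-1); have := cV_norm_coord x i.
rewrite ler_norml intrD => /andP[a b] /andP[c e].
by rewrite ler_norml; apply/andP; split; rewrite -pmulrn; lra.
Qed.

(** The space is cut into integer translates of the cube and each piece is moved back by periodicity
    of [P], which replaces [H] by its periodization. The margin 1 in M + 1 <= N absorbs the rounding
    of [zfloor]. *)
Lemma unfold H P (M : R) N : cL1 mu (fun x => H x * P x) -> periodic P -> (forall x, M < `|x| -> H x = 0) ->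
  M + 1 <= N%:R ->
  cint mu (fun x => H x * P x) = cint mu (fun x => (chi x)%:C%C * ((\sum_(k <- zbox N) H (x + iv k)) * P x)) /\
  forall k, cL1 mu (fun x => (chi x)%:C%C * (H (x + iv k) * P x)).
Proof.
move=> hp pP H0 MN.
have i1 k : cL1 mu (fun x => (chi (x - iv k))%:C%C * (H x * P x)).
  apply: (cL1_le (u := fun x => cabs (H x * P x))).
  - apply: cmeasM; last by case: hp.
    by apply: cmeasR; exact: (measurable_shift (- iv k) measurable_chi).
  - by case: hp.
  - move=> x; rewrite cabsM cabsR ger0_norm ?chi_ge0// ler_piMl ?cabs_ge0//; exact: chi_le1.
have i2 k : cL1 mu (fun x => (chi x)%:C%C * (H (x + iv k) * P x)).
  have := cL1_shift (iv k) (i1 k); congr cL1; apply/funext => x.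
  by rewrite addrK pP.
split => //; transitivity (cint mu (fun x => \sum_(k <- zbox N) (chi (x - iv k))%:C%C * (H x * P x))).
  congr cint; apply/funext => x; have [xM|/H0 ->] := leP `|x| M; last first.
    by rewrite mul0r big1// => k _; rewrite mulr0.
  rewrite (bigD1_seq (zfloor x)) ?uniq_zbox//=; last first.
    by apply: mem_zbox => i; exact: zfloor_bound xM MN.
  rewrite big1 ?addr0 => [|k kx].
    by rewrite /chi indicE mem_set ?mul1r//; exact/hcube_floor.
  rewrite /chi indicE memNset ?mul0r// => /hcube_floor e.
  by move: kx; rewrite e eqxx.
rewrite cint_sum//; under eq_bigr => k _ do rewrite -(cint_shift (iv k) (i1 k)).
rewrite -cint_sum; last first.
  by move=> k; exact: (cL1_shift (iv k) (i1 k)).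
congr cint; apply/funext => x; rewrite mulrA mulr_sumr mulr_suml; apply: eq_bigr => k _.
by rewrite addrK pP mulrA.
Qed.

Lemma cL1_chiM P : cmeas P -> (exists M : R, forall x, cabs (P x) <= M) -> cL1 mu (fun x => (chi x)%:C%C * P x).
Proof.
move=> mP [M HM]; apply: (cL1_prod_bounded (M := M)) => //.
apply: (@cL1_le _ _ _ _ _ chi); first exact: cmeasR measurable_chi.
  by rewrite nint_chi ltry.
by move=> x; rewrite cabsR ger0_norm ?chi_ge0.
Qed.

Lemma sum_chi x N (M : R) : `|x| <= M -> M + 1 <= N%:R -> \sum_(k <- zbox N) chi (x + iv k) = 1.
Proof.
move=> xM MN; rewrite (bigD1_seq (- zfloor x)) ?uniq_zbox//=; last first.
  by apply: mem_zbox => i; rewrite mxE normrN; exact: zfloor_bound xM MN.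
rewrite big1 ?addr0 => [|k kx].
  by rewrite /chi indicE mem_set// intvN; exact/hcube_floor.
rewrite /chi indicE memNset// -[iv k]opprK -intvN => /hcube_floor e.
by move: kx; rewrite -e opprK eqxx.
Qed.

(** Orthogonality of characters without computing an integral: translating the cell does not change
    the integral of a periodic function, whereas a translation by half a period of the character
    multiplies it by -1. *)
Lemma cint_chi_cis l : cint mu (fun x => (chi x)%:C%C * cis (2 * pi * dot (iv l) x)) = (l == 0)%:R.
Proof.
have [->|l0] := eqVneq l 0.
  rewrite (_ : (fun x => _) = fun x => (chi x)%:C%C); last first.
    by apply/funext => x; rewrite intv0 dot0l mulr0 cis0 mulr1.
  by apply: cplx_eq; rewrite /= /Rintegral ?integral0// -/(nint mu chi) nint_chi.
have [i li] : exists i, l i ord0 != 0.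
  apply: contrapT => h; case/negP: l0; apply/eqP/colP => i; rewrite mxE.
  by apply/eqP; apply: contrapT => /negP hi; apply: h; exists i.
(* Chosen so that the scalar product of l and t is 1/2. *)
pose t : V := (2 * (l i ord0)%:~R)^-1 *: delta_mx i ord0.
set I := cint _ _.
have bP : exists M : R, forall x, cabs (cis (2 * pi * dot (iv l) x)) <= M.
  by exists 1 => x; rewrite cabs_cis.
have mP : cmeas (fun x => cis (2 * pi * dot (iv l) x)).
  by apply: csmooth_cmeas; have := csmooth_cis (2 * pi *: iv l) 0; congr csmooth;
    apply/funext => x; rewrite dotZl addr0.
have cP := cL1_chiM mP bP.
suff : I = cis (2 * pi * dot (iv l) t) * I.
  rewrite dotZr dot_delta mxE (_ : 2 * pi * _ = pi); last by field; rewrite intr_eq0.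
  rewrite {1}/cis cospi sinpi => E.
  have E2 : I = - I by rewrite {1}E; apply: cplx_eq; rewrite ?(cReM, cImM, cReN, cImN) /=; ring.
  have : I + I = 0 by rewrite {1}E2 addNr.
  by move=> E3; apply: cplx_eq; [have := congr1 (@complex.Re R) E3|have := congr1 (@complex.Im R) E3];
    rewrite ?(cReD, cImD) /=; lra.
have cPt : cL1 mu (fun x => (chi (x - t))%:C%C * cis (2 * pi * dot (iv l) x)).
  have := cL1_shift (- t) (cL1Z (cis (2 * pi * dot (iv l) t)) cP).
  congr cL1; apply/funext => x; by rewrite mulrCA -cisD -mulrDr -dotDr [t + _]addrC subrK.
pose M : R := 2^-1 + `|t|; pose N := (Num.truncn (M + 1)).+1.
have MN : M + 1 <= N%:R by rewrite ltW// truncnS_gt.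
have [|E _] := unfold (H := fun x => (chi (x - t))%:C%C) (M := M) (N := N) cPt (@periodic_cis l) _ MN.
  move=> x Mx; rewrite chi_out//; have := ler_normB x t; rewrite /M in Mx => h.
  have tri : `|x| <= `|x - t| + `|t| by rewrite -{1}(subrK t x) ler_normD.
  lra.
have -> : cis (2 * pi * dot (iv l) t) * I = cint mu (fun x => (chi (x - t))%:C%C * cis (2 * pi * dot (iv l) x)).
  rewrite -(cint_shift t cPt) -cintZ//; congr cint; apply/funext => x.
  by rewrite addrK mulrCA -cisD -mulrDr -dotDr (addrC t).
rewrite E; congr cint; apply/funext => x.
have [h|/chi_out ->] := leP `|x| 2^-1; last by rewrite !mul0r.
rewrite (_ : \sum_(_ <- _) _ = 1) ?mul1r// -rmorph_sum.
rewrite (_ : \sum_(_ <- _) _ = 1)//; under eq_bigr do rewrite addrAC.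
by apply: (sum_chi (M := M)) => //; rewrite (le_trans (ler_normB _ _))// lerD2r.
Qed.

(* A nonnegative trigonometric polynomial whose powers concentrate at the integer points. *)
Definition tker x : R := \prod_i ((1 + cos (2 * pi * x i ord0)) / 2).

Lemma tker_factor (t : R) : 0 <= (1 + cos t) / 2 <= 1.
Proof. by have := cos_geN1 t; have := cos_le1 t => a b; apply/andP; split; lra. Qed.

Lemma tker_ge0 x : 0 <= tker x.
Proof. by apply: prodr_ge0 => i _; have /andP[] := tker_factor (2 * pi * x i ord0). Qed.

Lemma tker_le1 x : tker x <= 1.
Proof. by apply: prodr_ile1 => i _; exact: tker_factor. Qed.

Lemma tker0 : tker 0 = 1.
Proof. by rewrite /tker big1// => i _; rewrite mxE mulr0 cos0 -[1 + 1]/(2%:R) divff. Qed.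

(** A trigonometric polynomial as a list of coefficients and frequencies; a repeated frequency adds
    up. *)
Definition tpoly (s : seq (R * Z)) x : C := \sum_(p <- s) p.1%:C%C * cis (2 * pi * dot (iv p.2) x).

Definition tposs (s : seq (R * Z)) := all (fun p => 0 <= p.1) s.

Lemma tpolyM s1 s2 : tposs s1 -> tposs s2 -> exists2 s, tposs s & forall x, tpoly s x = tpoly s1 x * tpoly s2 x.
Proof.
move=> p1 p2; exists [seq (a.1 * b.1, a.2 + b.2) | a <- s1, b <- s2].
  apply/allP => _ /allpairsP[[a b] /= [h1 h2 ->]] /=.
  by rewrite mulr_ge0//; [exact: (allP p1)|exact: (allP p2)].
move=> x; rewrite /tpoly big_allpairs_dep mulr_suml; apply: eq_bigr => a _.
rewrite mulr_sumr; apply: eq_bigr => b _ /=.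
by rewrite intvD dotDl mulrDr cisD rmorphM; ring.
Qed.

Lemma tpoly_tkerX n : exists2 s, tposs s & forall x, tpoly s x = (tker x ^+ n)%:C%C.
Proof.
have one : exists2 s, tposs s & forall x, tpoly s x = 1.
  exists [:: (1, 0)]; first by rewrite /tposs /= ler01.
  by move=> x; rewrite /tpoly big_seq1 intv0 dot0l mulr0 cis0 mulr1.
have H (r : seq 'I_d) : exists2 s, tposs s & forall x, tpoly s x = (\prod_(i <- r) ((1 + cos (2 * pi * x i ord0)) / 2))%:C%C.
  elim: r => [|i r [s ps Hs]].
    by have [s ps Hs] := one; exists s => // x; rewrite Hs big_nil.
  (* (1 + cos t)/2 = 1/2 + e^(it)/4 + e^(-it)/4. *)
  pose s1 : seq (R * Z) := [:: (2^-1, 0); (4^-1, delta_mx i ord0); (4^-1, - delta_mx i ord0)].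
  have p1 : tposs s1 by rewrite /tposs /= !invr_ge0 !ler0n.
  have [s2 p2 H2] := tpolyM p1 ps; exists s2 => // x; rewrite H2 Hs big_cons rmorphM; congr (_ * _).
  have e1 : dot (iv (delta_mx i ord0)) x = x i ord0.
    rewrite dotC (_ : iv _ = delta_mx i ord0) ?dot_delta//.
    by apply/colP => j; rewrite !mxE; case: (_ && _).
  rewrite /tpoly !big_cons big_nil /= intv0 intvN dot0l dotNl e1 mulr0 cis0 mulrN -conj_cis.
  by apply: cplx_eq; rewrite ?(cReD, cImD, cReM, cImM, cReconj, cImconj) /=; field.
elim: n => [|n [s ps Hs]]; first by have [s ps Hs] := one; exists s => // x; rewrite Hs expr0.
have [s1 p1 H1] := H (index_enum 'I_d); have [s2 p2 H2] := tpolyM p1 ps.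
by exists s2 => // x; rewrite H2 Hs H1 -rmorphM exprS.
Qed.

Lemma cmeas_tpoly s : cmeas (tpoly s).
Proof.
apply: csmooth_cmeas; apply: csmooth_sum => p; apply: csmoothM; first exact: csmooth_cst.
have := csmooth_cis (2 * pi *: iv p.2) 0; congr csmooth.
by apply/funext => x; rewrite dotZl addr0.
Qed.

Lemma measurable_tkerX n : measurable_fun setT (fun x => tker x ^+ n).
Proof.
have [s _ Hs] := tpoly_tkerX n; have [m _] := cmeas_tpoly s.
by move: m; congr measurable_fun; apply/funext => x; rewrite Hs.
Qed.

Lemma tkerX_period n x k : tker (x + iv k) ^+ n = tker x ^+ n.
Proof.
have [s _ Hs] := tpoly_tkerX n; apply/(@complexI R); rewrite -!Hs /tpoly.
by apply: eq_bigr => p _; rewrite periodic_cis.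
Qed.

Definition tmass n : R := fine (nint mu (fun x => chi x * tker x ^+ n)).

Lemma tker_pow_ge0 n x : 0 <= tker x ^+ n. Proof. by rewrite exprn_ge0// tker_ge0. Qed.
Lemma tker_pow_le1 n x : tker x ^+ n <= 1. Proof. by rewrite exprn_ile1 ?tker_ge0 ?tker_le1. Qed.

Lemma tmassE n : nint mu (fun x => chi x * tker x ^+ n) = (tmass n)%:E.
Proof.
rewrite /tmass fineK// ge0_fin_numE; last by apply: nint_ge0 => x; rewrite mulr_ge0 ?chi_ge0 ?tker_pow_ge0.
apply: (@le_lt_trans _ _ 1%E); last exact: ltry.
rewrite -nint_chi; apply: nint_le => x; first by rewrite mulr_ge0 ?chi_ge0 ?tker_pow_ge0.
by rewrite ler_piMr ?chi_ge0 ?tker_pow_le1.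
Qed.

Lemma tker_away (e : R) : 0 < e -> exists2 r : R, 0 <= r < 1 &
  forall x, hcube x -> e <= `|x| -> tker x <= r.
Proof.
move=> e0; pose e' := Num.min e 2^-1.
have e'0 : 0 < e' by rewrite lt_min e0 invr_gt0 ltr0n.
have e'2 : e' <= 2^-1 by rewrite ge_min lexx orbT.
have pp : 0 < pi :> R by exact: pi_gt0.
have bnd (t : R) : 0 <= t <= 2^-1 -> 2 * pi * t \in `[0, pi].
  move=> /andP[t0 t2]; rewrite in_itv /= mulr_ge0 ?mulr_ge0 ?(ltW pp)//=.
  rewrite -[leRHS](_ : 2 * pi * 2^-1 = _); last by field.
  by rewrite ler_wpM2l// mulr_ge0// ltW.
exists ((1 + cos (2 * pi * e')) / 2).
  have /andP[-> _] := tker_factor (2 * pi * e') => /=.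
  have lt1 : cos (2 * pi * e') < 1.
    have h0 : (0 : R) \in `[0, pi] by rewrite in_itv /= lexx ltW.
    have h1 : 2 * pi * e' \in `[0, pi] by apply: bnd; rewrite (ltW e'0).
    by rewrite -[ltRHS]cos0 (ltr_cos h0 h1) !mulr_gt0.
  lra.
move=> x hx ex; have [x0|[i xi]] := norm_coord_max x; first by rewrite x0 leNgt e0 in ex.
rewrite /tker (bigD1 i)//=; apply: (@le_trans _ _ ((1 + cos (2 * pi * x i ord0)) / 2)).
  apply: ler_piMr; first by have /andP[] := tker_factor (2 * pi * x i ord0).
  by apply: prodr_ile1 => j _; exact: tker_factor.
have -> : cos (2 * pi * x i ord0) = cos (2 * pi * `|x i ord0|).
  by case: (ger0P (x i ord0)) => _ //; rewrite mulrN cosN.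
have xb : `|x i ord0| <= 2^-1 by rewrite ler_norml; have /andP[-> /ltW ->] := hx i.
rewrite ler_pM2r ?invr_gt0// lerD2l leNgt ltr_cos; last 2 first.
- by apply: bnd; rewrite normr_ge0.
- by apply: bnd; rewrite (ltW e'0).
by rewrite -leNgt ler_pM2l ?mulr_gt0// -xi ge_min ex.
Qed.

Lemma tker_near (r : R) : r < 1 -> exists2 e : R, 0 < e & forall x, `|x| <= e -> r <= tker x.
Proof.
move=> r1; have [s _ Hs] := tpoly_tkerX 1.
have /smoothP[ct _ _] : smooth tker.
  apply: smooth_prod => i; have := smoothM (smoothD (smooth_cst 1) (smooth_cos (2 * pi *: delta_mx i ord0 : V) 1 0)) (smooth_cst 2^-1).
  congr smooth; apply/funext => x; rewrite mul1r addr0 dotZl dotC dot_delta//.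
have /cvgrPdist_lt/(_ (1 - r)) := ct 0; rewrite tker0 subr_gt0 => /(_ r1)/nbhs_ballP[e /= e0 he].
exists (e / 2); first by rewrite divr_gt0.
move=> x xe; have := he x; rewrite -ball_normE /= sub0r normrN.
have xe' : `|x| < e by rewrite (le_lt_trans xe)// ltr_pdivrMr// mulr_natr mulr2n ltrDl.
move=> /(_ xe'); rewrite ger0_norm ?subr_ge0 ?tker_le1//; lra.
Qed.

(** On a small cube around 0 the kernel is at least [r], so the mass decays no faster than r^n, for
    r as close to 1 as desired. Away from 0 the powers decay at a fixed rate below 1 by [tker_away];
    this gap makes the normalized powers an approximate identity. *)
Lemma tmass_lower (r : R) : 0 <= r < 1 -> exists2 c : R, 0 < c & forall n, c * r ^+ n <= tmass n.
Proof.
move=> /andP[r0 r1]; have [e e0 He] := tker_near r1.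
pose e' := Num.min e 4^-1; have e'0 : 0 < e' by rewrite lt_min e0 invr_gt0 ltr0n.
pose a : V := const_mx (- e'); pose b : V := const_mx e'.
have ab i : a i ord0 <= b i ord0 by rewrite !mxE; lra.
exists (\prod_i (b i ord0 - a i ord0)); first by apply: prodr_gt0 => i _; rewrite !mxE; lra.
move=> n; rewrite -lee_fin -tmassE EFinM.
have mc : measurable_fun setT (\1_(cbox a b) : V -> R) by apply: measurable_indic; exact: measurable_cbox.
have -> : (\prod_i (b i ord0 - a i ord0))%:E = nint mu (\1_(cbox a b) : V -> R).
  by rewrite /nint integral_indic ?setIT -?(lebesgue_cbox ab)//; exact: measurable_cbox.
rewrite muleC -nintZ ?exprn_ge0//; apply: nint_le => x; first by rewrite mulr_ge0 ?exprn_ge0.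
rewrite indicE; have [h|h] := boolP (x \in cbox a b); last first.
  by rewrite mulr0 mulr_ge0 ?chi_ge0 ?tker_pow_ge0.
move: h; rewrite inE => h; rewrite mulr1 /chi indicE mem_set ?mul1r.
  rewrite lerXn2r ?nnegrE ?tker_ge0//; apply: He; apply/cV_norm_le; first exact: ltW.
  move=> i; have := h i; rewrite !mxE ler_norml => /andP[h1 h2].
  have : e' <= e by rewrite ge_min lexx.
  by move=> ee; apply/andP; split; lra.
move=> i; have := h i; rewrite !mxE => /andP[h1 h2].
have : e' <= 4^-1 by rewrite ge_min lexx orbT.
by move=> ee; apply/andP; split; lra.
Qed.

Lemma tmass_gt0 n : 0 < tmass n.
Proof.
have [|c c0 /(_ n)] := tmass_lower (r := 2^-1); first by rewrite invr_ge0 ler0n invf_lt1// ltr1n.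
by apply: lt_le_trans; rewrite mulr_gt0// exprn_gt0// invr_gt0.
Qed.

(** The cell is split at distance [dl] from 0. Inside, f differs from f(0) by at most e/2; outside,
    at most 2 M r^n remains, against a total mass of at least c r'^n. *)
Lemma tker_approx f (M : R) : cmeas f -> (forall x, cabs (f x) <= M) -> ccont_at f 0 ->
  cabs ((tmass n)^-1%:C%C * cint mu (fun x => (chi x)%:C%C * ((tker x ^+ n)%:C%C * f x)) - f 0) @[n --> \oo] --> (0 : R).
Proof.
move=> mf fM f0.
have M0 : 0 <= M := le_trans (cabs_ge0 _) (fM 0).
have i1 g n : cmeas g -> (exists M : R, forall x, cabs (g x) <= M) ->
    cL1 mu (fun x => (chi x)%:C%C * ((tker x ^+ n)%:C%C * g x)).
  move=> mg [M' HM']; apply: cL1_chiM; first by apply: cmeasM => //; exact: cmeasR (measurable_tkerX n).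
  exists M' => x; rewrite cabsM cabsR ger0_norm ?tker_pow_ge0// (le_trans _ (HM' x))//.
  by rewrite ler_piMl ?cabs_ge0// tker_pow_le1.
have main n : (cabs ((tmass n)^-1%:C%C * cint mu (fun x => (chi x)%:C%C * ((tker x ^+ n)%:C%C * f x)) - f 0)%R)%:E =
   ((tmass n)^-1%:E * (cabs (cint mu (fun x => (chi x)%:C%C * ((tker x ^+ n)%:C%C * (f x - f 0)))))%:E)%E.
  have bf : exists M : R, forall x, cabs (f x) <= M by exists M.
  have b0 : exists M : R, forall x : V, cabs (f 0) <= M by exists M.
  rewrite -EFinM; congr EFin; rewrite -[X in X * cabs _](@ger0_norm _ (tmass n)^-1) ?invr_ge0 ?(ltW (tmass_gt0 n))//.
  rewrite -cabsR -cabsM; congr cabs.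
  rewrite (_ : (fun x => _ * (_ * (f x - f 0))) = fun x => (chi x)%:C%C * ((tker x ^+ n)%:C%C * f x) - (chi x)%:C%C * ((tker x ^+ n)%:C%C * f 0)); last first.
    by apply/funext => x; rewrite mulrBr mulrBr.
  rewrite cintB; [|exact: i1|by apply: i1 => //; exact: cmeas_cst].
  rewrite mulrBr; congr (_ - _).
  rewrite (_ : (fun x => _) = fun x => f 0 * (chi x * tker x ^+ n)%:C%C); last first.
    by apply/funext => x; rewrite rmorphM; ring.
  rewrite cintZ; last first.
    have b1 : exists M : R, forall x : V, cabs (1 : C) <= M by exists 1 => x; rewrite cabs1.
    have mc1 : cmeas (fun _ : V => (1 : C)) by exact: cmeas_cst.
    have := i1 (fun=> 1) n mc1 b1.
    by congr cL1; apply/funext => x; rewrite mulr1 rmorphM.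
  rewrite (_ : cint mu _ = (tmass n)%:C%C); last first.
    by apply: cplx_eq => //=; rewrite /Rintegral integral0.
  by rewrite mulrCA -rmorphM mulVf ?mulr1// gt_eqF// tmass_gt0.
apply/cvgr0Pnorm_le => e e0; have e2 : 0 < e / 2 by rewrite divr_gt0.
have /nbhs_ballP[dl /= dl0 hdl] := f0 _ e2.
have [r /andP[r0 r1] Hr] := tker_away dl0.
(* Any rate strictly between r and 1 serves. *)
pose r' := (1 + r) / 2; have rr' : r < r' by rewrite /r'; lra.
have r'0 : 0 < r' by lra.
have [|c c0 Hc] := tmass_lower (r := r'); first by rewrite /r'; apply/andP; split; lra.
have lim : geometric (2 * M / c) (r / r') n @[n --> \oo] --> (0 : R).
  have q0 : 0 <= r / r' := divr_ge0 r0 (ltW r'0).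
  by apply: cvg_geometric; rewrite ger0_norm// ltr_pdivrMr// mul1r.
move/cvgr0Pnorm_le : lim => /(_ _ e2)[N _ HN]; exists N => // n /= /HN /= lim.
rewrite ger0_norm ?cabs_ge0// -lee_fin main.
have mass0 := tmass_gt0 n.
have b : exists M : R, forall x, cabs (f x - f 0) <= M.
  by exists (M + M) => x; rewrite (le_trans (cabsD _ _))// cabsN lerD.
have mb : cmeas (fun x => f x - f 0) by apply: cmeasB => //; exact: cmeas_cst.
apply: (@le_trans _ _ ((tmass n)^-1%:E * (e / 2 * tmass n + 2 * M * r ^+ n)%:E)%E).
  apply: lee_wpmul2l; first by rewrite lee_fin invr_ge0 ltW.
  apply: le_trans (cabs_cint_le (i1 _ n mb b)) _.
  have -> : ((e / 2 * tmass n + 2 * M * r ^+ n)%:E = (e / 2)%:E * (tmass n)%:E + (2 * M * r ^+ n)%:E * 1)%E.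
    by rewrite mule1 -EFinM -EFinD.
  have k0 : 0 <= 2 * M * r ^+ n by rewrite !mulr_ge0// exprn_ge0.
  have mck : measurable_fun setT (fun x => chi x * tker x ^+ n).
    by apply: measurable_funM; [exact: measurable_chi|exact: measurable_tkerX].
  have ck0 x : 0 <= chi x * tker x ^+ n by rewrite mulr_ge0 ?chi_ge0 ?tker_pow_ge0.
  rewrite -tmassE -nint_chi -(nintZ _ mck (ltW e2) ck0) -(nintZ _ measurable_chi k0 chi_ge0).
  rewrite -nintD; first last.
  - by move=> x; rewrite mulr_ge0 ?chi_ge0.
  - by move=> x; apply: mulr_ge0; [exact: ltW|exact: ck0].
  - by apply: measurable_funM; [exact: measurable_cst|exact: measurable_chi].
  - by apply: measurable_funM => //; exact: measurable_cst.
  apply: nint_le => x; first exact: cabs_ge0.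
  rewrite !cabsM !cabsR !ger0_norm ?chi_ge0 ?tker_pow_ge0//.
  rewrite [leRHS](_ : _ = chi x * (2 * M * r ^+ n + e / 2 * tker x ^+ n)); last by ring.
  have [hx|hx] := pselect (hcube x); last by rewrite /chi indicE memNset ?mul0r.
  apply: ler_wpM2l; first exact: chi_ge0.
  have [xd|xd] := ltP `|x| dl.
    rewrite ler_wpDl// mulrC ler_wpM2r ?tker_pow_ge0// ltW//; apply: hdl.
    by rewrite -ball_normE /= sub0r normrN.
  apply: (@le_trans _ _ (2 * M * r ^+ n)); last by rewrite lerDl mulr_ge0 ?(ltW e2)// tker_pow_ge0.
  rewrite mulrC; apply: ler_pM; rewrite ?cabs_ge0 ?tker_pow_ge0//.
    by rewrite mulr_natl mulr2n (le_trans (cabsD _ _))// cabsN lerD.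
  by rewrite lerXn2r ?nnegrE ?tker_ge0// Hr.
rewrite -EFinM lee_fin mulrDr [X in X + _](_ : _ = e / 2); last by rewrite mulrC mulfK// gt_eqF.
rewrite [leRHS]splitr lerD2l.
apply: le_trans (le_trans (ler_norm _) lim).
have cr0 : 0 < c * r' ^+ n by rewrite mulr_gt0// exprn_gt0.
rewrite (_ : 2 * M / c * (r / r') ^+ n = (c * r' ^+ n)^-1 * (2 * M * r ^+ n)); last first.
  by rewrite expr_div_n; field; rewrite !gt_eqF// exprn_gt0.
apply: ler_wpM2r; first by rewrite !mulr_ge0// exprn_ge0.
by rewrite lef_pV2 ?posrE.
Qed.

Lemma tpoly_coef s l : cint mu (fun x => (chi x)%:C%C * (tpoly s x * cis (2 * pi * dot (iv (- l)) x))) =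
  (\sum_(p <- s | p.2 == l) p.1)%:C%C.
Proof.
have c1 k : cL1 mu (fun x => (chi x)%:C%C * cis (2 * pi * dot (iv k) x)).
  apply: cL1_chiM; last by exists 1 => x; rewrite cabs_cis.
  have := csmooth_cis (2 * pi *: iv k) 0 => /csmooth_cmeas; congr cmeas.
  by apply/funext => x; rewrite dotZl addr0.
rewrite (_ : (fun x => _) = fun x => \sum_(p <- s) p.1%:C%C * ((chi x)%:C%C * cis (2 * pi * dot (iv (p.2 - l)) x))); last first.
  apply/funext => x; rewrite /tpoly mulr_suml mulr_sumr; apply: eq_bigr => p _.
  have -> : 2 * pi * dot (iv (p.2 - l)) x = 2 * pi * dot (iv p.2) x + 2 * pi * dot (iv (- l)) x.
    by rewrite intvD dotDl mulrDr.
  by rewrite cisD; ring.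
rewrite cint_sum; last by move=> p; apply: cL1Z.
rewrite rmorph_sum [RHS]big_mkcond; apply: eq_bigr => p _.
by rewrite cintZ// cint_chi_cis subr_eq0; case: eqP; rewrite ?mulr1 ?mulr0.
Qed.

(** Averaging the periodization against the normalized n-th power of [tker] gives a finite sum of b
    n k times p k, with 0 <= b n k <= 1 and b n k -> 1. For p >= 0, letting n grow over a fixed
    finite set of k bounds the full sum by the value at 0, and b n k <= 1 gives the converse. *)
Lemma poisson_pos H (p : Z -> R) (M : R) N : cmeas H -> (forall x, cabs (H x) <= M) ->
  (forall x, M < `|x| -> H x = 0) -> (forall x, ccont_at H x) -> (forall k, 0 <= p k) ->
  (forall k, cint mu (fun x => H x * cis (2 * pi * dot (iv k) x)) = (p k)%:C%C) -> M + 1 <= N%:R ->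
  (\esum_(k in [set: Z]) (p k)%:E)%E = (complex.Re (\sum_(k <- zbox N) H (iv k)))%:E.
Proof.
move=> mH HM H0 Hc p0 pE MN; have M0 : 0 <= M := le_trans (cabs_ge0 _) (HM 0).
have H1 : cL1 mu H.
  split => //; apply: le_lt_trans (nint_boxcst M0 M0); apply: nint_le => x; first exact: cabs_ge0.
  by case: ifPn => //; rewrite -ltNge => /H0 ->; rewrite cabs0.
pose f x := \sum_(k <- zbox N) H (x + iv k).
have mf : cmeas f by apply: cmeas_sum => k; exact: cmeas_shift.
have fM x : cabs (f x) <= \sum_(k <- zbox N) M.
  rewrite /f; elim: (zbox N) => [|k s ih]; first by rewrite !big_nil cabs0.
  by rewrite !big_cons (le_trans (cabsD _ _))// lerD.
have fc : ccont_at f 0.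
  rewrite /f; elim: (zbox N) => [|k s ih].
    by move=> e e0; apply: (filterS _ (@filterT _ (nbhs (0 : V)) _)) => y _; rewrite !big_nil subrr cabs0.
  move=> e e0; have e2 : 0 < e / 2 by rewrite divr_gt0.
  have h1 : \forall y \near (0 : V), cabs (H (y + iv k) - H (0 + iv k)) < e / 2.
    have c : {for (0 : V), continuous (fun y : V => y + iv k)}.
      by apply: (@continuousD _ _ _ (fun y : V => y) (cst (iv k))); [exact: cvg_id|exact: cst_continuous].
    exact: (c _ (Hc (0 + iv k) _ e2)).
  have := ih _ e2; apply: filterS2 h1 => y h1 h2; rewrite !big_cons opprD addrACA.
  by rewrite (le_lt_trans (cabsD _ _))// (splitr e) ltrD.
pose a n k := cint mu (fun x => (chi x)%:C%C * ((tker x ^+ n)%:C%C * cis (2 * pi * dot (iv (- k)) x))).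
have mcis k : cmeas (fun x => cis (2 * pi * dot (iv k) x)).
  have := csmooth_cis (2 * pi *: iv k) 0 => /csmooth_cmeas; congr cmeas.
  by apply/funext => x; rewrite dotZl addr0.
have mass n : 0 < tmass n := tmass_gt0 n.
pose b n k := (tmass n)^-1 * complex.Re (a n k).
have b1 n k : b n k <= 1.
  rewrite /b mulrC ler_pdivrMr// mul1r -lee_fin -tmassE.
  have i1 : cL1 mu (fun x => (chi x)%:C%C * ((tker x ^+ n)%:C%C * cis (2 * pi * dot (iv (- k)) x))).
    apply: cL1_chiM; first by apply: cmeasM => //; exact: cmeasR (measurable_tkerX n).
    by exists 1 => x; rewrite cabsM cabs_cis mulr1 cabsR ger0_norm ?tker_pow_ge0 ?tker_pow_le1.
  apply: le_trans (le_trans (_ : _ <= (cabs (a n k))%:E)%E (cabs_cint_le i1)) _.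
    by rewrite lee_fin (le_trans (ler_norm _))// normRe_le.
  apply: nint_le => x; first exact: cabs_ge0.
  by rewrite !cabsM cabs_cis mulr1 !cabsR !ger0_norm ?chi_ge0 ?tker_pow_ge0.
have bc k : b n k @[n --> \oo] --> (1 : R).
  have cc : ccont_at (fun x => cis (2 * pi * dot (iv (- k)) x)) 0.
    apply: csmooth_ccont; have := csmooth_cis (2 * pi *: iv (- k)) 0; congr csmooth.
    by apply/funext => x; rewrite dotZl addr0.
  have bd x : cabs (cis (2 * pi * dot (iv (- k)) x)) <= (1 : R) by rewrite cabs_cis.
  have := tker_approx (mcis (- k)) bd cc; rewrite dot0r mulr0 cis0 => lim.
  apply/subr_cvg0; apply: norm_cvg0; apply: cvg_squeeze0 lim => n.
  rewrite normr_ge0 /= (le_trans _ (normRe_le _))// cReD cReN cReM mul0r subr0.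
  exact: lexx.
have aE n : exists2 S : seq Z, uniq S & [/\ forall k, 0 <= complex.Re (a n k),
    forall k, k \notin S -> complex.Re (a n k) = 0 &
    complex.Re (cint mu (fun x => H x * (tker x ^+ n)%:C%C)) = \sum_(k <- S) complex.Re (a n k) * p k].
  have [s ps Hs] := tpoly_tkerX n.
  have aE k : a n k = (\sum_(q <- s | q.2 == k) q.1)%:C%C.
    rewrite -tpoly_coef; congr cint; apply/funext => x; by rewrite Hs.
  exists (undup [seq q.2 | q <- s]); first exact: undup_uniq.
  split=> [k|k|].
  - by rewrite aE /= big_seq_cond sumr_ge0// => q /andP[qs _]; exact: (allP ps).
  - rewrite mem_undup aE /= => kS; rewrite big_seq_cond big1// => q /andP[qs /eqP qk].
    by case/negP: kS; rewrite -qk; exact: map_f.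
  rewrite (_ : (fun x => _) = fun x => \sum_(q <- s) q.1%:C%C * (H x * cis (2 * pi * dot (iv q.2) x))); last first.
    by apply/funext => x; rewrite -Hs /tpoly mulr_sumr; apply: eq_bigr => q _; rewrite mulrCA.
  rewrite cint_sum; last by move=> q; apply: cL1Z; exact: cL1_ifourier.
  rewrite (eq_bigr (fun q => (q.1 * p q.2)%:C%C)); last first.
    by move=> q _; rewrite (cintZ _ (cL1_ifourier (iv q.2) H1)) pE rmorphM.
  transitivity (\sum_(q <- s) q.1 * p q.2); first by rewrite -rmorph_sum.
  rewrite (eq_bigr (fun k => \sum_(q <- s) if q.2 == k then q.1 * p k else 0)); last first.
    by move=> k _; rewrite aE /= mulr_suml big_mkcond.
  rewrite exchange_big /= [LHS]big_seq [RHS]big_seq; apply: eq_bigr => q qs.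
  rewrite (bigD1_seq q.2) ?undup_uniq ?mem_undup ?map_f//= eqxx big1 ?addr0// => k.
  by rewrite eq_sym => /negPf ->.
(* Computed in two ways: on the cell, where it tends to the periodization at 0, and through the
   Fourier coefficients of the kernel. *)
pose L n := (tmass n)^-1 * complex.Re (cint mu (fun x => H x * (tker x ^+ n)%:C%C)).
have Lc : L n @[n --> \oo] --> complex.Re (f 0).
  have lim := tker_approx mf fM fc.
  apply/subr_cvg0; apply: norm_cvg0; apply: cvg_squeeze0 lim => n.
  have Hp : periodic (fun x => (tker x ^+ n)%:C%C) by move=> x k; rewrite tkerX_period.
  have i1 : cL1 mu (fun x => H x * (tker x ^+ n)%:C%C).
    apply: (@cL1_prod_bounded _ _ H (fun x => (tker x ^+ n)%:C%C) 1 H1); first exact: cmeasR (measurable_tkerX n).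
    by move=> x; rewrite cabsR ger0_norm ?tker_pow_ge0 ?tker_pow_le1.
  have [E _] := unfold i1 Hp H0 MN.
  rewrite normr_ge0 /= /L E (le_trans _ (normRe_le _))// cReD cReN cReM mul0r subr0.
  by under [in leRHS]eq_fun do rewrite [(tker _ ^+ n)%:C%C * _]mulrC.
have f0E : f 0 = \sum_(k <- zbox N) H (iv k) by apply: eq_bigr => k _; rewrite add0r.
have b0 n k : 0 <= b n k.
  by have [S _ [a0 _ _]] := aE n; rewrite mulr_ge0// invr_ge0 ltW.
have LE n : exists2 S : seq Z, uniq S & (forall k, k \notin S -> b n k = 0) /\ L n = \sum_(k <- S) b n k * p k.
  have [S uS [_ aS LS]] := aE n; exists S => //; split=> [k /aS|]; first by rewrite /b => ->; rewrite mulr0.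
  by rewrite /L LS mulr_sumr; apply: eq_bigr => k _; rewrite mulrA.
have sum_le (X S : seq Z) (F : Z -> R) : uniq X -> uniq S -> (forall k, 0 <= F k) ->
    (forall k, k \notin S -> F k = 0) -> \sum_(k <- X) F k <= \sum_(k <- S) F k.
  move=> uX uS F0 FS; rewrite [leRHS](bigID (mem X)) /= ler_wpDr ?sumr_ge0//.
  rewrite [leLHS](bigID (mem S)) /= [X in _ + X]big1 ?addr0 => [|k /FS//].
  rewrite -big_filter -[leRHS]big_filter (perm_big [seq k <- S | k \in X])//.
  by apply: uniq_perm; rewrite ?filter_uniq// => k; rewrite !mem_filter andbC.
rewrite -f0E; apply/eqP; rewrite eq_le; apply/andP.
have up : (\esum_(k in [set: Z]) (p k)%:E <= (complex.Re (f 0))%:E)%E.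
  apply: ge_ereal_sup => _ [A [finA _] <-]; rewrite fsbig_finite//= sumEFin lee_fin.
  set X := finmap.enum_fset _; have uX : uniq X by exact: fset_uniq.
  have c1 : \sum_(k <- X) b n k * p k @[n --> \oo] --> \sum_(k <- X) p k.
    elim: (X) => [|k s ih]; first by under eq_fun do rewrite big_nil; rewrite big_nil; exact: cvg_cst.
    under eq_fun do rewrite big_cons; rewrite big_cons; apply: cvgD => //.
    by rewrite -[X in _ --> X]mul1r; apply: cvgMl; exact: bc.
  rewrite -(cvg_lim _ c1)// -(cvg_lim _ Lc)//; apply: ler_lim.
  - by apply/cvg_ex; eexists; exact: c1.
  - by apply/cvg_ex; eexists; exact: Lc.
  - apply: nearW => n; have [S uS [bS ->]] := LE n; apply: sum_le => // k; first exact: mulr_ge0.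
    by move=> /bS ->; rewrite mul0r.
split => //.
have es0 : (0 <= \esum_(k in [set: Z]) (p k)%:E)%E by apply: esum_ge0 => k _; rewrite lee_fin.
have fin : (\esum_(k in [set: Z]) (p k)%:E)%E \is a fin_num.
  by rewrite ge0_fin_numE// (le_lt_trans up)// ltry.
rewrite -(fineK fin) lee_fin -(cvg_lim _ Lc)//; apply: limr_le; first by apply/cvg_ex; eexists; exact: Lc.
apply: nearW => n; have [S uS [_ ->]] := LE n.
apply: (@le_trans _ _ (\sum_(k <- S) p k)); first by apply: ler_sum => k _; rewrite ler_piMl.
rewrite -lee_fin fineK// -sumEFin; apply: esum_ge.
exists [set` S]; first by split => //; exact: finite_seq.
by rewrite -fsbig_seq.
Qed.

End poisson.

Lemma esumZ (X : choiceType) (R : realType) (D : set X) (c : R) (a : X -> \bar R) :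
  countable D -> 0 <= c -> (forall x, (0 <= a x)%E) ->
  (\esum_(x in D) (c%:E * a x) = c%:E * \esum_(x in D) a x)%E.
Proof.
move=> cD c0 a0; have [e eP] := countable_enum cD.
rewrite 2?(esum_enum eP)//; last first.
  by move=> x; rewrite mule_ge0// lee_fin.
rewrite -ge0_integralZl_EFin//=.
- by apply: eq_integral => n _; case: (e n) => [x|] //=; rewrite mule0.
- by move=> n _; case: (e n) => /=.
Qed.

Lemma csum_seq (X : choiceType) (R : realType) (s : seq X) (a : X -> R[i]) :
  countable [set: X] -> uniq s -> (forall x, x \notin s -> a x = 0) ->
  csum setT a = \sum_(x <- s) a x /\ csummable setT a.
Proof.
move=> cX us as0.
have E : (fun x => if x \in [fset y in s]%fset then a x else 0) = a.
  by apply/funext => x; rewrite inE; case: ifPn => // /as0.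
have S := csummable_fset [fset y in s]%fset a; rewrite E in S; split => //.
have := csum_fset [fset y in s]%fset a cX; rewrite E => ->.
apply: perm_big; apply: uniq_perm; rewrite ?fset_uniq// => x.
by rewrite inE.
Qed.

(** * Parseval's identity over a lattice *)

Section lattice_parseval.
Context {R : realType} {d : nat}.
Local Notation C := R[i].
Local Notation V := 'cV[R]_d.
Local Notation Z := 'cV[int]_d.
Local Notation mu := (@lebesgue_cV R d).
Implicit Types (f Psi : V -> C) (x y z xi zeta alpha : V) (k n : Z) (A : 'M[R]_d).
Local Notation iv := (@intv R d).

Lemma mulmx_bound A : exists2 c : R, 0 < c & forall x, `|A *m x| <= c * `|x|.
Proof.
pose c := 1 + \sum_i \sum_j `|A i j|.
have c0 : 0 < c by rewrite ltr_pwDl// sumr_ge0// => i _; exact: sumr_ge0.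
exists c => // x; apply/cV_norm_le => [|i]; first by rewrite mulr_ge0// ltW.
rewrite mxE (le_trans (ler_norm_sum _ _ _))//.
apply: (@le_trans _ _ (\sum_j `|A i j| * `|x|)).
  by apply: ler_sum => j _; rewrite normrM ler_wpM2l// cV_norm_coord.
rewrite -mulr_suml ler_wpM2r// /c ler_wpDl//.
by rewrite [leRHS](bigD1 i)//= lerDl sumr_ge0// => j _; exact: sumr_ge0.
Qed.

Lemma Ccinfty_lipschitz U Psi : Ccinfty U Psi -> exists2 L : R, 0 < L &
  forall x y, cabs (Psi x - Psi y) <= L * `|x - y|.
Proof. by move=> cP; rewrite -(ifourierK cP); apply: fourier_lipschitz; exact: rapid_ifourier cP. Qed.

Section autocorrelation.
Variables (f : V -> C) (M L : R).
Hypotheses (f1 : cL1 mu f) (M0 : 0 <= M) (fM : forall x, cabs (f x) <= M) (fs : forall x, M < `|x| -> f x = 0).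
Hypotheses (L0 : 0 <= L) (fL : forall x y, cabs (f x - f y) <= L * `|x - y|).

Definition autocor z : C := cint mu (fun y => f (y + z) * ((f y)^*)%C).

Let mf : cmeas f. Proof. by case: f1. Qed.

Let fc1 z : cL1 mu (fun y => f (y + z) * ((f y)^*)%C).
Proof.
rewrite (_ : (fun y => _) = fun y => ((f y)^*)%C * f (y + z)); last by apply/funext => y; rewrite mulrC.
by apply: (cL1_prod_bounded (M := M)); [exact: cL1_conj|exact: cmeas_shift|].
Qed.

Let I1 : R := fine (nint mu (fun y => cabs (f y))).

Let I1E : nint mu (fun y => cabs (f y)) = I1%:E.
Proof.
rewrite /I1 fineK// ge0_fin_numE; first by case: f1.
by apply: nint_ge0 => x; exact: cabs_ge0.
Qed.

Let I10 : 0 <= I1. Proof. by rewrite fine_ge0// nint_ge0// => x; exact: cabs_ge0. Qed.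

Lemma cmeas_prod_add (T := [the measurableType _ of (V * V)%type]) : cmeas (fun z : V * V => f (z.1 + z.2)).
Proof.
apply: (cmeas_comp mf (g := fun z : V * V => z.1 + z.2)).
apply: measurable_cV => i; under eq_fun do rewrite mxE.
by apply: measurable_funD;
  [exact: (measurableT_comp (measurable_coord i) measurable_fst)|
   exact: (measurableT_comp (measurable_coord i) measurable_snd)].
Qed.

Lemma autocor_bound z : cabs (autocor z) <= M * I1.
Proof.
rewrite -lee_fin; apply: le_trans (cabs_cint_le (fc1 z)) _.
rewrite EFinM -I1E -nintZ//; last by move=> x; exact: cabs_ge0.
  by apply: nint_le => x; rewrite ?cabs_ge0// cabsM cabs_conj ler_wpM2r ?cabs_ge0.
exact: measurable_cabs.
Qed.

Lemma autocor_support z : M + M < `|z| -> autocor z = 0.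
Proof.
move=> zM; rewrite /autocor (_ : (fun y => _) = fun=> 0) ?cint0//; apply/funext => y.
have [yM|/fs ->] := leP `|y| M; last by rewrite (_ : (0^*)%C = 0 :> C) ?mulr0// rmorph0.
rewrite fs ?mul0r//; have : `|z| <= `|y + z| + `|y|.
  by have := ler_normB (y + z) y; rewrite addrAC subrr add0r.
lra.
Qed.

Lemma autocor_lipschitz z w : cabs (autocor z - autocor w) <= L * I1 * `|z - w|.
Proof.
rewrite /autocor -cintB// -lee_fin; apply: le_trans (cabs_cint_le (cL1B (fc1 z) (fc1 w))) _.
rewrite mulrAC EFinM -I1E -nintZ ?mulr_ge0//; last by move=> x; exact: cabs_ge0.
  apply: nint_le => x; first exact: cabs_ge0.
  rewrite -mulrBl cabsM cabs_conj ler_wpM2r ?cabs_ge0// (le_trans (fL _ _))//.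
  by rewrite opprD addrACA subrr add0r.
exact: measurable_cabs.
Qed.

Lemma autocor_ccont z : ccont_at autocor z.
Proof.
move=> e e0; have c0 : 0 < L * I1 + 1 by rewrite ltr_wpDl// mulr_ge0.
have e1 : 0 < e / (L * I1 + 1) by rewrite divr_gt0.
have : nbhs z (ball z (e / (L * I1 + 1))) by exact: nbhsx_ballx.
apply: filterS => y; rewrite -ball_normE /= distrC => h.
apply: le_lt_trans (autocor_lipschitz _ _) _.
rewrite ltr_pdivlMr// mulrC in h; apply: le_lt_trans h.
by rewrite ler_wpM2r// lerDl.
Qed.

Lemma cmeas_autocor : cmeas autocor.
Proof.
have c (p : C -> R) : (forall z w : C, p (z - w) = p z - p w) -> (forall z : C, `|p z| <= cabs z) ->
    continuous (fun z : V => p (autocor z) : R).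
  move=> pB pc x; apply/(@cvgrPdist_lt _ _ _ _ (@nbhs_filter V x)) => e e0.
  by have := autocor_ccont x e0; apply: filterS => y h; rewrite distrC -pB (le_lt_trans (pc _)).
split; apply: continuous_measurable_cV.
  by apply: (c (@complex.Re R)) => [z w|z]; rewrite ?normRe_le// cReD cReN.
by apply: (c (@complex.Im R)) => [z w|z]; rewrite ?normIm_le// cImD cImN.
Qed.

(** The autocorrelation is [f] convolved with its reflected conjugate, so Fubini factors the
    transform into a number and its conjugate. This supplies the nonnegativity on which
    [poisson_pos] rests. *)
Lemma ifourier_autocor x : ifourier autocor x = (cabs (ifourier f x) ^+ 2)%:C%C.
Proof.
pose F (z : V * V) : C := f (z.1 + z.2) * ((f z.1)^*)%C * cis (2 * pi * dot z.2 x).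
have mF : cmeas F.
  apply: cmeasM; first apply: cmeasM; first exact: cmeas_prod_add.
    by apply: cmeas_conj; apply: cmeas_comp mf _; exact: measurable_fst.
  exact: (cmeas_comp (f := fun y => cis (2 * pi * dot y x)) (cmeas_cis (measurable_dotl _ _)) measurable_snd).
have i1 y : nint mu (fun z => cabs (F (y, z))) = (cabs (f y) * I1)%:E.
  rewrite (@nint_eq _ _ _ _ _ (fun z => cabs (f y) * cabs (f (z + y)))); last first.
    by move=> z; rewrite /F !cabsM cabs_conj cabs_cis mulr1 mulrC addrC.
  have ms : measurable_fun setT (fun z => cabs (f (z + y))) by apply: measurable_cabs; exact: cmeas_shift.
  rewrite (nintZ _ ms (cabs_ge0 _)); last by move=> z; exact: cabs_ge0.
  rewrite (nint_shift (u := fun z => cabs (f z))) ?I1E// => [|z]; [exact: measurable_cabs|exact: cabs_ge0].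
have fin : (\int[mu]_y nint mu (fun z => cabs (F (y, z))) < +oo)%E.
  under eq_integral do rewrite i1 mulrC.
  have := nintZ mu (measurable_cabs mf) I10 (fun x => cabs_ge0 (f x)).
  by rewrite /nint => ->; rewrite -/(nint mu (fun x => cabs (f x))) I1E -EFinM ltry.
have [_ _ E] := cfubini mF fin.
rewrite ifourierE; transitivity (cint mu (fun z => cint mu (fun y => F (y, z)))).
  congr cint; apply/funext => z; rewrite /autocor mulrC -(cintZ _ (fc1 z)); congr cint; apply/funext => y.
  by rewrite mulrC /F /= dotC.
have f1x := cL1_ifourier x f1.
rewrite -E; transitivity (cint mu (fun y => ifourier f x * ((f y * cis (2 * pi * dot x y))^*)%C)).
  congr cint; apply/funext => y.
  rewrite mulrC ifourierE -(cint_shift y f1x) -(cintZ _ (cL1_shift y f1x)).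
  congr cint; apply/funext => z; rewrite /F /= conjCM conj_cis.
  rewrite (_ : cis (2 * pi * dot z x) = cis (2 * pi * dot x (z + y)) * cis (- (2 * pi * dot x y))).
    by rewrite (addrC y); ring.
  by rewrite -cisD dotDr (dotC z); congr cis; ring.
by rewrite (cintZ _ (cL1_conj f1x)) (cint_conj f1x) -ifourierE mulC_conj.
Qed.

End autocorrelation.

Definition lattice_pt A n : V := (invmx A)^T *m iv n.

Lemma lattice_pt_inj A : A \in unitmx -> injective (lattice_pt A).
Proof.
move=> uA m n; rewrite /lattice_pt => E.
have /colP H : iv m = iv n.
  have uT : (invmx A)^T \in unitmx by rewrite unitmx_tr unitmx_inv.
  by rewrite -[LHS](mulKmx uT) E mulKmx.
by apply/colP => i; have := H i; rewrite !mxE => /intr_inj.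
Qed.

Lemma dual_lattice_bij A : A \in unitmx -> set_bij [set: Z] (dual_lattice A) (lattice_pt A).
Proof.
move=> uA; split.
- by move=> n _; exists n.
- by move=> m n _ _; exact: lattice_pt_inj.
- by move=> x [n ->]; exists n.
Qed.

(* Poisson summation for the autocorrelation of Psi over the lattice A Z^d *)
Lemma lattice_parseval U Psi A : Ccinfty U Psi -> A \in unitmx ->
  (\esum_(k in [set: Z]) (cabs (ifourier Psi (A *m iv k)) ^+ 2)%:E)%E =
  (`|\det A|^-1 * complex.Re (csum (dual_lattice A) (fun alpha =>
     cint mu (fun xi => Psi (xi + alpha) * ((Psi xi)^*)%C))))%:E /\
  csummable (dual_lattice A) (fun alpha => cint mu (fun xi => Psi (xi + alpha) * ((Psi xi)^*)%C)).
Proof.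
move=> cP uA; pose B := (invmx A)^T.
have uB : B \in unitmx by rewrite unitmx_tr unitmx_inv.
have P1 := Ccinfty_cL1 cP; have [M1 M10 HM1] := Ccinfty_box cP; have [L1 L10 HL1] := Ccinfty_lipschitz cP.
(* The substitution by [B], the inverse transpose of [A], reduces the lattice A Z^d to Z^d. *)
pose f y := Psi (B *m y).
have f1 : cL1 mu f by exact: cL1_mulmx.
have [c1 c10 Hc1] := mulmx_bound A^T; have [c2 c20 Hc2] := mulmx_bound B.
have AB x : A^T *m (B *m x) = x by rewrite mulmxA /B -trmx_mul mulVmx// trmx1 mul1mx.
pose M := Num.max M1 (c1 * M1).
have M0 : 0 <= M by rewrite le_max M10.
have fM x : cabs (f x) <= M by rewrite le_max (HM1 _).1.
have fs x : M < `|x| -> f x = 0.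
  rewrite gt_max => /andP[_ xM]; apply: (HM1 _).2; rewrite -(ltr_pM2l c10).
  by apply: lt_le_trans xM _; rewrite -{1}(AB x).
have L0 : 0 <= L1 * c2 by rewrite mulr_ge0// ltW.
have fL x y : cabs (f x - f y) <= L1 * c2 * `|x - y|.
  by rewrite (le_trans (HL1 _ _))// -mulrA ler_wpM2l ?(ltW L10)// -mulmxBr.
have dB : `|\det B|^-1 = `|\det A| by rewrite det_tr det_inv normfV invrK.
have detA : 0 < `|\det A| by rewrite normr_gt0 -unitfE -unitmxE.
have fE k : ifourier f (iv k) = `|\det A|%:C%C * ifourier Psi (A *m iv k).
  rewrite !ifourierE -dB -(cint_mulmx uB (cL1_ifourier (A *m iv k) P1)).
  by congr cint; apply/funext => y; rewrite dot_mulmx AB.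
have aE n : autocor f (iv n) = `|\det A|%:C%C * cint mu (fun xi => Psi (xi + lattice_pt A n) * ((Psi xi)^*)%C).
  rewrite -dB -(cint_mulmx uB); last first.
    have [mP _] := P1; under eq_fun do rewrite mulrC.
    apply: (cL1_prod_bounded (M := M1) (cL1_conj P1)); first exact: cmeas_shift.
    by move=> x; have [] := HM1 (x + lattice_pt A n).
  by congr cint; apply/funext => y; rewrite /f mulmxDr.
pose a n := cint mu (fun xi => Psi (xi + lattice_pt A n) * ((Psi xi)^*)%C).
pose K : R := M * fine (nint mu (fun y => cabs (f y))).
(* [M + M] bounds the support of the autocorrelation and [K] its modulus; [poisson_pos] takes one
   constant for both. *)
pose MM := Num.max (M + M) K; pose N := (Num.truncn (MM + 1)).+1.
have MN : MM + 1 <= N%:R by rewrite ltW// truncnS_gt.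
have bij := dual_lattice_bij uA.
have ak n : n \notin zbox N -> a n = 0.
  move=> nN; have : autocor f (iv n) = 0.
    apply: (autocor_support fs); rewrite ltNge; apply/negP => nM; case/negP: nN.
    apply: mem_zbox => i; rewrite -(ler_int R) intr_norm.
    have := cV_norm_coord (iv n) i; rewrite mxE => /le_trans; apply.
    apply: le_trans nM _; rewrite -pmulrn; apply: le_trans MN.
    by rewrite -[leLHS]addr0 lerD// le_max lexx.
  rewrite aE => /eqP; rewrite mulf_eq0 => /orP[|/eqP//].
  by move=> /eqP/(congr1 (@complex.Re R))/= d0; move: detA; rewrite d0 ltxx.
have [sE sS] := csum_seq (countableP _) (uniq_zbox N) ak.
split; last first.
  rewrite /csummable (reindex_esum setT _ (lattice_pt A))//; exact: sS.
rewrite (csum_reindex _ bij) -[_ \o _]/a sE.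
have p0 k : 0 <= cabs (ifourier f (iv k)) ^+ 2 by exact: sqr_ge0.
have pE k : cint mu (fun x => autocor f x * cis (2 * pi * dot (iv k) x)) = (cabs (ifourier f (iv k)) ^+ 2)%:C%C.
  by rewrite -(ifourier_autocor f1 fM) ifourierE.
have E : (\esum_(k in [set: Z]) (cabs (ifourier f (iv k)) ^+ 2)%:E)%E =
    (complex.Re (\sum_(k <- zbox N) autocor f (iv k)))%:E.
  apply: (@poisson_pos _ _ _ _ MM) => //.
  - by apply: cmeas_autocor fL.
  - by move=> z; rewrite (le_trans (autocor_bound f1 M0 fM z))// le_max lexx orbT.
  - by move=> z; rewrite gt_max => /andP[zM _]; exact: (autocor_support fs).
  - by apply: autocor_ccont fL.
have d2 : 0 <= `|\det A| ^- 2 by rewrite invr_ge0 sqr_ge0.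
have -> : (\esum_(k in [set: Z]) (cabs (ifourier Psi (A *m iv k)) ^+ 2)%:E)%E =
    (\esum_(k in [set: Z]) ((`|\det A| ^- 2)%:E * (cabs (ifourier f (iv k)) ^+ 2)%:E))%E.
  apply: eq_esum => k _; rewrite -EFinM fE cabsM cabsR normr_id exprMn mulrA mulVf ?mul1r//.
  by rewrite expf_neq0// gt_eqF.
rewrite (esumZ (countableP _) d2) ?E; last by move=> k; rewrite lee_fin.
rewrite -EFinM; congr EFin.
rewrite (eq_bigr _ (fun n _ => aE n)) -mulr_sumr.
set X := \sum_(_ <- _) _.
have -> : complex.Re (`|\det A|%:C%C * X) = `|\det A| * complex.Re X by case: X => a1 b1 /=; rewrite mul0r subr0.
have dn : `|\det A| != 0 by rewrite gt_eqF.
by field.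
Qed.

End lattice_parseval.

Section esum_extra.
Context {R : realType} (X : choiceType).
Implicit Types (D : set X).

Lemma ae_countable dT (T : measurableType dT) (m : {measure set T -> \bar R}) D (P : X -> T -> Prop) :
  countable D -> (forall x, D x -> {ae m, forall t, P x t}) -> {ae m, forall t, forall x, D x -> P x t}.
Proof.
move=> cD aeP; have [e [eD De _]] := countable_enum cD.
have : {ae m, forall t, forall n, forall x, e n = Some x -> P x t}.
  apply/ae_foralln => n; case E : (e n) => [x|]; last by apply: aeW => t x.
  by have := aeP x (eD _ _ E); apply: filterS => t Pt y [<-].
by apply: filterS => t h x /De[n /h].
Qed.

Lemma csum_conjE D (a : X -> R[i]) : csum D (fun x => ((a x)^*)%C) = ((csum D a)^*)%C.
Proof.
apply: cplx_eq => /=; rewrite /rsum.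
  by congr (fine _ - fine _); apply: eq_esum => x _; case: (a x).
rewrite opprB; congr (fine _ - fine _); apply: eq_esum => x _; case: (a x) => //= u v.
by rewrite opprK.
Qed.

(** AM-GM in each term with a parameter l, then l = (r + e)/s; the e > 0 keeps l positive when q =
    0. *)
Lemma esum_cauchy_schwarz D (a y w : X -> R) (s q : R) :
  (forall x, 0 <= a x) -> (forall x, 0 <= y x) -> (forall x, 0 < w x) -> 0 < s -> 0 <= q ->
  countable D ->
  (\esum_(x in D) (a x * w x)%:E <= s%:E)%E ->
  (\esum_(x in D) (a x * (w x)^-1 * y x ^+ 2)%:E <= q%:E)%E ->
  (\esum_(x in D) (a x * y x)%:E <= (Num.sqrt (s * q))%:E)%E.
Proof.
move=> a0 y0 w0 s0 q0 cD hs hq; apply/lee_addgt0Pr => e e0.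
set r := Num.sqrt (s * q); have r0 : 0 <= r := sqrtr_ge0 _.
have r2 : r ^+ 2 = s * q by rewrite sqr_sqrtr// mulr_ge0// ltW.
pose l := (r + e) / s; have l0 : 0 < l by rewrite divr_gt0// ltr_wpDl.
apply: (@le_trans _ _ (\esum_(x in D) ((l / 2)%:E * (a x * w x)%:E +
    (l^-1 / 2)%:E * (a x * (w x)^-1 * y x ^+ 2)%:E)))%E.
  apply: le_esum => x Dx; rewrite -!EFinM -EFinD lee_fin.
  have -> : l / 2 * (a x * w x) + l^-1 / 2 * (a x * (w x)^-1 * y x ^+ 2) =
      a x * y x + a x / 2 / l / w x * (l * w x - y x) ^+ 2.
    by have := lt0r_neq0 l0; have := lt0r_neq0 (w0 x) => hw hl; field; apply/andP.
  rewrite lerDl mulr_ge0 ?sqr_ge0// !divr_ge0// ltW// ltr_wpDl//.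
have wi x : 0 <= (w x)^-1 by rewrite invr_ge0 ltW.
rewrite esumD => [|x _|x _]; last 2 first.
- by rewrite -EFinM lee_fin; apply: mulr_ge0; [rewrite divr_ge0// ltW|rewrite mulr_ge0// ltW].
- by rewrite -EFinM lee_fin; apply: mulr_ge0; [rewrite divr_ge0// invr_ge0 ltW|rewrite !mulr_ge0 ?sqr_ge0].
rewrite !esumZ//; last 4 first.
- by rewrite divr_ge0// invr_ge0 ltW.
- by move=> x; rewrite lee_fin !mulr_ge0 ?sqr_ge0.
- by rewrite divr_ge0// ltW.
- by move=> x; rewrite lee_fin mulr_ge0// ltW.
apply: (@le_trans _ _ ((l / 2)%:E * s%:E + (l^-1 / 2)%:E * q%:E)%E).
  by apply: leeD; apply: lee_wpmul2l => //; rewrite lee_fin divr_ge0// ?invr_ge0 ltW.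
rewrite -!EFinM -!EFinD lee_fin /l invf_div.
have re : 0 < r + e by rewrite ltr_wpDl.
rewrite -(ler_pM2r re) mulrDl.
have -> : s / (r + e) / 2 * q * (r + e) = (s * q) / 2 by have := lt0r_neq0 re => h; field.
have -> : (r + e) / s / 2 * s * (r + e) = (r + e) ^+ 2 / 2 by have := lt0r_neq0 s0 => h; field.
by rewrite -r2; nra.
Qed.

End esum_extra.

(** * Schur's test *)

Section schur.
Context {R : realType} {d : nat}.
Local Notation C := R[i].
Local Notation V := 'cV[R]_d.
Local Notation mu := (@lebesgue_cV R d).

Definition shift_op (L : set V) (t : V -> V -> C) (F : V -> C) : V -> C :=
  fun xi => csum L (fun alpha => ((t alpha xi)^*)%C * F (xi + alpha)).

Variables (L : set V) (t : V -> V -> C) (v0 : V -> R) (s c : R).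
Hypotheses (cL : countable L) (LN : forall alpha, L alpha -> L (- alpha)) (mt : forall alpha, cmeas (t alpha)).
Hypothesis tN : forall alpha xi, cabs (t alpha (xi - alpha)) = cabs (t (- alpha) xi).
Hypotheses (v00 : forall alpha, 0 < v0 alpha) (v0N : forall alpha, v0 (- alpha) = v0 alpha) (s0 : 0 < s) (c0 : 0 < c).
Hypothesis ts : {ae mu, forall xi, (\esum_(alpha in L) (cabs (t alpha xi) * v0 alpha)%:E <= s%:E)%E}.
Variable u : V -> R.
Hypotheses (mu_ : measurable_fun setT u) (u0 : {ae mu, forall xi, 0 < u xi}).
Hypothesis uv : forall alpha, L alpha -> {ae mu, forall xi, u xi <= c * u (xi + alpha) * v0 alpha}.

Lemma cmeas_shift_op F : cmeas F -> cmeas (shift_op L t F).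
Proof.
move=> mF; apply: (cmeas_csum (f := fun alpha xi => ((t alpha xi)^*)%C * F (xi + alpha))) => // alpha.
by apply: cmeasM; [exact: cmeas_conj|exact: cmeas_shift].
Qed.

Let q F alpha xi := u xi ^+ 2 * (cabs (t alpha xi) * (v0 alpha)^-1 * cabs (F (xi + alpha)) ^+ 2).

Let q0 F alpha xi : 0 <= q F alpha xi.
Proof. by rewrite /q mulr_ge0 ?sqr_ge0// mulr_ge0 ?sqr_ge0// mulr_ge0 ?cabs_ge0// invr_ge0 ltW. Qed.

Let mq F alpha : cmeas F -> measurable_fun setT (q F alpha).
Proof.
move=> mF; apply: measurable_funM; first exact: measurable_funX.
apply: measurable_funM; first by apply: measurable_funM => //; exact: measurable_cabs.
by apply: measurable_cabs2; exact: cmeas_shift.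
Qed.

Let cmuF F : cmeas F -> cmeas (fun x => (u x)%:C%C * F x).
Proof. by move=> mF; apply: cmeasM => //; exact: cmeasR. Qed.

(** Moderateness of [u], used squared, trades u(xi)^2/v0 for c^2 u(xi + alpha)^2 v0. Translation by
    alpha then turns the coefficient t_alpha into t_(-alpha) by [tN], and reindexing by alpha ->
    -alpha leaves the weighted row sum, bounded by [s]. *)
Lemma schur_quadratic F : cmeas F ->
  ((\int[mu]_xi \esum_(alpha in L) (q F alpha xi)%:E) <=
   (c ^+ 2 * s)%:E * n2 mu (fun x => (u x)%:C%C * F x)%R)%E.
Proof.
move=> mF; rewrite nint_esum//; last by move=> alpha; exact: mq.
pose p alpha xi := c ^+ 2 * (cabs (t alpha xi) * v0 alpha * cabs ((u xi)%:C%C * F xi) ^+ 2).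
have p0 alpha xi : 0 <= p alpha xi.
  by rewrite mulr_ge0 ?sqr_ge0// mulr_ge0 ?sqr_ge0// mulr_ge0 ?cabs_ge0// ltW.
have mp alpha : measurable_fun setT (p alpha).
  apply: measurable_funM => //; apply: measurable_funM; last exact: measurable_cabs2 (cmuF mF).
  by apply: measurable_funM => //; exact: measurable_cabs.
have qp alpha : L alpha -> (nint mu (q F alpha) <= nint mu (p (- alpha)%R))%E.
  move=> La; rewrite -(nint_shift alpha (mp _) (p0 _)).
  apply: nint_le_ae => //; apply: filterS2 u0 (uv La) => xi u1 u2.
  rewrite /q /p -tN addrK v0N cabsM cabsR exprMn.
  have -> : `|u (xi + alpha)| ^+ 2 = u (xi + alpha) ^+ 2 by rewrite real_normK// num_real.
  set T := cabs _; set G := cabs _ ^+ 2; set U := u (xi + alpha) in u2 *; set w := v0 alpha.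
  have w0 : 0 < w by exact: v00.
  have T0 : 0 <= T by exact: cabs_ge0.
  have G0 : 0 <= G by exact: sqr_ge0.
  have -> : c ^+ 2 * (T * w * (U ^+ 2 * G)) = (c * U * w) ^+ 2 * (T * w^-1 * G).
    by have := lt0r_neq0 w0 => h; field.
  have TG : 0 <= T / w * G by rewrite mulr_ge0// divr_ge0// ltW.
  rewrite ler_wpM2r// lerXn2r// ?nnegrE ltW// (lt_le_trans u1)//.
apply: (@le_trans _ _ (\esum_(alpha in L) nint mu (p (- alpha)%R))%E); first exact: le_esum.
rewrite -(reindex_esum L L (fun x : V => - x) (fun alpha => nint mu (p alpha))); last 1 first.
- split => [a /LN//|a b _ _ /oppr_inj//|a La]; by exists (- a); rewrite ?opprK//; exact: LN.
rewrite -nint_esum//.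
have cs0 : 0 <= c ^+ 2 * s by rewrite mulr_ge0 ?sqr_ge0// ltW.
rewrite /n2 -(nintZ _ _ cs0); last 2 first.
- exact: measurable_cabs2 (cmuF mF).
- by move=> x; exact: sqr_ge0.
apply: integral_le_ae => [xi|xi|].
- by apply: esum_ge0 => a _; rewrite lee_fin.
- by rewrite lee_fin; apply: mulr_ge0; last exact: sqr_ge0.
apply: filterS ts => xi tx.
have -> : (\esum_(a in L) (p a xi)%:E = (cabs ((u xi)%:C%C * F xi) ^+ 2 * c ^+ 2)%:E * \esum_(a in L) (cabs (t a xi) * v0 a)%:E)%E.
  have k0 : 0 <= cabs ((u xi)%:C%C * F xi) ^+ 2 * c ^+ 2 by apply: mulr_ge0; exact: sqr_ge0.
  rewrite -(esumZ cL k0) => [|a]; last by rewrite lee_fin mulr_ge0 ?cabs_ge0// ltW.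
  by apply: eq_esum => a _; rewrite -EFinM /p; congr EFin; ring.
apply: (@le_trans _ _ ((cabs ((u xi)%:C%C * F xi) ^+ 2 * c ^+ 2)%:E * s%:E)%E).
  by apply: lee_wpmul2l => //; rewrite lee_fin; apply: mulr_ge0; exact: sqr_ge0.
by rewrite -EFinM lee_fin le_eqVlt; apply/orP; left; apply/eqP; ring.
Qed.

(** Cauchy-Schwarz in alpha with Schur weight [v0]: one factor is the row sum, at most [s], the
    other is the quadratic expression of [schur_quadratic], which contributes c^2 s. *)
Lemma shift_op_bound F : cmeas F -> (n2 mu (fun x => (u x)%:C%C * F x)%R < +oo)%E ->
  {ae mu, forall xi, csummable L (fun alpha => ((t alpha xi)^*)%C * F (xi + alpha))} /\
  (n2 mu (fun x => (u x)%:C%C * shift_op L t F x)%R <= ((c * s) ^+ 2)%:E * n2 mu (fun x => (u x)%:C%C * F x)%R)%E.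
Proof.
move=> mF F2; have Q := schur_quadratic mF.
have mQ : measurable_fun setT (fun xi => \esum_(alpha in L) (q F alpha xi)%:E)%E.
  by apply: measurable_esum => // alpha; exact: mq.
have Q0 xi : (0 <= \esum_(alpha in L) (q F alpha xi)%:E)%E.
  by apply: esum_ge0 => a _; rewrite lee_fin.
have Qoo : ((\int[mu]_xi \esum_(alpha in L) (q F alpha xi)%:E) < +oo)%E.
  by apply: le_lt_trans Q _; rewrite lte_mul_pinfty// lee_fin; apply: mulr_ge0; [exact: sqr_ge0|exact: ltW].
have aeQ : {ae mu, forall xi, (\esum_(alpha in L) (q F alpha xi)%:E < +oo)%E}.
  have i : mu.-integrable setT (fun xi => \esum_(alpha in L) (q F alpha xi)%:E)%E.
    apply/integrableP; split => //; apply: le_lt_trans Qoo.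
    by apply: integral_le_ae => //; apply: nearW => x; rewrite gee0_abs.
  have := integrable_ae measurableT i; apply: filterS => x /(_ I).
  by rewrite ge0_fin_numE.
have key xi : 0 < u xi -> (\esum_(alpha in L) (q F alpha xi)%:E < +oo)%E ->
    (\esum_(alpha in L) (cabs (t alpha xi) * v0 alpha)%:E <= s%:E)%E ->
    csummable L (fun alpha => ((t alpha xi)^*)%C * F (xi + alpha)) /\
    ((cabs ((u xi)%:C%C * shift_op L t F xi) ^+ 2)%:E <= s%:E * \esum_(alpha in L) (q F alpha xi)%:E)%E.
  move=> u1 fq ft; set S := (\esum_(alpha in L) (q F alpha xi)%:E)%E in fq *.
  pose r := fine S; have Sr : S = r%:E by rewrite fineK// ge0_fin_numE// Q0.
  have r0 : 0 <= r by exact/fine_ge0/Q0.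
  have u2 : 0 < u xi ^+ 2 by rewrite exprn_gt0.
  have hq : (\esum_(alpha in L) (cabs (t alpha xi) * (v0 alpha)^-1 * cabs (F (xi + alpha)) ^+ 2)%:E <= (r / u xi ^+ 2)%:E)%E.
    rewrite mulrC EFinM -Sr /S -esumZ//; last 2 first.
    - by rewrite invr_ge0 ltW.
    - by move=> a; rewrite lee_fin.
    apply: le_esum => a _; rewrite -EFinM lee_fin /q [leRHS]mulrA mulVf ?mul1r// gt_eqF//.
  have r1 : 0 <= r / u xi ^+ 2 by rewrite divr_ge0// ltW.
  have h := esum_cauchy_schwarz (fun a => cabs_ge0 _) (fun a => cabs_ge0 _) v00 s0 r1 cL ft hq.
  have sm : csummable L (fun alpha => ((t alpha xi)^*)%C * F (xi + alpha)).
    rewrite /csummable; under eq_esum => a _ do rewrite cabsM cabs_conj.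
    by apply: le_lt_trans h _; rewrite ltry.
  split => //; rewrite Sr -EFinM lee_fin cabsM cabsR exprMn real_normK ?num_real// mulrC -ler_pdivlMr//.
  have : cabs (shift_op L t F xi) <= Num.sqrt (s * (r / u xi ^+ 2)).
    rewrite -lee_fin; apply: le_trans (cabs_csum_le cL sm) _.
    by under eq_esum => a _ do rewrite cabsM cabs_conj.
  have sr : 0 <= s * (r / u xi ^+ 2) by rewrite mulr_ge0// ltW.
  move=> h2; rewrite -mulrA -(sqr_sqrtr sr) lerXn2r ?nnegrE ?cabs_ge0 ?sqrtr_ge0//.
split.
  by apply: filterS3 u0 aeQ ts => xi h1 h2 h3; have [] := key xi h1 h2 h3.
apply: (@le_trans _ _ (\int[mu]_xi (s%:E * \esum_(alpha in L) (q F alpha xi)%:E))%E).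
  apply: integral_le_ae => [xi|xi|]; first by rewrite lee_fin sqr_ge0.
    by rewrite mule_ge0// lee_fin ltW.
  by apply: filterS3 u0 aeQ ts => xi h1 h2 h3; have [] := key xi h1 h2 h3.
rewrite ge0_integralZl_EFin ?(ltW s0)//.
apply: le_trans (lee_wpmul2l _ Q) _; first by rewrite lee_fin ltW.
by rewrite muleA -EFinM le_eqVlt (_ : s * (c ^+ 2 * s) = (c * s) ^+ 2) ?eqxx//; ring.
Qed.

End schur.

(** * The L^2 norms and function classes of the statement *)

Section lp2.
Context {R : realType} {d : nat}.
Local Notation C := R[i].
Local Notation V := 'cV[R]_d.
Local Notation mu := (@lebesgue_cV R d).
Implicit Types (f g F : V -> C) (O : set V).

Lemma ecvg0F (T : Type) (F : set_system T) (FF : Filter F) (u : T -> \bar R) : (forall n, (0 <= u n)%E) ->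
  (u @ F --> 0%E) <-> (forall a : R, 0 < a -> F (fun n => (u n <= a%:E)%E)).
Proof.
move=> u0; split=> [u_ a a0|h].
  have /fine_cvgP[H1 /cvgr0Pnorm_le/(_ a a0) H2] := u_.
  apply: filterS2 H1 H2 => n n1 n2.
  by rewrite -(fineK n1) lee_fin; move: n2 => /=; rewrite ger0_norm ?fine_ge0.
apply/fine_cvgP; split.
  by apply: filterS (h 1 ltr01) => n hn; rewrite ge0_fin_numE// (le_lt_trans hn)// ltry.
apply/cvgr0Pnorm_le => a a0; apply: filterS (h a a0) => n hn /=.
rewrite ger0_norm ?fine_ge0// -lee_fin fineK// ge0_fin_numE//.
by rewrite (le_lt_trans hn)// ltry.
Qed.

Lemma cLnorm2E f : cLnorm 2%:E f = (n2 mu f `^ 2^-1)%E.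
Proof.
rewrite /cLnorm unlock; congr (_ `^ _)%E; apply: eq_integral => x _ /=.
by rewrite ger0_norm ?cabs_ge0// powR_mulrn ?cabs_ge0.
Qed.

Lemma cLnorm2_le f (a : R) : 0 <= a -> (cLnorm 2%:E f <= a%:E)%E = (n2 mu f <= (a ^+ 2)%:E)%E.
Proof.
move=> a0; rewrite cLnorm2E; have := n2_ge0 mu f.
case: (n2 mu f) => [r| |]//=.
- rewrite !lee_fin => r0; rewrite -(@ler_pXn2r _ 2) ?nnegrE ?powR_ge0//.
  rewrite (_ : (r `^ 2^-1) ^+ 2 = r)//.
  by rewrite -(powR_mulrn 2 (powR_ge0 _ _)) -powRrM mulVf ?pnatr_eq0// powRr1.
- by rewrite invr_eq0 pnatr_eq0/= !leye_eq.
Qed.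

Lemma cLnorm2_lty f : (cLnorm 2%:E f < +oo)%E = (n2 mu f < +oo)%E.
Proof.
rewrite cLnorm2E; have := n2_ge0 mu f.
by case: (n2 mu f) => [r| |]//=; rewrite ?ltry// invr_eq0 pnatr_eq0.
Qed.

Lemma cLnorm2_cvg (T : Type) (F : set_system T) (FF : Filter F) (u : T -> V -> C) :
  cLnorm 2%:E (u n) @[n --> F] --> 0%E <-> n2 mu (u n) @[n --> F] --> 0%E.
Proof.
rewrite !ecvg0F; [|by move=> n; exact: n2_ge0|by move=> n; exact: Lnorm_ge0].
split=> h a a0.
  have s0 : 0 < Num.sqrt a by rewrite sqrtr_gt0.
  by apply: filterS (h _ s0) => n; rewrite cLnorm2_le ?sqrtr_ge0// sqr_sqrtr// ltW.
have s0 : 0 < a ^+ 2 by rewrite exprn_gt0.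
by apply: filterS (h _ s0) => n; rewrite cLnorm2_le// ltW.
Qed.

Lemma cmeas_clmeasurable f : cmeas f -> clmeasurable f.
Proof. by move=> [h1 h2]; split; [exists (rpart f)|exists (ipart f)] => //; exact: aeW. Qed.

Lemma clmeasurable_cmeas f : clmeasurable f -> exists2 f', cmeas f' & {ae mu, forall x, f x = f' x}.
Proof.
move=> [[u mu_ fu] [w mw fw]]; exists (fun x => Complex (u x) (w x)); first by split.
by apply: filterS2 fu fw => x e1 e2; apply: cplx_eq.
Qed.

Lemma ess_support_sub f : ess_support f `<=` csupport f.
Proof.
move=> x fx; rewrite -[csupport f]setCK => nx; have op : open (~` csupport f) by apply: closed_openC; exact: closed_closure.
apply: (fx (~` csupport f)); first exact: open_nbhs_nbhs.
by apply: aeW => y /csupport_cmpl.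
Qed.

Lemma closed_ess_support f : closed (ess_support f).
Proof.
rewrite -openC openE => x /= nx.
have [U [xU f0]] : exists U, nbhs x U /\ {ae mu, forall y, U y -> f y = 0}.
  by apply: contrapT => h; apply: nx => U xU fU; apply: h; exists U.
rewrite /interior; have := nbhs_interior xU; apply: filterS => y yU h.
exact: (h U yU f0).
Qed.

(** This makes the local integrability condition available for the inverse transforms of test
    functions. *)
Lemma Ccinfty_B_space O psi : Ccinfty O psi -> B_space O (ifourier psi) psi.
Proof.
move=> Op; have P1 := Ccinfty_cL1 Op; have P2 := Ccinfty_n2 Op.
have mi : cmeas (ifourier psi) by exact: cmeas_ifourier P1.1.
have i2 : (n2 mu (ifourier psi) < +oo)%E by apply: decays_n2; exact: decays_ifourier Op.
have [_ [cs sO]] := Op; split.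
- by split; [exact: cmeas_clmeasurable|rewrite cLnorm2_lty].
- split; first by split; [exact: cmeas_clmeasurable P1.1|rewrite cLnorm2_lty].
  by apply/cLnorm2_cvg; exact: fourier_truncate_ifourier P1 P2.
- split; first exact: cmeas_clmeasurable P1.1.
  have [M M0 HM] := Ccinfty_box Op.
  rewrite /cLnorm unlock; case: ifP => // _; apply: (@le_lt_trans _ _ M%:E); last exact: ltry.
  apply/ess_supP; apply: aeW => x /=.
  by rewrite lee_fin ger0_norm ?cabs_ge0//; have [] := HM x.
- apply: (subclosed_compact (@closed_ess_support psi) cs); exact: ess_support_sub.
- exact: subset_trans (@ess_support_sub psi) sO.
Qed.

End lp2.

Section csum_extra.
Context {R : realType} (X : choiceType).
Implicit Types (D : set X) (a : X -> R[i]).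

Lemma csum_real D (r : X -> R) : (forall x, 0 <= r x) ->
  csum D (fun x => (r x)%:C%C) = (fine (\esum_(x in D) (r x)%:E)%E)%:C%C.
Proof.
move=> r0; apply: cplx_eq; rewrite /= /rsum /=.
  rewrite (_ : \esum_(x in D) (Num.max (- r x) 0)%:E = 0%E)%E; last first.
    by apply: esum1 => x _; rewrite max_r// oppr_le0.
  by rewrite subr0; congr fine; apply: eq_esum => x _; rewrite max_l.
by rewrite oppr0 subrr.
Qed.

Lemma countableU D (E : set X) : countable D -> countable E -> countable (D `|` E).
Proof.
move=> cD cE; rewrite -bigcup2E; apply: bigcup_countable => // -[|[|i]] _ //=.
Qed.

Lemma esum_term D (b : X -> \bar R) x : D x -> (b x <= \esum_(y in D) b y)%E.
Proof.
move=> Dx; apply: esum_ge; exists [set x]; last by rewrite fsbig_set1.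
by split => // y ->.
Qed.

Lemma csumU1 D x0 a : countable D -> ~ D x0 -> csummable D a ->
  csummable ([set x0] `|` D) a /\ csum ([set x0] `|` D) a = a x0 + csum D a.
Proof.
move=> cD nD sD.
pose p x := if x == x0 then a x0 else 0; pose q x := if x \in D then a x else 0.
have cU : countable ([set x0] `|` D) by apply: countableU => //; exact: countable1.
have sq : csummable ([set x0] `|` D) q.
  rewrite /csummable; apply: le_lt_trans sD; rewrite esum_mkcond [leRHS]esum_mkcond.
  apply: le_esum => x _; rewrite /q; case: (x \in D) => //; rewrite ?cabs0; last by case: ifP.
  by case: ifP => // _; rewrite lee_fin cabs_ge0.
have sp : csummable ([set x0] `|` D) p.
  apply: (@le_lt_trans _ _ (\esum_(x in [set x0]) (cabs (p x))%:E)%E).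
    rewrite esum_mkcond [leRHS]esum_mkcond; apply: le_esum => x _.
    rewrite in_set1 /p; case: eqP => [->|_]; first by rewrite mem_set//; left.
    by rewrite cabs0; case: ifP.
  by rewrite esum_set1 ?lee_fin ?cabs_ge0// ltry.
have apq x : ([set x0] `|` D) x -> a x = p x + q x.
  rewrite /p /q => -[/= ->|Dx]; first by rewrite eqxx memNset ?addr0.
  by rewrite (mem_set Dx); case: eqP => [e|]; [rewrite -e in nD|rewrite add0r].
split; first by apply: le_lt_trans (csummableD sp sq); apply: le_esum => x Dx; rewrite apq.
rewrite (eq_csum apq) csumD//; congr (_ + _).
  rewrite csum_mkcond -[RHS](csum_set1 x0); apply: eq_csum => x _; rewrite /p.
  case: eqP => [->|_]; last by case: ifP.
  by rewrite mem_set//; left.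
rewrite csum_mkcond [RHS]csum_mkcond; apply: eq_csum => x _; rewrite /q.
case: ifPn => // /negP nx; case: ifPn => // Dx; exfalso; apply: nx.
by rewrite inE; right; rewrite inE in Dx.
Qed.

Lemma esum_swap (Y : choiceType) D (E : set Y) (a : X -> Y -> \bar R) :
  (forall x y, (0 <= a x y)%E) ->
  (\esum_(x in D) \esum_(y in E) a x y = \esum_(y in E) \esum_(x in D) a x y)%E.
Proof.
move=> a0; rewrite (esum_esum (J := fun=> E))// (esum_esum (J := fun=> D) (a := fun y x => a x y))//.
rewrite (reindex_esum (E `*`` (fun=> D)) _ (fun p => (p.2, p.1)))//.
split => [[y x] [/= h1 h2]|[y x] [y' x'] _ _ [-> ->]//|[x y] [/= h1 h2]]; first by split.
by exists (y, x).
Qed.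

End csum_extra.

(** * The frame operator on the Fourier side *)

Section frame.
Context {R : realType} {d : nat}.
Local Notation C := R[i].
Local Notation V := 'cV[R]_d.
Local Notation Z := 'cV[int]_d.
Local Notation mu := (@lebesgue_cV R d).
Local Notation iv := (@intv R d).
Variables (O : set V) (J : countType) (g : J -> V -> C) (A : J -> 'M[R]_d) (a b : R).
Hypotheses (uA : forall j, A j \in unitmx) (g1 : forall j, cL1 mu (g j)) (g2 : forall j, (n2 mu (g j) < +oo)%E).
Hypothesis gs : forall j, csmooth (fourier (g j)).
Local Notation gh j := (fourier (g j)).
Local Notation D j := (`|\det (A j)|^-1).
Hypothesis ab : {ae mu, forall xi, (a%:E <= \esum_(j in [set: J]) (D j * cabs (gh j xi) ^+ 2)%:E <= b%:E)%E}.
Hypothesis LIC : alpha_LIC g A O.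

Let L0 : set V := Lambda A `\ 0.
Let L1 : set V := [set 0] `|` L0.
Local Notation t := (t_fun g A).

Lemma detV_gt0 j : 0 < D j.
Proof. by rewrite invr_gt0 normr_gt0 -unitfE -unitmxE. Qed.

Lemma dual_latticeN (B : 'M[R]_d) x : dual_lattice B x -> dual_lattice B (- x).
Proof.
move=> [k ->]; exists (- k); rewrite -mulmxN; congr (_ *m _).
by apply/colP => i; rewrite !mxE rmorphN.
Qed.

Lemma dual_lattice0 (B : 'M[R]_d) : dual_lattice B 0.
Proof.
by exists 0; rewrite (_ : intv 0 = 0) ?mulmx0//; apply/colP => i; rewrite !mxE.
Qed.

Lemma countable_Lambda : countable (Lambda A).
Proof.
apply: bigcup_countable => // j _.
rewrite (_ : dual_lattice (A j) = (fun k : Z => (invmx (A j))^T *m iv k) @` setT).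
  exact: sub_countable (card_image_le _ _) (countableP _).
by apply/seteqP; split => x [k]; [move=> ->; exists k|move=> _ <-; exists k].
Qed.

Lemma countable_L0 : countable L0.
Proof. exact: sub_countable (subset_card_le (@subDsetl _ _ _)) countable_Lambda. Qed.

Lemma L1c : countable L1.
Proof. by apply: countableU countable_L0; exact: countable1. Qed.

Lemma L0N x : L0 x -> L0 (- x).
Proof.
move=> [[j _ jx] /= x0]; split; first by exists j => //; exact: dual_latticeN.
by move=> /= /eqP; rewrite oppr_eq0 => /eqP.
Qed.

Lemma kappaN x : kappa A (- x) = kappa A x.
Proof.
apply/seteqP; split => j; rewrite /kappa /= => /dual_latticeN//.
by rewrite opprK.
Qed.

Lemma kappa0 : kappa A 0 = setT.
Proof. by apply/seteqP; split => // j _; exact: dual_lattice0. Qed.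

Lemma cmeas_gh j : cmeas (gh j). Proof. exact: csmooth_cmeas. Qed.

Lemma cmeas_t x : cmeas (t x).
Proof.
apply: (cmeas_csum (f := fun j xi => (D j)%:C%C * (gh j xi)^*%C * gh j (xi + x))) => [|j].
  exact: countableP.
apply: cmeasM; last by apply: cmeas_shift; exact: cmeas_gh.
by apply: cmeasM; [exact: cmeas_cst|apply: cmeas_conj; exact: cmeas_gh].
Qed.

Lemma t_shiftN x xi : cabs (t x (xi - x)) = cabs (t (- x) xi).
Proof.
rewrite -[RHS]cabs_conj /t_fun -csum_conjE kappaN; congr cabs; apply: eq_csum => j _.
rewrite subrK !conjCM cconjK (_ : ((D j)%:C^*)%C = (D j)%:C%C); first by rewrite mulrAC.
by apply: cplx_eq => //=; rewrite oppr0.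
Qed.

(** |xy| <= x^2 + y^2, with the upper bound on the sum of squares used at xi and at xi + alpha;
    there are countably many shifts, so one null set suffices. *)
Lemma t_summable : {ae mu, forall xi, forall x, L1 x ->
  csummable (kappa A x) (fun j => (D j)%:C%C * (gh j xi)^*%C * gh j (xi + x))}.
Proof.
apply: ae_countable; first exact: L1c.
move=> x _; apply: filterS2 ab (ae_shift x ab) => xi /andP[_ h1] /andP[_ h2].
apply: (@csummable_le _ _ _ _ (fun j => D j * cabs (gh j xi) ^+ 2 + D j * cabs (gh j (xi + x)) ^+ 2)).
  move=> j _; rewrite !cabsM cabs_conj cabsR ger0_norm ?(ltW (detV_gt0 j))// -mulrA -mulrDr.
  rewrite ler_wpM2l ?(ltW (detV_gt0 j))//; have := cabs_ge0 (gh j xi); have := cabs_ge0 (gh j (xi + x)); nra.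
have p0 z j : (0 <= (D j * cabs (gh j z) ^+ 2)%:E)%E.
  by rewrite lee_fin; apply: mulr_ge0; [exact/ltW/detV_gt0|exact: sqr_ge0].
under eq_esum => j _ do rewrite EFinD.
rewrite esumD//; apply: lte_add_pinfty.
  by apply: le_lt_trans (ltry b); apply: le_trans h1; rewrite esum_mkcond; apply: le_esum => j _; case: ifP.
by apply: le_lt_trans (ltry b); apply: le_trans h2; rewrite esum_mkcond; apply: le_esum => j _; case: ifP.
Qed.

Lemma t0_bounds : {ae mu, forall xi, exists2 r : R, t 0 xi = r%:C%C & a <= r <= b}.
Proof.
apply: filterS ab => xi /andP[h1 h2].
have e : t 0 xi = csum [set: J] (fun j => (D j * cabs (gh j xi) ^+ 2)%:C%C).
  rewrite /t_fun kappa0; apply: eq_csum => j _; rewrite addr0 -mulrA [_^*%C * _]mulrC mulC_conj.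
  by apply: cplx_eq => /=; rewrite !(mul0r, mulr0, subr0, addr0).
move: h1 h2; set S := esum _ _ => h1 h2.
have fS : S \is a fin_num by apply/fin_real; rewrite (lt_le_trans _ h1) ?ltNyr// (le_lt_trans h2) ?ltry.
exists (fine S); last by rewrite -!lee_fin fineK// h1 h2.
rewrite e csum_real// => j; apply: mulr_ge0; [exact/ltW/detV_gt0|exact: sqr_ge0].
Qed.

(** The coefficient of F^{-1} psi against an atom, written on the Fourier side; see
    [inner2_atom]. *)
Definition frame_coef (psi : V -> C) (jk : J * Z) : C :=
  ifourier (fun x => psi x * (gh jk.1 x)^*%C) (A jk.1 *m iv jk.2).

(** The shift 0 is treated apart because [L0] omits it. Conjugating [t] moves the conjugate to the
    factor at xi + alpha. *)
Definition frame_op (F : V -> C) : V -> C :=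
  fun xi => (t 0 xi)^*%C * F xi + shift_op L0 t F xi.

Section diagonal.
Variable psi : V -> C.
Hypothesis Op : Ccinfty O psi.

Let Psi j x := psi x * (gh j x)^*%C.

Let OPsi j : Ccinfty O (Psi j).
Proof. by apply: CcinftyM => //; exact: csmooth_conj. Qed.

(** Extended by 0 to shifts outside the lattice of [j], so that the sums over [j] and over [x] have
    independent index sets and can be exchanged. *)
Let f j x xi : C := (if x \in dual_lattice (A j) then (D j)%:C%C else 0) * (Psi j (xi + x) * (Psi j xi)^*%C).

Let mf j x : cmeas (f j x).
Proof.
have m := Ccinfty_cmeas (OPsi j); apply: cmeasM; first exact: cmeas_cst.
by apply: cmeasM; [exact: cmeas_shift|exact: cmeas_conj].
Qed.

(** The local integrability condition for the pair (F^{-1} psi, psi). *)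
Let f_finite : (\esum_(j in [set: J]) \esum_(x in L1) nint mu (fun xi => cabs (f j x xi)) < +oo)%E.
Proof.
apply: le_lt_trans (LIC (Ccinfty_B_space Op)); apply: le_esum => j _.
rewrite -esumZ ?(ltW (detV_gt0 j))//; last 2 first.
- exact: sub_countable (subset_card_le (@bigcup_sup _ _ j setT (fun j => dual_lattice (A j)) I)) countable_Lambda.
- by move=> x; apply: nint_ge0 => xi; exact: cabs_ge0.
rewrite esum_mkcond [leRHS]esum_mkcond; apply: le_esum => x _.
have [xj|xj] := boolP (x \in dual_lattice (A j)); last first.
  case: ifP => // _; rewrite /nint (_ : (\int[mu]_xi (cabs (f j x xi))%:E)%E = 0%E)//.
  by apply: integral0_eq => xi _; rewrite /f (negbTE xj) mul0r cabs0.
case: ifP => _; last first.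
  by rewrite mule_ge0 ?lee_fin ?(ltW (detV_gt0 j))//; apply: nint_ge0 => xi; exact: cabs_ge0.
rewrite -/(nint mu (fun xi => cabs (psi xi * psi (xi + x) * gh j xi * gh j (xi + x)))).
have mP := Ccinfty_cmeas Op.
rewrite -nintZ ?(ltW (detV_gt0 j))//; last 2 first.
- apply: measurable_cabs; apply: cmeasM; last by apply: cmeas_shift; exact: cmeas_gh.
  by apply: cmeasM; [apply: cmeasM => //; exact: cmeas_shift|exact: cmeas_gh].
- by move=> xi; exact: cabs_ge0.
apply: nint_le => xi; first exact: cabs_ge0.
rewrite /f xj !cabsM !cabs_conj !cabsM !cabs_conj cabsR ger0_norm ?(ltW (detV_gt0 j))//.
by rewrite le_eqVlt; apply/orP; left; apply/eqP; ring.
Qed.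

Let dl_L1 j : dual_lattice (A j) `<=` L1.
Proof.
move=> x jx; have [->|/eqP x0] := eqVneq x 0; first by left.
by right; split => //; exists j.
Qed.

(** [lattice_parseval] gives a real part; the lattice sum is real because alpha -> -alpha conjugates
    its terms. *)
Let parseval j : exists2 r : R, (\esum_(k in [set: Z]) (cabs (frame_coef psi (j, k)) ^+ 2)%:E = r%:E)%E &
  csum L1 (fun x => cint mu (f j x)) = r%:C%C.
Proof.
have [E S] := lattice_parseval (OPsi j) (uA j).
pose p x := cint mu (fun xi => Psi j (xi + x) * (Psi j xi)^*%C).
have P1 := Ccinfty_cL1 (OPsi j).
have p1 x : cL1 mu (fun xi => Psi j (xi + x) * (Psi j xi)^*%C).
  have [M M0 HM] := Ccinfty_box (OPsi j); under eq_fun do rewrite mulrC.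
  apply: (cL1_prod_bounded (M := M) (cL1_conj P1)); first by apply: cmeas_shift; exact: P1.1.
  by move=> xi; have [] := HM (xi + x).
have pN x : p (- x) = (p x)^*%C.
  rewrite /p -(cint_shift x (p1 _)) -(cint_conj (p1 _)); congr cint; apply/funext => xi.
  by rewrite addrK [RHS]conjCM cconjK mulrC.
have cj : countable (dual_lattice (A j)) by exact: sub_countable (subset_card_le (@dl_L1 j)) L1c.
have Im0 : complex.Im (csum (dual_lattice (A j)) p) = 0.
  have : csum (dual_lattice (A j)) p = (csum (dual_lattice (A j)) p)^*%C.
    rewrite -csum_conjE {1}(@csum_reindex _ _ _ (dual_lattice (A j)) _ (fun x => - x)).
      by apply: eq_csum => x _; rewrite /= pN.
    split => [x /dual_latticeN//|x y _ _ /oppr_inj//|x xj]; by exists (- x); rewrite ?opprK//; exact: dual_latticeN.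
  case: (csum _ _) => u w /= [] /eqP; rewrite -addr_eq0 -mulr2n mulrn_eq0 => /eqP //.
exists (D j * complex.Re (csum (dual_lattice (A j)) p)); first exact: E.
transitivity ((D j)%:C%C * csum (dual_lattice (A j)) p).
  rewrite -csumZ// csum_mkcond [RHS]csum_mkcond; apply: eq_csum => x _.
  rewrite /f; have [xj|xj] := boolP (x \in dual_lattice (A j)).
    have xL : x \in L1 by apply: mem_set; apply: dl_L1; exact: set_mem xj.
    by rewrite xL (cintZ _ (p1 x)).
  by case: ifP => // _; rewrite (cintZ _ (p1 x)) mul0r.
by case: (csum _ p) Im0 => u w /= ->; apply: cplx_eq; rewrite /= ?mul0r ?mulr0 ?subr0 ?addr0.
Qed.

(** After Parseval over each lattice, [f_finite] permits the sums over [j] and alpha and the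
    integral to be exchanged. For a.e. xi the inner sum over [j] is then a conjugated t_alpha times
    values of psi, which is [ptw]. *)
Lemma frame_diag : {ae mu, forall xi, csummable L0 (fun x => (t x xi)^*%C * psi (xi + x))} ->
  exists2 r : R, (\esum_(jk in [set: J * Z]) (cabs (frame_coef psi jk) ^+ 2)%:E = r%:E)%E &
  cint mu (fun xi => frame_op psi xi * (psi xi)^*%C) = r%:C%C.
Proof.
move=> sm; have cJ : countable [set: J] by exact: countableP.
have n0 j x : (0 <= nint mu (fun xi => cabs (f j x xi)))%E by apply: nint_ge0 => xi; exact: cabs_ge0.
have ff' := f_finite; rewrite esum_swap// in ff'.
have fx x : L1 x -> (\esum_(j in [set: J]) nint mu (fun xi => cabs (f j x xi)) < +oo)%E.
  move=> Lx; apply: le_lt_trans ff'.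
  exact: (esum_term (fun x => \esum_(j in [set: J]) nint mu (fun xi => cabs (f j x xi)))%E Lx).
pose h x xi := csum [set: J] (fun j => f j x xi).
have mh x : cmeas (h x) by exact: cmeas_csum.
have hx x : L1 x -> {ae mu, forall xi, csummable setT (fun j => f j x xi)} /\
    csum [set: J] (fun j => cint mu (f j x)) = cint mu (h x).
  by move=> Lx; have [] := csum_cint cJ (mf ^~ x) (fx x Lx).
have h_fin : (\esum_(x in L1) nint mu (fun xi => cabs (h x xi)) < +oo)%E.
  apply: le_lt_trans ff'; apply: le_esum => x Lx.
  rewrite -nint_esum//; last 2 first.
  - by move=> j; exact: measurable_cabs.
  - by move=> j xi; exact: cabs_ge0.
  apply: integral_le_ae => [xi|xi|]; first by rewrite lee_fin cabs_ge0.
    by apply: esum_ge0 => j _; rewrite lee_fin cabs_ge0.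
  by have [+ _] := hx x Lx; apply: filterS => xi s1; exact: cabs_csum_le.
have [_ _ _ E3] := csum_cint L1c mh h_fin.
have c_fin : (\esum_(j in [set: J]) \esum_(x in L1) (cabs (cint mu (f j x)))%:E < +oo)%E.
  apply: le_lt_trans f_finite; apply: le_esum => j _; apply: le_esum => x _.
  have [fin|] := ltP (nint mu (fun xi => cabs (f j x xi))) +oo%E; first by apply: cabs_cint_le; split.
  by rewrite leye_eq => /eqP ->; rewrite leey.
have [_ _ E1] := csum_exchange cJ L1c c_fin.
have E2 : csum [set: J] (fun j => csum L1 (fun x => cint mu (f j x))) = cint mu (fun xi => csum L1 (h ^~ xi)).
  by rewrite E1 -E3; apply: eq_csum => x Lx; have [_ ->] := hx x Lx.
have ptw : {ae mu, forall xi, csum L1 (h ^~ xi) = frame_op psi xi * (psi xi)^*%C}.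
  apply: filterS2 t_summable sm => xi ts ss.
  have hE x : L1 x -> h x xi = (psi xi)^*%C * ((t x xi)^*%C * psi (xi + x)).
    move=> Lx; rewrite (_ : _ * (_ * _) = (psi (xi + x) * (psi xi)^*%C) * (t x xi)^*%C); last by ring.
    rewrite /t_fun -csum_conjE -csumZ//; last 2 first.
    - exact: sub_countable (subset_card_le (@subsetT _ _)) cJ.
    - by have := ts x Lx; apply: le_lt_trans; apply: le_esum => j _; rewrite cabs_conj.
    rewrite /h [RHS]csum_mkcond; apply: eq_csum => j _; rewrite /f.
    rewrite (_ : (j \in kappa A x) = (x \in dual_lattice (A j))); last by apply/idP/idP; rewrite !inE.
    case: ifP => _; last by rewrite mul0r.
    rewrite !conjCM !cconjK (_ : ((D j)%:C^*)%C = (D j)%:C%C) /Psi ?conjCM ?cconjK; first by ring.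
    by apply: cplx_eq => //=; rewrite oppr0.
  rewrite (eq_csum hE).
  have [s1 e1] := csumU1 countable_L0 (fun h => h.2 erefl) ss.
  by rewrite (csumZ _ L1c s1) [csum L1 _]e1 addr0 mulrC.
pose r j := sval (cid2 (parseval j)).
have rE j : (\esum_(k in [set: Z]) (cabs (frame_coef psi (j, k)) ^+ 2)%:E = (r j)%:E)%E by rewrite /r; case: cid2.
have r0 j : 0 <= r j by rewrite -lee_fin -rE; apply: esum_ge0 => k _; rewrite lee_fin sqr_ge0.
have rS j : csum L1 (fun x => cint mu (f j x)) = (r j)%:C%C by rewrite /r; case: cid2.
exists (fine (\esum_(j in [set: J]) (r j)%:E)%E); last first.
  rewrite -(cint_eq_ae ptw) -E2 -csum_real//; apply: eq_csum => j _; exact: rS.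
have rfin : (\esum_(j in [set: J]) (r j)%:E < +oo)%E.
  apply: le_lt_trans (c_fin); apply: le_esum => j _.
  have s1 : csummable L1 (fun x => cint mu (f j x)).
    apply: le_lt_trans (c_fin).
    by apply: (esum_term (fun j => \esum_(x in L1) (cabs (cint mu (f j x)))%:E)%E).
  by apply: le_trans (cabs_csum_le L1c s1); rewrite rS cabsR ger0_norm.
rewrite fineK; last by rewrite ge0_fin_numE//; apply: esum_ge0 => j _; rewrite lee_fin.
transitivity (\esum_(jk in [set: J] `*`` (fun=> [set: Z])) (cabs (frame_coef psi (jk.1, jk.2)) ^+ 2)%:E)%E.
  by rewrite (_ : _ `*`` _ = setT); [apply: eq_esum => -[]|apply/seteqP; split].
rewrite -(esum_esum (a := fun j k => (cabs (frame_coef psi (j, k)) ^+ 2)%:E)); last first.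
  by move=> j k; rewrite lee_fin sqr_ge0.
by apply: eq_esum => j _; exact: rE.
Qed.

End diagonal.

End frame.

(** * Weighted bounds, Bessel inequality and polarization *)

Section frame_bounds.
Context {R : realType} {d : nat}.
Local Notation C := R[i].
Local Notation V := 'cV[R]_d.
Local Notation Z := 'cV[int]_d.
Local Notation mu := (@lebesgue_cV R d).
Local Notation iv := (@intv R d).
Variables (O : set V) (J : countType) (g : J -> V -> C) (A : J -> 'M[R]_d) (a b : R).
Hypotheses (uA : forall j, A j \in unitmx) (g1 : forall j, cL1 mu (g j)) (g2 : forall j, (n2 mu (g j) < +oo)%E).
Hypothesis gs : forall j, csmooth (fourier (g j)).
Local Notation gh j := (fourier (g j)).
Local Notation D j := (`|\det (A j)|^-1).
Hypothesis ab : {ae mu, forall xi, (a%:E <= \esum_(j in [set: J]) (D j * cabs (gh j xi) ^+ 2)%:E <= b%:E)%E}.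
Hypothesis LIC : alpha_LIC g A O.
Local Notation L0 := (Lambda A `\ (0 : V)).
Local Notation t := (t_fun g A).
Variables (v0 : V -> R) (s c : R).
Hypotheses (v00 : forall x, 0 < v0 x) (v0N : forall x, v0 (- x) = v0 x) (s0 : 0 < s) (c0 : 0 < c).
Hypotheses (cv1 : forall x, 1 <= c * v0 x) (a0 : 0 < a) (b0 : 0 <= b).
Hypothesis ts : {ae mu, forall xi, (\esum_(x in L0) (cabs (t x xi) * v0 x)%:E <= s%:E)%E}.

(** Stated almost everywhere so that it holds for a Borel version of [v]; the constant 1 satisfies
    it with the same [c] and [v0]. *)
Definition frame_weight (u : V -> R) := [/\ measurable_fun setT u, {ae mu, forall xi, 0 < u xi} &
  forall x, L0 x -> {ae mu, forall xi, u xi <= c * u (xi + x) * v0 x}].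

Lemma frame_weight1 : frame_weight (fun=> 1).
Proof. by split => [//||x _]; apply: aeW => // xi; rewrite mulr1. Qed.

Local Notation K := (frame_op g A).
Local Notation W u F := (fun x => (u x)%:C%C * F x)%R.

Lemma cmeasW u F : frame_weight u -> cmeas F -> cmeas (W u F).
Proof. by move=> [mu_ _ _] mF; apply: cmeasM => //; exact: cmeasR. Qed.

Lemma cmeas_off F : cmeas F -> cmeas (shift_op L0 t F).
Proof. by move=> mF; apply: cmeas_shift_op => //; [exact: countable_L0|exact: cmeas_t]. Qed.

Lemma cmeas_frame_op F : cmeas F -> cmeas (K F).
Proof.
move=> mF; apply: cmeasD; last exact: cmeas_off.
by apply: cmeasM => //; apply: cmeas_conj; exact: cmeas_t.
Qed.

Lemma off_bound u F : frame_weight u -> cmeas F -> (n2 mu (W u F) < +oo)%E ->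
  {ae mu, forall xi, csummable L0 (fun x => (t x xi)^*%C * F (xi + x))} /\
  (n2 mu (W u (shift_op L0 t F)) <= ((c * s) ^+ 2)%:E * n2 mu (W u F))%E.
Proof.
move=> [mu_ u0 uv] mF F2; have H := shift_op_bound (@countable_L0 _ _ _ A) (@L0N _ _ _ A) (@cmeas_t _ _ _ g A gs) (@t_shiftN _ _ _ g A) v00 v0N s0 ts mu_ u0 uv mF F2.
by split; [exact H.1|exact H.2].
Qed.

Lemma diag_bound u F : frame_weight u -> cmeas F ->
  (n2 mu (W u (fun x => (t 0 x)^*%C * F x)%R) <= (b ^+ 2)%:E * n2 mu (W u F))%E.
Proof.
move=> wu mF; have mW := cmeasW wu mF.
rewrite /n2 -(nintZ _ (measurable_cabs2 mW) (sqr_ge0 b)); last by move=> x; exact: sqr_ge0.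
apply: nint_le_ae => [x|x|]; [exact: sqr_ge0|by apply: mulr_ge0; exact: sqr_ge0|].
apply: filterS (t0_bounds uA ab) => x [r -> /andP[ar rb]].
rewrite [cabs _ in leLHS](_ : _ = `|r| * cabs ((u x)%:C%C * F x)); last by rewrite !cabsM cabs_conj !cabsR mulrCA.
rewrite exprMn ler_wpM2r ?sqr_ge0//.
by rewrite real_normK ?num_real// lerXn2r// ?nnegrE// ltW// (lt_le_trans a0).
Qed.

Lemma frame_op_bound u F : frame_weight u -> cmeas F -> (n2 mu (W u F) < +oo)%E ->
  (n2 mu (W u (K F)) <= (2 * b ^+ 2 + 2 * (c * s) ^+ 2)%:E * n2 mu (W u F))%E.
Proof.
move=> wu mF F2; have [_ E2] := off_bound wu mF F2; have D2 := diag_bound wu mF.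
have m1 : cmeas (W u (fun x => (t 0 x)^*%C * F x)).
  by apply: cmeasW => //; apply: cmeasM => //; apply: cmeas_conj; exact: cmeas_t.
have m2 : cmeas (W u (shift_op L0 t F)) by apply: cmeasW => //; exact: cmeas_off.
have := n2D_le mu m1 m2; rewrite (_ : (fun x => _) = W u (K F)); last first.
  by apply/funext => x; rewrite -mulrDr.
move=> /le_trans; apply.
have -> : (2 * b ^+ 2 + 2 * (c * s) ^+ 2)%:E = (2%:E * (b ^+ 2)%:E + 2%:E * ((c * s) ^+ 2)%:E)%E by rewrite -!EFinM -EFinD.
rewrite ge0_muleDl ?mule_ge0 ?lee_fin ?sqr_ge0// -!muleA.
by apply: leeD; apply: lee_wpmul2l.
Qed.

Lemma frame_op_lin u (z : C) F G : frame_weight u -> cmeas F -> cmeas G -> (n2 mu (W u F) < +oo)%E ->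
  (n2 mu (W u G) < +oo)%E -> {ae mu, forall xi, K (fun x => z * F x + G x) xi = z * K F xi + K G xi}.
Proof.
move=> wu mF mG F2 G2; have [sF _] := off_bound wu mF F2; have [sG _] := off_bound wu mG G2.
apply: filterS2 sF sG => xi sF sG; have cL := countable_L0 A.
rewrite /frame_op [shift_op L0 t (fun x => _) xi](_ : _ = z * shift_op L0 t F xi + shift_op L0 t G xi); first by ring.
rewrite /shift_op -csumZ// -csumD//; last exact: csummableZ.
by apply: eq_csum => x _; ring.
Qed.

Lemma n2W1 F : n2 mu (W (fun=> 1) F) = n2 mu F.
Proof. by apply: n2_eq_ae; apply: aeW => x; rewrite mul1r. Qed.

Local Notation coef := (frame_coef g A).
Local Notation n2f F := (fine (n2 mu F)).

(** The added 1 makes the bound at least 1, hence at most its square. *)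
Definition bessel_bound : R := 2 * b ^+ 2 + 2 * (c * s) ^+ 2 + 1.

Let B := bessel_bound.

Lemma bessel_ge1 : 1 <= B.
Proof. by rewrite lerDr addr_ge0// mulr_ge0// sqr_ge0. Qed.

Lemma frame_op_n2 F : cmeas F -> (n2 mu F < +oo)%E -> (n2 mu (K F) <= B%:E * n2 mu F)%E.
Proof.
move=> mF F2; have := frame_op_bound frame_weight1 mF; rewrite !n2W1 => /(_ F2) /le_trans; apply.
by apply: lee_wpmul2r; [exact: n2_ge0|rewrite lee_fin lerDl].
Qed.

Lemma frame_diag_Cc psi : Ccinfty O psi ->
  exists2 r : R, (\esum_(jk in [set: J * Z]) (cabs (coef psi jk) ^+ 2)%:E = r%:E)%E &
  cint mu (fun xi => K psi xi * (psi xi)^*%C) = r%:C%C.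
Proof.
move=> Op; apply: (frame_diag uA gs ab LIC Op).
have := off_bound frame_weight1 (Ccinfty_cmeas Op).
by rewrite n2W1 => /(_ (Ccinfty_n2 Op))[].
Qed.

(** The sum of squares is the quadratic form of the frame operator, which Cauchy-Schwarz bounds by
    the L^2 norms of K psi and psi. *)
Lemma bessel psi : Ccinfty O psi ->
  (\esum_(jk in [set: J * Z]) (cabs (coef psi jk) ^+ 2)%:E <= B%:E * n2 mu psi)%E.
Proof.
move=> Op; have [r -> rE] := frame_diag_Cc Op.
have mP := Ccinfty_cmeas Op; have P2 := Ccinfty_n2 Op.
have KB := frame_op_n2 mP P2; have K2 : (n2 mu (K psi) < +oo)%E.
  by apply: le_lt_trans KB _; rewrite lte_mul_pinfty// lee_fin (le_trans _ bessel_ge1).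
have c2 : n2 mu (fun x => (psi x)^*%C) = n2 mu psi.
  by rewrite /n2; congr nint; apply/funext => x; rewrite cabs_conj.
have cP2 : (n2 mu (fun x => (psi x)^*%C) < +oo)%E by rewrite c2.
have [_] := cauchy_schwarz (cmeas_frame_op mP) (cmeas_conj mP) K2 cP2.
rewrite rE c2 cabsR real_normK ?num_real//.
have fP : n2 mu psi \is a fin_num by rewrite ge0_fin_numE// n2_ge0.
have n0 : 0 <= n2f psi by rewrite fine_ge0// n2_ge0.
have kb : n2f (K psi) <= B * n2f psi.
  by rewrite -lee_fin EFinM !fineK// ge0_fin_numE// n2_ge0.
move=> h; rewrite -(fineK fP) -EFinM lee_fin.
have B1 := bessel_ge1.
have h2 : r ^+ 2 <= (B * n2f psi) ^+ 2.
  apply: (le_trans h); apply: (@le_trans _ _ (B * n2f psi * n2f psi)); first by rewrite ler_wpM2r.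
  rewrite -mulrA exprMn ler_wpM2r ?sqr_ge0// expr2 ler_peMl// (le_trans _ B1)//.
have Bn : 0 <= B * n2f psi by rewrite mulr_ge0// (le_trans _ B1).
by have := ler_norm r; move=> /le_trans; apply; rewrite -(ger0_norm Bn) -ler_sqr ?nnegrE// !real_normK ?num_real.
Qed.

Lemma coef_lin (z : C) psi chi jk : Ccinfty O psi -> Ccinfty O chi ->
  coef (fun x => psi x + z * chi x) jk = coef psi jk + z * coef chi jk.
Proof.
move=> Op Oc; rewrite /frame_coef !ifourierE.
have h eta : Ccinfty O eta -> cL1 mu (fun xi => eta xi * (gh jk.1 xi)^*%C * cis (2 * pi * dot (A jk.1 *m iv jk.2) xi)).
  move=> Oe; apply: cL1_ifourier; apply: (@Ccinfty_cL1 _ _ O); apply: CcinftyM => //.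
  exact: csmooth_conj.
have hp := h _ Op; have hc := h _ Oc.
rewrite -(cintZ _ hc) -(cintD hp (cL1Z z hc)); congr cint; apply/funext => x; ring.
Qed.

Lemma coef_summable psi chi : Ccinfty O psi -> Ccinfty O chi ->
  csummable setT (fun jk => coef psi jk * (coef chi jk)^*%C).
Proof.
move=> Op Oc; apply: (@csummable_le _ _ _ _ (fun jk => cabs (coef psi jk) ^+ 2 + cabs (coef chi jk) ^+ 2)).
  by move=> jk _; rewrite cabsM cabs_conj; have := cabs_ge0 (coef psi jk); have := cabs_ge0 (coef chi jk); nra.
under eq_esum => jk _ do rewrite EFinD.
rewrite esumD; last 2 first.
- by move=> jk _; rewrite lee_fin sqr_ge0.
- by move=> jk _; rewrite lee_fin sqr_ge0.
apply: lte_add_pinfty.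
  by have [r -> _] := frame_diag_Cc Op; rewrite ltry.
by have [r -> _] := frame_diag_Cc Oc; rewrite ltry.
Qed.

(** Both sesquilinear forms agree on the diagonal. Expanding them at psi + z chi, for z = 1 and z =
    i, separates the two mixed terms. *)
Lemma polarization psi chi : Ccinfty O psi -> Ccinfty O chi ->
  csum [set: J * Z] (fun jk => coef psi jk * (coef chi jk)^*%C) =
  cint mu (fun xi => K psi xi * (chi xi)^*%C).
Proof.
move=> Op Oc.
pose S p q := csum [set: J * Z] (fun jk => coef p jk * (coef q jk)^*%C).
pose T p q := cint mu (fun xi => K p xi * (q xi)^*%C).
have cJ : countable [set: J * Z] by exact: countableP.
have diag p : Ccinfty O p -> S p p = T p p.
  move=> Pp; have [r E1 E2] := frame_diag_Cc Pp; rewrite /T E2 /S.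
  under eq_csum => jk _ do rewrite mulC_conj.
  by rewrite csum_real ?E1// => x; exact: sqr_ge0.
have T1 p q : Ccinfty O p -> Ccinfty O q -> cL1 mu (fun xi => K p xi * (q xi)^*%C).
  move=> Pp Pq; have mp := Ccinfty_cmeas Pp; have mq := Ccinfty_cmeas Pq.
  have K2 : (n2 mu (K p) < +oo)%E.
    by apply: le_lt_trans (frame_op_n2 mp (Ccinfty_n2 Pp)) _; rewrite lte_mul_pinfty ?(Ccinfty_n2 Pp)// lee_fin (le_trans _ bessel_ge1).
  exact: (cauchy_schwarz (cmeas_frame_op mp) (cmeas_conj mq) K2 (Ccinfty_n2 (Ccinfty_conj Pq))).1.
have expS z : let p x := psi x + z * chi x in
    S p p = S psi psi + z^*%C * S psi chi + z * S chi psi + z * z^*%C * S chi chi.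
  have s1 := coef_summable Op Op; have s2 := coef_summable Op Oc.
  have s3 := coef_summable Oc Op; have s4 := coef_summable Oc Oc.
  have z2 := csummableZ (z^*)%C cJ s2; have z3 := csummableZ z cJ s3; have z4 := csummableZ (z * z^*%C) cJ s4.
  move=> p; rewrite /S -(csumZ _ cJ s2) -(csumZ _ cJ s3) -(csumZ _ cJ s4).
  rewrite -(csumD cJ s1 z2) -(csumD cJ (csummableD s1 z2) z3) -(csumD cJ (csummableD (csummableD s1 z2) z3) z4).
  by apply: eq_csum => jk _; rewrite (coef_lin z jk Op Oc : coef p jk = _) conjCD conjCM; ring.
have expT z : let p x := psi x + z * chi x in
    T p p = T psi psi + z^*%C * T psi chi + z * T chi psi + z * z^*%C * T chi chi.
  have s1 := T1 _ _ Op Op; have s2 := T1 _ _ Op Oc.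
  have s3 := T1 _ _ Oc Op; have s4 := T1 _ _ Oc Oc.
  move=> p; rewrite /T -(cintZ _ s2) -(cintZ _ s3) -(cintZ _ s4).
  have z2 := cL1Z (z^*)%C s2; have z3 := cL1Z z s3; have z4 := cL1Z (z * z^*%C) s4.
  rewrite -(cintD s1 z2) -(cintD (cL1D s1 z2) z3) -(cintD (cL1D (cL1D s1 z2) z3) z4).
  apply: cint_eq_ae.
  have := frame_op_lin z frame_weight1 (Ccinfty_cmeas Oc) (Ccinfty_cmeas Op).
  rewrite !n2W1 => /(_ (Ccinfty_n2 Oc) (Ccinfty_n2 Op)); apply: filterS => xi e.
  rewrite (_ : p = fun x => z * chi x + psi x); last by apply/funext => x; rewrite /p addrC.
  by rewrite e conjCD conjCM; ring.
have eqz z : z^*%C * S psi chi + z * S chi psi = z^*%C * T psi chi + z * T chi psi.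
  have Oz : Ccinfty O (fun x => psi x + z * chi x) by apply: CcinftyD => //; exact: CcinftyZ.
  have := diag _ Oz; rewrite expS expT diag// diag// => /addIr; rewrite -!addrA => /addrI; by [].
have e1 := eqz 1; have e2 := eqz (Complex 0 1).
rewrite -/(S psi chi) -/(T psi chi).
move: e1 e2; rewrite (_ : (Complex 0 1)^*%C = - Complex 0 1); last by apply: cplx_eq => /=; rewrite ?oppr0.
rewrite (_ : 1^*%C = 1); last by apply: cplx_eq => /=; rewrite ?oppr0.
set i := Complex 0 1; have i2 : i * i = -1 by apply: cplx_eq => /=; ring.
move: (S psi chi) (S chi psi) (T psi chi) (T chi psi) => x y x' y' e1 e2.
have e3 : i * (i * (y - y' - (x - x'))) = 0.
  by rewrite (_ : i * (y - y' - (x - x')) = (- i * x + i * y) - (- i * x' + i * y')); [rewrite e2 subrr mulr0|ring].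
have e4 : y - y' = x - x'.
  by apply/eqP; rewrite -subr_eq0; apply/eqP; move: e3; rewrite mulrA i2 mulN1r => /eqP; rewrite oppr_eq0 => /eqP.
have e5 : (x - x') + (y - y') = 0.
  by rewrite (_ : _ + _ = 1 * x + 1 * y - (1 * x' + 1 * y')); [rewrite e1 subrr|ring].
move: e5; rewrite e4 -mulr2n => /eqP; rewrite mulrn_eq0/= subr_eq0 => /eqP //.
Qed.

End frame_bounds.

Lemma conj_sum (R : realType) (I : Type) (s : seq I) (F : I -> R[i]) :
  ((\sum_(i <- s) F i)^*)%C = \sum_(i <- s) ((F i)^*)%C.
Proof. by elim/big_rec2: _ => [|i x y _ <-]; [exact: rmorph0|exact: conjCD]. Qed.

Section n2_extra.
Context {R : realType} dT (T : measurableType dT) (m : {sigma_finite_measure set T -> \bar R}).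
Local Notation C := R[i].
Implicit Types f g : T -> C.

Lemma n2D_lty f g : cmeas f -> cmeas g -> (n2 m f < +oo)%E -> (n2 m g < +oo)%E ->
  (n2 m (fun x => f x + g x)%R < +oo)%E.
Proof.
move=> mf mg f2 g2; apply: le_lt_trans (n2D_le m mf mg) _.
by apply: lte_add_pinfty; rewrite lte_mul_pinfty.
Qed.

Lemma n2B_le f g h : cmeas f -> cmeas g -> cmeas h ->
  (n2 m (fun x => f x - h x)%R <= 2%:E * n2 m (fun x => f x - g x)%R + 2%:E * n2 m (fun x => g x - h x)%R)%E.
Proof.
move=> mf mg mh; have := n2D_le m (cmeasD mf (cmeasN mg)) (cmeasD mg (cmeasN mh)).
by congr (_ <= _)%E; apply: n2_eq_ae; apply: aeW => x; ring.
Qed.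

Lemma n2_sum_lty (I : Type) (s : seq I) (F : I -> T -> C) : (forall i, cmeas (F i)) ->
  (forall i, n2 m (F i) < +oo)%E -> (n2 m (fun x => \sum_(i <- s) F i x)%R < +oo)%E.
Proof.
move=> mF F2; elim: s => [|i s ih].
  by under eq_fun do rewrite big_nil; rewrite /n2 /nint cabs0 expr0n/= integral0.
under eq_fun do rewrite big_cons; apply: n2D_lty => //; exact: cmeas_sum.
Qed.

Lemma n2Z_lty (a : C) f : cmeas f -> (n2 m f < +oo)%E -> (n2 m (fun x => a * f x)%R < +oo)%E.
Proof. by move=> mf f2; rewrite n2Z// lte_mul_pinfty// lee_fin sqr_ge0. Qed.

Lemma n2_conj f : n2 m (fun x => (f x)^*%C) = n2 m f.
Proof. by rewrite /n2; congr nint; apply/funext => x; rewrite cabs_conj. Qed.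

Lemma cL1M_n2 f g : cmeas f -> cmeas g -> (n2 m f < +oo)%E -> (n2 m g < +oo)%E -> cL1 m (fun x => f x * g x).
Proof. by move=> mf mg f2 g2; exact: (cauchy_schwarz mf mg f2 g2).1. Qed.

Lemma cint_sqr f : cint m (fun x => f x * (f x)^*%C) = (fine (n2 m f))%:C%C.
Proof.
apply: cplx_eq => /=; last first.
  by rewrite /Rintegral integral0_eq// => x _; case: (f x) => u w /=; rewrite mulrN (mulrC w) addNr.
rewrite /Rintegral; congr fine; apply: eq_integral => x _; congr EFin.
by rewrite mulC_conj.
Qed.

Lemma n2_expand f g : cmeas f -> cmeas g -> (n2 m f < +oo)%E -> (n2 m g < +oo)%E ->
  fine (n2 m f) + fine (n2 m g) =
  fine (n2 m (fun x => f x - g x)%R) + 2 * complex.Re (cint m (fun x => g x * (f x)^*%C)).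
Proof.
move=> mf mg f2 g2; have cf2 : (n2 m (fun x => (f x)^*%C) < +oo)%E by rewrite n2_conj.
have cg2 : (n2 m (fun x => (g x)^*%C) < +oo)%E by rewrite n2_conj.
have ff := cL1M_n2 mf (cmeas_conj mf) f2 cf2; have gg := cL1M_n2 mg (cmeas_conj mg) g2 cg2.
have gf := cL1M_n2 mg (cmeas_conj mf) g2 cf2.
have e := cint_sqr (fun x => f x - g x).
have := congr1 (@complex.Re R) e; rewrite [X in _ = X]/= => <-.
have -> : cint m (fun x => (f x - g x) * (f x - g x)^*%C) =
    cint m (fun x => f x * (f x)^*%C) + cint m (fun x => g x * (g x)^*%C) +
    (- 1) * (cint m (fun x => g x * (f x)^*%C) + (cint m (fun x => g x * (f x)^*%C))^*%C).
  rewrite -(cint_conj gf) -(cintD gf (cL1_conj gf)) -(cintZ _ (cL1D gf (cL1_conj gf))) -(cintD ff gg).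
  rewrite -(cintD (cL1D ff gg) (cL1Z _ (cL1D gf (cL1_conj gf)))); congr cint; apply/funext => x.
  by rewrite conjCM cconjK conjCD (_ : (- g x)^*%C = - (g x)^*%C) ?rmorphN//; ring.
rewrite !cint_sqr; case: (cint m (fun x => g x * (f x)^*%C)) => u w /=.
ring.
Qed.

End n2_extra.

(** * Convergence of the frame series *)

Section frame_sums.
Context {R : realType} {d : nat}.
Local Notation C := R[i].
Local Notation V := 'cV[R]_d.
Local Notation Z := 'cV[int]_d.
Local Notation mu := (@lebesgue_cV R d).
Local Notation iv := (@intv R d).
Variables (O : set V) (J : countType) (g : J -> V -> C) (A : J -> 'M[R]_d) (B : R).
Hypotheses (g1 : forall j, cL1 mu (g j)) (g2 : forall j, (n2 mu (g j) < +oo)%E).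
Hypothesis gs : forall j, csmooth (fourier (g j)).
Local Notation gh j := (fourier (g j)).
Local Notation coef := (frame_coef g A).
Hypothesis B1 : 1 <= B.
Hypothesis bessel : forall psi, Ccinfty O psi ->
  (\esum_(jk in [set: J * Z]) (cabs (coef psi jk) ^+ 2)%:E <= B%:E * n2 mu psi)%E.
Hypothesis dens : forall F, cmeas F -> (n2 mu F < +oo)%E -> forall e : R, 0 < e ->
  exists2 eta, Ccinfty O eta & (n2 mu (fun x => F x - eta x)%R <= e%:E)%E.

Lemma cL1_atom jk : cL1 mu (atom g A jk).
Proof. exact: cL1_shift. Qed.

Lemma n2_atom jk : (n2 mu (atom g A jk) < +oo)%E.
Proof.
rewrite /n2 /atom /translate (nint_shift (- (A jk.1 *m iv jk.2)) (measurable_cabs2 (g1 jk.1).1) (fun x => sqr_ge0 _)).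
exact: g2.
Qed.

Lemma fourier_atom jk xi : fourier (atom g A jk) xi = gh jk.1 xi * cis (- (2 * pi * dot (A jk.1 *m iv jk.2) xi)).
Proof. by rewrite /atom /translate (fourier_shift _ _ (g1 _)) dotC dotNr mulrN mulrC dotC. Qed.

Lemma inner2_atom psi jk : Ccinfty O psi -> inner2 (ifourier psi) (atom g A jk) = coef psi jk.
Proof.
move=> Op; transitivity (cint mu (fun x => psi x * ifourier (fun y => (atom g A jk y)^*%C) x)).
  exact: (ifourier_mul (Ccinfty_cL1 Op) (cL1_conj (cL1_atom jk))).
rewrite /frame_coef ifourierE; congr cint; apply/funext => x.
by rewrite (ifourier_conj _ (cL1_atom jk)) fourier_atom conjCM conj_cis opprK mulrA.
Qed.

Lemma test_atom eta jk : Ccinfty O eta ->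
  cint mu (fun x => atom g A jk x * fourier eta x) = (coef (fun x => (eta x)^*%C) jk)^*%C.
Proof.
move=> Oe; rewrite -(fourier_mul (cL1_atom jk) (Ccinfty_cL1 Oe)) /frame_coef ifourierE -cint_conj.
  by congr cint; apply/funext => x; rewrite fourier_atom !conjCM !cconjK conj_cis; ring.
apply: cL1_ifourier; apply: (@Ccinfty_cL1 _ _ O); apply: CcinftyM; first exact: Ccinfty_conj.
exact: csmooth_conj.
Qed.

Definition synth (X : seq (J * Z)) (z : J * Z -> C) : V -> C := fun x => \sum_(jk <- X) z jk * atom g A jk x.

Lemma cL1_synth X z : cL1 mu (synth X z).
Proof. by apply: cL1_sum => jk; apply: cL1Z; exact: cL1_atom. Qed.

Lemma n2_synth X z : (n2 mu (synth X z) < +oo)%E.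
Proof.
apply: n2_sum_lty => jk; first by apply: cmeasM; [exact: cmeas_cst|exact: (cL1_atom jk).1].
by apply: n2Z_lty; [exact: (cL1_atom jk).1|exact: n2_atom].
Qed.

Lemma fourier_synth X z xi : fourier (synth X z) xi = \sum_(jk <- X) z jk * fourier (atom g A jk) xi.
Proof.
rewrite fourierE /synth; under eq_fun do rewrite mulr_suml.
rewrite cint_sum => [|jk]; last by apply: cL1_fourier; apply: cL1Z; exact: cL1_atom.
apply: eq_bigr => jk _; rewrite fourierE -cintZ; last by apply: cL1_fourier; exact: cL1_atom.
by congr cint; apply/funext => x; rewrite mulrA.
Qed.

(** Duality without an adjoint. For a test function eta close to the transform G of the sum, |G|^2 =
    |G - eta|^2 + 2 Re <eta, G> - |eta|^2 in L^2 norms. The pairing is a finite sum of conjugates of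
    z times coefficients c of eta; 2|z c| <= B|z|^2 + |c|^2/B and the Bessel inequality cancel
    |eta|^2. *)
Lemma dual_bessel X z : uniq X -> (n2 mu (synth X z) <= (B * \sum_(jk <- X) cabs (z jk) ^+ 2)%:E)%E.
Proof.
move=> uX; have h1 := cL1_synth X z; have h2 := n2_synth X z.
rewrite -(fourier_isometry h1 h2); set G := fourier _.
have mG : cmeas G by apply: cmeas_fourier; exact: h1.1.
have G2 : (n2 mu G < +oo)%E by rewrite fourier_isometry.
have fG : n2 mu G \is a fin_num by rewrite ge0_fin_numE// n2_ge0.
set S := \sum_(_ <- X) _; apply/lee_addgt0Pr => e e0.
have [eta Oe ge] := dens mG G2 e0.
have me := Ccinfty_cmeas Oe; have e2 := Ccinfty_n2 Oe.
have fe : n2 mu eta \is a fin_num by rewrite ge0_fin_numE// n2_ge0.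
have fGe : fine (n2 mu (fun x => G x - eta x)) <= e.
  by rewrite -lee_fin fineK// ge0_fin_numE ?n2_ge0// (le_lt_trans ge)// ltry.
have E := n2_expand mG me G2 e2.
have cE : cint mu (fun x => eta x * (G x)^*%C) = \sum_(jk <- X) (z jk)^*%C * coef eta jk.
  transitivity (cint mu (fun x => \sum_(jk <- X) (z jk)^*%C * (eta x * (gh jk.1 x)^*%C * cis (2 * pi * dot (A jk.1 *m iv jk.2) x)))).
    congr cint; apply/funext => x; rewrite /G fourier_synth conj_sum mulr_sumr; apply: eq_bigr => jk _.
    by rewrite fourier_atom !conjCM conj_cis opprK; ring.
  have l1 jk : cL1 mu (fun x => eta x * (gh jk.1 x)^*%C * cis (2 * pi * dot (A jk.1 *m iv jk.2) x)).
    apply: cL1_ifourier; apply: (@Ccinfty_cL1 _ _ O); apply: CcinftyM => //; exact: csmooth_conj.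
  rewrite cint_sum => [|jk]; last exact: cL1Z.
  by apply: eq_bigr => jk _; rewrite (cintZ _ (l1 jk)) /frame_coef ifourierE.
have B0 : 0 < B by rewrite (lt_le_trans ltr01).
have cb : \sum_(jk <- X) cabs (coef eta jk) ^+ 2 <= B * fine (n2 mu eta).
  rewrite -lee_fin EFinM fineK//; apply: le_trans (bessel Oe).
  rewrite -sumEFin; apply: (le_trans _ (esum_ge (x := _) _)); last first.
    by exists [set` [fset jk in X]%fset]; [split => //; exact: finite_fset|exact: lexx].
  rewrite fsbig_finite//=.
  rewrite set_fsetK (perm_big (enum_fset [fset jk in X]%fset))//=.
  by apply: uniq_perm; rewrite ?fset_uniq// => jk; rewrite inE.
have re : 2 * complex.Re (\sum_(jk <- X) (z jk)^*%C * coef eta jk) <= B * S + fine (n2 mu eta).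
  apply: (@le_trans _ _ (\sum_(jk <- X) (B * cabs (z jk) ^+ 2 + B^-1 * cabs (coef eta jk) ^+ 2))).
    rewrite (_ : complex.Re (\sum_(_ <- X) _) = \sum_(jk <- X) complex.Re ((z jk)^*%C * coef eta jk)); last first.
      by elim/big_rec2: _ => // jk x y _ <-; rewrite cReD.
    rewrite mulr_sumr; apply: ler_sum => jk _.
    apply: (@le_trans _ _ (2 * (cabs (z jk) * cabs (coef eta jk)))).
      by rewrite ler_wpM2l// -(cabs_conj (z jk)) -cabsM (le_trans (ler_norm _))// normRe_le.
    rewrite -subr_ge0 (_ : _ - _ = B^-1 * (B * cabs (z jk) - cabs (coef eta jk)) ^+ 2).
      by rewrite mulr_ge0 ?sqr_ge0// invr_ge0 ltW.
    by have := lt0r_neq0 B0 => hB; field.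
  rewrite big_split/= -!mulr_sumr lerD2l -[leRHS](mulKf (lt0r_neq0 B0)).
  by rewrite ler_wpM2l// invr_ge0 ltW.
rewrite -(fineK fG) -EFinD lee_fin; rewrite cE in E; lra.
Qed.

Lemma synth_sub (X Y : {fset J * Z}) z x : (X `<=` Y)%fset -> synth Y z x - synth X z x = synth (Y `\` X)%fset z x.
Proof.
move=> XY; rewrite /synth (big_fsetID _ (mem X) Y)/= addrC.
rewrite (_ : [fset jk | jk in Y & jk \in X]%fset = X).
  by rewrite addrK; apply: eq_fbigl => jk; rewrite !inE andbC.
by apply/fsetP => jk; rewrite !inE; apply/andP/idP => [[]//|h]; rewrite (fsubsetP XY).
Qed.

Section synthesis.
Variable psi : V -> C.
Hypothesis Op : Ccinfty O psi.
Local Notation c := (coef psi).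

Lemma tail_small (e : R) : 0 < e -> exists s0 : {fset J * Z}, forall X Y : {fset J * Z},
  (s0 `<=` X)%fset -> (X `<=` Y)%fset -> (n2 mu (fun x => synth Y c x - synth X c x)%R <= e%:E)%E.
Proof.
move=> e0; have B0 : 0 < B by rewrite (lt_le_trans ltr01).
have sc : csummable setT (fun jk => (cabs (c jk) ^+ 2)%:C%C).
  rewrite /csummable; under eq_esum => jk _ do rewrite cabsR (ger0_norm (sqr_ge0 _)).
  by apply: le_lt_trans (bessel Op) _; rewrite lte_mul_pinfty ?(Ccinfty_n2 Op)// lee_fin ltW.
have [|s0 hs] := csum_lim _ sc (divr_gt0 e0 B0); first exact: countableP.
exists s0 => X Y sX XY; have [h _] := hs X sX.
under eq_fun do rewrite synth_sub//; apply: le_trans (dual_bessel c (fset_uniq _)) _.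
rewrite lee_fin mulrC -ler_pdivlMr// -lee_fin; apply: le_trans h.
rewrite -sumEFin; apply: (le_trans _ (esum_ge (x := _) _)); last first.
  exists [set` (Y `\` X)%fset]; last exact: lexx.
  by split => [|jk /=]; [exact: finite_fset|rewrite inE => /andP[/negP]].
rewrite fsbig_finite//=.
by rewrite set_fsetK; apply: lee_sum => jk _; rewrite cabsR ger0_norm ?sqr_ge0.
Qed.

(** A sequence of growing finite sets has a Cauchy sequence of partial sums by [tail_small]; its
    limit then attracts the partial sums over all larger finite sets. *)
Lemma frame_sum_exists : exists h, frame_sum g A (ifourier psi) h.
Proof.
have p2 n : 0 < (n.+1%:R^-1 : R) by rewrite invr_gt0.
pose s n := sval (cid (tail_small (p2 n))).
have sP n : forall X Y : {fset J * Z}, (s n `<=` X)%fset -> (X `<=` Y)%fset ->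
    (n2 mu (fun x => synth Y c x - synth X c x)%R <= (n.+1%:R^-1)%:E)%E by exact: svalP (cid (tail_small (p2 n))).
(* Unions make the finite sets increase with n. *)
pose X n := (\bigcup_(k <- iota 0 n.+1) s k)%fset.
have sX n : (s n `<=` X n)%fset by apply: bigfcup_sup; rewrite ?mem_iota//= add0n ltnSn.
have XX n k : (n <= k)%N -> (X n `<=` X k)%fset.
  move=> nk; apply/bigfcupsP => i; rewrite mem_iota add0n => /andP[_ ik] _.
  by apply: bigfcup_sup => //; rewrite mem_iota add0n (leq_trans ik).
have mS Y : cmeas (synth Y c) by exact: (cL1_synth Y c).1.
have small (e : R) : 0 < e -> exists n, (n.+1%:R^-1 : R) <= e.
  move=> e0; exists (Num.truncn e^-1); by rewrite invf_ple ?posrE// ltW// truncnS_gt.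
have [|h mh hX] := L2_complete (m := mu) (f := fun n => synth (X n) c) (fun n => mS _).
  move=> e e0; have [N Ne] := small e e0; exists N => n k /andP[Nn nk].
  apply: le_trans (sP N _ _ (fsubset_trans (sX N) (XX _ _ Nn)) (XX _ _ nk)) _.
  by rewrite lee_fin.
have h2 : (n2 mu h < +oo)%E.
  have /ecvg0P := hX => /(_ (fun n => n2_ge0 _ _)) /(_ 1 ltr01)[N /(_ N (leqnn _)) hN].
  rewrite (_ : h = fun x => synth (X N) c x + (h x - synth (X N) c x)); last by apply/funext => x; rewrite addrC subrK.
  apply: n2D_lty => //; [exact: cmeasD mh (cmeasN (mS _))|exact: n2_synth|].
  by rewrite n2B_sym (le_lt_trans hN)// ltry.
exists h; split; first by split; [exact: cmeas_clmeasurable|rewrite cLnorm2_lty].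
have FF : Filter (@summability.totally (J * Z)%type) by exact: summability.totally_filter.
apply/(cLnorm2_cvg FF)/(ecvg0F FF) => [Y|e e0]; first exact: n2_ge0.
have e4 : 0 < e / 4 by rewrite divr_gt0.
have [n ne] := small _ e4.
have /ecvg0P := hX => /(_ (fun n => n2_ge0 _ _)) /(_ _ e4)[N hN].
pose k := maxn n N; exists (X k) => // Y /= XY.
have -> : n2 mu (fun x => h x - \sum_(jk <- Y) inner2 (ifourier psi) (atom g A jk) * atom g A jk x) =
    n2 mu (fun x => h x - synth Y c x).
  by apply: n2_eq_ae; apply: aeW => x; congr (_ - _); apply: eq_bigr => jk _; rewrite inner2_atom.
apply: le_trans (n2B_le mu mh (mS (X k)) (mS Y)) _.
rewrite (n2B_sym mu h) (n2B_sym mu (synth (X k) c) (synth Y c)).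
apply: (@le_trans _ _ (2%:E * (e / 4)%:E + 2%:E * (e / 4)%:E)%E); last by rewrite -!EFinM -EFinD lee_fin; lra.
apply: leeD; apply: lee_wpmul2l => //; first exact: hN (leq_maxr _ _).
apply: le_trans (sP n _ _ (fsubset_trans (sX n) (XX _ _ (leq_maxl _ _))) XY) _.
by rewrite lee_fin.
Qed.

(** L^2 convergence of the series allows it to be paired with [fourier eta] term by term, and each
    pairing with an atom is again a conjugated coefficient. So [KF] is weakly the Fourier transform
    of [h]. *)
Lemma frame_sum_weak (KF : V -> C) h eta : Ccinfty O eta ->
  csummable setT (fun jk => coef psi jk * (coef (fun x => (eta x)^*%C) jk)^*%C) ->
  csum [set: J * Z] (fun jk => coef psi jk * (coef (fun x => (eta x)^*%C) jk)^*%C) =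
    cint mu (fun xi => KF xi * eta xi) ->
  frame_sum g A (ifourier psi) h ->
  cintegral (fun x => h x * fourier eta x) = cint mu (fun xi => KF xi * eta xi).
Proof.
move=> Oe sm <- [[clh h2'] hX]; have [h' mh hh] := clmeasurable_cmeas clh.
have -> : cintegral (fun x => h x * fourier eta x) = cint mu (fun x => h' x * fourier eta x).
  by apply: cint_eq_ae; apply: filterS hh => x ->.
have h2 : (n2 mu h' < +oo)%E by rewrite -(n2_eq_ae hh) -cLnorm2_lty.
have e1 := Ccinfty_cL1 Oe; have me : cmeas (fourier eta) by exact: cmeas_fourier e1.1.
have e2 : (n2 mu (fourier eta) < +oo)%E by rewrite fourier_isometry// (Ccinfty_n2 Oe).
apply/eqP; rewrite -subr_eq0; apply/eqP/cabs_eq0/le_anti; rewrite cabs_ge0 andbT.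
apply/ler_addgt0Pr => e e0; rewrite add0r.
have e20 : 0 < e / 2 by rewrite divr_gt0.
have [|s0 hs] := csum_lim _ sm e20; first exact: countableP.
pose M := fine (n2 mu (fourier eta)); have M0 : 0 <= M by rewrite fine_ge0// n2_ge0.
(* Cauchy-Schwarz then leaves at most e/2; the added 1 covers M = 0. *)
pose q := (e / 2) ^+ 2 / (M + 1).
have q0 : 0 < q by rewrite divr_gt0// ?exprn_gt0// ltr_wpDl.
have FF : Filter (@summability.totally (J * Z)%type) by exact: summability.totally_filter.
have /(ecvg0F FF (fun X => n2_ge0 mu _))/(_ _ q0)[s1 _ H] := (cLnorm2_cvg FF _).1 hX.
pose Y := (s0 `|` s1)%fset; have := H Y (fsubsetUr _ _) => /= HY.
have mS : cmeas (synth Y c) by exact: (cL1_synth Y c).1.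
have [_ hY] := hs Y (fsubsetUl _ _).
have E : cint mu (fun x => synth Y c x * fourier eta x) = \sum_(jk <- Y) c jk * (coef (fun x => (eta x)^*%C) jk)^*%C.
  have l1 jk : cL1 mu (fun x => atom g A jk x * fourier eta x).
    by apply: cL1M_n2 => //; [exact: (cL1_atom jk).1|exact: n2_atom].
  rewrite (_ : (fun x => synth Y c x * fourier eta x) = fun x => \sum_(jk <- Y) c jk * (atom g A jk x * fourier eta x)); last first.
    by apply/funext => x; rewrite mulr_suml; apply: eq_bigr => jk _; rewrite mulrA.
  rewrite cint_sum => [|jk]; last exact: cL1Z.
  by apply: eq_bigr => jk _; rewrite (cintZ _ (l1 jk)) test_atom.
have mD : cmeas (fun x => h' x - synth Y c x) by exact: cmeasD mh (cmeasN mS).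
have HY' : (n2 mu (fun x => h' x - synth Y c x)%R <= q%:E)%E.
  apply: le_trans HY; rewrite le_eqVlt; apply/orP; left; apply/eqP/n2_eq_ae.
  apply: filterS hh => x ->; congr (_ - _); apply: eq_bigr => jk _; by rewrite inner2_atom.
have D2 : (n2 mu (fun x => h' x - synth Y c x)%R < +oo)%E by rewrite (le_lt_trans HY')// ltry.
have [_ CS] := cauchy_schwarz mD me D2 e2.
have : cint mu (fun x => (h' x - synth Y c x) * fourier eta x) =
    cint mu (fun x => h' x * fourier eta x) - cint mu (fun x => synth Y c x * fourier eta x).
  rewrite -cintB; [|exact: cL1M_n2|by apply: cL1M_n2 => //; exact: n2_synth].
  by congr cint; apply/funext => x; rewrite mulrBl.
rewrite E => E'; rewrite E' in CS.
have b1 : cabs (cint mu (fun x => h' x * fourier eta x) - \sum_(jk <- Y) c jk * (coef (fun x => (eta x)^*%C) jk)^*%C) <= e / 2.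
  rewrite -(@ler_pXn2r _ 2) ?nnegrE ?cabs_ge0 ?(ltW e20)//; apply: le_trans CS _.
  have qn : fine (n2 mu (fun x => h' x - synth Y c x)) <= q.
    by rewrite -lee_fin fineK// ge0_fin_numE// n2_ge0.
  apply: le_trans (ler_wpM2r M0 qn) _.
  rewrite /q -mulrA ler_piMr ?sqr_ge0// mulrC ler_pdivrMr ?ltr_wpDl// mul1r lerDl//.
rewrite cabsB in hY.
set S := \sum_(_ <- _) _ in b1 hY; set T := csum _ _ in hY *; set U := cint _ _ in b1 *.
rewrite (_ : U - T = (U - S) + (S - T)); last by ring.
by apply: le_trans (cabsD _ _) _; rewrite [leRHS](splitr e); exact: lerD.
Qed.

End synthesis.

End frame_sums.

(** * Decomposition spaces *)

Section decomposition.
Context {R : realType} {d : nat}.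
Local Notation C := R[i].
Local Notation V := 'cV[R]_d.
Local Notation mu := (@lebesgue_cV R d).
Variables (O : set V) (I : choiceType) (Q : I -> set V) (phi : I -> V -> C).
Hypotheses (O_open : open O) (O_full : mu.-negligible (~` O)).
Hypotheses (Q_adm : admissible_cover O Q) (phi_BAPU : BAPU O Q phi).

Lemma ae_O : {ae mu, forall x, O x}. Proof. exact: O_full. Qed.

Lemma phi_Cc i : Ccinfty O (phi i). Proof. by case: phi_BAPU. Qed.

Lemma phi_Q i x : phi i x != 0 -> Q i x.
Proof.
move=> p0; apply: contrapT => nQ; have [h _ h3 _] := phi_BAPU.
have [Ox|nOx] := pselect (O x); first by rewrite h3// eqxx in p0.
by rewrite csupport_cmpl ?eqxx// in p0 => sx; apply: nOx; have [_ [_]] := h i; exact.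
Qed.

(** The sets [Q i] need not be open. Some [phi i] does not vanish at [x], hence on a neighbourhood
    of [x], and [phi i] vanishes outside [Q i]. *)
Lemma phi_nbhs x : O x -> exists i, (Q i)^° x.
Proof.
move=> Ox; have [_ h _ _] := phi_BAPU.
have [i pi0] : exists i, phi i x != 0.
  apply: contrapT => nh; have := h x Ox; rewrite fsbig1; first by move/eqP; rewrite eq_sym oner_eq0.
  by move=> i _; apply/eqP; apply: contrapT => /negP hi; apply: nh; exists i.
exists i; have pc : 0 < cabs (phi i x).
  by rewrite lt_neqAle cabs_ge0 andbT eq_sym; apply/eqP => /cabs_eq0/eqP; rewrite (negbTE pi0).
have := @csmooth_ccont _ _ _ x (phi_Cc i).1 _ pc; apply: filterS => y h2.
by apply: phi_Q; apply/eqP => p0; move: h2; rewrite p0 sub0r cabsN ltxx.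
Qed.

Lemma compact_Q K : compact K -> K `<=` O -> exists s : seq I, forall x, K x -> exists2 i, i \in s & Q i x.
Proof.
rewrite compact_cover => cK KO.
have [|x /KO/phi_nbhs[i hi]|D _ KD] := cK I setT (fun i => (Q i)^°).
- by move=> i _; exact: open_interior.
- by exists i.
exists (enum_fset D) => x /KD[i /= iD ix]; exists i => //; exact: interior_subset ix.
Qed.

(** Finitely many of the sets cover [K], and any member meeting [K] is a neighbour of one of these;
    admissibility bounds the number of neighbours. *)
Lemma compact_finite K : compact K -> K `<=` O -> exists s : {fset I}, forall i x, K x -> i \notin s -> ~ Q i x.
Proof.
move=> cK KO; have [s sP] := compact_Q cK KO; have [_ _ _ [N hN]] := Q_adm.
have fin : finite_set (\bigcup_(i in [set` s]) neighbors Q i).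
  apply: bigcup_finite => [|i _]; first exact: finite_seq.
  by apply/finite_set_leP; exists N.
exists (fset_set (\bigcup_(i in [set` s]) neighbors Q i)) => i x Kx nis Qi; have [l ls Ql] := sP x Kx.
case/negP: nis; rewrite in_fset_set// inE; exists l => //; by exists x.
Qed.

(** The sum of the finitely many [phi i] that matter on [K]. *)
Lemma cutoff K : compact K -> K `<=` O -> exists2 chi, Ccinfty O chi & forall x, K x -> chi x = 1.
Proof.
move=> cK KO; have [s sP] := compact_finite cK KO; have [h1 h2 _ _] := phi_BAPU.
exists (fun x => \sum_(i <- s) phi i x); first exact: Ccinfty_sum.
move=> x Kx; rewrite -(h2 x (KO _ Kx)); symmetry; apply: fsbigTE => i nis.
by apply/eqP; apply: contrapT => /negP/phi_Q; exact: sP nis.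
Qed.

Lemma Ccinfty_K eta : Ccinfty O eta -> exists K, [/\ compact K, K `<=` O & forall x, ~ K x -> eta x = 0].
Proof. by move=> [_ [h1 h2]]; exists (csupport eta); split => // x; exact: csupport_cmpl. Qed.

Lemma Ccinfty_chi eta : Ccinfty O eta -> exists2 chi, Ccinfty O chi & forall x, eta x = chi x * eta x.
Proof.
move=> Oe; have [K [cK KO e0]] := Ccinfty_K Oe; have [chi Oc c1] := cutoff cK KO.
exists chi => // x; have [/c1 ->|/e0 ->] := pselect (K x); by rewrite ?mul1r ?mulr0.
Qed.

(** The regularity needed for F to define an element of Z'(O) and to be recovered from it a.e. *)
Definition locL2 (F : V -> C) := cmeas F /\ forall chi, Ccinfty O chi -> (n2 mu (fun x => chi x * F x)%R < +oo)%E.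

Lemma locL2_cL1 F eta : locL2 F -> Ccinfty O eta -> cL1 mu (fun x => F x * eta x).
Proof.
move=> [mF LF] Oe; have [chi Oc ce] := Ccinfty_chi Oe.
rewrite (_ : (fun x => _) = fun x => (chi x * F x) * eta x); last first.
  by apply/funext => x; rewrite {1}ce mulrCA mulrA.
apply: cL1M_n2; [|exact: Ccinfty_cmeas Oe|exact: LF|exact: Ccinfty_n2 Oe].
by apply: cmeasM => //; exact: Ccinfty_cmeas Oc.
Qed.

Lemma locL2_box F a b : locL2 F -> cbox a b `<=` O ->
  (nint mu (fun x => cabs (F x) * \1_(cbox a b) x)%R < +oo)%E.
Proof.
move=> [mF LF] sub; have [chi Oc c1] := cutoff (@compact_cbox _ _ a b) sub.
have mc : cmeas (fun x => chi x * F x) by apply: cmeasM => //; exact: Ccinfty_cmeas Oc.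
apply: le_lt_trans (L2_locint a b mc (LF _ Oc)); apply: nint_le => x; first by rewrite mulr_ge0 ?cabs_ge0.
have [ax|ax] := boolP (x \in cbox a b); last by rewrite indicE (negbTE ax) !mulr0.
by rewrite c1 ?mul1r//; rewrite inE in ax.
Qed.

Lemma locL2_lin (z : C) F G : locL2 F -> locL2 G -> locL2 (fun x => z * F x + G x).
Proof.
move=> [mF LF] [mG LG]; split; first by apply: cmeasD => //; apply: cmeasM => //; exact: cmeas_cst.
move=> chi Oc; have mc := Ccinfty_cmeas Oc.
rewrite (_ : (fun x => _) = fun x => z * (chi x * F x) + chi x * G x); last by apply/funext => x; ring.
apply: n2D_lty; [|exact: cmeasM|apply: n2Z_lty; [exact: cmeasM|exact: LF]|exact: LG].
by apply: cmeasM; [exact: cmeas_cst|exact: cmeasM].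
Qed.

Lemma locL2_eq F G U : locL2 F -> locL2 G -> open U -> U `<=` O ->
  (forall eta, Ccinfty U eta -> cint mu (fun x => F x * eta x) = cint mu (fun x => G x * eta x)) ->
  {ae mu, forall x, U x -> F x = G x}.
Proof.
move=> LF LG oU UO FG; have LD := locL2_lin (- 1) LG LF; have mD := LD.1.
have : {ae mu, forall x, U x -> (fun x => -1 * G x + F x) x = 0}.
  apply: (fundamental_lemma oU mD) => [a b abU|eta Ue]; first exact: locL2_box LD (subset_trans abU UO).
  have Oe := Ccinfty_sub UO Ue; have iF := locL2_cL1 LF Oe; have iG := locL2_cL1 LG Oe.
  rewrite (_ : (fun x => _) = fun x => -1 * (G x * eta x) + F x * eta x); last by apply/funext => x; ring.
  by rewrite (cintD (cL1Z _ iG) iF) (cintZ _ iG) FG// mulN1r addNr.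
by apply: filterS => x h Ux; move: (h Ux) => /= /eqP; rewrite mulN1r addrC subr_eq0 => /eqP.
Qed.

Lemma rapid_truncate (r : R) (f : V -> C) (M : R) : cmeas f -> (forall x, cabs (f x) <= M) -> 0 <= r -> rapid (truncate r f).
Proof.
move=> mf fM r0 s; have M0 : 0 <= M := le_trans (cabs_ge0 _) (fM 0).
split; first apply: cmeasM; last 2 first.
- exact: cmeas_truncate.
- apply: le_lt_trans (nint_boxcst r0 (mulr_ge0 (exprn_ge0 (size s) r0) M0)); apply: nint_le => x; first exact: cabs_ge0.
  rewrite /truncate; case: ifP => xr; last by rewrite mulr0 cabs0.
  rewrite cabsM cabsR normr_prod; apply: ler_pM => //; first exact: prodr_ge0.
    exact: cabs_ge0.
  elim: s => [|i s ih]; first by rewrite big_nil.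
  by rewrite big_cons exprS; apply: ler_pM => //; [exact: prodr_ge0|exact: le_trans (cV_norm_coord _ _) xr].
exact: csmooth_cmeas (csmoothR (smooth_prod _ (fun i => smooth_coord i))).
Qed.

Section weighted.
Variable u : V -> R.
Hypothesis mu_ : measurable_fun setT u.
Hypothesis ub : forall K, compact K -> K `<=` O -> exists m M : R, 0 < m /\ {ae mu, forall x, K x -> m <= u x <= M}.
Local Notation W F := (fun x => (u x)%:C%C * F x)%R.

Let cmeasW' F : cmeas F -> cmeas (W F).
Proof. by move=> mF; apply: cmeasM => //; exact: cmeasR. Qed.

Lemma weight_locL2 F : cmeas F -> (n2 mu (W F) < +oo)%E -> locL2 F.
Proof.
move=> mF F2; split => // chi Oc; have [K [cK KO c0]] := Ccinfty_K Oc.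
have [m [M [m0 um]]] := ub cK KO; have [B B0 HB] := Ccinfty_box Oc.
apply: (@le_lt_trans _ _ (((B / m) ^+ 2)%:E * n2 mu (W F))%E); last first.
  by rewrite lte_mul_pinfty// lee_fin sqr_ge0.
rewrite /n2 -nintZ ?sqr_ge0//; last 2 first.
- by apply: measurable_cabs2; exact: cmeasW'.
- by move=> x; exact: sqr_ge0.
apply: nint_le_ae => [x|x|]; [exact: sqr_ge0|by apply: mulr_ge0; exact: sqr_ge0|].
apply: filterS um => x ux; have [Kx|/c0 ->] := pselect (K x); last first.
  by rewrite mul0r cabs0 expr0n/=; apply: mulr_ge0; exact: sqr_ge0.
have /andP[mx _] := ux Kx; have Bm : 0 <= B / m by rewrite divr_ge0// ltW.
rewrite -exprMn lerXn2r ?nnegrE ?cabs_ge0 ?(mulr_ge0 Bm (cabs_ge0 _))//.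
rewrite !cabsM cabsR ger0_norm ?(le_trans (ltW m0))// mulrA ler_wpM2r ?cabs_ge0//.
apply: le_trans (HB x).1 _; rewrite -mulrA ler_peMr// mulrC ler_pdivlMr// mul1r//.
Qed.

Lemma weight_exh F (e : R) : cmeas F -> (n2 mu (W F) < +oo)%E -> 0 < e -> exists n,
  (n2 mu (W (fun x => F x - (\1_(exh_open O n) x)%:C%C * F x)) <= e%:E)%E.
Proof.
move=> mF F2 e0; pose q n x := cabs ((u x)%:C%C * (F x - (\1_(exh_open O n) x)%:C%C * F x)) ^+ 2.
have mi n : cmeas (fun x : V => (\1_(exh_open O n) x)%:C%C : C).
  apply: cmeasR; apply: measurable_indic; apply: open_measurable_cV; exact: open_exh.
have : nint mu (q n) @[n --> \oo] --> 0%E.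
  apply: (nint_dct (G := fun x => cabs ((u x)%:C%C * F x) ^+ 2)) => //.
  - by move=> n; apply: measurable_cabs2; apply: cmeasW'; apply: cmeasD => //; apply: cmeasN; exact: cmeasM.
  - by apply: measurable_cabs2; exact: cmeasW'.
  - move=> n x; rewrite /q sqr_ge0/= lerXn2r ?nnegrE ?cabs_ge0// !cabsM ler_wpM2l ?cabs_ge0//.
    rewrite indicE; case: (_ \in _); last by rewrite mul0r subr0.
    by rewrite mul1r subrr cabs0 cabs_ge0.
  - apply: filterS ae_O => x Ox; apply/cvgrPdist_le => e1 e10.
    have [n0 hn] := exh_cover O_open Ox; exists n0 => // n /= nn.
    rewrite /q indicE mem_set; last exact: exh_mono nn _ hn.
    by rewrite mul1r subrr mulr0 cabs0 expr0n/= subrr normr0 ltW.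
move=> /ecvg0P => /(_ (fun n => nint_ge0 _ (fun x => sqr_ge0 _))) /(_ _ e0)[N /(_ N (leqnn _)) h].
by exists N.
Qed.

(** F is cut off to an exhausting open set, giving f; then f is smoothed by truncating its inverse
    transform instead of mollifying, and a cutoff equal to 1 on the support of f restores compact
    support in O. The weight is bounded on the support of the cutoff. *)
Lemma density F (e : R) : cmeas F -> (n2 mu (W F) < +oo)%E -> 0 < e ->
  exists2 eta, Ccinfty O eta & (n2 mu (W (fun x => F x - eta x)) <= e%:E)%E.
Proof.
move=> mF F2 e0; have e4 : 0 < e / 4 by rewrite divr_gt0.
have [n hn] := weight_exh mF F2 e4.
pose f x := (\1_(exh_open O n) x)%:C%C * F x.
have mf : cmeas f.
  apply: cmeasM => //; apply: cmeasR; apply: measurable_indic; apply: open_measurable_cV; exact: open_exh.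
have [chi Oc c1] := cutoff (@compact_exh _ _ O n) (@exh_compactS _ _ O n).
have mc := Ccinfty_cmeas Oc.
have fc x : chi x * f x = f x.
  rewrite /f indicE; have [ix|] := boolP (x \in exh_open O n); last by rewrite mul0r mulr0.
  by rewrite c1 ?mul1r//; apply: exh_sub; rewrite inE in ix.
have [mF' LF] := weight_locL2 mF F2.
have f2 : (n2 mu f < +oo)%E.
  apply: le_lt_trans (LF _ Oc); apply: nint_le => x; first exact: sqr_ge0.
  rewrite -fc lerXn2r ?nnegrE ?cabs_ge0// /f indicE; case: (_ \in _); rewrite ?mul1r//.
  by rewrite mul0r mulr0 cabs0 cabs_ge0.
have f1 : cL1 mu f.
  rewrite (_ : f = fun x => chi x * f x); last by apply/funext => x; rewrite fc.
  by apply: cL1M_n2 => //; exact: Ccinfty_n2 Oc.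
have [K [cK KO c0]] := Ccinfty_K Oc; have [m [M [m0 um]]] := ub cK KO; have [B B0 HB] := Ccinfty_box Oc.
(* Bounds the squared weight times the squared cutoff almost everywhere. *)
pose k := (`|M| * B) ^+ 2; have k0 : 0 <= k by exact: sqr_ge0.
have e5 : 0 < e / 4 / (k + 1) by rewrite divr_gt0// ltr_wpDl.
have [M1 HM1] := ifourier_bounded f1.
have mif : cmeas (ifourier f) by exact: cmeas_ifourier f1.1.
have := fourier_truncate_ifourier f1 f2 => /ecvg0P => /(_ (fun n => n2_ge0 _ _)) /(_ _ e5)[N /(_ N (leqnn _)) hN].
pose G := fourier (truncate N%:R (ifourier f)).
have sG : csmooth G by apply: csmooth_fourier; exact: rapid_truncate mif HM1 _.
have mG := csmooth_cmeas sG.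
exists (fun x => chi x * G x); first exact: CcinftyM.
have mcG : cmeas (fun x => chi x * G x) by exact: cmeasM.
have E : (fun x => (u x)%:C%C * (F x - chi x * G x)) =
    fun x => (u x)%:C%C * (F x - f x) + (u x)%:C%C * (f x - chi x * G x) by apply/funext => x; ring.
rewrite E; apply: le_trans (n2D_le mu _ _) _; [exact: cmeasW' (cmeasD mF (cmeasN mf))|exact: cmeasW' (cmeasD mf (cmeasN mcG))|].
apply: (@le_trans _ _ (2%:E * (e / 4)%:E + 2%:E * (e / 4)%:E)%E); last by rewrite -!EFinM -EFinD lee_fin; lra.
apply: leeD; apply: lee_wpmul2l => //.
apply: (@le_trans _ _ (k%:E * n2 mu (fun x => G x - f x)%R)%E); last first.
  apply: le_trans (lee_wpmul2l _ hN) _; first by rewrite lee_fin.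
  rewrite -EFinM lee_fin mulrA ler_pdivrMr ?ltr_wpDl// mulrC ler_wpM2l ?(ltW e4)// lerDl//.
rewrite /n2 -(nintZ _ (measurable_cabs2 (cmeasD mG (cmeasN mf))) k0); last by move=> x; exact: sqr_ge0.
apply: nint_le_ae => [x|x|]; [exact: sqr_ge0|by apply: mulr_ge0 => //; exact: sqr_ge0|].
apply: filterS um => x ux.
rewrite -{1}fc -mulrBr (_ : cabs (_ * (chi x * (f x - G x))) = `|u x| * cabs (chi x) * cabs (G x - f x)); last first.
  by rewrite !cabsM cabsR mulrA cabsB.
rewrite exprMn /k ler_wpM2r ?sqr_ge0// lerXn2r ?nnegrE ?mulr_ge0 ?cabs_ge0//.
have [Kx|/c0 ->] := pselect (K x); last by rewrite cabs0 mulr0 mulr_ge0.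
have /andP[mx Mx] := ux Kx; apply: ler_pM; rewrite ?cabs_ge0 ?(HB x).1//.
rewrite ger0_norm; first exact: le_trans Mx (ler_norm _).
exact: le_trans (ltW m0) mx.
Qed.

End weighted.

(** Each set of the exhaustion meets finitely many of the nonempty sets [Q i]. *)
Lemma countable_I : countable [set: I].
Proof.
pose s n := sval (cid (compact_finite (@compact_exh _ _ O n) (@exh_compactS _ _ O n))).
have sP n : forall i x, exh_compact O n x -> i \notin s n -> ~ Q i x.
  exact: svalP (cid (compact_finite (@compact_exh _ _ O n) (@exh_compactS _ _ O n))).
have : countable (\bigcup_n [set` s n]) by apply: bigcup_countable => // n _; exact: countable_fset.
apply: sub_countable; apply: subset_card_le => i _.
have [h1 h2 _ _] := Q_adm; have [x Qx] := h1 i.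
have [n xn] := exh_cover O_open (h2 _ _ Qx); exists n => //=.
by apply: contrapT => /negP ni; exact: sP _ _ _ (exh_sub xn) ni Qx.
Qed.

(** The indices with [phi i x != 0] all lie in [neighbors Q i0] for any one of them, whose size is
    at most N. *)
Lemma point_finite : exists N : nat, forall x, O x -> exists s : {fset I},
  [/\ (#|` s| <= N)%N, forall i, i \notin s -> phi i x = 0, forall i, i \in s -> Q i x & \sum_(i <- s) phi i x = 1].
Proof.
have [_ _ _ [N hN]] := Q_adm; exists N => x Ox.
have [s0 s0P] : exists s : {fset I}, forall i x0, [set x] x0 -> i \notin s -> ~ Q i x0.
  by apply: compact_finite => [|y ->//]; exact: compact_set1.
pose s := [fset i in s0 | phi i x != 0]%fset.
have sQ i : i \in s -> Q i x by rewrite !inE => /andP[_ /phi_Q].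
have s0' i : i \notin s -> phi i x = 0.
  rewrite !inE negb_and negbK => /orP[is0|/eqP//].
  by apply/eqP; apply: contrapT => /negP/phi_Q; exact: s0P is0.
exists s; split => //.
- case: (fset_0Vmem s) => [->|[i0 i0s]]; first by rewrite cardfs0.
  have : ([set` s] #<= `I_N)%card.
    apply: card_le_trans (hN i0); apply: subset_card_le => i /= /sQ Qi; exists x; split => //; exact: sQ.
  have h : ([set` s] #= `I_(#|` s|))%card by apply/card_eq_fsetP.
  by rewrite (card_le_eql h) card_le_II.
- by have [_ h _ _] := phi_BAPU; rewrite -(h x Ox); symmetry; apply: fsbigTE.
Qed.

(** Fourier inversion bounds [phi i] pointwise by the L^1 norm of its inverse transform. *)
Lemma phi_bound : exists2 c : R, 0 <= c & forall i x, cabs (phi i x) <= c.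
Proof.
have [h _ _ [c hc]] := phi_BAPU.
have P i x : cabs (phi i x) <= c.
  have r1 := rapid_cL1 (rapid_ifourier (h i)).
  rewrite -(ifourierK (h i)) -lee_fin; apply: le_trans (cabs_fourier_le x r1) _.
  apply: le_trans (hc i); rewrite /cLnorm Lnorm1 le_eqVlt; apply/orP; left; apply/eqP.
  by apply: eq_integral => y _; rewrite gee0_abs// lee_fin cabs_ge0.
exists `|c| => // i x; exact: le_trans (P i x) (ler_norm c).
Qed.

Lemma esum_fsetE (X : choiceType) (s : {fset X}) (b : X -> R) : (forall i, 0 <= b i) -> (forall i, i \notin s -> b i = 0) ->
  (\esum_(i in [set: X]) (b i)%:E)%E = (\sum_(i <- s) b i)%:E.
Proof.
move=> b0 bs; rewrite (_ : \esum_(x in _) _ = \esum_(x in [set` s]) (b x)%:E)%E; last first.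
  by rewrite [RHS]esum_mkcond; apply: eq_esum => x _; rewrite mem_setE; case: ifPn => // /bs ->.
rewrite esum_fset//; last by move=> x _; rewrite lee_fin.
by rewrite fsbig_finite//= set_fsetK sumEFin.
Qed.

Lemma sqr_sum_le (X : Type) (s : seq X) (b : X -> R) : (forall i, 0 <= b i) ->
  (\sum_(i <- s) b i) ^+ 2 <= (size s)%:R * \sum_(i <- s) b i ^+ 2.
Proof.
move=> b0; elim: s => [|i s ih]; first by rewrite !big_nil expr0n mul0r.
rewrite !big_cons /= -natr1; set S := \sum_(j <- s) b j in ih *; set T := \sum_(j <- s) _ in ih *.
case: s => [|j s] in S T ih *; first by rewrite /S /T !big_nil !addr0 add0r mul1r.
set n : R := (size (j :: s))%:R in ih *; have n0 : 0 < n by rewrite ltr0n.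
have h : 2 * b i * S <= n * b i ^+ 2 + T.
  apply: (@le_trans _ _ (n * b i ^+ 2 + n^-1 * S ^+ 2)).
    rewrite -subr_ge0 (_ : _ - _ = n^-1 * (n * b i - S) ^+ 2); first by rewrite mulr_ge0 ?sqr_ge0// invr_ge0 ltW.
    by have := lt0r_neq0 n0 => hn; field.
  by rewrite lerD2l mulrC ler_pdivrMr// mulrC.
by nra.
Qed.

Section norm.
Variables (w : I -> R) (u : V -> R) (c1 c2 : R).
Hypotheses (w0 : forall i, 0 < w i) (mu_ : measurable_fun setT u) (c10 : 0 < c1) (c20 : 0 < c2).
Hypothesis uw : {ae mu, forall x, forall i, Q i x -> c1 * w i <= u x <= c2 * w i}.
Local Notation W F := (fun x => (u x)%:C%C * F x)%R.

Lemma weight_bound K : compact K -> K `<=` O -> exists m M : R, 0 < m /\ {ae mu, forall x, K x -> m <= u x <= M}.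
Proof.
move=> cK KO; have [s sP] := compact_Q cK KO.
pose S := \sum_(i <- s) (c1 * w i)^-1; pose M := \sum_(i <- s) c2 * w i.
have p1 i : 0 < c1 * w i by rewrite mulr_gt0.
have S0 : 0 <= S by apply: sumr_ge0 => i _; rewrite invr_ge0 ltW.
exists (S + 1)^-1, M; split; first by rewrite invr_gt0 ltr_wpDl.
apply: filterS uw => x ux /sP[i si /ux/andP[h1 h2]]; apply/andP; split.
  apply: le_trans h1; rewrite invf_ple ?posrE ?ltr_wpDl// (@le_trans _ _ S)// ?lerDl//.
  by rewrite /S (big_rem i)//= lerDl; apply: sumr_ge0 => k _; rewrite invr_ge0 ltW.
apply: le_trans h2 _; rewrite /M (big_rem i)//= lerDl; apply: sumr_ge0 => k _.
by rewrite mulr_ge0// ltW.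
Qed.

Definition normsq (F : V -> C) := (\esum_(i in [set: I]) ((w i ^+ 2)%:E * n2 mu (fun x => phi i x * F x)%R))%E.

Let b F i x := w i ^+ 2 * cabs (phi i x * F x) ^+ 2.

Let mb F i : cmeas F -> measurable_fun setT (b F i).
Proof.
move=> mF; apply: measurable_funM => //; apply: measurable_cabs2; apply: cmeasM => //.
exact: Ccinfty_cmeas (phi_Cc i).
Qed.

Let b0 F i x : 0 <= b F i x. Proof. by apply: mulr_ge0; exact: sqr_ge0. Qed.

Lemma normsqE F : cmeas F -> normsq F = (\int[mu]_x \esum_(i in [set: I]) (b F i x)%:E)%E.
Proof.
move=> mF; rewrite nint_esum//; last 2 first.
- exact: countable_I.
- by move=> i; exact: mb.
apply: eq_esum => i _; rewrite /n2 -nintZ ?sqr_ge0//; last by move=> x; exact: sqr_ge0.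
by apply: measurable_cabs2; apply: cmeasM => //; exact: Ccinfty_cmeas (phi_Cc i).
Qed.

(** Pointwise comparison at almost every x. At most N of the [phi i] are nonzero there, each bounded
    by c, and [u] is comparable to [w i]; conversely 1 = |sum phi_i|^2 <= N sum |phi_i|^2. The added
    1 makes both constants positive. *)
Lemma norm_equiv : exists k1 k2 : R, [/\ 0 < k1, 0 < k2 & forall F, cmeas F ->
  (normsq F <= k1%:E * n2 mu (W F))%E /\ (n2 mu (W F) <= k2%:E * normsq F)%E].
Proof.
have [N hN] := point_finite; have [c c0 hc] := phi_bound.
pose k1 : R := N%:R * (c / c1) ^+ 2 + 1; pose k2 : R := N%:R * c2 ^+ 2 + 1.
have k10 : 0 < k1 by rewrite ltr_wpDl// mulr_ge0// sqr_ge0.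
have k20 : 0 < k2 by rewrite ltr_wpDl// mulr_ge0// sqr_ge0.
exists k1, k2; split => // F mF.
have mW : cmeas (W F) by apply: cmeasM => //; exact: cmeasR.
have mE : measurable_fun setT (fun x => \esum_(i in [set: I]) (b F i x)%:E)%E.
  by apply: measurable_esum => //; [exact: countable_I|move=> i; exact: mb].
have E0 x : (0 <= \esum_(i in [set: I]) (b F i x)%:E)%E by apply: esum_ge0 => i _; rewrite lee_fin.
have key : {ae mu, forall x, (\esum_(i in [set: I]) (b F i x)%:E <= (k1 * cabs ((u x)%:C%C * F x) ^+ 2)%:E)%E /\
    ((cabs ((u x)%:C%C * F x) ^+ 2)%:E <= k2%:E * \esum_(i in [set: I]) (b F i x)%:E)%E}.
  apply: filterS2 ae_O uw => x Ox ux; have [s [sN s0 sQ s1]] := hN x Ox.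
  have bE : (\esum_(i in [set: I]) (b F i x)%:E)%E = (\sum_(i <- s) b F i x)%:E.
    by apply: esum_fsetE => // i /s0 e; rewrite /b e mul0r cabs0 expr0n mulr0.
  have sNR : (size s)%:R <= N%:R :> R by rewrite ler_nat.
  have n0 : 0 <= cabs ((u x)%:C%C * F x) ^+ 2 by exact: sqr_ge0.
  rewrite bE -EFinM !lee_fin; split.
    apply: (@le_trans _ _ (\sum_(i <- s) (c / c1) ^+ 2 * cabs ((u x)%:C%C * F x) ^+ 2)).
      rewrite big_seq [leRHS]big_seq; apply: ler_sum => i /sQ/ux/andP[h1 _].
      rewrite /b !cabsM cabsR -!exprMn; apply: lerXn2r; rewrite ?nnegrE.
      - by rewrite !mulr_ge0 ?cabs_ge0// ltW.
      - by rewrite !mulr_ge0 ?cabs_ge0// invr_ge0 ltW.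
      rewrite !mulrA ler_wpM2r ?cabs_ge0//.
      have cu : c1 * w i <= `|u x| by rewrite (le_trans h1)// ler_norm.
      apply: (@le_trans _ _ (w i * c)); first by rewrite ler_wpM2l ?(ltW (w0 i)).
      rewrite mulrC -mulrA ler_wpM2l// mulrC ler_pdivlMr// mulrC //.
    rewrite big_const_seq count_predT iter_addr_0 -[leLHS]mulr_natl mulrA.
    rewrite ler_wpM2r// /k1 (@le_trans _ _ (N%:R * (c / c1) ^+ 2))// ?lerDl//.
    by rewrite ler_wpM2r ?sqr_ge0.
  have one : 1 <= N%:R * \sum_(i <- s) cabs (phi i x) ^+ 2.
    have := sqr_sum_le s (fun i => cabs_ge0 (phi i x)) => h.
    apply: (@le_trans _ _ ((\sum_(i <- s) cabs (phi i x)) ^+ 2)).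
      rewrite -[leLHS](expr1n _ 2) lerXn2r ?nnegrE ?sumr_ge0// => [i _|]; first exact: cabs_ge0.
      rewrite -(@cabs1 R) -s1; elim/big_rec2: _ => [|i y1 y2 _ ih]; first by rewrite cabs0.
      by apply: le_trans (cabsD _ _) _; rewrite lerD2l.
    apply: le_trans h _; rewrite ler_wpM2r// sumr_ge0// => i _; exact: sqr_ge0.
  apply: (@le_trans _ _ (N%:R * \sum_(i <- s) (cabs (phi i x) ^+ 2 * cabs ((u x)%:C%C * F x) ^+ 2))).
    by rewrite -mulr_suml mulrA ler_peMl.
  apply: (@le_trans _ _ (N%:R * \sum_(i <- s) c2 ^+ 2 * b F i x)); last first.
    have sb0 : 0 <= \sum_(i <- s) b F i x by apply: sumr_ge0 => i _; exact: b0.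
    by rewrite -mulr_sumr mulrA ler_wpM2r// lerDl.
  rewrite ler_wpM2l// big_seq [leRHS]big_seq; apply: ler_sum => i /sQ/ux/andP[h1 h2].
  rewrite /b !cabsM cabsR -!exprMn; apply: lerXn2r; rewrite ?nnegrE.
  - by rewrite !mulr_ge0 ?cabs_ge0.
  - by rewrite !mulr_ge0 ?cabs_ge0// ltW.
  rewrite (_ : c2 * _ = (c2 * w i) * (cabs (phi i x) * cabs (F x))); last by ring.
  rewrite mulrCA ler_wpM2r ?mulr_ge0 ?cabs_ge0// ger0_norm//.
  by rewrite (le_trans _ h1)// mulr_ge0// ltW.
rewrite normsqE//; split.
  rewrite /n2 -(nintZ _ (measurable_cabs2 mW) (ltW k10)); last by move=> x; exact: sqr_ge0.
  apply: integral_le_ae => // [x|]; first by rewrite lee_fin; apply: mulr_ge0; [exact: ltW|exact: sqr_ge0].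
  by apply: filterS key => x [].
rewrite -ge0_integralZl_EFin ?(ltW k20)//.
apply: integral_le_ae => [x|x|]; first by rewrite lee_fin sqr_ge0.
  by rewrite mule_ge0// lee_fin ltW.
by apply: filterS key => x [].
Qed.

End norm.

(** The functional whose Fourier transform is integration against F; it is 0 outside Z(O), following
    the convention of [Zdual]. *)
Definition ufun (F : V -> C) : (V -> C) -> C := fun psi =>
  if `[< Zspace O psi >] then cint mu (fun x => F x * ifourier psi x) else 0.

Lemma ufunE F eta : Ccinfty O eta -> ufun F (fourier eta) = cint mu (fun x => F x * eta x).
Proof. by move=> Oe; rewrite /ufun asboolT ?(fourierK Oe)//; exists eta. Qed.

Lemma ufun_ext (f : (V -> C) -> C) F : (forall psi, ~ Zspace O psi -> f psi = 0) ->
  (forall eta, Ccinfty O eta -> f (fourier eta) = cint mu (fun x => F x * eta x)) -> f = ufun F.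
Proof.
move=> f0 fE; apply/funext => psi; have [Zp|nZ] := pselect (Zspace O psi); last first.
  by rewrite f0// /ufun asboolF.
by have [eta Oe <-] := Zp; rewrite fE// ufunE.
Qed.

Lemma ufun_eq_ae F G : {ae mu, forall x, F x = G x} -> ufun F = ufun G.
Proof.
move=> FG; apply: ufun_ext => [psi nZ|eta Oe]; first by rewrite /ufun asboolF.
by rewrite ufunE//; apply: cint_eq_ae; apply: filterS FG => x ->.
Qed.

Lemma ufun_lin (z : C) F G : locL2 F -> locL2 G ->
  (fun psi => z * ufun F psi + ufun G psi) = ufun (fun x => z * F x + G x).
Proof.
move=> LF LG; apply: ufun_ext => [psi nZ|eta Oe]; first by rewrite /ufun !asboolF// mulr0 addr0.
have iF := locL2_cL1 LF Oe; have iG := locL2_cL1 LG Oe.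
rewrite !ufunE// -(cintZ _ iF) -(cintD (cL1Z z iF) iG); congr cint; apply/funext => x; ring.
Qed.

Lemma ufun_inj F G : locL2 F -> locL2 G -> ufun F = ufun G -> {ae mu, forall x, F x = G x}.
Proof.
move=> LF LG FG.
have h : {ae mu, forall x, O x -> F x = G x}.
  by apply: (locL2_eq LF LG O_open) => // eta Oe; rewrite -(ufunE F Oe) -(ufunE G Oe) FG.
by apply: filterS2 ae_O h => x Ox; exact.
Qed.

Lemma ufun_Zdual F : locL2 F -> Zdual O (ufun F).
Proof.
move=> LF; split; last by move=> psi nZ; rewrite /ufun asboolF.
split=> [z p q Op Oq|K cK KO].
  have iP := locL2_cL1 LF Op; have iQ := locL2_cL1 LF Oq.
  rewrite /fourierZ !ufunE//; last by apply: CcinftyD => //; exact: CcinftyZ.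
  rewrite -(cintZ _ iP) -(cintD (cL1Z z iP) iQ); congr cint; apply/funext => x; ring.
have [chi Oc c1] := cutoff cK KO; have iC := locL2_cL1 LF Oc.
have [M [M0 HM]] := cL1_bound iC.
(* Integration against a locally integrable function has order 0. Strict positivity of M + 1 also
   settles the case of an infinite [CNnorm]. *)
exists (M + 1), 0%N => p Kp; have Op := Ccinfty_sub KO Kp.
have px x : p x = chi x * p x.
  have [sx|/csupport_cmpl ->] := pselect (csupport p x); last by rewrite mulr0.
  by rewrite c1 ?mul1r//; have [_ [_]] := Kp; exact.
have sup x : ((cabs (p x))%:E <= CNnorm 0 p)%E.
  by apply: ereal_sup_ubound; exists [::] => //; exists x => //; rewrite cpartial_nil.
have M1 : 0 < M + 1 by rewrite ltr_wpDl.
rewrite /fourierZ ufunE//; have ip := locL2_cL1 LF Op.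
apply: le_trans (cabs_cint_le ip) _.
case E : (CNnorm 0 p) sup => [r| |] sup; last 2 first.
- by rewrite gt0_muley ?leey// lte_fin.
- by have := sup 0; rewrite leeNy_eq.
have r0 : 0 <= r by have := sup 0; rewrite lee_fin; apply: le_trans; exact: cabs_ge0.
apply: (@le_trans _ _ (r%:E * nint mu (fun x => cabs (F x * chi x))%R)%E).
  rewrite -nintZ//; [|exact: measurable_cabs iC.1|by move=> x; exact: cabs_ge0].
  apply: nint_le => x; first exact: cabs_ge0.
  by rewrite {1}px mulrA cabsM mulrC ler_wpM2r ?cabs_ge0// -lee_fin.
apply: le_trans (lee_wpmul2l _ HM) _; first by rewrite lee_fin.
by rewrite -!EFinM lee_fin mulrC ler_wpM2r// lerDl.
Qed.

Lemma n2_ifourier f : cL1 mu f -> (n2 mu f < +oo)%E -> n2 mu (ifourier f) = n2 mu f.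
Proof.
move=> f1 f2; rewrite -(n2_conj _ f) -(n2_conj _ (ifourier f)).
have c2 : (n2 mu (fun x => (f x)^*%C) < +oo)%E by rewrite n2_conj.
rewrite -(fourier_isometry (cL1_conj f1) c2); apply: n2_eq_ae; apply: aeW => x.
by rewrite fourier_conj.
Qed.

(** The inverse transform of phi_i F represents the localized piece, hence competes in the infimum
    defining [LnormS]. *)
Lemma cut_upper i F : locL2 F ->
  (LnormS 2%:E (ifourier_cut (phi i) (ufun F)) <= cLnorm 2%:E (fun x => (phi i x * F x)%R))%E.
Proof.
move=> LF; pose f x := phi i x * F x.
have f1 : cL1 mu f by have := locL2_cL1 LF (phi_Cc i); congr cL1; apply/funext => x; rewrite mulrC.
have f2 : (n2 mu f < +oo)%E by exact: LF.2 _ (phi_Cc i).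
apply: ereal_inf_lbound; exists (ifourier f); last by rewrite !cLnorm2E n2_ifourier.
have mi : cmeas (ifourier f) by exact: cmeas_ifourier f1.1.
split; first exact: cmeas_clmeasurable.
move=> psi sp; have rp := schwartz_rapid sp; have p1 := rapid_cL1 rp.
have [M HM] := ifourier_bounded f1.
have h1 : cL1 mu (fun x => ifourier f x * psi x).
  by under eq_fun do rewrite mulrC; exact: cL1_prod_bounded p1 mi HM.
split.
  split; first exact: cmeas_clmeasurable h1.1.
  rewrite /cLnorm Lnorm1; apply: le_lt_trans h1.2; rewrite le_eqVlt; apply/orP; left; apply/eqP.
  by apply: eq_integral => y _; rewrite gee0_abs// lee_fin cabs_ge0.
rewrite /ifourier_cut /fourierZ ufunE; last by apply: CcinftyM (phi_Cc i) _; exact: csmooth_ifourier.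
transitivity (cint mu (fun x => f x * ifourier psi x)); last by symmetry; exact: (ifourier_mul f1 p1).
congr cint; apply/funext => x.
by rewrite /f mulrA (mulrC (F x)).
Qed.

(** F is the L^2 Fourier transform of a Borel version of [h], tested on the Schwartz functions
    [fourier eta]. *)
Lemma cut_lower i (f : (V -> C) -> C) h : represents h (ifourier_cut (phi i) f) -> (cLnorm 2%:E h < +oo)%E ->
  exists F, [/\ cmeas F, (n2 mu F <= n2 mu h)%E &
    forall eta, Ccinfty setT eta -> f (fourier (fun x => phi i x * eta x)) = cint mu (fun x => F x * eta x)].
Proof.
move=> [clh rep]; rewrite cLnorm2_lty => h2; have [h' mh hh] := clmeasurable_cmeas clh.
have e2 := n2_eq_ae hh; rewrite e2 in h2 *.
have [F [mF Fh _ FE]] := L2_fourier_ex mh h2; exists F; split => // eta Ce.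
have := (rep _ (schwartz_fourier Ce)).2; rewrite /ifourier_cut /fourierZ (fourierK Ce) => ->.
rewrite FE; [|exact: Ccinfty_cL1 Ce|exact: Ccinfty_n2 Ce].
by apply: cint_eq_ae; apply: filterS hh => x ->.
Qed.

Lemma n2_locL2 F : cmeas F -> (n2 mu F < +oo)%E -> locL2 F.
Proof.
move=> mF F2; apply: (weight_locL2 (u := fun=> 1)) => // [K _ _|].
  by exists 1, 1; split => //; apply: aeW => x _; rewrite lexx.
by rewrite (n2_eq_ae (g := F))//; apply: aeW => x; rewrite mul1r.
Qed.

(** Every square integrable representative has a transform that tests like phi_i F, so it cannot
    have a smaller norm. *)
Lemma LnormS_ufun i F : locL2 F ->
  LnormS 2%:E (ifourier_cut (phi i) (ufun F)) = cLnorm 2%:E (fun x => phi i x * F x).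
Proof.
move=> LF; apply/eqP; rewrite eq_le cut_upper//=; apply: le_ereal_inf_tmp => _ [h rh <-].
have [h2|] := ltP (cLnorm 2%:E h) +oo%E; last by rewrite leye_eq => /eqP ->; rewrite leey.
have [Fi [mFi Fih FE]] := cut_lower rh h2; rewrite cLnorm2_lty in h2.
have Fi2 := le_lt_trans Fih h2.
have LFi := n2_locL2 mFi Fi2.
have mp : cmeas (fun x => phi i x * F x) by apply: cmeasM LF.1; exact: Ccinfty_cmeas (phi_Cc i).
have Lp : locL2 (fun x => phi i x * F x) by apply: n2_locL2 => //; exact: LF.2 _ (phi_Cc i).
have ae : {ae mu, forall x, phi i x * F x = Fi x}.
  have h0 := locL2_eq Lp LFi O_open (@subset_refl _ O).
  apply: filterS2 ae_O (h0 _) => [x Ox|eta Oe]; first exact.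
  rewrite -(FE _ (Ccinfty_sub (@subsetT _ O) Oe)) ufunE.
    by congr cint; apply/funext => x; ring.
  by apply: CcinftyM (phi_Cc i) _; case: Oe.
rewrite !cLnorm2E (n2_eq_ae ae).
by apply: gt0_ler_poweR; rewrite ?in_itv/= ?n2_ge0 ?leey ?invr_ge0.
Qed.

Lemma decomp_norm_ufun w F : (forall i, 0 < w i) -> locL2 F ->
  decomp_norm phi 2%:E 2%:E w (ufun F) = (normsq w F `^ 2^-1)%E.
Proof.
move=> w0 LF; rewrite /decomp_norm /lqnorm; congr (_ `^ _)%E; apply: eq_esum => i _.
rewrite LnormS_ufun// poweRM ?lee_fin ?(ltW (w0 i))//; last exact: Lnorm_ge0.
rewrite cLnorm2E -poweRrM mulVf ?pnatr_eq0// poweRe1 ?n2_ge0//.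
by rewrite poweR_EFin powR_mulrn// ltW.
Qed.

(** Finiteness of the norm makes each localized piece a square integrable function F_i on the
    Fourier side. Their sum is the desired function, and the partition of unity reassembles the
    functional on test functions. *)
Lemma Zdual_ufun w (f : (V -> C) -> C) : (forall i, 0 < w i) -> Zdual O f ->
  (decomp_norm phi 2%:E 2%:E w f < +oo)%E -> exists2 F, locL2 F & f = ufun F.
Proof.
move=> w0 [[flin _] f0] Nf.
have ex i : exists F, [/\ cmeas F, (n2 mu F < +oo)%E & forall eta, Ccinfty setT eta ->
    f (fourier (fun x => phi i x * eta x)) = cint mu (fun x => F x * eta x)].
  have L2 : (LnormS 2%:E (ifourier_cut (phi i) f) < +oo)%E.
    rewrite ltNge leye_eq; apply/negP => /eqP E; move: Nf; rewrite /decomp_norm /lqnorm.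
    have : (+oo <= \esum_(j in [set: I]) ((w j)%:E * LnormS 2%:E (ifourier_cut (phi j) f)) `^ 2)%E.
      apply: le_trans (esum_term (fun j => ((w j)%:E * LnormS 2%:E (ifourier_cut (phi j) f)) `^ 2)%E (Logic.I : [set: I] i)).
      by rewrite E gt0_muley ?lte_fin// poweRyr.
    by rewrite leye_eq => /eqP ->; rewrite poweRyr// invr_eq0.
  have [_ [h rh <-] h2] : exists2 y, [set cLnorm 2%:E h | h in represents ^~ (ifourier_cut (phi i) f)] y & (y < +oo)%E.
    by apply/ereal_inf_lt.
  have [F [mF Fh FE]] := cut_lower rh h2; exists F; split => //.
  by apply: le_lt_trans Fh _; rewrite -cLnorm2_lty.
pose Fi i := sval (cid (ex i)).
have FiP i : [/\ cmeas (Fi i), (n2 mu (Fi i) < +oo)%E & forall eta, Ccinfty setT eta ->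
    f (fourier (fun x => phi i x * eta x)) = cint mu (fun x => Fi i x * eta x)] by exact: svalP (cid (ex i)).
pose F x := csum [set: I] (Fi ^~ x).
have mF : cmeas F by apply: cmeas_csum; [exact: countable_I|move=> i; case: (FiP i)].
have fz : f (fourier (fun=> 0)) = 0.
  have := flin 1 _ _ (Ccinfty0 O) (Ccinfty0 O); rewrite /fourierZ.
  rewrite (_ : (fun x : V => 1 * 0 + 0) = fun=> 0); last by apply/funext => x; rewrite mulr0 addr0.
  rewrite mul1r.
  by move/eqP; rewrite -subr_eq0 opprD addrA subrr sub0r oppr_eq0 => /eqP.
(* Over each exhausting set only finitely many F_i survive, so the sum is finite there and finite
   linearity of [f] suffices. *)
have loc n : exists s : {fset I}, (forall i x, exh_compact O n x -> i \notin s -> phi i x = 0) /\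
    {ae mu, forall x, exh_open O n x -> F x = \sum_(i <- s) Fi i x}.
  have [s sP] := compact_finite (@compact_exh _ _ O n) (@exh_compactS _ _ O n).
  have sP' i x : exh_compact O n x -> i \notin s -> phi i x = 0.
    by move=> xn nis; apply/eqP; apply: contrapT => /negP/phi_Q; exact: sP xn nis.
  exists s; split => //.
  have z i : [set j | j \notin s] i -> {ae mu, forall x, exh_open O n x -> Fi i x = 0}.
    move=> /= nis; have [mi i2 iE] := FiP i.
    have L0 : locL2 (fun=> 0 : C).
      by apply: n2_locL2; [exact: cmeas_cst|rewrite /n2 /nint cabs0 expr0n/= integral0].
    apply: (locL2_eq (n2_locL2 mi i2) L0 (@open_exh _ _ O n) (@exh_openS _ _ O n)) => eta Ue.
    rewrite -iE; last exact: Ccinfty_sub Ue.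
    rewrite (_ : (fun x => phi i x * eta x) = fun=> 0); last first.
      apply/funext => x; have [sx|/csupport_cmpl ->] := pselect (csupport eta x); last by rewrite mulr0.
      by rewrite sP' ?mul0r//; apply: exh_sub; have [_ [_]] := Ue; exact.
    rewrite fz; symmetry; rewrite (_ : (fun x => 0 * eta x) = fun=> 0) ?cint0//.
    by apply/funext => x; rewrite mul0r.
  have cz : countable [set j | j \notin s] by apply: sub_countable countable_I; exact: subset_card_le.
  apply: filterS (ae_countable cz z) => x hx xn.
  rewrite /F -(csum_fset s (Fi ^~ x) countable_I); apply: eq_csum => i _.
  by case: ifPn => // nis; exact: hx.
have LF : locL2 F.
  split => // chi Oc; have [K [cK KO c0]] := Ccinfty_K Oc.
  have [n Kn] := exh_absorb O_open cK KO; have [s [_ sF]] := loc n.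
  rewrite (n2_eq_ae (g := fun x => \sum_(i <- s) chi x * Fi i x)); last first.
    apply: filterS sF => x xn; rewrite -mulr_sumr.
    by have [/Kn/xn ->//|/c0 ->] := pselect (K x); rewrite !mul0r.
  apply: n2_sum_lty => i; have [mi i2 _] := FiP i.
    by apply: cmeasM => //; exact: Ccinfty_cmeas Oc.
  exact: (n2_locL2 mi i2).2.
exists F => //; apply: ufun_ext => // eta Oe.
have [K [cK KO e0]] := Ccinfty_K Oe; have [n Kn] := exh_absorb O_open cK KO; have [s [s0 sF]] := loc n.
have Te : Ccinfty setT eta by exact: Ccinfty_sub Oe.
have pe i : Ccinfty O (fun x => phi i x * eta x) by apply: CcinftyM (phi_Cc i) _; case: Oe.
have linS (r : seq I) : f (fourier (fun x => \sum_(i <- r) phi i x * eta x)) = \sum_(i <- r) f (fourier (fun x => phi i x * eta x)).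
  elim: r => [|i r ih]; first by under eq_fun do rewrite big_nil; rewrite big_nil.
  rewrite big_cons -ih; have := flin 1 _ _ (pe i) (Ccinfty_sum r pe); rewrite /fourierZ mul1r => <-.
  by congr f; congr fourier; apply/funext => x; rewrite big_cons mul1r.
have {1}-> : eta = fun x => \sum_(i <- s) phi i x * eta x.
  apply/funext => x; rewrite -mulr_suml; have [Kx|/e0 ->] := pselect (K x); last by rewrite mulr0.
  have [_ h2 _ _] := phi_BAPU; have xn := exh_sub (Kn _ Kx).
  rewrite -(@fsbigTE _ _ _ _ s (phi ^~ x)) ?h2 ?mul1r//; first exact: KO.
  by move=> i; exact: s0.
rewrite linS; have i1 i : cL1 mu (fun x => Fi i x * eta x).
  have [mi i2 _] := FiP i; apply: cL1M_n2 => //; [exact: Ccinfty_cmeas Oe|exact: Ccinfty_n2 Oe].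
under eq_bigr => i _ do rewrite (let: And3 _ _ e := FiP i in e) //.
rewrite -cint_sum//; apply: cint_eq_ae; apply: filterS sF => x xn; rewrite -mulr_suml.
by have [/Kn/xn ->//|/e0 ->] := pselect (K x); rewrite !mulr0.
Qed.

End decomposition.

(** * Inversion by Neumann iteration *)

Section neumann.
Context {R : realType} {d : nat}.
Local Notation C := R[i].
Local Notation V := 'cV[R]_d.
Local Notation mu := (@lebesgue_cV R d).
Variables (u : V -> R) (T : (V -> C) -> V -> C) (lam q kap : R).
Local Notation W F := (fun x => (u x)%:C%C * F x)%R.

Definition L2w (F : V -> C) := cmeas F /\ (n2 mu (W F) < +oo)%E.

Hypotheses (mu_ : measurable_fun setT u) (u0 : {ae mu, forall x, 0 < u x}).
Hypotheses (mT : forall F, cmeas F -> cmeas (T F)) (lam0 : 0 < lam) (q0 : 0 < q) (q1 : q < 1) (kap0 : 0 <= kap).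
Hypothesis T_lin : forall (z : C) F G, L2w F -> L2w G -> {ae mu, forall x, T (fun y => z * F y + G y) x = z * T F x + T G x}.
Hypothesis T_bd : forall F, L2w F -> (n2 mu (W (T F)) <= kap%:E * n2 mu (W F))%E.
Hypothesis T_con : forall F, L2w F -> (n2 mu (W (fun x => F x - lam%:C%C * T F x)) <= (q ^+ 2)%:E * n2 mu (W F))%E.

Lemma cmeas_mulw F : cmeas F -> cmeas (W F).
Proof. by move=> mF; apply: cmeasM => //; exact: cmeasR. Qed.

Lemma L2w_lin (z : C) F G : L2w F -> L2w G -> L2w (fun x => z * F x + G x).
Proof.
move=> [mF F2] [mG G2]; split; first by apply: cmeasD => //; apply: cmeasM => //; exact: cmeas_cst.
rewrite (_ : W (fun x => z * F x + G x) = fun x => z * ((u x)%:C%C * F x) + (u x)%:C%C * G x); last by apply/funext => x; ring.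
apply: n2D_lty; [|exact: cmeas_mulw|apply: n2Z_lty => //; exact: cmeas_mulw|exact: G2].
by apply: cmeasM; [exact: cmeas_cst|exact: cmeas_mulw].
Qed.

Lemma L2wB F G : L2w F -> L2w G -> L2w (fun x => F x - G x).
Proof.
move=> hF hG; have := L2w_lin (- 1) hG hF; congr L2w; apply/funext => x; by rewrite mulN1r addrC.
Qed.

Lemma L2w0 : L2w (fun=> 0).
Proof.
split; first exact: cmeas_cst.
by rewrite /n2 /nint; under eq_integral do rewrite mulr0 cabs0 expr0n/=; rewrite integral0.
Qed.

Lemma L2w_op F : L2w F -> L2w (T F).
Proof.
move=> hF; split; first exact: mT hF.1.
by apply: le_lt_trans (T_bd hF) _; rewrite lte_mul_pinfty ?lee_fin// hF.2.
Qed.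

Lemma n2w_eq0 F : cmeas F -> (n2 mu (W F) <= 0)%E -> {ae mu, forall x, F x = 0}.
Proof.
move=> mF F0; have E0 : n2 mu (W F) = 0%E by apply/le_anti; rewrite F0 n2_ge0.
have := ae0_nint (measurable_cabs2 (cmeas_mulw mF)) (fun x => sqr_ge0 _) E0.
apply: filterS2 u0 => x ux /eqP; rewrite sqrf_eq0 => /eqP/cabs_eq0/eqP.
rewrite mulf_eq0 => /orP[/eqP/(congr1 (@complex.Re R))/= e|/eqP//].
by rewrite e ltxx in ux.
Qed.

Lemma n2w_small F : cmeas F -> (forall e : R, 0 < e -> (n2 mu (W F) <= e%:E)%E) -> {ae mu, forall x, F x = 0}.
Proof. by move=> mF h; apply: n2w_eq0 => //; apply/lee_addgt0Pr => e e0; rewrite add0e; exact: h. Qed.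

(** The difference of F and G vanishes a.e., so its weighted norm is 0 and [T_bd] forces its image
    to vanish a.e. *)
Lemma op_ext F G : L2w F -> L2w G -> {ae mu, forall x, F x = G x} -> {ae mu, forall x, T F x = T G x}.
Proof.
move=> hF hG FG; have hD := L2w_lin (- 1) hF hG.
have z : {ae mu, forall x, T (fun x => -1 * F x + G x) x = 0}.
  apply: n2w_eq0; first exact: mT hD.1.
  apply: le_trans (T_bd hD) _; rewrite (n2_eq_ae (g := fun=> 0)).
    by rewrite /n2 /nint cabs0 expr0n/= integral0 mule0.
  by apply: filterS FG => x ->; rewrite mulN1r addNr mulr0.
apply: filterS2 z (T_lin (- 1) hF hG) => x -> /eqP; rewrite mulN1r eq_sym addrC subr_eq0 => /eqP //.
Qed.

(** From F = (F - lam T F) + lam T F: the first term is contracted, and Young's inequality absorbs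
    it into the left side. *)
Lemma op_lower : exists2 k : R, 0 < k & forall F, L2w F -> (n2 mu (W F) <= k%:E * n2 mu (W (T F)))%E.
Proof.
have qq : 0 < q ^+ 2 < 1 by rewrite exprn_gt0//= expr_lt1// ltW.
(* Makes (1 + s) q^2 = (1 + q^2)/2, still below 1. *)
pose s := (1 - q ^+ 2) / (2 * q ^+ 2).
have s0 : 0 < s by rewrite divr_gt0 ?subr_gt0 ?mulr_gt0//; case/andP: qq.
pose k := 2 / (1 - q ^+ 2) * (1 + s^-1) * lam ^+ 2.
have p0 : 0 < 1 - q ^+ 2 by rewrite subr_gt0; case/andP: qq.
have s1 : 0 < 1 + s^-1 by rewrite addr_gt0// invr_gt0.
have k0 : 0 < k by rewrite mulr_gt0 ?exprn_gt0// mulr_gt0// divr_gt0.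
exists k => // F hF; have hT := L2w_op hF.
have fin G : L2w G -> n2 mu (W G) = (fine (n2 mu (W G)))%:E by move=> [_ g2]; rewrite fineK// ge0_fin_numE// n2_ge0.
have m1 : cmeas (W (fun x => F x - lam%:C%C * T F x)).
  by apply: cmeas_mulw; apply: cmeasD hF.1 (cmeasN _); apply: cmeasM hT.1; exact: cmeas_cst.
have m2 : cmeas (fun x => lam%:C%C * ((u x)%:C%C * T F x)).
  by apply: cmeasM; [exact: cmeas_cst|exact: cmeas_mulw hT.1].
have := n2D_le_s mu s0 m1 m2.
rewrite (_ : (fun x => _ + _) = W F); last by apply/funext => x; ring.
rewrite (n2Z _ _ (cmeas_mulw hT.1)) cabsR (real_normK (num_real _)).
have hD : L2w (fun x => F x - lam%:C%C * T F x).
  by have := L2wB hF (L2w_lin lam%:C%C hT L2w0); congr L2w; apply/funext => x; rewrite addr0.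
have := T_con hF; rewrite (fin _ hF) (fin _ hT) (fin _ hD) -!EFinM -EFinD !lee_fin.
move: (fine _) (fine _) (fine _) => z y x h1 h2.
have h3 : (1 + s) * q ^+ 2 = (1 + q ^+ 2) / 2.
  by have := lt0r_neq0 q0 => hq; rewrite /s; field.
have h4 : y <= (1 + q ^+ 2) / 2 * y + (1 + s^-1) * (lam ^+ 2 * z).
  by apply: (le_trans h2); rewrite lerD2r -h3 -mulrA ler_wpM2l// addr_ge0// ltW.
have {}h4 : (1 - q ^+ 2) * y <= 2 * ((1 + s^-1) * (lam ^+ 2 * z)) by lra.
rewrite -(ler_pM2l p0) (le_trans h4)// /k; set v := s^-1.
rewrite le_eqVlt; apply/orP; left; apply/eqP.
by have := lt0r_neq0 p0 => hp; field.
Qed.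

Section solve.
Variable G : V -> C.
Hypothesis hG : L2w G.

(** The iteration F <- F + lam (G - T F), which needs no powers of an operator that is linear only
    up to null sets. Its increments satisfy D_(n+1) = D_n - lam T D_n a.e. and so decay like q^n. *)
Let Fn n : V -> C := iter n (fun F x => F x + lam%:C%C * (G x - T F x)) (fun=> 0).

Let stepE F : (fun x => F x + lam%:C%C * (G x - T F x)) = fun x => lam%:C%C * (G x - T F x) + F x.
Proof. by apply/funext => x; rewrite addrC. Qed.

Let hFn n : L2w (Fn n).
Proof.
elim: n => [|n ih]; first exact: L2w0.
by rewrite /Fn iterS -/(Fn n) stepE; apply: L2w_lin => //; apply: L2wB => //; exact: L2w_op.
Qed.

Let Dn n x := lam%:C%C * (G x - T (Fn n) x).

Let hDn n : L2w (Dn n).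
Proof.
have := L2w_lin lam%:C%C (L2wB hG (L2w_op (hFn n))) L2w0.
by congr L2w; apply/funext => x; rewrite addr0.
Qed.

Let DnE n x : Fn n.+1 x - Fn n x = Dn n x.
Proof. by rewrite /Fn iterS -/(Fn n) addrC addKr. Qed.

Let Dn_rate n : (n2 mu (W (Dn n)) <= (fine (n2 mu (W (Dn 0))) * (q ^+ 2) ^+ n)%:E)%E.
Proof.
elim: n => [|n ih].
  by rewrite expr0 mulr1 fineK// ge0_fin_numE ?n2_ge0//; exact: (hDn 0).2.
apply: (@le_trans _ _ ((q ^+ 2)%:E * n2 mu (W (Dn n)))%E); last first.
  apply: le_trans (lee_wpmul2l _ ih) _; first by rewrite lee_fin sqr_ge0.
  by rewrite -EFinM lee_fin (exprS (q ^+ 2) n) mulrCA.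
apply: le_trans (T_con (hDn n)); rewrite le_eqVlt; apply/orP; left; apply/eqP/n2_eq_ae.
have e : Fn n.+1 = fun x => 1 * Dn n x + Fn n x by apply/funext => x; rewrite mul1r -DnE subrK.
apply: filterS (T_lin 1 (hDn n) (hFn n)) => x; rewrite -e => ex.
by congr (_ * _); rewrite {1}/Dn ex mul1r opprD addrCA addrC mulrDr -/(Dn n x) mulrN.
Qed.

(** The weighted iterates converge geometrically, and dividing their limit by [u] gives F. The
    residual G - T F is controlled by the n-th increment and by T applied to Fn - F. *)
Lemma op_solve : exists2 F, L2w F & {ae mu, forall x, T F x = G x}.
Proof.
have q2 : 0 < q ^+ 2 < 1 by rewrite exprn_gt0//= expr_lt1// ltW.
have c0 : 0 <= fine (n2 mu (W (Dn 0))) by rewrite fine_ge0// n2_ge0.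
have mFn n := (hFn n).1.
have hyp n : (n2 mu (fun x => (u x)%:C%C * Fn n.+1 x - (u x)%:C%C * Fn n x)%R <= (fine (n2 mu (W (Dn 0))) * (q ^+ 2) ^+ n)%:E)%E.
  apply: le_trans (Dn_rate n); rewrite le_eqVlt; apply/orP; left; apply/eqP/n2_eq_ae.
  by apply: aeW => x; rewrite -mulrBr DnE.
have [H mH HF] := riesz_fischer (fun n => cmeas_mulw (mFn n)) q2 c0 hyp.
(* The inverse as a power, which is measurable; it is 1/u wherever u > 0. *)
pose F x := (u x `^ (-1))%:C%C * H x.
have mF : cmeas F.
  apply: cmeasM => //; apply: cmeasR.
  have mp : measurable_fun setT (fun r : measurableTypeR R => (r : R) `^ (-1) : measurableTypeR R) by exact: measurable_powR.
  exact: (measurableT_comp mp mu_).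
have WF : {ae mu, forall x, (u x)%:C%C * F x = H x}.
  apply: filterS u0 => x ux; rewrite /F mulrA (_ : (u x)%:C%C * _ = 1) ?mul1r//.
  by apply: cplx_eq => /=; rewrite !(mulr0, mul0r, subr0, addr0)// powR_inv1 ?ltW// mulfV// gt_eqF.
have dFn n : n2 mu (W (fun x => Fn n x - F x)) = n2 mu (fun x => (u x)%:C%C * Fn n x - H x).
  by apply: n2_eq_ae; apply: filterS WF => x <-; rewrite mulrBr.
have small (e : R) : 0 < e -> exists N, forall n, (N <= n)%N -> (n2 mu (W (fun x => Fn n x - F x)) <= e%:E)%E.
  move=> e0; have /ecvg0P := HF => /(_ (fun n => n2_ge0 _ _)) /(_ _ e0)[N hN].
  by exists N => n /hN; rewrite dFn.
have hF : L2w F.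
  split => //; have [N hN] := small 1 ltr01.
  rewrite (_ : W F = fun x => (u x)%:C%C * Fn N x + (- 1) * ((u x)%:C%C * (Fn N x - F x))); last by apply/funext => x; ring.
  have mD : cmeas (fun x => Fn N x - F x) by exact: cmeasD (mFn N) (cmeasN mF).
  have m1 : cmeas (W (fun x => Fn N x - F x)) by exact: cmeas_mulw.
  apply: n2D_lty; [exact: cmeas_mulw|by apply: cmeasM => //; exact: cmeas_cst|exact: (hFn N).2|].
  by apply: n2Z_lty => //; apply: le_lt_trans (hN N (leqnn _)) _; rewrite ltry.
exists F => //; have mG := hG.1.
have rateD (e : R) : 0 < e -> exists N, forall n, (N <= n)%N -> (n2 mu (W (Dn n)) <= e%:E)%E.
  move=> e0; have e4 : 0 < e / 4 by rewrite divr_gt0.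
  have [N hN] := small _ e4; exists N => n nN.
  rewrite (_ : W (Dn n) = fun x => (u x)%:C%C * (Fn n.+1 x - F x) + (- 1) * ((u x)%:C%C * (Fn n x - F x))); last first.
    by apply/funext => x; rewrite -DnE; ring.
  have mD k : cmeas (W (fun x => Fn k x - F x)) by apply: cmeas_mulw; exact: cmeasD (mFn k) (cmeasN mF).
  apply: le_trans (n2D_le mu (mD _) _) _; first by apply: cmeasM => //; exact: cmeas_cst.
  rewrite (n2Z _ _ (mD n)) cabsN cabs1 expr1n mul1e.
  apply: (@le_trans _ _ (2%:E * (e / 4)%:E + 2%:E * (e / 4)%:E)%E); last by rewrite -!EFinM -EFinD lee_fin; lra.
  by apply: leeD; apply: lee_wpmul2l => //; apply: hN => //; exact: leqW.
have z : {ae mu, forall x, G x - T F x = 0}.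
  apply: n2w_small => [|e e0]; first exact: cmeasD mG (cmeasN (mT mF)).
  (* The squared weighted residual is at most 2 P e1 = e/2. *)
  pose P := lam ^- 2 + kap; pose e1 := e / (4 * P).
  have p0 : 0 < P by rewrite ltr_pwDl// invr_gt0 exprn_gt0.
  have e10 : 0 < e1 by rewrite divr_gt0// mulr_gt0.
  have [N1 h1] := small _ e10; have [N2 h2] := rateD _ e10.
  pose n := maxn N1 N2; have {}h1 := h1 n (leq_maxl _ _); have {}h2 := h2 n (leq_maxr _ _).
  have hD := L2wB (hFn n) hF.
  have E : {ae mu, forall x, (u x)%:C%C * (G x - T F x) = (lam^-1)%:C%C * ((u x)%:C%C * Dn n x) + (u x)%:C%C * T (fun x => Fn n x - F x) x}.
    have := T_lin (- 1) hF (hFn n); rewrite (_ : (fun y => -1 * F y + Fn n y) = fun x => Fn n x - F x); last first.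
      by apply/funext => x; rewrite mulN1r addrC.
    apply: filterS => x ->; rewrite /Dn mulrCA [X in (u x)%:C%C * X + _]mulrA.
    rewrite (_ : (lam^-1)%:C%C * lam%:C%C = 1); first by ring.
    by apply: cplx_eq => /=; rewrite !(mulr0, mul0r, subr0, addr0)// mulVf// gt_eqF.
  rewrite (n2_eq_ae E).
  have m1 := cmeas_mulw (hDn n).1; have m2 := cmeas_mulw (mT hD.1).
  apply: le_trans (n2D_le mu _ m2) _; first by apply: cmeasM => //; exact: cmeas_cst.
  rewrite (n2Z _ _ m1) cabsR.
  apply: (@le_trans _ _ (2%:E * ((lam ^- 2)%:E * e1%:E) + 2%:E * (kap%:E * e1%:E))%E).
    apply: leeD; apply: lee_wpmul2l => //.
      by rewrite (real_normK (num_real _)) exprVn; apply: lee_wpmul2l => //; rewrite lee_fin invr_ge0 sqr_ge0.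
    by apply: le_trans (T_bd hD) _; apply: lee_wpmul2l; rewrite ?lee_fin.
  rewrite -!EFinM -EFinD lee_fin (_ : _ + _ = 2 * P * e1); last by rewrite /P; ring.
  have hp := lt0r_neq0 p0.
  by rewrite (_ : 2 * P * e1 = e / 2); [lra|rewrite /e1; field].
by apply: filterS z => x /eqP; rewrite subr_eq0 eq_sym => /eqP.
Qed.

End solve.

End neumann.

(** * The extended frame operator and its inverse *)

Section frame_inverse.
Context {R : realType} {d : nat}.
Local Notation C := R[i].
Local Notation V := 'cV[R]_d.
Local Notation Z := 'cV[int]_d.
Local Notation mu := (@lebesgue_cV R d).
Variables (O : set V) (I : choiceType) (Q : I -> set V) (phi : I -> V -> C).
Hypotheses (O_open : open O) (O_full : mu.-negligible (~` O)).
Hypotheses (Q_adm : admissible_cover O Q) (phi_BAPU : BAPU O Q phi).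
Variables (w : I -> R) (u : V -> R) (c1 c2 : R).
Hypotheses (w0 : forall i, 0 < w i) (mu_ : measurable_fun setT u) (c10 : 0 < c1) (c20 : 0 < c2).
Hypothesis uw : {ae mu, forall x, forall i, Q i x -> c1 * w i <= u x <= c2 * w i}.
Variables (J : countType) (g : J -> V -> C) (A : J -> 'M[R]_d) (a b : R).
Hypotheses (uA : forall j, A j \in unitmx) (g1 : forall j, cL1 mu (g j)) (g2 : forall j, (n2 mu (g j) < +oo)%E).
Hypothesis gs : forall j, csmooth (fourier (g j)).
Hypothesis ab : {ae mu, forall xi, (a%:E <= \esum_(j in [set: J]) (`|\det (A j)|^-1 * cabs (fourier (g j) xi) ^+ 2)%:E <= b%:E)%E}.
Hypothesis LIC : alpha_LIC g A O.
Local Notation L0 := (Lambda A `\ (0 : V)).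
Local Notation t := (t_fun g A).
Variables (v0 : V -> R) (s c : R).
Hypotheses (v00 : forall x, 0 < v0 x) (v0N : forall x, v0 (- x) = v0 x) (s0 : 0 < s) (c0 : 0 < c).
Hypotheses (cv1 : forall x, 1 <= c * v0 x) (a0 : 0 < a) (b0 : 0 < b) (abl : a <= b) (csa : c * s < a).
Hypothesis ts : {ae mu, forall xi, (\esum_(x in L0) (cabs (t x xi) * v0 x)%:E <= s%:E)%E}.
Hypothesis uW : frame_weight A v0 c u.
Local Notation W F := (fun x => (u x)%:C%C * F x)%R.
Local Notation K := (frame_op g A).
Local Notation D := (decomp_space O phi 2%:E 2%:E w).
Local Notation N := (decomp_norm phi 2%:E 2%:E w).
Local Notation uf := (ufun O).
Local Notation L2u := (L2w u).

Let u0 : {ae mu, forall x, 0 < u x}. Proof. by case: uW. Qed.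
Let b0' : 0 <= b. Proof. exact: ltW. Qed.
Let kap := 2 * b ^+ 2 + 2 * (c * s) ^+ 2.
Let kap0 : 0 <= kap. Proof. by rewrite addr_ge0// mulr_ge0// sqr_ge0. Qed.
Let lam := b^-1.
Let lam0 : 0 < lam. Proof. by rewrite invr_gt0. Qed.
(** The norm of I - K/b is at most 1 - (a - c s)/b; half of the gap is given away so that [al] in
    [K_con] stays positive even when a = b. *)
Let q := 1 - (a - c * s) / (2 * b).
Let cs0 : 0 < c * s. Proof. exact: mulr_gt0. Qed.
Let r0 : 0 < (a - c * s) / (2 * b).
Proof. by rewrite divr_gt0 ?subr_gt0// mulr_gt0. Qed.
Let q1 : q < 1. Proof. by rewrite /q gtrBl. Qed.
Let q0 : 0 < q.
Proof. rewrite /q subr_gt0 ltr_pdivrMr ?mulr_gt0// mul1r; move: abl b0 cs0; lra. Qed.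

Let mK F : cmeas F -> cmeas (K F). Proof. exact: cmeas_frame_op gs F. Qed.

Let K_lin (z : C) F G : L2u F -> L2u G -> {ae mu, forall x, K (fun y => z * F y + G y) x = z * K F x + K G x}.
Proof. by move=> [mF F2] [mG G2]; exact: (frame_op_lin gs v00 v0N s0 ts z uW mF mG F2 G2). Qed.

Let K_bd F : L2u F -> (n2 mu (W (K F)) <= kap%:E * n2 mu (W F))%E.
Proof. by move=> [mF F2]; exact: (frame_op_bound uA gs ab v00 v0N s0 a0 b0' ts uW mF F2). Qed.

Let K_con F : L2u F -> (n2 mu (W (fun x => F x - lam%:C%C * K F x)) <= (q ^+ 2)%:E * n2 mu (W F))%E.
Proof.
move=> [mF F2]; have [_ off] := off_bound gs v00 v0N s0 ts uW mF F2.
pose al := 1 - a / b + (a - c * s) / (2 * b); pose be := c * s / b.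
have al0 : 0 < al by rewrite ltr_wpDl// subr_ge0 ler_pdivrMr// mul1r.
have be0 : 0 < be by rewrite divr_gt0.
have qE : q = al + be by have := lt0r_neq0 b0 => hb; rewrite /q /al /be; field.
pose F1 x := (u x)%:C%C * ((1 - lam%:C%C * (t 0 x)^*%C) * F x).
pose F2' x := (- lam%:C%C) * ((u x)%:C%C * shift_op L0 t F x).
have mo := cmeas_off A gs mF.
have m2' : cmeas (W (shift_op L0 t F)) := cmeas_mulw mu_ mo.
have m2 : cmeas F2' by apply: cmeasM => //; exact: cmeas_cst.
have m1 : cmeas F1.
  apply: cmeas_mulw => //; apply: cmeasM => //; apply: cmeasB; first exact: cmeas_cst.
  by apply: cmeasM; [exact: cmeas_cst|apply: cmeas_conj; exact: cmeas_t].
rewrite (_ : W (fun x => F x - lam%:C%C * K F x) = fun x => F1 x + F2' x); last first.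
  by apply/funext => x; rewrite /F1 /F2' /frame_op; ring.
have mW := cmeas_mulw mu_ mF.
(* With this parameter Young's inequality combines the bounds al^2 and be^2 to (al + be)^2 = q^2. *)
have sp : 0 < be / al by rewrite divr_gt0.
have e1 : (n2 mu F1 <= (al ^+ 2)%:E * n2 mu (W F))%E.
  rewrite /n2 -(nintZ _ (measurable_cabs2 mW) (sqr_ge0 al)); last by move=> x; exact: sqr_ge0.
  apply: nint_le_ae => [x|x|]; [exact: sqr_ge0|by apply: mulr_ge0; exact: sqr_ge0|].
  apply: filterS (t0_bounds uA ab) => x [r tr /andP[ar rb]].
  have e : 1 - lam%:C%C * (t 0 x)^*%C = (1 - r / b)%:C%C.
    by rewrite tr /lam; apply: cplx_eq => /=; rewrite ?oppr0; ring.
  have -> : cabs (F1 x) = `|1 - r / b| * cabs ((u x)%:C%C * F x) by rewrite /F1 e !cabsM !cabsR mulrCA.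
  rewrite exprMn ler_wpM2r ?sqr_ge0//.
  have rb1 : 0 <= 1 - r / b by rewrite subr_ge0 ler_pdivrMr// mul1r.
  rewrite ger0_norm// lerXn2r ?nnegrE ?(ltW al0)// /al -[leLHS]addr0 lerD ?(ltW r0)//.
  by rewrite lerD2l lerN2 ler_pM2r// invr_gt0.
have e2 : (n2 mu F2' <= (be ^+ 2)%:E * n2 mu (W F))%E.
  rewrite (n2Z _ _ m2') cabsN cabsR (real_normK (num_real _)).
  apply: le_trans (lee_wpmul2l _ off) _; first by rewrite lee_fin sqr_ge0.
  by rewrite muleA -EFinM -exprMn (mulrC lam).
apply: le_trans (n2D_le_s mu sp m1 m2) _.
apply: (@le_trans _ _ ((1 + be / al)%:E * ((al ^+ 2)%:E * n2 mu (W F)) + (1 + (be / al)^-1)%:E * ((be ^+ 2)%:E * n2 mu (W F)))%E).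
  by apply: leeD; apply: lee_wpmul2l => //; rewrite lee_fin addr_ge0// ?invr_ge0 ltW.
rewrite !muleA -!EFinM -ge0_muleDl ?lee_fin; last 2 first.
- by rewrite mulr_ge0 ?sqr_ge0// addr_ge0// ltW.
- by rewrite mulr_ge0 ?sqr_ge0// addr_ge0// invr_ge0 ltW.
rewrite -EFinD (_ : _ + _ = q ^+ 2)// qE.
by have := lt0r_neq0 al0; have := lt0r_neq0 be0 => hb ha; field; apply/andP.
Qed.

Let K_ext F G := op_ext mu_ u0 mK K_lin K_bd (F := F) (G := G).
Let ub := weight_bound phi_BAPU w0 c10 c20 uw.

Lemma L2w_locL2 F : L2u F -> locL2 O F.
Proof. by move=> [mF F2]; exact: (weight_locL2 mu_ ub mF F2). Qed.

Let ufE F : L2u F -> N (uf F) = (normsq phi w F `^ 2^-1)%E.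
Proof. by move=> hF; apply: (decomp_norm_ufun O_open O_full Q_adm phi_BAPU w0); exact: L2w_locL2. Qed.

Let nsq0 F : (0 <= normsq phi w F)%E.
Proof. by apply: esum_ge0 => i _; rewrite mule_ge0 ?n2_ge0// lee_fin sqr_ge0. Qed.

Lemma D_ufun F : L2u F -> D (uf F).
Proof.
move=> hF; split; first by apply: (ufun_Zdual Q_adm phi_BAPU); exact: L2w_locL2.
have [k1 [k2 [k10 k20 hk]]] := norm_equiv O_open O_full Q_adm phi_BAPU w0 mu_ c10 c20 uw.
rewrite ufE//; apply: poweR_lty; apply: le_lt_trans (hk F hF.1).1 _.
by rewrite lte_mul_pinfty ?lee_fin ?(ltW k10)// hF.2.
Qed.

Lemma D_rep f : D f -> exists2 F, L2u F & f = uf F.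
Proof.
move=> [Zf Nf]; have [F LF fF] := Zdual_ufun O_open Q_adm phi_BAPU w0 Zf Nf.
have [k1 [k2 [k10 k20 hk]]] := norm_equiv O_open O_full Q_adm phi_BAPU w0 mu_ c10 c20 uw.
exists F => //; split; first exact: LF.1.
move: Nf; rewrite fF (decomp_norm_ufun O_open O_full Q_adm phi_BAPU w0 LF) => Nf.
apply: le_lt_trans (hk F LF.1).2 _; rewrite lte_mul_pinfty ?lee_fin ?(ltW k20)//.
by rewrite ltNge leye_eq; apply/negP => /eqP E; move: Nf; rewrite E poweRyr// invr_eq0.
Qed.

(** Transfers bounds on L^2(u) to the decomposition norm; the constant k comes from [norm_equiv] and
    is the same for every operator. *)
Lemma norm_le : exists2 k : R, 0 < k & forall (m : R) F G, 0 <= m -> L2u F -> L2u G ->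
  (n2 mu (W F) <= (m ^+ 2)%:E * n2 mu (W G) -> N (uf F) <= (k * m)%:E * N (uf G))%E.
Proof.
have [k1 [k2 [k10 k20 hk]]] := norm_equiv O_open O_full Q_adm phi_BAPU w0 mu_ c10 c20 uw.
exists (Num.sqrt (k1 * k2)); first by rewrite sqrtr_gt0 mulr_gt0.
move=> m F G m0 hF hG FG; rewrite !ufE//.
have km : 0 <= Num.sqrt (k1 * k2) * m by rewrite mulr_ge0// sqrtr_ge0.
have -> : ((Num.sqrt (k1 * k2) * m)%:E = (k1 * k2 * m ^+ 2)%:E `^ 2^-1)%E.
  rewrite poweR_EFin -[in RHS](sqr_sqrtr (_ : 0 <= k1 * k2)) ?mulr_ge0 ?ltW// -exprMn -powR_mulrn//.
  by rewrite -powRrM mulfV ?pnatr_eq0// powRr1.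
have k3 : 0 <= k1 * k2 * m ^+ 2 by rewrite mulr_ge0 ?sqr_ge0// mulr_ge0 ?ltW.
rewrite -poweRM ?lee_fin//; apply: gt0_ler_poweR; rewrite ?in_itv/= ?invr_ge0 ?leey ?andbT ?mule_ge0//.
apply: le_trans (hk F hF.1).1 _.
apply: le_trans (lee_wpmul2l _ FG) _; first by rewrite lee_fin ltW.
rewrite muleA -EFinM; apply: le_trans (lee_wpmul2l _ (hk G hG.1).2) _.
  by rewrite lee_fin mulr_ge0 ?sqr_ge0// ltW.
by rewrite muleA -EFinM le_eqVlt (_ : k1 * m ^+ 2 * k2 = k1 * k2 * m ^+ 2) ?eqxx//; ring.
Qed.

Lemma norm_ge : exists2 k : R, 0 < k & forall (m : R) F G, L2u F -> L2u G ->
  (N (uf F) <= m%:E * N (uf G) -> n2 mu (W F) <= (k * m ^+ 2)%:E * n2 mu (W G))%E.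
Proof.
have [k1 [k2 [k10 k20 hk]]] := norm_equiv O_open O_full Q_adm phi_BAPU w0 mu_ c10 c20 uw.
exists (k2 * k1); first by rewrite mulr_gt0.
move=> m F G hF hG; rewrite !ufE// => FG.
have h : (normsq phi w F <= (m ^+ 2)%:E * normsq phi w G)%E.
  have p2 (x : \bar R) : (0 <= x)%E -> x = ((x `^ 2^-1) `^ 2)%E.
    by move=> x0; rewrite -poweRrM mulVf ?pnatr_eq0// poweRe1.
  have FG' : (normsq phi w F `^ 2^-1 <= `|m|%:E * normsq phi w G `^ 2^-1)%E.
    by apply: le_trans FG _; apply: lee_wpmul2r; rewrite ?poweR_ge0// lee_fin ler_norm.
  rewrite (p2 _ (nsq0 F)) [in leRHS](p2 _ (nsq0 G)).
  rewrite (_ : (m ^+ 2)%:E = (`|m|%:E `^ 2)%E); last by rewrite poweR_EFin powR_mulrn// real_normK// num_real.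
  rewrite -poweRM ?poweR_ge0//; apply: gt0_ler_poweR; rewrite ?in_itv/= ?poweR_ge0 ?leey ?mule_ge0 ?poweR_ge0//.
apply: le_trans (hk F hF.1).2 _.
apply: le_trans (lee_wpmul2l _ h) _; first by rewrite lee_fin ltW.
rewrite muleA -EFinM; apply: le_trans (lee_wpmul2l _ (hk G hG.1).1) _.
  by rewrite lee_fin mulr_ge0 ?sqr_ge0// ltW.
by rewrite muleA -EFinM le_eqVlt (_ : k2 * m ^+ 2 * k1 = k2 * k1 * m ^+ 2) ?eqxx//; ring.
Qed.

(** A chosen function behind each functional of D; by [rep_ufun] the choice matters on null sets
    only. *)
Let rep f : V -> C := if pselect (D f) is left h then s2val (cid2 (D_rep h)) else fun=> 0.

Let repP f : D f -> L2u (rep f) /\ f = uf (rep f).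
Proof. by rewrite /rep; case: pselect => // h _; case: cid2. Qed.

Let rep_ufun F : L2u F -> {ae mu, forall x, rep (uf F) x = F x}.
Proof.
move=> hF; have [hr e] := repP (D_ufun hF).
by apply: (ufun_inj O_open O_full Q_adm phi_BAPU (L2w_locL2 hr) (L2w_locL2 hF)).
Qed.

Let L2u_K F : L2u F -> L2u (K F). Proof. exact: (L2w_op mK kap0 K_bd). Qed.

Let uf_lin (z : C) F G : L2u F -> L2u G -> (fun p => z * uf F p + uf G p) = uf (fun x => z * F x + G x).
Proof. by move=> hF hG; apply: (ufun_lin Q_adm phi_BAPU z); exact: L2w_locL2. Qed.

Lemma Ccinfty_L2w psi : Ccinfty O psi -> L2u psi.
Proof.
move=> Op; have m := Ccinfty_cmeas Op; split => //.
have [L [cL LO l0]] := Ccinfty_K Op; have [m1 [M [m10 um]]] := ub cL LO.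
apply: (@le_lt_trans _ _ ((M ^+ 2)%:E * n2 mu psi)%E).
  rewrite /n2 -(nintZ _ (measurable_cabs2 m) (sqr_ge0 M)); last by move=> x; exact: sqr_ge0.
  apply: nint_le_ae => [x|x|]; [exact: sqr_ge0|by apply: mulr_ge0; exact: sqr_ge0|].
  apply: filterS um => x ux; rewrite cabsM cabsR exprMn.
  have [/ux/andP[h1 h2]|/l0 ->] := pselect (L x); last by rewrite cabs0 expr0n !mulr0.
  rewrite ler_wpM2r ?sqr_ge0// real_normK ?num_real// lerXn2r// nnegrE.
    by rewrite (le_trans _ h1)// ltW.
  by rewrite (le_trans _ h2)// (le_trans _ h1)// ltW.
by rewrite lte_mul_pinfty ?lee_fin ?sqr_ge0// (Ccinfty_n2 Op).
Qed.

Lemma embed_ifourier psi : Ccinfty O psi -> embedZ O (ifourier psi) = uf psi.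
Proof.
move=> Op; apply: ufun_ext => [p nZ|eta Oe]; first by rewrite /embedZ asboolF.
rewrite /embedZ asboolT; last by exists eta.
transitivity (cint mu (fun x => psi x * ifourier (fourier eta) x)); last by rewrite (fourierK Oe).
apply: (ifourier_mul (Ccinfty_cL1 Op)); apply: rapid_cL1; apply: schwartz_rapid; exact: schwartz_fourier Oe.
Qed.

(** Tested against [fourier eta], the frame series gives the coefficient pairing of psi with the
    conjugate of eta, which polarization converts into the frame operator. *)
Lemma embed_frame_sum psi h : Ccinfty O psi -> frame_sum g A (ifourier psi) h -> embedZ O h = uf (K psi).
Proof.
move=> Op fh; apply: ufun_ext => [p nZ|eta Oe]; first by rewrite /embedZ asboolF.
rewrite /embedZ asboolT; last by exists eta.
have Oc := Ccinfty_conj Oe.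
apply: (frame_sum_weak g1 g2 gs Op Oe _ _ fh); first exact: (coef_summable uA gs ab LIC v00 v0N s0 cv1 ts Op Oc).
rewrite (polarization uA gs ab LIC v00 v0N s0 cv1 a0 b0' ts Op Oc).
by congr cint; apply/funext => x; rewrite cconjK.
Qed.

(** The dual Bessel inequality asks for density of test functions in plain L^2, which is [density]
    with the weight 1. *)
Lemma frame_sum_ex psi : Ccinfty O psi -> exists h, frame_sum g A (ifourier psi) h.
Proof.
apply: (frame_sum_exists g1 g2 gs (bessel_ge1 b s c)).
  by move=> p Op; exact: (bessel uA gs ab LIC v00 v0N s0 cv1 a0 b0' ts Op).
move=> F mF F2 e e0.
have ub1 : forall L : set V, compact L -> L `<=` O -> exists m M : R, 0 < m /\ {ae mu, forall x, L x -> m <= (fun=> 1 : R) x <= M}.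
  by move=> L _ _; exists 1, 1; split => //; apply: aeW => x _; rewrite lexx.
have F2' : (n2 mu (fun x => (1 : R)%:C%C * F x)%R < +oo)%E by rewrite n2W1.
have [eta Oe he] := density O_open O_full Q_adm phi_BAPU (u := fun=> 1) (@measurable_cst _ _ _ _ _ _) ub1 mF F2' e0.
by exists eta => //; rewrite n2W1 in he.
Qed.

(** Independent of the representative, since the frame operator respects a.e. equality; see
    [frame_ext_ufun]. *)
Definition frame_ext (f : (V -> C) -> C) : (V -> C) -> C := uf (K (rep f)).

Lemma frame_ext_ufun F : L2u F -> frame_ext (uf F) = uf (K F).
Proof.
move=> hF; apply: ufun_eq_ae; apply: K_ext => //; last exact: rep_ufun.
by have [] := repP (D_ufun hF).
Qed.

(** The premise [D f] sits under the existential, so that a solution can be chosen for every [f] at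
    once. *)
Let solveP f : exists F, D f -> L2u F /\ {ae mu, forall x, K F x = rep f x}.
Proof.
have [Df|nD] := pselect (D f); last by exists (fun=> 0).
have [hr _] := repP Df.
have [F hF KF] := op_solve mu_ u0 mK lam0 q0 q1 kap0 K_lin K_bd K_con hr.
by exists F.
Qed.

Let sol f := sval (cid (solveP f)).
Let solE f : D f -> L2u (sol f) /\ {ae mu, forall x, K (sol f) x = rep f x}.
Proof. exact: svalP (cid (solveP f)). Qed.

Definition frame_inv (f : (V -> C) -> C) : (V -> C) -> C := uf (sol f).

Let low := op_lower mu_ mK lam0 q0 q1 kap0 K_bd K_con.

(** The lower bound [op_lower], applied to the difference. *)
Let K_inj F G : L2u F -> L2u G -> {ae mu, forall x, K F x = K G x} -> {ae mu, forall x, F x = G x}.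
Proof.
move=> hF hG FG; have hD := L2w_lin mu_ (- 1) hF hG; have [k k0 hk] := low.
have z : {ae mu, forall x, -1 * F x + G x = 0}.
  apply: (n2w_eq0 mu_ u0 hD.1); apply: le_trans (hk _ hD) _.
  rewrite (n2_eq_ae (g := fun=> 0)); first by rewrite /n2 /nint cabs0 expr0n/= integral0 mule0.
  by apply: filterS2 FG (K_lin (- 1) hF hG) => x e ->; rewrite e mulN1r addNr mulr0.
by apply: filterS z => x /eqP; rewrite mulN1r addrC subr_eq0 eq_sym => /eqP.
Qed.

Let sol_lin z f1 f2 : D f1 -> D f2 ->
  {ae mu, forall x, sol (fun p => z * f1 p + f2 p) x = z * sol f1 x + sol f2 x}.
Proof.
move=> D1 D2; have [h1 e1] := solE D1; have [h2 e2] := solE D2.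
have [r1 E1] := repP D1; have [r2 E2] := repP D2.
have hl := L2w_lin mu_ z r1 r2.
have Ef : (fun p => z * f1 p + f2 p) = uf (fun x => z * rep f1 x + rep f2 x) by rewrite -uf_lin// -E1 -E2.
have D3 : D (fun p => z * f1 p + f2 p) by rewrite Ef; exact: D_ufun.
have [h3 e3] := solE D3; apply: K_inj => //; first exact: L2w_lin.
have R3 : {ae mu, forall x, rep (fun p => z * f1 p + f2 p) x = z * rep f1 x + rep f2 x} by rewrite Ef; exact: rep_ufun.
have Q1 : {ae mu, forall x, K (sol f1) x = rep f1 x /\ K (sol f2) x = rep f2 x} by apply: filterS2 e1 e2.
pose f3 : (V -> C) -> C := fun p => z * f1 p + f2 p; rewrite -/f3 in e3 R3 *.
have Q2 : {ae mu, forall x, K (sol f3) x = rep f3 x /\ rep f3 x = z * rep f1 x + rep f2 x} by apply: filterS2 e3 R3.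
apply: filterS3 Q1 Q2 (K_lin z h1 h2) => x [E3 E4] [E5 E6] ->.
by rewrite E5 E6 E3 E4.
Qed.

Lemma frame_ext_bounded : bounded_linear_on D N frame_ext.
Proof.
split.
- by move=> f Df; apply: D_ufun; apply: L2u_K; have [] := repP Df.
- move=> z f1 f2 D1 D2; have [r1 E1] := repP D1; have [r2 E2] := repP D2.
  have hl := L2w_lin mu_ z r1 r2.
  rewrite {1}E1 {1}E2 uf_lin// frame_ext_ufun// /frame_ext uf_lin; [|exact: L2u_K|exact: L2u_K].
  by apply: ufun_eq_ae; exact: K_lin.
have [k k0 hk] := norm_le; exists (k * Num.sqrt kap) => f Df; have [r1 E1] := repP Df.
rewrite {2}E1; apply: hk; [exact: sqrtr_ge0|exact: L2u_K|by []|].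
by rewrite sqr_sqrtr//; exact: K_bd.
Qed.

Lemma frame_inv_bounded : bounded_linear_on D N frame_inv.
Proof.
split.
- by move=> f Df; apply: D_ufun; have [] := solE Df.
- move=> z f1 f2 D1 D2; have [h1 _] := solE D1; have [h2 _] := solE D2.
  by rewrite /frame_inv uf_lin//; apply: ufun_eq_ae; exact: sol_lin.
have [k k0 hk] := norm_le; have [m m0 hm] := low.
exists (k * Num.sqrt m) => f Df; have [r1 E1] := repP Df; have [h1 e1] := solE Df.
rewrite {2}E1; apply: hk; [exact: sqrtr_ge0|exact: h1|exact: r1|].
rewrite (sqr_sqrtr (ltW m0)); apply: le_trans (hm _ h1) _; rewrite le_eqVlt; apply/orP; left; apply/eqP.
by congr (_ * _)%E; apply: n2_eq_ae; apply: filterS e1 => x ->.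
Qed.

Lemma frame_inv_ext f : D f -> frame_inv (frame_ext f) = f.
Proof.
move=> Df; have [r1 E1] := repP Df; have hK := L2u_K r1; have DK := D_ufun hK.
have [h1 e1] := solE DK; rewrite [RHS]E1; apply: ufun_eq_ae; apply: K_inj => //.
by apply: filterS2 e1 (rep_ufun hK) => x -> ->.
Qed.

Lemma frame_ext_inv f : D f -> frame_ext (frame_inv f) = f.
Proof.
move=> Df; have [r1 E1] := repP Df; have [h1 e1] := solE Df.
by rewrite frame_ext_ufun// [RHS]E1; exact: ufun_eq_ae.
Qed.

Lemma frame_ext_extends f : S_space O f -> D (embedZ O f) /\
  forall h, frame_sum g A f h -> frame_ext (embedZ O f) = embedZ O h.
Proof.
move=> [psi Op <-]; have hp := Ccinfty_L2w Op; rewrite embed_ifourier//; split; first exact: D_ufun.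
by move=> h fh; rewrite frame_ext_ufun// (embed_frame_sum Op fh).
Qed.

(** The extension property speaks only of frame sums, so their existence is what fixes [S1] on test
    functions. Density and the two bounds do the rest: with psi close to [rep f], the difference of
    the images splits into S1 and K applied to rep f - psi. *)
Lemma frame_ext_unique S1 : bounded_linear_on D N S1 ->
  (forall f, S_space O f -> D (embedZ O f) /\ forall h, frame_sum g A f h -> S1 (embedZ O f) = embedZ O h) ->
  forall f, D f -> S1 f = frame_ext f.
Proof.
move=> [S1D S1lin [M S1M]] ext f Df.
have [_ S0lin [M0 S0M]] := frame_ext_bounded.
have [r1 E1] := repP Df; have [F1 h1 EF1] := D_rep (S1D f Df).
have [k k0 hk] := norm_ge.
rewrite EF1; apply: ufun_eq_ae; have hK := L2u_K r1.
have z : {ae mu, forall x, F1 x - K (rep f) x = 0}.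
  apply: (n2w_small mu_ u0) => [|e e0]; first exact: (L2wB mu_ h1 hK).1.
  (* Collects the constants of both bounds; the added 1 makes it positive, and accuracy e/P for psi
     leaves an error of at most e. *)
  pose P := 2 * (k * M ^+ 2) + 2 * kap + 1.
  have P0 : 0 < P by rewrite ltr_wpDl// addr_ge0// mulr_ge0// mulr_ge0 ?sqr_ge0// ltW.
  have e1 : 0 < e / P by rewrite divr_gt0.
  have [psi Op hpsi] := density O_open O_full Q_adm phi_BAPU mu_ ub r1.1 r1.2 e1.
  have hp := Ccinfty_L2w Op; have [h fh] := frame_sum_ex Op.
  have S_p : S1 (uf psi) = uf (K psi).
    have [|_ S1E] := ext (ifourier psi); first by exists psi.
    by rewrite -(embed_ifourier Op) (S1E h fh) (embed_frame_sum Op fh).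
  pose G x := (-1) * psi x + rep f x.
  have hG : L2u G := L2w_lin mu_ (- 1) hp r1.
  have Gn : n2 mu (W G) = n2 mu (W (fun x => rep f x - psi x)).
    by congr n2; apply/funext => x; rewrite /G mulN1r addrC.
  have hKp := L2u_K hp.
  have S1G : S1 (uf G) = uf (fun x => -1 * K psi x + F1 x).
    by rewrite -uf_lin// S1lin; [rewrite S_p -E1 EF1 uf_lin|exact: D_ufun|rewrite -E1].
  have b1 := S1M _ (D_ufun hG); rewrite S1G in b1.
  have {}b1 := hk _ _ _ (L2w_lin mu_ (- 1) hKp h1) hG b1.
  have b2 := K_bd hG.
  have KG := K_lin (- 1) hp r1.
  have E : {ae mu, forall x, (u x)%:C%C * (F1 x - K (rep f) x) =
      (u x)%:C%C * (-1 * K psi x + F1 x) + (-1) * ((u x)%:C%C * K G x)}.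
    by apply: filterS KG => x ->; ring.
  have m1 := cmeas_mulw mu_ (L2w_lin mu_ (- 1) hKp h1).1.
  have m2 := cmeas_mulw mu_ (mK hG.1).
  rewrite (n2_eq_ae E); apply: le_trans (n2D_le mu m1 _) _; first by apply: cmeasM => //; exact: cmeas_cst.
  rewrite (n2Z _ _ m2) cabsN cabs1 expr1n mul1e.
  rewrite Gn in b1 b2.
  apply: (@le_trans _ _ (2%:E * ((k * M ^+ 2)%:E * (e / P)%:E) + 2%:E * (kap%:E * (e / P)%:E))%E).
    apply: leeD; apply: lee_wpmul2l => //.
      by apply: le_trans b1 _; apply: lee_wpmul2l => //; rewrite lee_fin mulr_ge0 ?sqr_ge0// ltW.
    by apply: le_trans b2 _; apply: lee_wpmul2l.
  rewrite -!EFinM -EFinD lee_fin (_ : _ + _ = (2 * (k * M ^+ 2) + 2 * kap) * (e / P)); last by ring.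
  by rewrite mulrA ler_pdivrMr// mulrC ler_wpM2l ?(ltW e0)// /P lerDl.
by apply: filterS z => x /eqP; rewrite subr_eq0 => /eqP.
Qed.

End frame_inverse.

(** Countably many atoms change on null sets only, so neither coefficients nor L^2 norms are
    affected. This permits Borel versions of the generators. *)
Lemma frame_sum_eq_ae (R : realType) (d : nat) (J : countType) (g g' : J -> 'cV[R]_d -> R[i]) (A : J -> 'M[R]_d) :
  (forall j, {ae lebesgue_cV d, forall x, g j x = g' j x}) -> frame_sum g A = frame_sum g' A.
Proof.
move=> gg; apply/funext => f; apply/funext => h.
have aeA jk : {ae lebesgue_cV d, forall x, atom g A jk x = atom g' A jk x} by exact: (ae_shift (- (A jk.1 *m intv jk.2)) (gg jk.1)).
rewrite /frame_sum; congr (_ /\ _).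
set u1 := (X in X @ _); set u2 := (X in _ = (X @ _ --> _)); suff -> : u1 = u2 by [].
apply/funext => X; rewrite /u1 /u2 !cLnorm2E; congr (_ `^ _)%E; apply: n2_eq_ae.
have ca : countable [set: J * 'cV[int]_d] by exact: countableP.
apply: filterS (ae_countable ca (fun jk _ => aeA jk)) => x hx.
congr (_ - _); apply: eq_bigr => jk _; rewrite hx//; congr (_ * _).
by apply: cint_eq_ae; apply: filterS (aeA jk) => y ->.
Qed.

Theorem proposition5p14 (R : realType) (d : nat) (d_gt0 : (0 < d)%N)
    (O : set 'cV[R]_d) (O_open : open O) (O_neq0 : O !=set0)
    (O_full : (lebesgue_cV d).-negligible (~` O))
    (I : choiceType) (Q : I -> set 'cV[R]_d) (Q_adm : admissible_cover O Q)
    (phi : I -> 'cV[R]_d -> R[i]) (phi_BAPU : BAPU O Q phi)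
    (w : I -> R) (w_moderate : moderate Q w)
    (J : countType) (g : J -> 'cV[R]_d -> R[i])
    (g_L1 : forall j, cLp 1%E (g j)) (g_L2 : forall j, cLp 2%:E (g j))
    (g_smooth : forall j, csmooth (fourier (g j)))
    (C : J -> 'M[R]_d) (C_unit : forall j, C j \in unitmx)
    (A B : R) (A_gt0 : 0 < A) (B_gt0 : 0 < B)
    (AB_bounds : {ae lebesgue_cV d, forall xi,
      (A%:E <= \esum_(j in [set: J])
         (`|\det (C j)|^-1 * cabs (fourier (g j) xi) ^+ 2)%:E <= B%:E)%E})
    (LIC : alpha_LIC g C O)
    (v : 'cV[R]_d -> R) (v_gt0 : forall xi, 0 < v xi) (v_meas : lmeasurable v)
    (v_w : exists c1 c2 : R, [/\ 0 < c1, 0 < c2 &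
      forall i xi, Q i xi -> c1 * w i <= v xi <= c2 * w i])
    (v0 : 'cV[R]_d -> R) (v0_gt0 : forall eta, 0 < v0 eta)
    (v0_sym : forall eta : 'cV[R]_d, v0 (- eta) = v0 eta)
    (Cv : R) (Cv_gt0 : 0 < Cv)
    (v_v0 : forall xi eta, v (xi + eta) <= Cv * v xi * v0 eta)
    (smallness : (Cv%:E * ess_sup_on O (fun xi =>
      \esum_(alpha in Lambda C `\ (0 : 'cV[R]_d)%R) (cabs (t_fun g C alpha xi) * v0 alpha)%:E)
      < A%:E)%E) :
  let D := decomp_space O phi 2%:E 2%:E w in
  let N := decomp_norm phi 2%:E 2%:E w in
  let extends_S S0 := forall f, S_space O f -> D (embedZ O f) /\
    forall h, frame_sum g C f h -> S0 (embedZ O f) = embedZ O h in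
  (forall f, S_space O f -> exists h, frame_sum g C f h) /\
  exists S0,
    [/\ bounded_linear_on D N S0, extends_S S0,
        forall S1, bounded_linear_on D N S1 -> extends_S S1 ->
          forall f, D f -> S1 f = S0 f &
        exists T0, [/\ bounded_linear_on D N T0,
          forall f, D f -> T0 (S0 f) = f & forall f, D f -> S0 (T0 f) = f]].

Proof.
pose mu := @lebesgue_cV R d.
(* Each generator is replaced by a Borel version; Fourier transforms, and with them every hypothesis
   on the system, are unchanged. *)
have gex j : exists g', [/\ cL1 mu g', (n2 mu g' < +oo)%E & {ae mu, forall x, g j x = g' x}].
  have [clg gn1] := g_L1 j; have [_ gn2] := g_L2 j; have [g' mg gg] := clmeasurable_cmeas clg.
  exists g'; split => //; last by rewrite -(n2_eq_ae gg) -cLnorm2_lty.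
  split => //; rewrite -(@nint_eq_ae _ _ _ mu (fun x => cabs (g j x))); last by apply: filterS gg => x ->.
  apply: le_lt_trans gn1; rewrite /cLnorm Lnorm1 le_eqVlt; apply/orP; left; apply/eqP.
  by apply: eq_integral => x _; rewrite gee0_abs// lee_fin cabs_ge0.
pose g' j := sval (cid (gex j)).
have gP j : [/\ cL1 mu (g' j), (n2 mu (g' j) < +oo)%E & {ae mu, forall x, g j x = g' j x}] by exact: svalP (cid (gex j)).
have g1 j : cL1 mu (g' j) by case: (gP j).
have g2 j : (n2 mu (g' j) < +oo)%E by case: (gP j).
have gg j : {ae mu, forall x, g j x = g' j x} by case: (gP j).
have fE j : fourier (g j) = fourier (g' j) by exact: fourier_eq_ae.
have gs j : csmooth (fourier (g' j)) by rewrite -fE.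
have LIC' : alpha_LIC g' C O.
  move=> f F hF; apply: le_lt_trans (LIC f F hF); rewrite le_eqVlt; apply/orP; left; apply/eqP.
  by apply: eq_esum => j _; rewrite -fE.
have tE : t_fun g C = t_fun g' C.
  by apply/funext => x; apply/funext => xi; apply: eq_csum => j _; rewrite -fE.
(* Raising the upper bound to max(A, B) makes the inequality between the two bounds immediate. *)
have ab : {ae mu, forall xi, (A%:E <= \esum_(j in [set: J])
    (`|\det (C j)|^-1 * cabs (fourier (g' j) xi) ^+ 2)%:E <= (Num.max A B)%:E)%E}.
  apply: filterS AB_bounds => xi /andP[h1 h2].
  have -> : (\esum_(j in [set: J]) (`|\det (C j)|^-1 * cabs (fourier (g' j) xi) ^+ 2)%:E =
      \esum_(j in [set: J]) (`|\det (C j)|^-1 * cabs (fourier (g j) xi) ^+ 2)%:E)%E.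
    by apply: eq_esum => j _; rewrite fE.
  by rewrite h1/= (le_trans h2)// lee_fin le_max lexx orbT.
rewrite (frame_sum_eq_ae C gg).
(* Moderateness from 0 to x and back gives v(0) <= (Cv v0(x))^2 v(0); symmetry of [v0] makes both
   factors equal. *)
have cv1 x : 1 <= Cv * v0 x.
  have p0 : 0 < Cv * v0 x by rewrite mulr_gt0.
  rewrite -(@ler_pXn2r _ 2) ?nnegrE ?(ltW p0)// expr1n.
  have h1 := v_v0 x (- x); rewrite subrr v0_sym in h1.
  have h2 := v_v0 0 x; rewrite add0r in h2.
  rewrite -(ler_pM2r (v_gt0 0)) mul1r; apply: (le_trans h1).
  rewrite (_ : Cv * v x * v0 x = Cv * v0 x * v x); last by ring.
  rewrite (_ : (Cv * v0 x) ^+ 2 * v 0 = Cv * v0 x * (Cv * v 0 * v0 x)); last by ring.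
  by rewrite ler_wpM2l// ltW.
(* Schur's test wants a strictly positive row bound, while the essential supremum may be 0. It is
   therefore raised to at least A/(2 Cv), which contributes only A/2 after multiplication by Cv. *)
have [s [s0 sA ts]] : exists s : R, [/\ 0 < s, Cv * s < A &
    {ae mu, forall xi, (\esum_(x in Lambda C `\ (0 : 'cV[R]_d)%R) (cabs (t_fun g' C x xi) * v0 x)%:E <= s%:E)%E}].
  move: smallness; rewrite tE /ess_sup_on; set E := ess_sup _ _ => small.
  have AC : 0 < A / (2 * Cv) by rewrite divr_gt0// mulr_gt0.
  exists (Num.max (fine E) (A / (2 * Cv))); split; first by rewrite lt_max AC orbT.
    have h2 : Cv * (A / (2 * Cv)) < A.
      rewrite (_ : _ * _ = A / 2); first by rewrite ltr_pdivrMr// ltr_pMr// ltr1n.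
      by have := lt0r_neq0 Cv_gt0 => hc; field.
    rewrite maxr_pMr ?(ltW Cv_gt0)// gt_max h2 andbT.
    by case: E small => [r small|_|_] /=; rewrite ?mulr0// -lte_fin.
  apply: filterS2 (ae_O O_full) (@ess_sup_ge _ _ _ mu (fun xi => if xi \in O then
    (\esum_(x in Lambda C `\ (0 : 'cV[R]_d)%R) (cabs (t_fun g' C x xi) * v0 x)%:E)%E else -oo%E)) => xi Ox.
  rewrite mem_set// -/E => /le_trans; apply.
  case: E small => [r| |] /=; first by rewrite lee_fin le_max lexx.
    by rewrite gt0_muley ?lte_fin.
  by rewrite leNye.
(* [u] is a Borel version of [v]; from here on the weight is controlled almost everywhere only. *)
have [u mu_ vu] := v_meas; have [c1 [c2 [c10 c20 vw]]] := v_w; have [w0 _] := w_moderate.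
have uw : {ae mu, forall x, forall i, Q i x -> c1 * w i <= u x <= c2 * w i}.
  by apply: filterS vu => x <- i; exact: vw.
have uW : frame_weight C v0 Cv u.
  split => // [|x _]; first by apply: filterS vu => x <-.
  apply: filterS2 vu (ae_shift x vu) => xi <- <-.
  (* Moderateness at xi + x with the shift -x bounds v(xi) by v(xi + x). *)
  by have := v_v0 (xi + x) (- x); rewrite addrK v0_sym.
have b0 : 0 < Num.max A B by rewrite lt_max A_gt0.
have abl : A <= Num.max A B by rewrite le_max lexx.
move=> D N extends_S; split.
  move=> f [psi Op <-].
  exact: (frame_sum_ex O_open O_full Q_adm phi_BAPU C_unit g1 g2 gs ab LIC' v0_gt0 v0_sym s0 cv1 A_gt0 b0 ts Op).
exists (frame_ext O_open O_full Q_adm phi_BAPU w0 mu_ c10 c20 uw g' C); split.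
- exact: (frame_ext_bounded O_open O_full Q_adm phi_BAPU w0 mu_ c10 c20 uw C_unit gs ab v0_gt0 v0_sym s0 A_gt0 b0 ts uW).
- move=> f Sf; exact: (frame_ext_extends O_open O_full Q_adm phi_BAPU w0 mu_ c10 c20 uw C_unit g1 g2 gs ab LIC' v0_gt0 v0_sym s0 cv1 A_gt0 b0 ts uW Sf).
- move=> S1 S1b S1e f Df; exact: (frame_ext_unique O_open O_full Q_adm phi_BAPU w0 mu_ c10 c20 uw C_unit g1 g2 gs ab LIC' v0_gt0 v0_sym s0 cv1 A_gt0 b0 ts uW S1b S1e Df).
exists (frame_inv O_open O_full Q_adm phi_BAPU w0 mu_ c10 c20 uw C_unit gs ab v0_gt0 v0_sym s0 Cv_gt0 A_gt0 b0 abl sA ts uW).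
split; [exact: frame_inv_bounded|exact: frame_inv_ext|exact: frame_ext_inv].
Qed.
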